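(* Assume (H1), (H2), (H3). For any $x\in\mathbb X$, $y\in\mathbb R$, $l\geqslant1$, $m\geqslant1$ and $g\in\mathscr C^+(\mathbb X^{l+m}\times\mathbb R_+)$, \[ \begin{aligned} &\lim_{n\to\infty}n^{3/2}\,\mathbb E_x\big(g(X_1,\dots,X_l,X_{n-m+1},\dots,X_n,y+S_n)\,;\,\tau_y>n\big)\\ &=\frac{2}{\sqrt{2\pi}\,\sigma^3}\int_0^{+\infty}\sum_{x^*\in\mathbb X}\mathbb E_{x,x^*}\Big(g(X_1,\dots,X_l,X_m^*,\dots,X_1^*,z)\,V(X_l,y+S_l)\,V^*(X_m^*,z+S_m^* )\,;\,\tau_y>l,\ \tau_z^*>m\Big)\,\nu(x^* )\,dz. \end{aligned} \]
   Context: Let $\mathbb X$ be a finite set and $(X_n)_{n\geqslant0}$ a homogeneous Markov chain on $\mathbb X$ with transition matrix $\mathbf P$; $\mathbb P_x,\mathbb E_x$ denote probability and expectation when $X_0=x$; $\mathbf Pg(x)=\sum_{x'}g(x')\mathbf P(x,x')$. (H1): there exists $k_0\geqslant1$ with $\mathbf P^{k_0}g(x)>0$ for all $x$ and every non-negative, not identically zero $g$. Then $\mathbf P$ has a unique invariant probability $\nu$, positive everywhere; $\nu(g)=\sum_xg(x)\nu(x)$. Let $f:\mathbb X\to\mathbb R$, $S_0=0$, $S_n=\sum_{k=1}^nf(X_k)$, $\tau_y=\inf\{k\geqslant1: y+S_k\leqslant0\}$. (H2): $\nu(f)=0$. (H3): for every $(\theta,a)\in\mathbb R^2$ there exist $n\geqslant0$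 and $x_0,\dots,x_n$ with $\mathbf P(x_0,x_1)\cdots\mathbf P(x_{n-1},x_n)\mathbf P(x_n,x_0)>0$ and $f(x_0)+\dots+f(x_n)-(n+1)\theta\notin a\mathbb Z$. $\sigma^2=\nu(f^2)+2\sum_{n\geqslant1}\nu(f\mathbf P^nf)>0$. Under (H1)–(H3) the limit $\lim_n\sqrt n\,\mathbb P_x(\tau_y>n)$ exists and is finite, and $V(x,y):=\frac{\sqrt{2\pi}\sigma}{2}\lim_n\sqrt n\,\mathbb P_x(\tau_y>n)$. Dual chain: $\mathbf P^*(x,x^* )=\frac{\nu(x^* )}{\nu(x)}\mathbf P(x^*,x)$; $(X_n^* )$ is a Markov chain with transition matrix $\mathbf P^*$, independent of $(X_n)$; $S_0^*=0$, $S_n^*=-\sum_{k=1}^nf(X_k^* )$, $\tau^*_z=\inf\{k\geqslant1: z+S_k^*\leqslant0\}$; $\mathbb P^*_x$ refers to $X_0^*=x$; $V^*(x,z):=\frac{\sqrt{2\pi}\sigma}{2}\lim_n\sqrt n\,\mathbb P^*_x(\tau^*_z>n)$ (the dual chain satisfies (H1)–(H3) with $-f$, same $\nu$ and $\sigma$). $\mathbb E_{x,x^*}$ is expectation under $\mathbb P_x\times\mathbb P^*_{x^*}$ (i.e. $X_0=x$, $X_0^*=x^*$, chains independent). For $k\geqslant1$, $\mathscr C^+(\mathbb X^k\times\mathbb R_+)$ is the set of functions $g:\mathbb X^k\times\mathbb R_+\to\mathbb R_+$ such that $z\mapsto g(x_1,\dots,x_k,z)$ is continuous for every $(x_1,\dots,x_k)$,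 and there exists $\varepsilon>0$ with $\max_{x_1,\dots,x_k}\sup_{z\geqslant0}g(x_1,\dots,x_k,z)(1+z)^{2+\varepsilon}<\infty$. *)

(* Defs.v *)
From HB Require Import structures.
From mathcomp Require Import all_boot all_order all_algebra.
From mathcomp Require Import all_classical all_reals all_analysis.
Set Implicit Arguments. Unset Strict Implicit. Unset Printing Implicit Defensive.
Import Order.TTheory GRing.Theory Num.Theory.
Import numFieldNormedType.Exports.
Local Open Scope classical_set_scope.
Local Open Scope ring_scope.

Section MarkovDefs.
Variables (R : realType) (X : finType).

(* probability that the chain started at x follows the path s = (X_1,...,X_n) *)
Definition pathprob (P : X -> X -> R) (x : X) (s : seq X) : R :=
  \prod_(i < size s) P (nth x (x :: s) i) (nth x s i).

Definition Ex (P : X -> X -> R) (x : X) (n : nat) (F : seq X -> R) : R :=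
  \sum_(t : n.-tuple X) pathprob P x t * F t.

Definition Pk (P : X -> X -> R) (k : nat) (g : X -> R) (x : X) : R :=
  Ex P x k (fun s => g (last x s)).

Definition stochastic (P : X -> X -> R) : Prop :=
  (forall x x', 0 <= P x x') /\ (forall x, \sum_(x' : X) P x x' = 1).

Definition invariant_prob (P : X -> X -> R) (nu : X -> R) : Prop :=
  (forall x, 0 <= nu x) /\ \sum_(x : X) nu x = 1 /\
  (forall x', \sum_(x : X) nu x * P x x' = nu x').

Definition H1 (P : X -> X -> R) : Prop :=
  exists k0 : nat, (1 <= k0)%N /\
    forall g : X -> R, (forall x, 0 <= g x) -> (exists x, g x != 0) ->
      forall x, 0 < Pk P k0 g x.

Definition H2 (nu f : X -> R) : Prop := \sum_(x : X) f x * nu x = 0.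

Definition H3 (P : X -> X -> R) (f : X -> R) : Prop :=
  forall theta a : R, exists (n : nat) (x0 : X) (s : n.-tuple X),
    0 < pathprob P x0 s * P (last x0 s) x0 /\
    ~ (exists k : int,
         f x0 + \sum_(v <- s) f v - (n.+1)%:R * theta = k%:~R * a).

Definition sigma2 (P : X -> X -> R) (nu f : X -> R) : R :=
  \sum_(x : X) nu x * f x ^+ 2 +
  2 * limn (fun N : nat => \sum_(1 <= n < N) \sum_(x : X) nu x * (f x * Pk P n f x)).

Definition Ssum (f : X -> R) (k : nat) (s : seq X) : R := \sum_(v <- take k s) f v.

(* the event {tau_y > n} for the path s = (X_1,...,X_n), n = size s *)
Definition surv (f : X -> R) (y : R) (s : seq X) : bool :=
  all (fun k => 0 < y + Ssum f k s) (iota 1 (size s)).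

Definition Vfun (P : X -> X -> R) (f : X -> R) (sigma : R) (x : X) (y : R) : R :=
  Num.sqrt (2 * pi) * sigma / 2 *
  limn (fun n : nat => Num.sqrt n%:R * Ex P x n (fun s => (surv f y s)%:R)).

Definition Pdual (P : X -> X -> R) (nu : X -> R) (x xs : X) : R :=
  nu xs / nu x * P xs x.

(* g in C^+(X^k x R_+), g represented on sequences of length k *)
Definition Cplus (k : nat) (g : seq X -> R -> R) : Prop :=
  (forall s, size s = k -> forall z, 0 <= z -> 0 <= g s z) /\
  (forall s, size s = k -> {within `[0, +oo[, continuous (g s)}) /\
  (exists eps : R, 0 < eps /\ exists C : R,
     forall s, size s = k -> forall z, 0 <= z ->
       g s z * (1 + z) `^ (2 + eps) <= C).

End MarkovDefs.

(* Main.v *)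
Require Import Defs.
From HB Require Import structures.
From mathcomp Require Import all_boot all_order all_algebra.
From mathcomp Require Import all_classical all_reals all_analysis.
From mathcomp Require Import measurable_realfun ring lra zify.
Set Implicit Arguments. Unset Strict Implicit. Unset Printing Implicit Defensive.
Import Order.TTheory GRing.Theory Num.Theory.
Import numFieldNormedType.Exports.
Local Open Scope classical_set_scope.
Local Open Scope ring_scope.

(** Let [K] be the kernel of the walk killed on leaving the positive half-line and [T] the kernel
    of the free walk, both acting on functions on [X * R]. By (H3) and compactness, [T^n] contracts
    every wave of frequency [t] bounded away from infinity like [exp (- c t^2 n)]. Perturbing
    [sin (t u)] by correctors solving Poisson equations gives an approximate eigenfunction of [T] with
    eigenvalue [exp (- sigma^2 t^2 / 2)], whence [K^k sin(t .) / t -> exp (- sigma^2 theta / 2) V]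
    when [k t^2 -> theta]; here [V] is the limit of [K^n id], and integrating this limit against the
    Fejer kernel identifies it with the function [V] of the survival asymptotics.

    For the local limit, split the time [n] into a first part, a short middle part and a last part.
    In the middle part killing is replaced by reflection, [T^j Q (w) - T^j Q (-w)], whose error is
    controlled by a quadratic potential; after Fejer smoothing this is an integral of
    [sin (t w) sin (t v)]. The first part turns [sin (t w)] into [V]; Lebesgue duality between the
    walk and its time reversal turns the last part into the same problem for the dual chain, hence
    into [V*]. Dominated convergence in [t] leaves the constant [(2 / pi) int s^2 exp (- sigma^2 s^2 / 2)]. *)

(** The factor $n^{3/2}$ consists of three factors $\sqrt n$: survival over the first part, survival
    of the reversed walk over the last part, and landing in a bounded window over the middle part.
    Complex transfer operators are avoided: a frequency is carried by real functions that obey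
    d'Alembert's functional equation, and contraction comes from pairing two paths with common
    endpoints. (H3) gives no control of characteristic functions at infinity, so the kernel used for
    smoothing must have a compactly supported transform. The walk has no regularity in its starting
    height either; monotonicity replaces it, since a higher start survives longer and ends higher by
    the same amount. This is why steps $a(x)1_{u\le b}$ come first and continuous tests are built
    from them. Reflection is only an approximation of killing, good from heights of order $\sqrt n$
    over $n/p$ steps; $p$ is fixed before $n$ and is absent from the limit. The coordinates at both
    ends of $g$ are split off by conditioning: survival of a fixed tail of steps is an event
    $\{c<u\}$ for the height $u$ at which the tail starts. *)

Module KilledWalk.

(** * Expectations along finite paths *)

Section PathExpectation.
Variables (R : realType) (X : finType) (P : X -> X -> R).

Lemma pathprob_nil x : pathprob P x [::] = 1.
Proof. by rewrite /pathprob big_ord0. Qed.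

Lemma pathprob_cons x a s : pathprob P x (a :: s) = P x a * pathprob P a s.
Proof.
rewrite /pathprob /= big_ord_recl /=; congr (_ * _).
apply: eq_bigr => -[i ilt] _ /=.
rewrite (set_nth_default a) /=; last exact: ltnW.
by rewrite (set_nth_default a).
Qed.

Lemma pathprob_cat x s t :
  pathprob P x (s ++ t) = pathprob P x s * pathprob P (last x s) t.
Proof.
elim: s x => [|a s IH] x /=; first by rewrite pathprob_nil mul1r.
by rewrite !pathprob_cons IH mulrA.
Qed.

Lemma big_tuple0 (F : 0.-tuple X -> R) : \sum_(t : 0.-tuple X) F t = F [tuple].
Proof. by rewrite (big_pred1 [tuple]) // => t /=; rewrite tuple0; apply/esym/eqP. Qed.

Lemma big_tupleS n (F : seq X -> R) :
  \sum_(t : n.+1.-tuple X) F t = \sum_(a : X) \sum_(t : n.-tuple X) F (a :: t).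
Proof.
rewrite pair_big /=.
rewrite (reindex (fun p : X * n.-tuple X => [tuple of p.1 :: p.2])) //=.
exists (fun t : n.+1.-tuple X => (thead t, [tuple of behead t])).
- by move=> [a t] _ /=; congr pair => //; apply: val_inj.
- by move=> t _ /=; rewrite [in RHS](tuple_eta t).
Qed.

Lemma Ex0 x F : Ex P x 0 F = F [::].
Proof. by rewrite /Ex big_tuple0 pathprob_nil mul1r. Qed.

Lemma ExS x n F : Ex P x n.+1 F = \sum_x' P x x' * Ex P x' n (fun s => F (x' :: s)).
Proof.
rewrite /Ex (big_tupleS _ (fun s => pathprob P x s * F s)).
apply: eq_bigr => a _; rewrite big_distrr /=; apply: eq_bigr => t _.
by rewrite pathprob_cons mulrA.
Qed.

(** Markov property at time [m]. *)
Lemma ExD x m n F :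
  Ex P x (m + n) F = Ex P x m (fun s => Ex P (last x s) n (fun t => F (s ++ t))).
Proof.
elim: m x F => [|m IH] x F; first by rewrite add0n Ex0.
rewrite addSn !ExS; apply: eq_bigr => a _; by rewrite IH.
Qed.

Lemma eq_Ex x n F G : (forall s, size s = n -> F s = G s) -> Ex P x n F = Ex P x n G.
Proof. by move=> FG; apply: eq_bigr => t _; rewrite FG ?size_tuple. Qed.

Lemma ExZ x n a F : Ex P x n (fun s => a * F s) = a * Ex P x n F.
Proof. by rewrite /Ex big_distrr; apply: eq_bigr => t _; rewrite mulrCA. Qed.

Lemma Ex_add x n F G : Ex P x n (fun s => F s + G s) = Ex P x n F + Ex P x n G.
Proof. by rewrite /Ex -big_split; apply: eq_bigr => t _; rewrite mulrDr. Qed.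

Lemma Ex_sum x n (I : Type) (r : seq I) (p : pred I) F :
  Ex P x n (fun s => \sum_(i <- r | p i) F i s) = \sum_(i <- r | p i) Ex P x n (F i).
Proof.
rewrite /Ex exchange_big; apply: eq_bigr => t _; by rewrite big_distrr.
Qed.

Hypothesis hP : stochastic P.

Lemma pathprob_ge0 x s : 0 <= pathprob P x s.
Proof. by apply: prodr_ge0 => i _; apply: hP.1. Qed.

Lemma Ex_cst x n a : Ex P x n (fun=> a) = a.
Proof.
elim: n x => [|n IH] x; first by rewrite Ex0.
by rewrite ExS; under eq_bigr do rewrite IH; rewrite -big_distrl /= hP.2 mul1r.
Qed.

Lemma ler_Ex x n F G : (forall s, size s = n -> F s <= G s) -> Ex P x n F <= Ex P x n G.
Proof.
move=> FG; apply: ler_sum => t _; rewrite ler_wpM2l ?pathprob_ge0 //.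
by rewrite FG ?size_tuple.
Qed.

Lemma Ex_ge0 x n F : (forall s, size s = n -> 0 <= F s) -> 0 <= Ex P x n F.
Proof. by move=> F0; rewrite -[leLHS](Ex_cst x n) ler_Ex. Qed.

Lemma ler_norm_Ex x n F : `|Ex P x n F| <= Ex P x n (fun s => `|F s|).
Proof.
apply: le_trans (ler_norm_sum _ _ _) _; apply: ler_sum => t _.
by rewrite normrM (ger0_norm (pathprob_ge0 _ _)).
Qed.

End PathExpectation.

(** * Killing along a path *)

Section Survival.
Variables (R : realType) (X : finType) (f : X -> R).

Definition psum (s : seq X) : R := \sum_(v <- s) f v.

Lemma Ssum_size s : Ssum f (size s) s = psum s.
Proof. by rewrite /Ssum take_size. Qed.

Lemma psum_nil : psum [::] = 0. Proof. by rewrite /psum big_nil. Qed.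
Lemma psum_cons a s : psum (a :: s) = f a + psum s.
Proof. by rewrite /psum big_cons. Qed.
Lemma psum_cat s t : psum (s ++ t) = psum s + psum t.
Proof. by rewrite /psum big_cat. Qed.
Lemma psum_rev s : psum (rev s) = psum s.
Proof. by apply: perm_big; rewrite perm_rev. Qed.

Lemma surv_nil y : surv f y [::] = true. Proof. by []. Qed.

Lemma surv_cons y a s : surv f y (a :: s) = (0 < y + f a) && surv f (y + f a) s.
Proof.
rewrite /surv /= /Ssum /= take0 big_cons big_nil addr0; congr (_ && _).
rewrite -[2%N]/(1 + 1)%N iotaDl all_map; apply: eq_all => k /=.
by rewrite big_cons addrA.
Qed.

Lemma surv_cat y s t : surv f y (s ++ t) = surv f y s && surv f (y + psum s) t.
Proof.
elim: s y => [|a s IH] y /=; first by rewrite psum_nil addr0.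
by rewrite !surv_cons IH psum_cons addrA andbA.
Qed.

Lemma surv_last y s : 0 < y -> surv f y s -> 0 < y + psum s.
Proof.
elim: s y => [|a s IH] y y0; first by rewrite psum_nil addr0.
by rewrite surv_cons psum_cons addrA => /andP[]; apply: IH.
Qed.

Lemma surv_homo y y' s : y <= y' -> surv f y s -> surv f y' s.
Proof.
elim: s y y' => [//|a s IH] y y' yy'; rewrite !surv_cons => /andP[h1 h2].
by rewrite (lt_le_trans h1) ?lerD2r //=; apply: IH h2; rewrite lerD2r.
Qed.

End Survival.

(** * Free and killed kernels *)

Section Walk.
Variables (R : realType) (X : finType) (P : X -> X -> R) (f : X -> R).

Definition Tn (n : nat) (G : X -> R -> R) (x : X) (y : R) : R :=
  Ex P x n (fun s => G (last x s) (y + psum f s)).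

Definition Kn (n : nat) (G : X -> R -> R) (x : X) (y : R) : R :=
  Ex P x n (fun s => (surv f y s)%:R * G (last x s) (y + psum f s)).

Lemma Tn0 G x y : Tn 0 G x y = G x y.
Proof. by rewrite /Tn Ex0 psum_nil addr0. Qed.

Lemma TnD m n G x y : Tn (m + n) G x y = Tn m (Tn n G) x y.
Proof.
rewrite /Tn ExD; apply: eq_Ex => s _; apply: eq_Ex => t _.
by rewrite last_cat psum_cat addrA.
Qed.

Lemma Tn1 G x y : Tn 1 G x y = \sum_x' P x x' * G x' (y + f x').
Proof. by rewrite /Tn ExS; apply: eq_bigr => a _; rewrite Ex0 psum_cons psum_nil addr0. Qed.

Lemma Kn0 G x y : Kn 0 G x y = G x y.
Proof. by rewrite /Kn Ex0 psum_nil addr0 mul1r. Qed.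

Lemma KnD m n G x y : Kn (m + n) G x y = Kn m (Kn n G) x y.
Proof.
rewrite /Kn ExD; apply: eq_Ex => s _; rewrite -ExZ; apply: eq_Ex => t _.
by rewrite last_cat psum_cat addrA surv_cat mulrA -natrM mulnb.
Qed.

Lemma Kn1 G x y :
  Kn 1 G x y = \sum_x' P x x' * ((0 < y + f x')%R%:R * G x' (y + f x')).
Proof.
rewrite /Kn ExS; apply: eq_bigr => a _; rewrite Ex0 psum_cons psum_nil addr0.
by rewrite surv_cons andbT.
Qed.

Lemma KnS n G x y : Kn n.+1 G x y =
  \sum_x' P x x' * ((0 < y + f x')%R%:R * Kn n G x' (y + f x')).
Proof. by rewrite -add1n KnD Kn1. Qed.

Lemma KnSr n G x y : Kn n.+1 G x y = Kn n (Kn 1 G) x y.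
Proof. by rewrite -addn1 KnD. Qed.

Lemma KnDZ n a G H x y :
  Kn n (fun x y => a * G x y + H x y) x y = a * Kn n G x y + Kn n H x y.
Proof.
rewrite /Kn -ExZ -Ex_add; apply: eq_Ex => s _; by rewrite mulrDr mulrCA.
Qed.

Lemma KnZ n a G x y : Kn n (fun x y => a * G x y) x y = a * Kn n G x y.
Proof. by rewrite /Kn -ExZ; apply: eq_Ex => s _; rewrite mulrCA. Qed.

Lemma Kn_add n G H x y : Kn n (fun x y => G x y + H x y) x y = Kn n G x y + Kn n H x y.
Proof. by rewrite /Kn -Ex_add; apply: eq_Ex => s _; rewrite mulrDr. Qed.

Lemma Kn_sum n (I : Type) (r : seq I) (p : pred I) G x y :
  Kn n (fun x y => \sum_(i <- r | p i) G i x y) x y = \sum_(i <- r | p i) Kn n (G i) x y.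
Proof.
rewrite /Kn -Ex_sum; apply: eq_Ex => s _; by rewrite big_distrr.
Qed.

Lemma Tn_add n G H x y : Tn n (fun x y => G x y + H x y) x y = Tn n G x y + Tn n H x y.
Proof. by rewrite /Tn -Ex_add. Qed.

Lemma TnZ n a G x y : Tn n (fun x y => a * G x y) x y = a * Tn n G x y.
Proof. by rewrite /Tn -ExZ. Qed.

(** For [n = 0] nothing is tested, hence [0 < y]; later on killing confines the walk to positive
    heights, so only values there matter. *)
Lemma eq_Kn n G H x y : 0 < y -> (forall x y, 0 < y -> G x y = H x y) ->
  Kn n G x y = Kn n H x y.
Proof.
move=> y0 GH; apply: eq_Ex => s _; case: (boolP (surv f y s)) => [ss|]; last by rewrite !mul0r.
by rewrite GH ?surv_last.
Qed.

Lemma eq_Tn n G H x y : (forall x y, G x y = H x y) -> Tn n G x y = Tn n H x y.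
Proof. by move=> GH; apply: eq_Ex => s _; rewrite GH. Qed.

Lemma eq_Knw n G H x y : (forall x y, G x y = H x y) -> Kn n G x y = Kn n H x y.
Proof. by move=> GH; apply: eq_Ex => s _; rewrite GH. Qed.

Hypothesis hP : stochastic P.

Lemma ler_Kn n G H x y : 0 < y -> (forall x y, 0 < y -> G x y <= H x y) ->
  Kn n G x y <= Kn n H x y.
Proof.
move=> y0 GH; apply: ler_Ex => // s _; case: (boolP (surv f y s)) => [ss|]; last by rewrite !mul0r.
by rewrite !mul1r GH ?surv_last.
Qed.

Lemma ler_Tn n G H x y : (forall x y, G x y <= H x y) -> Tn n G x y <= Tn n H x y.
Proof. by move=> GH; apply: ler_Ex. Qed.

Lemma Kn_ge0 n G x y : 0 < y -> (forall x y, 0 < y -> 0 <= G x y) -> 0 <= Kn n G x y.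
Proof.
move=> y0 G0; apply: Ex_ge0 => // s _; case: (boolP (surv f y s)) => [ss|]; last by rewrite !mul0r.
by rewrite mul1r G0 ?surv_last.
Qed.

Lemma Tn_ge0 n G x y : (forall x y, 0 <= G x y) -> 0 <= Tn n G x y.
Proof. by move=> G0; apply: Ex_ge0. Qed.

Lemma ler_norm_Kn n G x y : `|Kn n G x y| <= Kn n (fun x y => `|G x y|) x y.
Proof.
apply: le_trans (ler_norm_Ex hP _ _ _) _; apply: ler_Ex => // s _.
by rewrite normrM normr_nat.
Qed.

Lemma ler_norm_Tn n G x y : `|Tn n G x y| <= Tn n (fun x y => `|G x y|) x y.
Proof. exact: ler_norm_Ex. Qed.

Lemma Tn_cst n a x y : Tn n (fun _ _ => a) x y = a. Proof. exact: Ex_cst. Qed.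

Lemma ler_Kn_Tn n G x y : (forall x y, 0 <= G x y) -> Kn n G x y <= Tn n G x y.
Proof.
move=> G0; apply: ler_Ex => // s _; case: (surv _ _ _); first by rewrite mul1r.
by rewrite mul0r.
Qed.

(** This is $\mathbb P_x(\tau_y>n)$. *)
Definition survn n x y := Kn n (fun _ _ => 1) x y.

Lemma survn_ge0 n x y : 0 <= survn n x y.
Proof. by apply: Ex_ge0 => // s _; rewrite mulr1 ler0n. Qed.

Lemma survn_le1 n x y : survn n x y <= 1.
Proof.
rewrite -(Ex_cst hP x n 1); apply: ler_Ex => // s _; rewrite mulr1; by case: surv.
Qed.

Lemma survnS_le n x y : survn n.+1 x y <= survn n x y.
Proof.
rewrite /survn -addn1 /Kn ExD; apply: ler_Ex => // s _.
rewrite -[leRHS](Ex_cst hP (last x s) 1); apply: ler_Ex => // t _.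
by rewrite surv_cat; case: (surv f y s) => //=; rewrite ?mul0r // !mulr1; case: surv.
Qed.

Lemma survn_homo m n x y : (m <= n)%N -> survn n x y <= survn m x y.
Proof.
move=> /subnK <-; elim: (n - m)%N => [//|k IH]; rewrite addSn.
exact: le_trans (survnS_le _ _ _) IH.
Qed.

Lemma Kn_cst n a x y : Kn n (fun _ _ => a) x y = a * survn n x y.
Proof. by rewrite /survn -KnZ; apply: eq_Ex => s _; rewrite mulr1. Qed.

Lemma Kn_bound n G x y M : 0 < y -> (forall x y, 0 < y -> `|G x y| <= M) ->
  `|Kn n G x y| <= M * survn n x y.
Proof.
move=> y0 GM; apply: le_trans (ler_norm_Kn _ _ _ _) _.
by rewrite -Kn_cst; apply: ler_Kn.
Qed.

Lemma Tn_bound n G x y M : (forall x y, `|G x y| <= M) -> `|Tn n G x y| <= M.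
Proof.
move=> GM; apply: le_trans (ler_norm_Tn _ _ _ _) _.
by rewrite -[leRHS](Tn_cst n _ x y); apply: ler_Tn.
Qed.

End Walk.

End KilledWalk.
Import KilledWalk.

(** * Bounds over a finite type *)

Section FiniteBounds.
Variables (R : realType) (T : finType).

Lemma fin_lower (F : T -> R) : (forall t, 0 < F t) -> exists2 c, 0 < c & forall t, c <= F t.
Proof.
move=> F0; suff [c c0 H] : exists2 c, 0 < c & forall t, t \in enum T -> c <= F t.
  by exists c => // t; apply: H; rewrite mem_enum.
elim: (enum T) => [|a s [c c0 IH]]; first by exists 1.
exists (Num.min c (F a)); first by rewrite lt_min c0 F0.
by move=> t; rewrite inE ge_min => /predU1P[->|/IH ->//]; rewrite lexx orbT.
Qed.

Lemma fin_upper (F : T -> R) : exists2 C, 0 < C & forall t, `|F t| <= C.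
Proof.
(* The 1 keeps the bound positive even when every value vanishes. *)
exists (1 + \sum_t `|F t|); first by rewrite ltr_pwDl // sumr_ge0.
move=> t; rewrite (bigD1 t) //= addrCA lerDl addr_ge0 // sumr_ge0 //.
Qed.

End FiniteBounds.

(** * Ergodicity and the Poisson equation *)

Section Mixing.
Variables (R : realType) (X : finType) (P : X -> X -> R) (nu : X -> R).
Hypotheses (hP : stochastic P) (hnu : invariant_prob P nu) (h1 : H1 P).

Lemma PkS k g x : Pk P k.+1 g x = \sum_x' P x x' * Pk P k g x'.
Proof. by rewrite /Pk ExS. Qed.

Lemma PkD m n g x : Pk P (m + n) g x = Pk P m (Pk P n g) x.
Proof. by rewrite /Pk ExD; apply: eq_Ex => s _; apply: eq_Ex => t _; rewrite last_cat. Qed.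

Lemma PkSr k g x : Pk P k.+1 g x = Pk P k (fun x => \sum_x' P x x' * g x') x.
Proof.
rewrite -addn1 PkD; congr Pk; apply: funext => z.
by rewrite PkS; apply: eq_bigr => w _; rewrite /Pk Ex0.
Qed.

Lemma nuPk k g : \sum_x nu x * Pk P k g x = \sum_x nu x * g x.
Proof.
elim: k => [|k IH]; first by apply: eq_bigr => x _; rewrite /Pk Ex0.
rewrite -IH; under eq_bigr do rewrite PkS big_distrr.
rewrite exchange_big /=; apply: eq_bigr => z _.
by rewrite -[in RHS]hnu.2.2 big_distrl; apply: eq_bigr => x _; rewrite mulrA.
Qed.

Lemma Pk_delta k g x : Pk P k g x = \sum_z Pk P k (fun w => (w == z)%:R) x * g z.
Proof.
transitivity (\sum_z Pk P k (fun w => g z * (w == z)%:R) x); last first.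
  by apply: eq_bigr => z _; rewrite /Pk ExZ mulrC.
rewrite /Pk -Ex_sum; apply: eq_Ex => s _.
rewrite (bigD1 (last x s)) //= eqxx mulr1 big1 ?addr0 // => z.
by rewrite eq_sym => /negPf ->; rewrite mulr0.
Qed.

Lemma Pk_cst k a x : Pk P k (fun=> a) x = a. Proof. exact: Ex_cst. Qed.

(** (H1) for indicators makes all entries of $P^{k_0}$ positive; a uniform lower bound survives
    further averaging, so later powers inherit positivity. *)
Lemma Pk_pos : exists2 k0 : nat, (0 < k0)%N & forall j x z, (k0 <= j)%N ->
  0 < Pk P j (fun w => (w == z)%:R) x.
Proof.
have [k0 [k01 H]] := h1; exists k0 => // j x z /subnK <-; rewrite PkD.
have [c c0 Hc] : exists2 c : R, 0 < c & forall x, c <= Pk P k0 (fun w => (w == z)%:R) x.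
  by apply: fin_lower => w; apply: H; [move=> ?; apply: ler0n|exists z; rewrite eqxx oner_eq0].
by apply: lt_le_trans c0 _; rewrite -[leLHS](Pk_cst (j - k0) c x); apply: ler_Ex.
Qed.

(** Invariance under [k0] steps gives [x] at least the smallest entry of its column in $P^{k_0}$. *)
Lemma nu_gt0 x : 0 < nu x.
Proof.
have [k0 _ H] := Pk_pos.
have -> : nu x = \sum_z nu z * (z == x)%:R.
  by rewrite (bigD1 x) //= eqxx mulr1 big1 ?addr0 // => z /negPf ->; rewrite mulr0.
rewrite -(nuPk k0).
have [c c0 Hc] : exists2 c : R, 0 < c & forall z, c <= Pk P k0 (fun w => (w == x)%:R) z.
  by apply: fin_lower => z; apply: H.
apply: lt_le_trans c0 _; rewrite -[leLHS]mul1r -[X in X * c]hnu.2.1 big_distrl /=.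
by apply: ler_sum => z _; apply: ler_wpM2l; [apply: hnu.1|apply: Hc].
Qed.

Lemma nu_le1 x : nu x <= 1.
Proof.
by rewrite -hnu.2.1 (bigD1 x) //= lerDl sumr_ge0 // => z _; apply: hnu.1.
Qed.

(** Doeblin's argument: the share $c\,\nu$ of each row of $P^{k_0}$ annihilates centred functions,
    and what remains is a non-negative kernel of mass $1-c$. *)
Lemma mix0 g : \sum_x nu x * g x = 0 -> forall eta, 0 < eta ->
  exists N, forall n x, (N <= n)%N -> `|Pk P n g x| <= eta.
Proof.
move=> g0 eta eta0; have [k0 k00 H] := Pk_pos.
have [c c0 Hc] : exists2 c : R, 0 < c &
    forall p : X * X, c <= Pk P k0 (fun w => (w == p.2)%:R) p.1.
  by apply: fin_lower => p; apply: H.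
have contr (u : X -> R) D : \sum_x nu x * u x = 0 -> (forall x, `|u x| <= D) ->
    forall x, `|Pk P k0 u x| <= (1 - c) * D.
  move=> u0 uD x.
  have -> : Pk P k0 u x = \sum_z (Pk P k0 (fun w => (w == z)%:R) x - c * nu z) * u z.
    under eq_bigr do rewrite mulrBl -mulrA; rewrite sumrB -mulr_sumr u0 mulr0 subr0.
    exact: Pk_delta.
  have le0 z : 0 <= Pk P k0 (fun w => (w == z)%:R) x - c * nu z.
    by rewrite subr_ge0 (le_trans _ (Hc (x, z))) // ler_piMr ?nu_le1 // ltW.
  apply: le_trans (ler_norm_sum _ _ _) _.
  apply: (@le_trans _ _ (\sum_z (Pk P k0 (fun w => (w == z)%:R) x - c * nu z) * D)).
    by apply: ler_sum => z _; rewrite normrM (ger0_norm (le0 z)) ler_wpM2l.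
  rewrite -big_distrl /= sumrB -mulr_sumr hnu.2.1 mulr1.
  have -> : \sum_z Pk P k0 (fun w => (w == z)%:R) x = 1.
    transitivity (Pk P k0 (fun=> 1) x); last exact: Pk_cst.
    by rewrite [RHS]Pk_delta; apply: eq_bigr => z _; rewrite mulr1.
  by [].
have [D D0 HD] := fin_upper g.
have iterc i x : `|Pk P (i * k0) g x| <= (1 - c) ^+ i * D.
  elim: i x => [|i IH] x; first by rewrite mul0n /Pk Ex0 mul1r.
  by rewrite mulSn PkD exprS -mulrA; apply: contr; rewrite ?nuPk.
have [x0|X0] := pickP (fun x : X => true); last by exists 0%N => n x; have := X0 x.
move=> _; have c1 : c <= 1.
  apply: le_trans (Hc (x0, x0)) _; rewrite -[leRHS](Pk_cst k0 1 x0); apply: ler_Ex => // s _.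
  by rewrite lern1 leq_b1.
have [i Hi] : exists i, (1 - c) ^+ i * D <= eta.
  have : (fun i => (1 - c) ^+ i * D) @ \oo --> 0 * D.
    apply: cvgM; last exact: cvg_cst.
    by apply: cvg_expr; rewrite ger0_norm ?subr_ge0 // ltrBlDr ltrDl.
  rewrite mul0r => /cvgrPdist_le/(_ _ eta0)[i _ /(_ i (leqnn _))].
  by rewrite sub0r normrN => Hi; exists i; apply: le_trans (ler_norm _) Hi.
exists (i * k0)%N => n x /subnK <-; rewrite PkD.
apply: le_trans (ler_norm_Ex hP _ _ _) _; rewrite -[leRHS](Ex_cst hP x (n - i * k0)).
by apply: ler_Ex => // s _; apply: le_trans (iterc _ _) Hi.
Qed.

Lemma mix g eta : 0 < eta ->
  exists N, forall n x, (N <= n)%N -> `|Pk P n g x - \sum_x nu x * g x| <= eta.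
Proof.
move=> eta0; set m := \sum_x _.
have [|N HN] := mix0 (g := fun x => g x - m) _ eta0.
  under eq_bigr do rewrite mulrBr; rewrite sumrB -big_distrl /= hnu.2.1 mul1r.
  by rewrite subrr.
exists N => n x Nn; have := HN n x Nn.
by rewrite {1}/Pk Ex_add Ex_cst.
Qed.

(** The solution is $r=\sum_{n\ge1}P^ng$, obtained without series by inverting $I-P+1\otimes\nu$: a
    vector in the kernel is centred and fixed by [P], hence equal to $P^nv\to0$. *)
Lemma poisson g : \sum_x nu x * g x = 0 ->
  exists r : X -> R, forall x, r x = \sum_x' P x x' * (g x' + r x').
Proof.
(* [M] acts on row vectors, so it is the transpose of $I-P+1\otimes\nu$. *)
move=> g0; pose M : 'M[R]_#|X| := \matrix_(i, j) (let z := enum_val i in let x := enum_val j in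
  (z == x)%:R - P x z + nu z).
pose fn (v : 'rV[R]_#|X|) x := v 0 (enum_rank x).
have vM v x : (v *m M) 0 (enum_rank x) = fn v x - \sum_z P x z * fn v z + \sum_z nu z * fn v z.
  rewrite mxE (reindex enum_rank) /=; last first.
    by exists enum_val => i _; rewrite ?enum_rankK ?enum_valK.
  under eq_bigr do rewrite mxE !enum_rankK mulrDr mulrBr.
  rewrite big_split sumrB /=; congr (_ - _ + _).
  - rewrite (bigD1 x) //= eqxx mulr1 big1 ?addr0 // => z /negPf ->; by rewrite mulr0.
  - by apply: eq_bigr => z _; rewrite mulrC.
  - by apply: eq_bigr => z _; rewrite mulrC.
have nuPg u : \sum_x nu x * (\sum_z P x z * u z) = \sum_x nu x * u x.
  by rewrite -[RHS](nuPk 1); apply: eq_bigr => x _; rewrite PkS; congr (_ * _);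
    apply: eq_bigr => z _; rewrite /Pk Ex0.
have Mu : M \in unitmx.
  rewrite -row_free_unit -kermx_eq0; apply/rowV0P => v /sub_kermxP v0.
  have E x : fn v x - \sum_z P x z * fn v z + \sum_z nu z * fn v z = 0.
    by rewrite -vM v0 mxE.
  have nuv : \sum_z nu z * fn v z = 0.
    have : \sum_x nu x * (fn v x - \sum_z P x z * fn v z + \sum_z nu z * fn v z) = 0.
      by rewrite big1 // => x _; rewrite E mulr0.
    under eq_bigr do rewrite mulrDr mulrBr.
    by rewrite big_split sumrB /= nuPg subrr add0r -big_distrl /= hnu.2.1 mul1r.
  have E1 n x : fn v x = Pk P n (fn v) x.
    elim: n x => [|n IH] x; first by rewrite /Pk Ex0.
    rewrite PkSr; have := E x; rewrite nuv addr0 => /eqP; rewrite subr_eq0 => /eqP Ex'.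
    rewrite {1}IH; congr Pk; apply: funext => z.
    by have := E z; rewrite nuv addr0 => /eqP; rewrite subr_eq0 => /eqP.
  apply/rowP => i; rewrite mxE; apply/eqP; rewrite -normr_eq0 eq_le normr_ge0 andbT.
  apply/ler_addgt0Pl => e e0; rewrite addr0; have [N HN] := mix0 nuv e0.
  by rewrite -[i]enum_valK -/(fn v _) (E1 N) HN.
(* The right-hand side is $Pg$, which is again centred; this forces $\nu(r)=0$ and removes the
   rank-one term. *)
pose w : 'rV[R]_#|X| := \row_j (\sum_z P (enum_val j) z * g z).
pose v := w *m invmx M.
have E x : fn v x - \sum_z P x z * fn v z + \sum_z nu z * fn v z = \sum_z P x z * g z.
  by rewrite -vM /v mulmxKV // mxE enum_rankK.
have nuv : \sum_z nu z * fn v z = 0.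
  have : \sum_x nu x * (fn v x - \sum_z P x z * fn v z + \sum_z nu z * fn v z) = 0.
    by under eq_bigr do rewrite E; rewrite nuPg.
  under eq_bigr do rewrite mulrDr mulrBr.
  by rewrite big_split sumrB /= nuPg subrr add0r -big_distrl /= hnu.2.1 mul1r.
exists (fn v) => x; under eq_bigr do rewrite mulrDr.
rewrite big_split /= -E nuv addr0; ring.
Qed.

End Mixing.

(** * Variance and second-order corrector *)

Section Variance.
Variables (R : realType) (X : finType) (P : X -> X -> R) (nu f : X -> R).
Hypotheses (hP : stochastic P) (hnu : invariant_prob P nu) (h1 : H1 P) (h2 : H2 nu f).

(** The series telescopes because $P^nf=P^{n-1}r-P^nr$; the remainder $\nu(fP^Nr)$ tends to
    $\nu(f)\nu(r)=0$ by mixing. *)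
Lemma sigma2E r : (forall x, r x = \sum_x' P x x' * (f x' + r x')) ->
  sigma2 P nu f = \sum_x nu x * f x ^+ 2 + 2 * \sum_x nu x * (f x * r x).
Proof.
move=> hr; rewrite /sigma2; congr (_ + 2 * _); apply: cvg_lim => //.
have h2' : \sum_x nu x * f x = 0 by rewrite -[RHS]h2; apply: eq_bigr => x _; rewrite mulrC.
have tele N x : \sum_(1 <= n < N.+1) Pk P n f x = r x - Pk P N r x.
  elim: N => [|N IH]; first by rewrite big_geq // /Pk Ex0 subrr.
  rewrite big_nat_recr //= IH.
  have -> : Pk P N r x = Pk P N.+1 f x + Pk P N.+1 r x.
    transitivity (Pk P N (fun x => \sum_x' P x x' * (f x' + r x')) x).
      by congr Pk; apply: funext.
    by rewrite -PkSr /Pk Ex_add.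
  ring.
pose nr := \sum_x nu x * r x.
rewrite -(cvg_shiftS (fun N => \sum_(1 <= n < N) \sum_x nu x * (f x * Pk P n f x))) /=.
have E N : \sum_(1 <= n < N.+1) \sum_x nu x * (f x * Pk P n f x) =
    \sum_x nu x * (f x * r x) - \sum_x nu x * (f x * (Pk P N r x - nr)).
  rewrite exchange_big /=.
  transitivity (\sum_x nu x * (f x * (r x - Pk P N r x))).
    apply: eq_bigr => x _; rewrite -tele mulr_sumr mulr_sumr; exact: eq_bigr.
  have -> : \sum_x nu x * (f x * (Pk P N r x - nr)) = \sum_x nu x * (f x * Pk P N r x).
    transitivity (\sum_x (nu x * (f x * Pk P N r x) - nu x * f x * nr)).
      by apply: eq_bigr => x _; ring.
    by rewrite sumrB -[X in _ - X]big_distrl /= h2' mul0r subr0.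
  by rewrite -sumrB; apply: eq_bigr => x _; ring.
apply/cvgrPdist_le => e e0.
have [C C0 HC] := fin_upper f.
have [N HN] := mix hP hnu h1 r (divr_gt0 e0 C0).
exists N => // n /= Nn; rewrite E opprB addrC subrK.
apply: le_trans (ler_norm_sum _ _ _) _.
rewrite -[leRHS]mul1r -[X in _ <= X * _]hnu.2.1 big_distrl /=; apply: ler_sum => x _.
rewrite normrM ger0_norm ?hnu.1 // ler_wpM2l ?hnu.1 // normrM.
rewrite (_ : e = C * (e / C)); last by rewrite mulrCA divff ?mulr1 // gt_eqF.
by apply: ler_pM => //; apply: HN.
Qed.

(** [r] cancels the first-order and [q] the second-order term in the expansion of a slowly varying
    wave. The [nu]-mean of $f^2/2+fr$ is $\sigma^2/2$, which is how the variance enters. *)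
Lemma poisson2 : exists r q : X -> R, (forall x, r x = \sum_x' P x x' * (f x' + r x')) /\
  forall x, q x + sigma2 P nu f / 2 =
    \sum_x' P x x' * (f x' ^+ 2 / 2 + f x' * r x' + q x').
Proof.
have h2' : \sum_x nu x * f x = 0 by rewrite -[RHS]h2; apply: eq_bigr => x _; rewrite mulrC.
have [r hr] := poisson hP hnu h1 h2'.
have [|q hq] := @poisson _ _ _ _ hP hnu h1 (fun x => f x ^+ 2 / 2 + f x * r x - sigma2 P nu f / 2).
  rewrite (sigma2E hr); under eq_bigr do rewrite mulrBr mulrDr.
  rewrite sumrB big_split /= -big_distrl /= hnu.2.1 mul1r.
  under eq_bigr do rewrite mulrA; rewrite -big_distrl /=; by field.
exists r; exists q; split=> // x; rewrite {1}(hq x).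
rewrite -[X in _ + X]mul1r -(hP.2 x) big_distrl -big_split /=.
by apply: eq_bigr => z _; ring.
Qed.

End Variance.

(** * The dual chain *)

Section Dual.
Variables (R : realType) (X : finType) (P : X -> X -> R) (nu f : X -> R).
Hypotheses (hP : stochastic P) (hnu : invariant_prob P nu) (h1 : H1 P) (h2 : H2 nu f).
Local Notation Ps := (Pdual P nu).

Lemma nu_Pdual x z : nu x * Ps x z = nu z * P z x.
Proof.
have := gt_eqF (nu_gt0 hP hnu h1 x); rewrite /Pdual => n0.
by rewrite mulrA mulrCA divff ?n0 // mulr1.
Qed.

Lemma Pdual_stochastic : stochastic Ps.
Proof.
split=> [x x'|x]; first by rewrite /Pdual mulr_ge0 ?divr_ge0 ?hnu.1 ?hP.1.
apply: (mulfI (negbT (gt_eqF (nu_gt0 hP hnu h1 x)))); rewrite mulr1 mulr_sumr.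
by under eq_bigr do rewrite nu_Pdual; rewrite hnu.2.2.
Qed.

Lemma Pdual_invariant : invariant_prob Ps nu.
Proof.
split; first exact: hnu.1; split; first exact: hnu.2.1.
by move=> x; under eq_bigr do rewrite nu_Pdual; rewrite -mulr_sumr hP.2 mulr1.
Qed.

(** One step is the balance [nu_Pdual]; this adjointness in $L^2(\nu)$ carries (H1) and the variance
    over to the dual chain. *)
Lemma Pk_adjoint n a b :
  \sum_x nu x * (a x * Pk Ps n b x) = \sum_x nu x * (Pk P n a x * b x).
Proof.
elim: n a => [|n IH] a; first by apply: eq_bigr => x _; rewrite /Pk !Ex0.
transitivity (\sum_z nu z * ((\sum_x P z x * a x) * Pk Ps n b z)); last first.
  by rewrite IH; apply: eq_bigr => x _; rewrite PkSr.
under eq_bigr do rewrite PkS !mulr_sumr; rewrite exchange_big /=.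
apply: eq_bigr => z _; rewrite mulr_suml mulr_sumr; apply: eq_bigr => x _.
have := nu_Pdual x z; move: (nu x) (Ps x z) (nu z) => c d e E.
transitivity (c * d * (a x * Pk Ps n b z)); first by ring.
by rewrite E; ring.
Qed.

(** By adjointness the value at [x] integrates [g] against $P^{k_0}$ of the indicator of [x], a
    function positive everywhere. *)
Lemma Pdual_H1 : H1 Ps.
Proof.
have [k0 [k01 H]] := h1; exists k0; split=> // g g0 [z gz] x.
suff : 0 < nu x * Pk Ps k0 g x by rewrite pmulr_rgt0 // (nu_gt0 hP hnu h1).
have -> : nu x * Pk Ps k0 g x = \sum_w nu w * ((w == x)%:R * Pk Ps k0 g w).
  rewrite (bigD1 x) //= eqxx mul1r big1 ?addr0 // => w /negPf ->.
  by rewrite mul0r mulr0.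
have Hx w : 0 < Pk P k0 (fun v => (v == x)%:R) w.
  by apply: H; [move=> ?; apply: ler0n|exists x; rewrite eqxx oner_eq0].
rewrite Pk_adjoint (bigD1 z) //=; apply: ltr_pwDl.
  by rewrite !mulr_gt0 ?(nu_gt0 hP hnu h1) // lt_neqAle eq_sym gz g0.
by apply: sumr_ge0 => w _; rewrite !mulr_ge0 ?hnu.1 // ltW.
Qed.

Lemma Pdual_H2 : H2 nu (fun x => - f x).
Proof.
by rewrite /H2; under eq_bigr do rewrite mulNr; rewrite sumrN (h2 : \sum_x f x * nu x = 0) oppr0.
Qed.

Lemma sigma2_dual : sigma2 Ps nu (fun x => - f x) = sigma2 P nu f.
Proof.
rewrite /sigma2; congr (_ + 2 * _).
  by apply: eq_bigr => x _; rewrite sqrrN.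
congr (limn _); apply: funext => N; apply: eq_bigr => n _.
transitivity (\sum_x nu x * (f x * Pk Ps n f x)).
  apply: eq_bigr => x _.
  have -> : Pk Ps n (fun x => - f x) x = - Pk Ps n f x.
    by rewrite -mulN1r /Pk -ExZ; apply: eq_Ex => s _; rewrite mulN1r.
  by rewrite mulrNN.
by rewrite Pk_adjoint; apply: eq_bigr => x _; rewrite [f x * _]mulrC.
Qed.

End Dual.

Lemma pathprob_gt0 (R : realType) (X : finType) (P : X -> X -> R) x s : stochastic P ->
  (0 < pathprob P x s) = path (fun a b => 0 < P a b) x s.
Proof.
move=> hP; elim: s x => [|a s IH] x; first by rewrite pathprob_nil ltr01.
rewrite pathprob_cons /= -IH; have := hP.1 x a.
rewrite le_eqVlt => /predU1P[<-|h]; first by rewrite mul0r ltxx.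
by rewrite h pmulr_rgt0.
Qed.

(** The cycle of (H3) is read backwards; changing the signs of [f] and [theta] together gives an
    equivalent lattice condition. *)
Lemma Pdual_H3 (R : realType) (X : finType) (P : X -> X -> R) (nu f : X -> R) :
  stochastic P -> invariant_prob P nu -> H1 P -> H3 P f ->
  H3 (Pdual P nu) (fun x => - f x).
Proof.
move=> hP hnu h1 h3 theta a; have [n [x0 [s [s0 hs]]]] := h3 (- theta) a.
have hPs := Pdual_stochastic hP hnu h1.
exists n, x0, [tuple of rev s]; split; last first.
  move=> [k hk]; apply: hs; exists (- k); rewrite mulrNz mulNr -hk.
  rewrite sumrN (_ : \sum_(v <- rev s) f v = \sum_(v <- s) f v); last exact: psum_rev.
  ring.
(* Written as one path that ends at [x0], the cycle has all its transitions reversed at once by list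
   reversal. *)
have cyc Q (t : seq X) : pathprob Q x0 t * Q (last x0 t) x0 = pathprob Q x0 (rcons t x0).
  by rewrite -cats1 pathprob_cat pathprob_cons pathprob_nil mulr1.
move: s0; rewrite !cyc !pathprob_gt0 // => s0.
have := rev_path (fun b c => 0 < P c b) x0 (rcons s x0).
rewrite last_rcons belast_rcons rev_cons => E.
rewrite (eq_path (e' := fun b c => 0 < P c b)) ?E // => b c.
by rewrite /Pdual pmulr_rgt0 // divr_gt0 // (nu_gt0 hP hnu h1).
Qed.

(** Bundled because this set of hypotheses is stable under duality, so every result also applies to
    the dual chain. *)
Definition good (R : realType) (X : finType) (P : X -> X -> R) (nu f : X -> R) :=
  [/\ stochastic P /\ invariant_prob P nu, H1 P, H2 nu f, H3 P f & 0 < sigma2 P nu f].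

Lemma good_dual (R : realType) (X : finType) (P : X -> X -> R) (nu f : X -> R) :
  good P nu f -> good (Pdual P nu) nu (fun x => - f x).
Proof.
move=> [[hP hnu] h1 h2 h3 s0]; split.
- by split; [apply: Pdual_stochastic|apply: Pdual_invariant].
- exact: Pdual_H1.
- exact: Pdual_H2.
- exact: Pdual_H3.
- by rewrite sigma2_dual.
Qed.

(** * Elementary trigonometric inequalities *)

Section TrigBounds.
Variable R : realType.
Implicit Types u v : R.

(** Feeds a ladder of Taylor inequalities: each of the next four integrates the one before, starting
    from [cos_le1]. *)
Lemma deriv_ge0_homo (F dF : R -> R) u : (forall v, is_derive v 1 F (dF v)) ->
  (forall v, 0 <= v -> 0 <= dF v) -> 0 <= u -> F 0 <= F u.
Proof.
move=> FdF dF0; rewrite le_eqVlt => /predU1P[<-//|u0].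
have [|c /andP[c0 _] E] := MVT u0 (fun v _ => FdF v).
  by apply: derivable_within_continuous => v _.
rewrite -subr_ge0 E mulr_ge0 ?subr_ge0 ?(ltW u0) // dF0 //.
by move: c0; rewrite bnd_simp => /ltW.
Qed.

Lemma sin_le_id u : 0 <= u -> sin u <= u.
Proof.
move=> u0; rewrite -subr_ge0.
pose F v : R := v - sin v; rewrite -[leRHS]/(F u) (_ : 0 = F 0); last by rewrite /F sin0 subr0.
by apply: (@deriv_ge0_homo F (fun v => 1 - cos v)) => // v _; rewrite subr_ge0 cos_le1.
Qed.

Lemma cos_ge_quad u : 0 <= u -> 1 - u ^+ 2 / 2 <= cos u.
Proof.
move=> u0; rewrite -subr_ge0.
pose F v : R := cos v - (1 - v ^+ 2 / 2); rewrite -[leRHS]/(F u).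
rewrite (_ : 0 = F 0); last by rewrite /F cos0 expr0n /= mul0r subr0 subrr.
apply: (@deriv_ge0_homo F (fun v => v - sin v)) => // v; last first.
  by move=> v0; rewrite subr_ge0 sin_le_id.
by apply: is_derive_eq; rewrite /GRing.scale /=; field.
Qed.

Lemma sin_ge_cubic u : 0 <= u -> u - u ^+ 3 / 6 <= sin u.
Proof.
move=> u0; rewrite -subr_ge0.
pose F v : R := sin v - (v - v ^+ 3 / 6); rewrite -[leRHS]/(F u).
rewrite (_ : 0 = F 0); last by rewrite /F sin0 expr0n /= mul0r subr0 subrr.
apply: (@deriv_ge0_homo F (fun v => cos v - (1 - v ^+ 2 / 2))) => // v; last first.
  by move=> v0; rewrite subr_ge0 cos_ge_quad.
by apply: is_derive_eq; rewrite /GRing.scale /=; field.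
Qed.

Lemma cos_le_quart u : 0 <= u -> cos u <= 1 - u ^+ 2 / 2 + u ^+ 4 / 24.
Proof.
move=> u0; rewrite -subr_ge0.
pose F v : R := 1 - v ^+ 2 / 2 + v ^+ 4 / 24 - cos v; rewrite -[leRHS]/(F u).
rewrite (_ : 0 = F 0); last by rewrite /F cos0 !expr0n /= !mul0r subr0 addr0 subrr.
apply: (@deriv_ge0_homo F (fun v => sin v - (v - v ^+ 3 / 6))) => // v; last first.
  by move=> v0; rewrite subr_ge0 sin_ge_cubic.
by apply: is_derive_eq; rewrite /GRing.scale /=; field.
Qed.

Lemma normr_sin_id u : `|sin u - u| <= `|u| ^+ 3 / 6.
Proof.
wlog u0 : u / 0 <= u => [H|].
  have [/H//|/ltW u0] := leP 0 u.
  have -> : sin u - u = - (sin (- u) - - u) by rewrite sinN; ring.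
  by rewrite normrN -(normrN u) H ?oppr_ge0.
rewrite (ger0_norm u0) ler_norml; have := sin_ge_cubic u0; have := sin_le_id u0.
have : 0 <= u ^+ 3 by rewrite exprn_ge0.
by move=> *; apply/andP; split; lra.
Qed.

Lemma normr_cos_quad u : `|cos u - (1 - u ^+ 2 / 2)| <= `|u| ^+ 4 / 24.
Proof.
wlog u0 : u / 0 <= u => [H|].
  have [/H//|/ltW u0] := leP 0 u.
  by rewrite -(normrN u) -(cosN u) -(sqrrN u) H ?oppr_ge0.
rewrite (ger0_norm u0) ler_norml; have := cos_ge_quad u0; have := cos_le_quart u0.
have : 0 <= u ^+ 4 by rewrite exprn_ge0.
by move=> *; apply/andP; split; lra.
Qed.

Lemma normr_sin_le u : `|sin u| <= `|u|.
Proof.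
wlog u0 : u / 0 <= u => [H|].
  have [/H//|/ltW u0] := leP 0 u.
  by rewrite -(normrN u) -(normrN (sin u)) -sinN H ?oppr_ge0.
rewrite (ger0_norm u0) ler_norml sin_le_id // andbT.
have [u1|/ltW u1] := leP u 1; last by rewrite (le_trans _ (sin_geN1 _)) // lerN2.
by rewrite (@le_trans _ _ 0) ?oppr_le0 // (le_trans _ (sin_ge_cubic u0)) //; nra.
Qed.

Lemma normr_cosB_le u v : `|cos u - cos v| <= `|u - v|.
Proof.
pose m := (u + v) / 2; pose d := (u - v) / 2.
rewrite [X in cos X - _](_ : u = m + d) ?[X in _ - cos X](_ : v = m - d) /m /d; try by field.
rewrite cosD cosB (_ : _ - _ = - (2 * (sin m * sin d))); last by rewrite /m /d; ring.
rewrite normrN normrM normrM.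
have -> : `|u - v| = `|2 : R| * (1 * `|d|) by rewrite mul1r -normrM /d; congr (`|_|); field.
by rewrite ler_wpM2l // ler_pM // ?sin_max ?normr_sin_le.
Qed.

Lemma normr_sinB_le u v : `|sin u - sin v| <= `|u - v|.
Proof.
pose m := (u + v) / 2; pose d := (u - v) / 2.
rewrite [X in sin X - _](_ : u = m + d) ?[X in _ - sin X](_ : v = m - d) /m /d; try by field.
rewrite sinD sinB (_ : _ - _ = 2 * (cos m * sin d)); last by rewrite /m /d; ring.
rewrite normrM normrM.
have -> : `|u - v| = `|2 : R| * (1 * `|d|) by rewrite mul1r -normrM /d; congr (`|_|); field.
by rewrite ler_wpM2l // ler_pM // ?cos_max ?normr_sin_le.
Qed.

(** Quantifies the gain of [wave_contract] at small frequencies, and the size of the Fejer kernel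
    near 0. *)
Lemma cos_le_small u : `|u| <= 1 -> `|cos u| <= 1 - u ^+ 2 / 4.
Proof.
move=> u1; have := normr_cos_quad u; rewrite -normrX.
have : 0 <= u ^+ 2 <= 1 by rewrite sqr_ge0 -real_normK ?num_real // expr_le1.
rewrite (_ : u ^+ 4 = u ^+ 2 * u ^+ 2); last by ring.
move: (u ^+ 2) => w /andP[w0 w1]; rewrite (ger0_norm (mulr_ge0 w0 w0)) !ler_norml => /andP[H1 H2].
by apply/andP; split; nra.
Qed.

(** After translation by the floor of [u / pi] the argument lies in $[0,\pi)$, and [sin] is positive
    inside. *)
Lemma sin_eq0_int u : sin u = 0 -> exists k : int, u = k%:~R * pi.
Proof.
have p0 := @pi_gt0 R.
have per (k : int) v : sin v = 0 -> sin (v - k%:~R * pi) = 0.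
  move=> v0; rewrite sinB v0 mul0r; suff -> : sin (k%:~R * pi) = 0 :> R by rewrite mulr0 subr0.
  have nat0 n : sin (n%:R * pi) = 0 :> R.
    elim: n => [|n IH]; first by rewrite mul0r sin0.
    by rewrite mulrSr mulrDl mul1r sinD sinpi IH mulr0 mul0r addr0.
  by case: k => n; [apply: nat0|rewrite NegzE mulrNz mulNr sinN nat0 oppr0].
move=> u0; exists (Num.floor (u / pi)).
have H0 := per (Num.floor (u / pi)) _ u0.
have /andP[h1 h2] := Num.Theory.floor_itv (u / pi).
move: h1 h2; rewrite ler_pdivlMr // ltr_pdivrMr // => h1 h2.
move: H0 h1 h2; rewrite intrD mulrDl mul1r; move: (_ * pi) => w H0 h1 h2.
apply/eqP; rewrite eq_le h1 andbT leNgt; apply/negP => h3.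
have : 0 < sin (u - w) by apply: sin_gt0_pi; rewrite subr_gt0 h3 ltrBlDl.
by rewrite H0 ltxx.
Qed.

End TrigBounds.

Lemma near_dist_le (R : realType) (t0 e : R) : 0 < e -> \forall t \near t0, `|t0 - t| <= e.
Proof. by move=> e0; have := @cvgr_dist_le R R^o R (nbhs t0) _ idfun t0; apply. Qed.

(** * Waves and their contraction *)

Section Waves.
Variables (R : realType) (X : finType) (P : X -> X -> R) (f : X -> R).
Hypothesis hP : stochastic P.
Local Notation Tn := (Tn P f).
Local Notation psum := (psum f).

(** D'Alembert's equation, satisfied by every combination of $\cos(ty)$ and $\sin(ty)$ with
    coefficients depending on [x]. It expresses a fixed frequency over the reals and is preserved by
    the free kernel. *)
Definition wave (t : R) (G : X -> R -> R) :=
  forall x m d, G x (m + d) + G x (m - d) = 2 * cos (t * d) * G x m.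

Lemma wave_Tn t n G : wave t G -> wave t (Tn n G).
Proof.
move=> wG x m d; rewrite /KilledWalk.Tn -Ex_add -ExZ; apply: eq_Ex => s _.
by rewrite -wG; congr (G _ _ + G _ _); ring.
Qed.

Lemma wave_cos t (a : X -> R) b : wave t (fun x y => a x * cos (t * y + b)).
Proof.
move=> x m d; rewrite (_ : t * (m + d) + b = (t * m + b) + t * d); last by ring.
rewrite (_ : t * (m - d) + b = (t * m + b) - t * d); last by ring.
by rewrite cosD cosB; ring.
Qed.

Lemma wave_sin t (a : X -> R) b : wave t (fun x y => a x * sin (t * y + b)).
Proof.
move=> x m d; rewrite (_ : t * (m + d) + b = (t * m + b) + t * d); last by ring.
rewrite (_ : t * (m - d) + b = (t * m + b) - t * d); last by ring.
by rewrite sinD sinB; ring.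
Qed.

(** A share [p] of each of two paths with a common endpoint is merged into one value at the mean
    height, multiplied by the cosine of half the phase difference; the other paths keep mass
    $1-2p$. *)
Lemma wave_contract N x (s1 s2 : N.-tuple X) p t G M y :
  wave t G -> (forall x y, `|G x y| <= M) -> s1 != s2 -> last x s1 = last x s2 ->
  0 <= p -> p <= pathprob P x s1 -> p <= pathprob P x s2 ->
  `|Tn N G x y| <=
  (1 - 2 * p * (1 - `|cos (t * ((psum s1 - psum s2) / 2))|)) * M.
Proof.
move=> wG GM s12 l12 p0 p1 p2; set c := cos _.
pose w (s : N.-tuple X) := pathprob P x s - p * (s == s1)%:R - p * (s == s2)%:R.
have w0 s : 0 <= w s.
  rewrite /w; have [->|] := eqVneq s s1; first by rewrite (negPf s12) mulr1 mulr0 subr0 subr_ge0.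
  have [->|] := eqVneq s s2; first by rewrite mulr0 subr0 mulr1 subr_ge0.
  by rewrite !mulr0 !subr0 pathprob_ge0.
have delta (s0 : N.-tuple X) (F : N.-tuple X -> R) : \sum_s p * (s == s0)%:R * F s = p * F s0.
  rewrite (bigD1 s0) //= eqxx mulr1 big1 ?addr0 // => s /negPf ->.
  by rewrite mulr0 mul0r.
pose F (s : N.-tuple X) := G (last x s) (y + psum s).
have sumw : \sum_s w s = 1 - 2 * p.
  rewrite /w !sumrB; have := delta s1 (fun=> 1); have := delta s2 (fun=> 1).
  under eq_bigr do rewrite mulr1; move=> ->.
  under eq_bigr do rewrite mulr1; move=> ->.
  have := Ex_cst hP x N 1; rewrite /Ex; under eq_bigr do rewrite mulr1; move=> ->.
  by ring.
have -> : Tn N G x y = \sum_s w s * F s + p * (F s1 + F s2).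
  rewrite /KilledWalk.Tn /Ex /w; under [X in _ = X + _]eq_bigr do rewrite !mulrBl.
  by rewrite !sumrB !delta; ring.
have -> : F s1 + F s2 = 2 * c * G (last x s1) (y + (psum s1 + psum s2) / 2).
  by rewrite -wG /F l12; congr (G _ _ + G _ _); field.
apply: le_trans (ler_normD _ _) _.
have h1 : `|\sum_s w s * F s| <= (1 - 2 * p) * M.
  apply: le_trans (ler_norm_sum _ _ _) _; rewrite -sumw big_distrl /=.
  by apply: ler_sum => s _; rewrite normrM (ger0_norm (w0 s)) ler_wpM2l ?w0 ?GM.
have h2 : `|p * (2 * c * G (last x s1) (y + (psum s1 + psum s2) / 2))| <= p * (2 * `|c| * M).
  rewrite normrM (ger0_norm p0) ler_wpM2l // normrM normrM (ger0_norm (x := 2)) //.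
  by rewrite ler_wpM2l ?GM // mulr_ge0.
by apply: le_trans (lerD h1 h2) _; rewrite le_eqVlt; apply/orP; left; apply/eqP; ring.
Qed.

End Waves.

(** * Decay of waves from the non-lattice condition *)

Section NonLattice.
Variables (R : realType) (X : finType) (P : X -> X -> R) (nu f : X -> R).
Hypotheses (hP : stochastic P) (hnu : invariant_prob P nu) (h1 : H1 P) (h3 : H3 P f).
Local Notation psum := (psum f).
Local Notation e := (fun a b => 0 < P a b).

Lemma conn : exists2 k0, (0 < k0)%N & forall j x z, (k0 <= j)%N ->
  exists s, [/\ size s = j, path e x s & last x s = z].
Proof.
have [k0 k00 H] := Pk_pos hP h1; exists k0 => // j x z /(H j x z) H0.
apply: contrapT => noS; move: H0; suff -> : Pk P j (fun w => (w == z)%:R) x = 0 by rewrite ltxx.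
rewrite /Pk /Ex big1 // => s _; have [l|] := eqVneq (last x s) z; last by rewrite mulr0.
rewrite mulr1; apply/eqP; apply: contrapT => /negP n0; apply: noS.
exists s; rewrite size_tuple; split=> //.
by rewrite -pathprob_gt0 // lt_neqAle eq_sym n0 pathprob_ge0.
Qed.

(** If this failed, finiteness of [X] would give a base point [b] from which any two paths of equal
    length and endpoint have equal sums modulo $(2\pi/t)\mathbb Z$. Sums would then grow by a
    constant [theta] per step modulo that group, against (H3). *)
Lemma nonlattice (x0 : X) (t : R) : t != 0 -> exists2 N, (0 < N)%N &
  forall x, exists s1 s2 : N.-tuple X,
  [/\ 0 < pathprob P x s1, 0 < pathprob P x s2, last x s1 = last x s2 &
      sin (t * ((psum s1 - psum s2) / 2)) != 0].
Proof.
(* [E] is membership in the group $(2\pi/t)\mathbb Z$. *)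
move=> t0; pose E z := sin (t * (z / 2)) = 0.
have EN z : E z -> E (- z) by rewrite /E mulNr mulrN sinN => ->; rewrite oppr0.
have ED z w : E z -> E w -> E (z + w).
  by rewrite /E !(mulrDl, mulrDr) sinD => -> ->; rewrite mulr0 mul0r addr0.
have Eeq z w : z = w -> E z -> E w by move=> ->.
have E0 : E 0 by rewrite /E mul0r mulr0 sin0.
pose bad N x := forall s1 s2, size s1 = N -> size s2 = N -> path e x s1 -> path e x s2 ->
  last x s1 = last x s2 -> E (psum s1 - psum s2).
suff [N HN] : exists N, forall x, ~ bad N x.
  have N0 : (0 < N)%N.
    case: N HN => // /(_ x0) []; move=> s1 s2 /size0nil -> /size0nil -> _ _ _.
    by rewrite subrr.
  exists N => // x; apply: contrapT => noS; apply: (HN x) => s1 s2 z1 z2 p1 p2 l12.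
  apply: contrapT => nE; apply: noS.
  have /eqP z1' := z1; have /eqP z2' := z2.
  exists (Tuple z1'), (Tuple z2'); split=> //; rewrite ?pathprob_gt0 //.
  by apply/eqP.
apply: contrapT => noN.
have badN N : exists x, bad N x.
  apply: contrapT => H; apply: noN; exists N => x bx; apply: H; by exists x.
have [k0 k00 cn] := conn.
(* Badness passes to shorter lengths: both paths are prolonged by the same tail, which exists by
   [conn] when at least [k0] steps are left. *)
have badW N n x : (n + k0 <= N)%N -> bad N x -> bad n x.
  move=> nN bN s1 s2 z1 z2 p1 p2 l12.
  have [|s [zs ps ls]] := cn (N - n)%N (last x s1) x0.
    by rewrite leq_subRL // (leq_trans _ nN) // leq_addr.
  have nN' : (n <= N)%N by rewrite (leq_trans _ nN) // leq_addr.
  have := bN (s1 ++ s) (s2 ++ s); rewrite !size_cat z1 z2 zs subnKC // !cat_path p1 p2 -l12 ps.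
  rewrite !last_cat -l12 !psum_cat => /(_ erefl erefl erefl erefl erefl).
  by rewrite (_ : _ - _ = psum s1 - psum s2) //; ring.
have [b bb] : exists b, forall N, bad N b.
  apply: contrapT => H.
  have H' x : exists N, ~ bad N x.
    by apply: contrapT => H2; apply: H; exists x => N; apply: contrapT => H3; apply: H2; exists N.
  have [M HM] := choice H'.
  have [x bx] := badN (\sum_x M x + k0)%N.
  apply: (HM x); apply: badW bx; rewrite leq_add2r (bigD1 x) //= leq_addr.
by [].
have [p0 [zp0 pp0 lp0]] := cn k0 b b (leqnn _).
have [q0 [zq0 pq0 lq0]] := cn k0.+1 b b (leqnSn _).
pose theta := psum q0 - psum p0.
(* [a] closes [p] and [q] to loops at [b], which are compared with [p0 ++ c] and [q0 ++ c] of the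
   same lengths; on subtraction [a] and [c] cancel. *)
have step n z p q : (k0 <= n)%N -> size p = n -> size q = n.+1 -> path e b p -> path e b q ->
    last b p = z -> last b q = z -> E (psum q - psum p - theta).
  move=> kn zp zq pp pq lp lq.
  have [a [za pa la]] := cn k0 z b (leqnn _).
  have [c [zc pc lc]] := cn n b b kn.
  have e1 : E (psum (p ++ a) - psum (p0 ++ c)).
    apply: (bb (n + k0)%N); rewrite ?size_cat ?zp ?za ?zp0 ?zc // 1?addnC //.
    - by rewrite cat_path pp lp.
    - by rewrite cat_path pp0 lp0.
    - by rewrite !last_cat lp lp0 la lc.
  have e2 : E (psum (q ++ a) - psum (q0 ++ c)).
    apply: (bb (n.+1 + k0)%N); rewrite ?size_cat ?zq ?za ?zq0 ?zc // 1?addnC ?addnS //.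
    - by rewrite cat_path pq lq.
    - by rewrite cat_path pq0 lq0.
    - by rewrite !last_cat lq lq0 la lc.
  have := ED _ _ e2 (EN _ e1); rewrite !psum_cat /theta.
  by rewrite (_ : _ - _ = psum q - psum p - (psum q0 - psum p0)) //; ring.
have steps i z p q : size p = k0 -> size q = (k0 + i)%N -> path e b p -> path e b q ->
    last b p = z -> last b q = z -> E (psum q - psum p - i%:R * theta).
  elim: i q => [|i IH] q zp zq pp pq lp lq.
    rewrite mul0r subr0; apply: (bb k0) => //; rewrite ?zq ?addn0 //; by rewrite lp lq.
  have [q' [zq' pq' lq']] := cn (k0 + i)%N b z (leq_addr _ _).
  have e1 := IH q' zp zq' pp pq' lp lq'.
  have e2 : E (psum q - psum q' - theta).
    by apply: (step (k0 + i)%N z) => //; rewrite ?leq_addr // zq addnS.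
  by apply: Eeq (ED _ _ e1 e2); rewrite -natr1; ring.
(* The cycle is appended to a path of length [k0] ending at [z], and its sum is compared with [n.+1]
   times the drift [theta]. *)
have [n [z [s [s0 hs]]]] := h3 theta (2 * pi / t).
apply: hs; have [p [zp pp lp]] := cn k0 b z (leqnn _).
have : E (psum (p ++ rcons s z) - psum p - n.+1%:R * theta).
  apply: (steps n.+1 z) => //.
  - by rewrite size_cat zp size_rcons size_tuple.
  - rewrite cat_path pp lp /= rcons_path -pathprob_gt0 //.
    have := s0; have := pathprob_ge0 hP z s; rewrite le_eqVlt => /predU1P[<-|h].
      by rewrite mul0r ltxx.
    by rewrite pmulr_rgt0 // h.
  - by rewrite last_cat last_rcons.
move=> /sin_eq0_int [k hk]; exists k.
have -> : f z + \sum_(v <- s) f v = psum (p ++ rcons s z) - psum p.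
  by rewrite psum_cat -cats1 psum_cat psum_cons psum_nil /KilledWalk.psum; ring.
move: hk; move: (_ - _ * theta) => w hk.
have -> : w = 2 / t * (t * (w / 2)) by field.
by rewrite hk; field.
Qed.

Lemma contract_near (t0 : R) : (exists x : X, True) -> exists N c, [/\ (0 < N)%N, 0 < c &
  \forall t \near t0, forall G M, wave t G -> (forall x y, `|G x y| <= M) ->
    forall x y, `|Tn P f N G x y| <= expR (- (c * t ^+ 2)) * M].
Proof.
move=> [x0 _].
suff [N [c [N0 c0 H]]] : exists N c, [/\ (0 < N)%N, 0 < c &
    \forall t \near t0, forall x, exists (s1 s2 : N.-tuple X) p,
    [/\ s1 != s2, last x s1 = last x s2, 0 <= p, p <= pathprob P x s1 /\ p <= pathprob P x s2
      & c * t ^+ 2 <= 2 * p * (1 - `|cos (t * ((psum s1 - psum s2) / 2))|)]].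
  exists N, c; split=> //; apply: filterS H => t Ht G M wG GM x y.
  have [s1 [s2 [p [s12 l12 p0 [p1 p2] cp]]]] := Ht x.
  apply: le_trans (wave_contract f hP y wG GM s12 l12 p0 p1 p2) _.
  have M0 : 0 <= M by apply: le_trans (GM x y).
  rewrite ler_wpM2r //; apply: le_trans (expR_ge1Dx _); by rewrite lerD2l lerN2.
pose pr x (N : nat) (s1 s2 : N.-tuple X) := Num.min (pathprob P x s1) (pathprob P x s2).
(* At [t0 = 0] frequency 1 serves only to find pairs of paths with distinct sums; the gain there is
   quadratic, $1-|\cos(td)|\ge t^2d^2/4$. Elsewhere it stays bounded below near [t0]. *)
pose tt := if t0 == 0 then 1 else t0.
have tt0 : tt != 0 by rewrite /tt; case: ifPn => //; rewrite oner_neq0.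
have [N N0 HN] := nonlattice x0 tt0.
have H x : exists st : N.-tuple X * N.-tuple X, let: (s1, s2) := st in
  [/\ 0 < pathprob P x s1, 0 < pathprob P x s2, last x s1 = last x s2 &
      sin (tt * ((psum s1 - psum s2) / 2)) != 0].
  by have [s1 [s2 ?]] := HN x; exists (s1, s2).
have [st Hst] := choice H.
pose s1 x := (st x).1; pose s2 x := (st x).2.
pose d x := (psum (s1 x) - psum (s2 x)) / 2.
pose p x := pr x N (s1 x) (s2 x).
have K x : [/\ 0 < p x, last x (s1 x) = last x (s2 x), sin (tt * d x) != 0 & s1 x != s2 x].
  have := Hst x; rewrite /s1 /s2 /d /p /pr /s1 /s2; case: (st x) => a b /= [ha hb hc hd].
  split=> //; first by rewrite lt_min ha hb.
  by apply: contraNneq hd => ->; rewrite subrr mul0r mulr0 sin0.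
suff [c c0 Hc] : exists2 c, 0 < c & \forall t \near t0, forall x,
    c * t ^+ 2 <= 2 * p x * (1 - `|cos (t * d x)|).
  exists N, c; split=> //; apply: filterS Hc => t Hc x; have [k1 k2 k3 k4] := K x.
  exists (s1 x), (s2 x), (p x); split=> //; first exact: ltW.
  by split; rewrite ge_min lexx ?orbT.
have [B B0 HB] := fin_upper d.
have [q q0 Hq] : exists2 q, 0 < q & forall x, q <= p x by apply: fin_lower => x; case: (K x).
rewrite /tt in K; move: K; case: ifPn => [/eqP ->|t00] K.
  have [a a0 Ha] : exists2 a, 0 < a & forall x, a <= `|d x|.
    apply: fin_lower => x; have [_ _ dx _] := K x; rewrite normr_gt0.
    by apply: contraNneq dx => ->; rewrite mulr0 sin0.
  exists (2 * q * (a ^+ 2 / 4)); first by rewrite !mulr_gt0 // ?exprn_gt0 ?invr_gt0.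
  near=> t.
  have tB : `|t| <= B^-1.
    by near: t; have := @nbhs0_le _ R^o (B^-1); rewrite invr_gt0; apply.
  move=> x.
  have td : `|t * d x| <= 1.
    rewrite normrM; apply: (@le_trans _ _ (B^-1 * B)); last by rewrite mulVf ?gt_eqF.
    exact: ler_pM.
  have := cos_le_small td => hcos.
  apply: (@le_trans _ _ (2 * p x * ((t * d x) ^+ 2 / 4))); last first.
    apply: ler_wpM2l; last by rewrite lerBrDl -lerBrDr.
    by rewrite mulr_ge0 // (le_trans (ltW q0)).
  rewrite (_ : 2 * q * (a ^+ 2 / 4) * t ^+ 2 = 2 * q * ((t ^+ 2 * a ^+ 2) / 4)); last by ring.
  apply: ler_pM.
  - by rewrite mulr_ge0 // ltW.
  - by rewrite divr_ge0 // mulr_ge0 // sqr_ge0.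
  - by rewrite ler_wpM2l.
  - rewrite ler_wpM2r ?invr_ge0 // exprMn ler_wpM2l ?sqr_ge0 //.
    by rewrite -[leRHS]real_normK ?num_real // ler_sqr ?nnegrE ?(ltW a0).
have [a a0 Ha] : exists2 a, 0 < a & forall x, a <= 1 - `|cos (t0 * d x)|.
  apply: fin_lower => x; have [_ _ dx _] := K x; rewrite subr_gt0 lt_neqAle cos_max andbT.
  by rewrite norm_cos_eq1.
exists (2 * q * (a / 2) / (`|t0| + 1) ^+ 2).
  by rewrite divr_gt0 ?mulr_gt0 ?exprn_gt0 ?divr_gt0 // ltr_wpDl.
near=> t.
have t1 : `|t| <= `|t0| + 1.
  have h : `|t0 - t| <= 1 by near: t; apply: near_dist_le; exact: ltr01.
  have := lerB_dist t t0; rewrite distrC; lra.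
have t2 : `|t - t0| <= a / 2 / B.
  rewrite distrC; near: t; apply: near_dist_le.
  by rewrite !divr_gt0.
move=> x.
have cc : a / 2 <= 1 - `|cos (t * d x)|.
  have h := normr_cosB_le (t * d x) (t0 * d x).
  have h2 : `|t * d x - t0 * d x| <= a / 2.
    rewrite -mulrBl normrM (_ : a / 2 = a / 2 / B * B); last by rewrite divfK ?gt_eqF.
    by apply: ler_pM.
  have h3' := lerB_dist (cos (t * d x)) (cos (t0 * d x)).
  have := Ha x; lra.
apply: (@le_trans _ _ (2 * q * (a / 2))).
  rewrite mulrAC ler_pdivrMr ?exprn_gt0 ?ltr_wpDl // ler_wpM2l ?mulr_ge0 ?divr_ge0 ?(ltW q0) ?(ltW a0) //.
  rewrite -real_normK ?num_real // ler_sqr ?nnegrE ?addr_ge0 //.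
by apply: ler_pM; rewrite ?mulr_ge0 ?(ltW q0) ?divr_ge0 ?(ltW a0) // ler_wpM2l.
Unshelve. all: by end_near. Qed.

(** Local constants are glued by compactness of [[0, A]]. One integer [i] serves as prefactor and
    inverse rate, since increasing it weakens both. *)
Lemma decay (A : R) : exists2 i : nat, (0 < i)%N & forall t, 0 <= t <= A -> forall n G M,
  wave t G -> (forall x y, `|G x y| <= M) -> forall x y,
  `|Tn P f n G x y| <= i%:R * expR (- (t ^+ 2 * n%:R / i%:R)) * M.
Proof.
have [x0|X0] := pickP (fun x : X => true); last by exists 1%N => // t _ n G M _ _ x; have := X0 x.
move=> _; pose Pr (i : nat) t := (0 < i)%N /\ forall n G M,
  wave t G -> (forall x y, `|G x y| <= M) -> forall x y,
  `|Tn P f n G x y| <= i%:R * expR (- (t ^+ 2 * n%:R / i%:R)) * M.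
suff : \forall i \near \oo, `[0, A]%classic `<=` Pr i.
  move=> [i _ /(_ i (leqnn i)) H]; exists (i.+1) => // t tA.
  have [i0 HH] : Pr i t by apply: H; rewrite /= in_itv.
  move=> n G M wG GM x y; apply: le_trans (HH n G M wG GM x y) _.
  have M0 : 0 <= M by apply: le_trans (GM x y).
  rewrite ler_wpM2r // ler_pM ?expR_ge0 // ?ler_nat // ler_expR lerN2.
  apply: ler_wpM2l; first by rewrite mulr_ge0 ?sqr_ge0.
  by rewrite lef_pV2 ?posrE ?ltr0n // ler_nat.
have /compact_near_coveringP cov := @segment_compact R 0 A.
apply: cov => t0 _.
have [N [c [N0 c0 H]]] := contract_near t0 (ex_intro _ x0 I).
(* The exponential pays for the [n %% N] steps left over; [N / c] is the inverse rate. *)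
pose D := expR (c * (`|t0| + 1) ^+ 2) + N%:R / c + 1.
near=> t i => /=.
have t1 : `|t| <= `|t0| + 1.
  have h : `|t0 - t| <= 1 by near: t; apply: near_dist_le; exact: ltr01.
  have := lerB_dist t t0; rewrite distrC; lra.
have iD : D <= i%:R by near: i; exact: nbhs_infty_ger.
have D1 : 1 <= D by rewrite lerDr addr_ge0 ?expR_ge0 ?divr_ge0 ?(ltW c0).
have i0 : 0 < i%:R :> R by apply: lt_le_trans iD; apply: lt_le_trans D1.
split; first by rewrite -(ltr0n R).
move=> n G M wG GM x y.
have HN : forall G M, wave t G -> (forall x y, `|G x y| <= M) ->
    forall x y, `|Tn P f N G x y| <= expR (- (c * t ^+ 2)) * M by near: t.
have iterN q z w : `|Tn P f (q * N) G z w| <= expR (- (c * t ^+ 2)) ^+ q * M.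
  elim: q z w => [|q IH] z w; first by rewrite mul0n Tn0 mul1r.
  rewrite mulSn TnD exprS -mulrA; apply: HN => //; exact: wave_Tn.
have M0 : 0 <= M by apply: le_trans (GM x y).
rewrite (divn_eq n N) addnC TnD.
have h4 := Tn_bound f hP (n %% N) x y (iterN (n %/ N)%N).
apply: le_trans h4 _; rewrite ler_wpM2r // -expRM_natl.
apply: (@le_trans _ _ (expR (c * (`|t0| + 1) ^+ 2) * expR (- (c * t ^+ 2 * (n%:R / N%:R))))).
  rewrite -expRD ler_expR.
  have qn : n%:R / N%:R <= (n %/ N)%:R + 1 :> R.
    rewrite ler_pdivrMr ?ltr0n // natr1 -natrM ler_nat ltnW // mulSn addnC.
    by rewrite {1}(divn_eq n N) ltn_add2l ltn_pmod.
  have t2 : t ^+ 2 <= (`|t0| + 1) ^+ 2.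
    by rewrite -real_normK ?num_real // ler_sqr ?nnegrE ?addr_ge0.
  have ct : 0 <= c * t ^+ 2 by rewrite mulr_ge0 ?sqr_ge0 // ltW.
  have ct2 : c * t ^+ 2 <= c * (`|t0| + 1) ^+ 2 by rewrite ler_wpM2l // ltW.
  have := ler_wpM2l ct qn; lra.
apply: ler_pM; rewrite ?expR_ge0 //.
  by apply: le_trans iD; rewrite /D -addrA lerDl addr_ge0 ?divr_ge0 ?(ltW c0).
rewrite addnC -divn_eq ler_expR lerN2.
rewrite (_ : c * t ^+ 2 * (n%:R / N%:R) = t ^+ 2 * n%:R * (c / N%:R)); last by ring.
apply: ler_wpM2l; first by rewrite mulr_ge0 ?sqr_ge0.
have N0R : 0 < N%:R :> R by rewrite ltr0n.
rewrite -[c / _]invrK lef_pV2 ?posrE ?invr_gt0 ?divr_gt0 //.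
by rewrite invf_div; apply: le_trans iD; rewrite /D addrAC lerDr addr_ge0 ?expR_ge0.
Unshelve. all: by end_near. Qed.

End NonLattice.

(** * Real-valued Lebesgue integrals *)

Section RealIntegral.
Variable R : realType.
Local Notation mu := (@lebesgue_measure R).
Implicit Types h g : R -> R.

(** All integrals run over the whole line; a domain enters as a boolean factor, which turns
    splittings of domains into ring identities. *)
Definition intg h := mu.-integrable setT (EFin \o h).
Definition RI h : R := \int[mu]_x h x.

Lemma intg_measurable h : intg h -> measurable_fun setT h.
Proof. by move/integrableP => [/measurable_EFinP]. Qed.

Lemma intg_le h g : measurable_fun setT h -> (forall x, `|h x| <= g x) -> intg g -> intg h.
Proof.
move=> mh hg; apply: le_integrable => //; first exact/measurable_EFinP.
by move=> x _ /=; rewrite lee_fin (le_trans (hg x)) // ler_norm.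
Qed.

Lemma intgD h g : intg h -> intg g -> intg (fun x => h x + g x).
Proof. by move=> ih ig; have := integrableD measurableT ih ig. Qed.

Lemma intgZ a h : intg h -> intg (fun x => a * h x).
Proof. by move=> ih; have := integrableZl measurableT a ih. Qed.

Lemma intgB h g : intg h -> intg g -> intg (fun x => h x - g x).
Proof. by move=> ih ig; have := integrableB measurableT ih ig. Qed.

Lemma intg_norm h : intg h -> intg (fun x => `|h x|).
Proof. by move=> ih; have := integrable_norm ih. Qed.

Lemma intg0 : intg (fun=> 0).
Proof. exact: integrable0. Qed.

Lemma intg_sum (I : Type) (r : seq I) (p : pred I) (F : I -> R -> R) :
  (forall i, p i -> intg (F i)) -> intg (fun x => \sum_(i <- r | p i) F i x).
Proof.
move=> iF; elim: r => [|a r IH].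
  by rewrite (_ : (fun x => _) = fun=> 0); [exact: intg0|apply: funext => x; rewrite big_nil].
have [pa|pa] := boolP (p a).
  rewrite (_ : (fun x => _) = fun x => F a x + \sum_(i <- r | p i) F i x).
    by apply: intgD => //; apply: iF.
  by apply: funext => x; rewrite big_cons pa.
rewrite (_ : (fun x => _) = fun x => \sum_(i <- r | p i) F i x) //.
by apply: funext => x; rewrite big_cons (negPf pa).
Qed.

Lemma RID h g : intg h -> intg g -> RI (fun x => h x + g x) = RI h + RI g.
Proof. by move=> ih ig; rewrite /RI RintegralD. Qed.

Lemma RIB h g : intg h -> intg g -> RI (fun x => h x - g x) = RI h - RI g.
Proof. by move=> ih ig; rewrite /RI RintegralB. Qed.

Lemma RIZ a h : intg h -> RI (fun x => a * h x) = a * RI h.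
Proof. by move=> ih; rewrite /RI RintegralZl. Qed.

Lemma RI0 : RI (fun=> 0) = 0.
Proof. by rewrite /RI /Rintegral integral0. Qed.

Lemma RI_sum (I : Type) (r : seq I) (p : pred I) (F : I -> R -> R) :
  (forall i, p i -> intg (F i)) ->
  RI (fun x => \sum_(i <- r | p i) F i x) = \sum_(i <- r | p i) RI (F i).
Proof.
move=> iF; elim: r => [|a r IH].
  rewrite big_nil (_ : (fun x => _) = fun=> 0) ?RI0 //.
  by apply: funext => x; rewrite big_nil.
rewrite big_cons; have [pa|pa] := boolP (p a).
  rewrite (_ : (fun x => _) = fun x => F a x + \sum_(i <- r | p i) F i x).
    by rewrite RID ?IH //; [exact: iF|exact: intg_sum].
  by apply: funext => x; rewrite big_cons pa.
by rewrite -IH; congr RI; apply: funext => x; rewrite big_cons (negPf pa).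
Qed.

Lemma RI_le h g : intg h -> intg g -> (forall x, h x <= g x) -> RI h <= RI g.
Proof. by move=> ih ig hg; rewrite /RI le_Rintegral. Qed.

Lemma RI_ge0 h : (forall x, 0 <= h x) -> 0 <= RI h.
Proof. by move=> h0; rewrite /RI Rintegral_ge0. Qed.

Lemma RI_norm h g : intg h -> intg g -> (forall x, `|h x| <= g x) -> `|RI h| <= RI g.
Proof.
move=> ih ig hg; apply: le_trans (le_normr_Rintegral measurableT ih) _.
by apply: RI_le => //; apply: intg_norm.
Qed.

Lemma RI_EFin h : intg h -> (\int[mu]_x (h x)%:E)%E = (RI h)%:E.
Proof. by move=> ih; rewrite /RI /Rintegral fineK // integrable_fin_num. Qed.

Lemma RI_dct (h_ : nat -> R -> R) h g :
  (forall n, measurable_fun setT (h_ n)) -> (forall n x, `|h_ n x| <= g x) -> intg g ->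
  (forall x, h_ ^~ x @ \oo --> h x) -> intg h /\ RI (h_ n) @[n --> \oo] --> RI h.
Proof.
move=> mh hg ig cv.
have mh' : measurable_fun setT h by apply: (measurable_fun_cvg mh) => x _; exact: cv.
have ih : intg h.
  apply: intg_le ig => // x.
  apply: (@ler_cvg_to nat \oo _ _ (fun n => `|h_ n x|) (fun=> g x) `|h x| (g x)); last by apply: nearW => n.
  - exact: cvg_norm.
  - exact: cvg_cst.
split=> //.
have [] := @dominated_convergence _ _ _ mu setT measurableT (fun n x => (h_ n x)%:E)
  (EFin \o h) (EFin \o g).
- by move=> n; apply/measurable_EFinP; exact: mh.
- exact/measurable_EFinP.
- by apply: aeW => x _; apply: cvg_EFin; [apply: nearW => n|exact: cv].
- exact: ig.
- by apply: aeW => x n _ /=; rewrite lee_fin.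
move=> _ _; rewrite RI_EFin // => /fine_cvgP[_] H.
exact: H.
Qed.

End RealIntegral.

(** * Affine changes of variable and antiderivatives *)

Section ChangeOfVariable.
Variable R : realType.
Local Notation mu := (@lebesgue_measure R).
Implicit Types h g : R -> R.

Lemma mf_bool (b : R -> bool) : measurable_fun setT b ->
  measurable_fun setT (fun x => (b x)%:R : R).
Proof.
move=> mb; rewrite (_ : (fun x => _) = fun x => if b x then 1 else 0 : R).
  by apply: measurable_fun_ifT.
by apply: funext => x; case: (b x).
Qed.

Lemma mf_andb (b c : R -> bool) : measurable_fun setT b -> measurable_fun setT c ->
  measurable_fun setT (fun x => b x && c x).
Proof.
move=> mb mc; rewrite (_ : (fun x => _) = fun x => if b x then c x else false).
  by apply: measurable_fun_ifT.
by apply: funext => x; case: (b x).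
Qed.

Lemma mf_le h g : measurable_fun setT h -> measurable_fun setT g ->
  measurable_fun setT (fun x => (h x <= g x)%R%:R : R).
Proof. by move=> mh mg; apply: mf_bool; apply: measurable_fun_ler. Qed.

Lemma mf_lt h g : measurable_fun setT h -> measurable_fun setT g ->
  measurable_fun setT (fun x => (h x < g x)%R%:R : R).
Proof. by move=> mh mg; apply: mf_bool; apply: measurable_fun_ltr. Qed.

Lemma mf_seg a b : measurable_fun setT (fun x : R => (a <= x <= b)%R%:R : R).
Proof.
by apply: mf_bool; apply: mf_andb; apply: measurable_fun_ler.
Qed.

Lemma mfM h g : measurable_fun setT h -> measurable_fun setT g ->
  measurable_fun setT (fun x => h x * g x).
Proof. exact: measurable_funM. Qed.

Lemma mfD h g : measurable_fun setT h -> measurable_fun setT g ->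
  measurable_fun setT (fun x => h x + g x).
Proof. exact: measurable_funD. Qed.

Lemma mf_affine h (a b : R) : measurable_fun setT h ->
  measurable_fun setT (fun x : R => h (a * x + b)).
Proof.
move=> mh; apply: (measurableT_comp mh).
by apply: measurable_funD => //; apply: measurable_funM.
Qed.

Lemma mf_shift h (b : R) : measurable_fun setT h ->
  measurable_fun setT (fun x : R => h (x + b)).
Proof.
move=> /(mf_affine 1 b); by under eq_fun do rewrite mul1r.
Qed.

Lemma lipschitz_measurable h C : (forall x y, `|h x - h y| <= C * `|x - y|) ->
  measurable_fun setT h.
Proof.
move=> hL; apply: continuous_measurable_fun => x; apply/cvgrPdist_le => e e0.
have C1 : 0 < `|C| + 1 by rewrite ltr_wpDl.
near=> y; apply: le_trans (hL _ _) _.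
apply: (@le_trans _ _ ((`|C| + 1) * (e / (`|C| + 1)))); last first.
  by rewrite mulrCA divff ?mulr1 // gt_eqF.
apply: (@le_trans _ _ ((`|C| + 1) * `|x - y|)).
  by rewrite ler_wpM2r // (le_trans (ler_norm _)) // lerDl.
rewrite ler_wpM2l ?(ltW C1) //; near: y; apply: near_dist_le; exact: divr_gt0.
Unshelve. all: by end_near. Qed.

Definition aff (a b : R) (x : measurableTypeR R) : measurableTypeR R := a * x + b.

Lemma measurable_aff a b : measurable_fun setT (aff a b).
Proof. by apply: measurable_funD => //; apply: measurable_funM. Qed.

(** Both sides agree on half-open intervals, which determine Lebesgue measure. *)
Lemma mu_affine (a b : R) (A : set (measurableTypeR R)) : 0 < a -> measurable A ->
  mu A = (a%:E * mu (aff a b @^-1` A))%E.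
Proof.
move=> a0 mA; pose k := NngNum (ltW a0).
pose m0 : {measure set (measurableTypeR R) -> \bar R} := mscale k (pushforward mu (aff a b)).
pose m' := m0 (measurable_aff a b).
rewrite (@lebesgue_measure_unique R m' _ A mA) // => Y [[c d] _ <-] /=.
rewrite /mscale /= /pushforward.
have -> : aff a b @^-1` `]c, d] = `](c - b) / a, (d - b) / a]%classic.
  apply/seteqP; split=> x /=; rewrite !in_itv /= /aff ltr_pdivrMr // ler_pdivlMr //;
    by rewrite ltrBlDr lerBrDr [x * a]mulrC.
rewrite !lebesgue_measure_itv /= !lte_fin ltr_pM2r ?invr_gt0 // ltrD2r.
case: ifPn => cd; last by rewrite mule0.
by rewrite -!EFinB -EFinM -mulrBl mulrC divfK ?gt_eqF //; congr EFin; ring.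
Qed.

Lemma ge0_int_affine (a b : R) h : 0 < a -> measurable_fun setT h -> (forall x, 0 <= h x) ->
  (\int[mu]_x (h x)%:E = \int[mu]_x (a * h (a * x + b))%:E)%E.
Proof.
move=> a0 mh h0; pose k := NngNum (ltW a0).
pose m0 : {measure set (measurableTypeR R) -> \bar R} := mscale k (pushforward mu (aff a b)).
pose m' := m0 (measurable_aff a b).
transitivity (\int[m']_x (h x)%:E)%E.
  apply: eq_measure_integral => A mA _; exact: mu_affine.
rewrite ge0_integral_mscale //=; last 2 first.
  exact/measurable_EFinP.
  by move=> x _; rewrite lee_fin.
rewrite (ge0_integral_pushforward (measurable_aff a b)) //=; last 2 first.
  exact/measurable_EFinP.
  by move=> x _; rewrite lee_fin.
rewrite preimage_setT -ge0_integralZl //.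
- apply/measurable_EFinP; exact: (mf_affine a b mh).
- by move=> x _; rewrite lee_fin.
- by rewrite lee_fin ltW.
Qed.

Lemma intg_affine (a b : R) h : 0 < a -> intg h -> intg (fun x => h (a * x + b)).
Proof.
move=> a0 ih; have mh := intg_measurable ih.
apply/integrableP; split; first by apply/measurable_EFinP; exact: mf_affine.
have /integrableP[_ lt] := intgZ a^-1 (intg_norm ih).
have an0 : a != 0 by rewrite gt_eqF.
have a1 : 0 <= a^-1 by rewrite invr_ge0 ltW.
suff -> : (\int[mu]_x `|(EFin \o (fun x => h (a * x + b))%R) x|)%E =
  (\int[mu]_x `|(EFin \o (fun x => a^-1 * `|h x|)%R) x|)%E by [].
transitivity (\int[mu]_x (a^-1 * `|h x|)%:E)%E; last first.
  by apply: eq_integral => x _ /=; rewrite normrM normr_id (ger0_norm a1).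
rewrite (@ge0_int_affine a b (fun x => a^-1 * `|h x|)) //.
- by apply: eq_integral => x _ /=; congr EFin; rewrite mulrA divff ?mul1r.
- by apply: mfM => //; apply: measurableT_comp.
- by move=> x; rewrite mulr_ge0.
Qed.

Lemma RI_affine (a b : R) h : 0 < a -> intg h -> RI (fun x => h (a * x + b)) = RI h / a.
Proof.
move=> a0 ih; have an0 : a != 0 by rewrite gt_eqF.
have key g : intg g -> (forall x, 0 <= g x) -> RI (fun x => g (a * x + b)) = RI g / a.
  move=> ig g0; have E := @ge0_int_affine a b g a0 (intg_measurable ig) g0.
  move: E; rewrite RI_EFin // RI_EFin; last by apply: intgZ; apply: intg_affine.
  move=> E; have {E} -> := EFin_inj E; rewrite RIZ; last exact: intg_affine.
  by rewrite mulrAC divff // mul1r.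
pose p x := (`|h x| + h x) / 2; pose q x := (`|h x| - h x) / 2.
have ip : intg p.
  rewrite (_ : p = fun x => 2^-1 * (`|h x| + h x)); last by apply: funext => x; rewrite mulrC.
  by apply: intgZ; apply: intgD => //; apply: intg_norm.
have iq : intg q.
  rewrite (_ : q = fun x => 2^-1 * (`|h x| - h x)); last by apply: funext => x; rewrite mulrC.
  by apply: intgZ; apply: intgB => //; apply: intg_norm.
have hE x : h x = p x - q x by rewrite /p /q; field.
have p0 x : 0 <= p x by rewrite divr_ge0 // -lerBlDr sub0r -normrN ler_norm.
have q0 x : 0 <= q x by rewrite divr_ge0 // subr_ge0 ler_norm.
have -> : RI h = RI p - RI q by rewrite -RIB //; congr RI; apply: funext.
have -> : RI (fun x => h (a * x + b)) = RI (fun x => p (a * x + b)) - RI (fun x => q (a * x + b)).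
  rewrite -RIB; first by congr RI; apply: funext.
  - exact: intg_affine.
  - exact: intg_affine.
rewrite (key p) // (key q) //; ring.
Qed.

Lemma intg_shift b h : intg h -> intg (fun x => h (x + b)).
Proof.
move=> ih; have := @intg_affine 1 b h ltr01 ih; by under eq_fun do rewrite mul1r.
Qed.

Lemma RI_shift b h : intg h -> RI (fun x => h (x + b)) = RI h.
Proof.
move=> ih; have := @RI_affine 1 b h ltr01 ih.
by under eq_fun do rewrite mul1r; rewrite divr1.
Qed.

Lemma intg_seg (a b : R) : intg (fun x => (a <= x <= b)%R%:R).
Proof.
have := @integrable_indic_itv R a b true false; rewrite /intg.
by congr (_.-integrable _ _); apply: funext => x /=; rewrite indicE mem_setE in_itv.
Qed.

Lemma RI_seg (a b : R) : a <= b -> RI (fun x => (a <= x <= b)%R%:R) = b - a.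
Proof.
move=> ab; rewrite /RI /Rintegral.
transitivity (fine (\int[mu]_x (\1_`[a, b] x)%:E)%E).
  by congr fine; apply: eq_integral => x _; rewrite indicE mem_setE in_itv.
rewrite integral_indic //= setIT lebesgue_measure_itv /= lte_fin.
by move: ab; rewrite le_eqVlt => /predU1P[->|->//]; rewrite ltxx subrr.
Qed.

Lemma intg_bounded (a b M : R) h : measurable_fun setT h -> (forall x, a <= x <= b -> `|h x| <= M) ->
  intg (fun x => (a <= x <= b)%R%:R * h x).
Proof.
move=> mh hM; apply: (@intg_le _ _ (fun x => M * (a <= x <= b)%R%:R)).
- by apply: mfM => //; apply: mf_seg.
- move=> x; case: (boolP (a <= x <= b)) => [/hM|_]; first by rewrite mul1r mulr1.
  by rewrite mul0r mulr0 normr0.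
- by apply: intgZ; apply: intg_seg.
Qed.

Lemma RI_FTC_seg (a b : R) h (F : R -> R) : a < b -> continuous h -> (forall x : R, is_derive x 1 F (h x)) ->
  RI (fun x => (a <= x <= b)%R%:R * h x) = F b - F a.
Proof.
move=> ab ch dF.
have dF' x : derivable F x 1 by case: (dF x).
have cF : continuous F by move=> x; apply/differentiable_continuous/derivable1_diffP.
have E := @continuous_FTC2 R h F a b ab.
rewrite /RI /Rintegral.
transitivity (fine (\int[mu]_(x in `[a, b]) (h x)%:E)%E); last first.
  rewrite E //.
  - by apply: continuous_subspaceT => x; exact: ch.
  - split=> //; first exact: (cvg_at_right_filter (cF a)).
    exact: (cvg_at_left_filter (cF b)).
  - by move=> x _; rewrite derive1E; case: (dF x).
congr fine; rewrite [RHS]integral_mkcond; apply: eq_integral => x _ /=.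
rewrite patchE mem_setE in_itv /=; case: ifP => _; first by rewrite mul1r.
by rewrite mul0r.
Qed.

(** Truncation at integers and dominated convergence reduce to a segment. *)
Lemma RI_FTC_half h (F : R -> R) (l : R) : continuous h -> (forall x : R, is_derive x 1 F (h x)) ->
  intg (fun x => (0 <= x)%R%:R * h x) -> F n%:R @[n --> \oo] --> l ->
  RI (fun x => (0 <= x)%R%:R * h x) = l - F 0.
Proof.
move=> ch dF ih Fl; have mh := continuous_measurable_fun ch.
pose h_ n x := (0 <= x <= n.+1%:R)%R%:R * h x.
have [||||_ cv] := @RI_dct R h_ (fun x => (0 <= x)%R%:R * h x) (fun x => `|(0 <= x)%R%:R * h x|).
- by move=> n; apply: mfM => //; apply: mf_seg.
- move=> n x; rewrite /h_; case: (0 <= x) => /=; last by rewrite !mul0r.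
  by case: (x <= _); rewrite ?mul1r // mul0r normr0.
- exact: intg_norm.
- move=> x; apply: cvg_near_cst; near=> n; rewrite /h_.
  suff -> : x <= n.+1%:R by rewrite andbT.
  rewrite (@le_trans _ _ n%:R) ?ler_nat //; near: n; exact: nbhs_infty_ger.
have E n : RI (h_ n) = F n.+1%:R - F 0 by apply: RI_FTC_seg.
have cv2 : RI (h_ n) @[n --> \oo] --> l - F 0.
  rewrite (_ : (fun n => RI (h_ n)) = fun n => F n.+1%:R - F 0); last exact: funext.
  by apply: cvgB; [rewrite (cvg_shiftS (fun n => F n%:R))|exact: cvg_cst].
exact: (cvg_unique _ cv cv2).
Unshelve. all: by end_near. Qed.

End ChangeOfVariable.

(** * The Fejer kernel *)

Section Fejer.
Variable R : realType.
Local Notation mu := (@lebesgue_measure R).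
Local Notation seg01 t := ((0 <= t <= 1)%R%:R : R).

Lemma is_deriveS (F : R -> R) (x d d' : R) : d = d' -> is_derive x 1 F d -> is_derive x 1 F d'.
Proof. by move=> ->. Qed.

Lemma continuous_compR (g h : R -> R) : continuous g -> continuous h ->
  continuous (fun x => g (h x)).
Proof. by move=> cg ch x; apply: continuous_comp; [exact: ch|exact: cg]. Qed.

Lemma continuous_cosM (u : R) : continuous (fun t : R => cos (t * u)).
Proof.
apply: continuous_compR; first exact: continuous_cos.
by move=> t; apply: cvgM; [exact: cvg_id|exact: cvg_cst].
Qed.

Lemma is_derive_mulr (t u : R) : is_derive t 1 (fun t : R => t * u) u.
Proof. by apply: is_derive_eq; rewrite /GRing.scale /=; ring. Qed.

Lemma is_derive_sinM (t u : R) : is_derive t 1 (fun t : R => sin (t * u)) (cos (t * u) * u).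
Proof.
by have := @is_derive1_comp R sin (fun t => t * u) t (cos (t * u)) u _ (is_derive_mulr t u); apply.
Qed.

Lemma is_derive_cosM (t u : R) : is_derive t 1 (fun t : R => cos (t * u)) (- sin (t * u) * u).
Proof.
by have := @is_derive1_comp R cos (fun t => t * u) t (- sin (t * u)) u _ (is_derive_mulr t u); apply.
Qed.

Lemma is_derive_expM (t u : R) : is_derive t 1 (fun t : R => expR (t * u)) (expR (t * u) * u).
Proof.
by have := @is_derive1_comp R expR (fun t => t * u) t (expR (t * u)) u _ (is_derive_mulr t u); apply.
Qed.

(** The value at 0 makes it continuous. Its transform is the triangle $1-|t|$ on $[-1,1]$, so
    smoothing with it involves bounded frequencies only. *)
Definition fej (u : R) : R :=
  if u == 0 then (2 * pi)^-1 else (1 - cos u) / (pi * u ^+ 2).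

Lemma measurable_cosM (u : R) : measurable_fun setT (fun t : R => cos (t * u)).
Proof. by apply: continuous_measurable_fun; exact: continuous_cosM. Qed.

Lemma intg_fej u : intg (fun t : R => seg01 t * ((1 - t) * cos (t * u))).
Proof.
apply: (@intg_bounded _ _ _ 1).
  by apply: mfM; [apply: measurable_funB|exact: measurable_cosM].
move=> t /andP[t0 t1]; rewrite normrM -[leRHS]mulr1 ler_pM ?cos_max //.
by rewrite ler_norml; lra.
Qed.

Lemma fejE u : fej u = pi^-1 * RI (fun t => seg01 t * ((1 - t) * cos (t * u))).
Proof.
have p0 : pi != 0 :> R by rewrite gt_eqF // pi_gt0.
have c : continuous (fun t : R => (1 - t) * cos (t * u)).
  move=> t; apply: cvgM; first by apply: cvgB; [exact: cvg_cst|exact: cvg_id].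
  exact: continuous_cosM.
rewrite /fej; have [u0|u0] := eqVneq u 0.
  have d (t : R) : is_derive t 1 (fun t : R => t - t ^+ 2 / 2) ((1 - t) * cos (t * u)).
    by apply: is_derive_eq; rewrite u0 mulr0 cos0 /GRing.scale /=; field.
  by rewrite (RI_FTC_seg ltr01 c d); move: (pi : R) p0 => p p0; field.
have d (t : R) : is_derive t 1 (fun t => (1 - t) * (sin (t * u) / u) - cos (t * u) / u ^+ 2)
    ((1 - t) * cos (t * u)).
  have d1 := is_derive_sinM t u; have d2 := is_derive_cosM t u.
  by apply: is_derive_eq; rewrite /GRing.scale /=; field.
rewrite (RI_FTC_seg ltr01 c d) mul1r mul0r sin0 cos0.
by move: (pi : R) p0 => p p0; field; rewrite u0.
Qed.

Lemma fejN u : fej (- u) = fej u.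
Proof. by rewrite /fej oppr_eq0 cosN sqrrN. Qed.

Lemma fej_ge0 u : 0 <= fej u.
Proof.
rewrite /fej; case: ifP => _; first by rewrite invr_ge0 mulr_ge0 // pi_ge0.
by apply: divr_ge0; [rewrite subr_ge0 cos_le1|rewrite mulr_ge0 ?pi_ge0 ?sqr_ge0].
Qed.

Lemma pi_ge2' : 2 <= pi :> R.
Proof. by have := @pihalf_ge1 R; rewrite ler_pdivlMr // mul1r. Qed.

(** An integrable majorant, from $1-\cos u\le\min(u^2/2,2)$ and $\pi\ge2$. *)
Lemma fej_le u : fej u <= 2 / (1 + u ^+ 2).
Proof.
have p2 := pi_ge2'; have p0 := @pi_gt0 R; have u2 : 0 <= u ^+ 2 by rewrite sqr_ge0.
have d0 : 0 < 1 + u ^+ 2 by rewrite ltr_pwDl.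
rewrite /fej; have [->|un] := eqVneq u 0.
  rewrite expr0n addr0 divr1 invf_ple ?posrE ?mulr_gt0 //; lra.
have u20 : 0 < u ^+ 2 by rewrite exprn_even_gt0.
rewrite (ler_pdivrMr _ _ (mulr_gt0 p0 u20)) [leRHS]mulrAC (ler_pdivlMr _ _ d0).
have c1 := cos_geN1 u.
have [h1 h2] : 1 - cos u <= u ^+ 2 / 2 /\ 1 - cos u <= 2.
  split; last lra.
  have := @cos_ge_quad R `|u| (normr_ge0 u); rewrite real_normK ?num_real //.
  have -> : cos `|u| = cos u by case: (ger0P u) => // _; rewrite cosN.
  lra.
have h0 : 0 <= 1 - cos u by rewrite subr_ge0 cos_le1.
have : 2 * u ^+ 2 <= pi * u ^+ 2 by rewrite ler_wpM2r.
have : (1 - cos u) * u ^+ 2 <= 2 * u ^+ 2 by rewrite ler_wpM2r.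
rewrite mulrDr mulr1; lra.
Qed.

Lemma fej_lip u v : `|fej u - fej v| <= 1 * `|u - v|.
Proof.
have p2 := pi_ge2'; have p0 := @pi_gt0 R.
rewrite !fejE -mulrBr normrM -RIB; try exact: intg_fej.
apply: ler_pM => //.
  by rewrite ger0_norm ?invr_ge0 ?(ltW p0) // invf_le1 //; lra.
apply: le_trans (_ : RI (fun t => `|u - v| * seg01 t) <= _); last first.
  by rewrite RIZ ?intg_seg // RI_seg // subr0 mulr1.
apply: RI_norm; [by apply: intgB; exact: intg_fej|by apply: intgZ; exact: intg_seg|].
move=> t; rewrite -mulrBr -mulrBr mulrC.
case: (boolP (0 <= t <= 1)) => [/andP[t0 t1]|_]; last by rewrite !mulr0 normr0.
rewrite !mulr1 normrM -[leRHS]mul1r; apply: ler_pM => //; first by rewrite ler_norml; lra.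
apply: le_trans (@normr_cosB_le _ _ _) _; rewrite -mulrBr normrM ger0_norm //.
by rewrite ler_piMl.
Qed.

Lemma fej_measurable : measurable_fun setT fej.
Proof. exact: lipschitz_measurable fej_lip. Qed.

Lemma fej_continuous : continuous fej.
Proof.
move=> u; apply/cvgrPdist_le => e e0; near=> v; apply: le_trans (fej_lip _ _) _.
by rewrite mul1r; near: v; exact: near_dist_le.
Unshelve. all: by end_near. Qed.

Lemma intg_cauchy : intg (fun u : R => (1 + u ^+ 2)^-1).
Proof.
have p u : 0 < 1 + u ^+ 2 :> R by rewrite ltr_pwDl // sqr_ge0.
have c : continuous (fun u : R => (1 + u ^+ 2)^-1).
  move=> u; apply: cvgV; first by rewrite gt_eqF.
  by apply: cvgD; [exact: cvg_cst|exact: exprn_continuous].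
apply/integrableP; split; first by apply/measurable_EFinP; exact: continuous_measurable_fun.
have -> : (\int[mu]_x `|(EFin \o (fun u : R => (1 + u ^+ 2)^-1)%R) x|)%E =
   (\int[mu]_x ((1 + x ^+ 2)^-1)%:E)%E.
  by apply: eq_integral => x _ /=; rewrite ger0_norm // invr_ge0 ltW.
rewrite ge0_symfun_integralT //; last 2 first.
- by move=> x; rewrite invr_ge0 ltW.
- by move=> x /=; rewrite sqrrN.
rewrite (_ : [set x | _] = `[0, +oo[%classic); last first.
  by apply/seteqP; split=> x /=; rewrite in_itv /= andbT.
rewrite (@ge0_continuous_FTC2y _ _ atan 0 (pi / 2)) ?atan0 //.
- by rewrite -EFinB -EFinM ltry.
- by move=> x _; rewrite invr_ge0 ltW.
- by apply: continuous_subspaceT => x; exact: c.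
- exact: cvgy_atan.
- by apply: cvg_at_right_filter; rewrite -{2}(@atan0 R); exact: continuous_atan.
- by move=> x _; rewrite derive1_atan.
Qed.

Lemma intg_fejT : intg fej.
Proof.
apply: intg_le (intgZ 2 intg_cauchy); first exact: fej_measurable.
by move=> u; rewrite ger0_norm ?fej_ge0 ?fej_le.
Qed.

End Fejer.

(** * Laplace regularisation of the Fejer mass *)

Section FejerMass.
Variable R : realType.
Local Notation mu := (@lebesgue_measure R).
Local Notation seg01 t := ((0 <= t <= 1)%R%:R : R).
Local Notation half u := ((0 <= u)%R%:R : R).

Lemma mf_half : measurable_fun setT (fun u : R => half u).
Proof. by apply: mf_le. Qed.

Lemma continuous_expM (e : R) : continuous (fun u : R => expR (u * e)).
Proof.
apply: continuous_compR; first exact: continuous_expR.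
by move=> t; apply: cvgM; [exact: cvg_id|exact: cvg_cst].
Qed.

Lemma cvg_expn (e : R) : 0 < e -> expR (n%:R * - e) @[n --> \oo] --> (0 : R).
Proof.
move=> e0; under eq_fun do rewrite expRM_natl.
apply: cvg_expr; rewrite ger0_norm ?expR_ge0 // -expR0 ltr_expR oppr_lt0 //.
Qed.

Lemma cvg_expy (e : R) : 0 < e -> expR (u * - e) @[u --> +oo] --> (0 : R).
Proof.
move=> e0; under eq_fun do rewrite mulrN.
apply: (cvg_comp (fun u : R => u * e) (fun u => expR (- u))); last exact: cvgr_expR.
exact: (gt0_cvgMly e0 cvg_id).
Qed.

Lemma intg_exp (e : R) : 0 < e -> intg (fun u => half u * expR (u * - e)).
Proof.
move=> e0; have ce := @continuous_expM (- e).
apply/integrableP; split.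
  by apply/measurable_EFinP; apply: mfM; [exact: mf_half|exact: continuous_measurable_fun].
rewrite (_ : (\int[mu]_x _)%E = (\int[mu]_(x in `[0%R, +oo[) (expR (x * - e))%:E)%E); last first.
  rewrite [RHS]integral_mkcond; apply: eq_integral => x _ /=.
  rewrite patchE mem_setE in_itv /= andbT; case: ifP => _; rewrite ?mul0r ?normr0 //.
  by rewrite mul1r ger0_norm // expR_ge0.
have d (u : R) : is_derive u 1 (fun u => - e^-1 * expR (u * - e)) (expR (u * - e)).
  have d1 := is_derive_expM u (- e).
  by apply: is_derive_eq; rewrite /GRing.scale /=; field; rewrite gt_eqF.
have E := @ge0_continuous_FTC2y R (fun u => expR (u * - e)) (fun u => - e^-1 * expR (u * - e))
  0 (- e^-1 * 0).
rewrite E -?EFinB ?ltry //.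
- by apply: continuous_subspaceT => x; exact: ce.
- by apply: cvgM; [exact: cvg_cst|exact: cvg_expy].
- apply: cvg_at_right_filter; apply: cvgM; [exact: cvg_cst|exact: ce].
- by move=> x _; rewrite derive1E; case: (d x).
Qed.

Lemma intg_exp_mul (e : R) (k : R -> R) : 0 < e -> measurable_fun setT k ->
  (forall u, `|k u| <= 1) -> intg (fun u => half u * (expR (u * - e) * k u)).
Proof.
move=> e0 mk k1; apply: intg_le (intg_exp e0).
  apply: mfM; [exact: mf_half|apply: mfM => //].
  by apply: continuous_measurable_fun; exact: continuous_expM.
move=> u; rewrite normrM (ger0_norm (ler0n _ _)) ler_wpM2l // normrM.
by rewrite (ger0_norm (expR_ge0 _)) ler_piMr // expR_ge0.
Qed.

Lemma RI_exp_cos (e t : R) : 0 < e ->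
  RI (fun u => half u * (expR (u * - e) * cos (u * t))) = e / (e ^+ 2 + t ^+ 2).
Proof.
move=> e0; have q0 : 0 < e ^+ 2 + t ^+ 2 by rewrite ltr_pwDl ?exprn_gt0 ?sqr_ge0.
have c : continuous (fun u : R => expR (u * - e) * cos (u * t)).
  by move=> u; apply: cvgM; [exact: continuous_expM|exact: continuous_cosM].
pose F u := expR (u * - e) * ((t * sin (u * t) - e * cos (u * t)) / (e ^+ 2 + t ^+ 2)).
have d (u : R) : is_derive u 1 F (expR (u * - e) * cos (u * t)).
  have d1 := is_derive_expM u (- e); have d2 := is_derive_sinM u t; have d3 := is_derive_cosM u t.
  rewrite /F; apply: is_derive_eq; rewrite /GRing.scale /=; field; by rewrite gt_eqF.
rewrite (@RI_FTC_half R _ F 0 c d).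
- rewrite /F !mul0r expR0 sin0 cos0; field; by rewrite gt_eqF.
- apply: intg_exp_mul => //; last by move=> u; exact: cos_max.
  exact: measurable_cosM.
- pose C := (`|t| + e) / (e ^+ 2 + t ^+ 2).
  apply: (@squeeze_cvgr _ _ _ _ (fun n : nat => - (expR (n%:R * - e) * C))
    (fun n : nat => expR (n%:R * - e) * C)).
  + apply: nearW => n; rewrite -ler_norml normrM ger0_norm ?expR_ge0 //.
    rewrite ler_wpM2l ?expR_ge0 // normrM (ger0_norm (x := _^-1)) ?invr_ge0 ?(ltW q0) //.
    rewrite ler_wpM2r ?invr_ge0 ?(ltW q0) // (le_trans (ler_normB _ _)) // !normrM.
    by rewrite (ger0_norm (ltW e0)) lerD // ler_piMr ?sin_max ?cos_max // ltW.
  + rewrite -oppr0 -(mul0r C); apply: cvgN; apply: cvgM; [exact: cvg_expn|exact: cvg_cst].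
  + rewrite -(mul0r C); apply: cvgM; [exact: cvg_expn|exact: cvg_cst].
Qed.

Lemma RI_exp (e : R) : 0 < e -> RI (fun u => half u * expR (u * - e)) = e^-1.
Proof.
move=> e0; have := RI_exp_cos 0 e0.
rewrite expr0n addr0 expr2 invfM mulrA divff ?gt_eqF // mul1r => <-.
by congr RI; apply: funext => u; rewrite mulr0 cos0 mulr1.
Qed.

Lemma intg_seg01_1t (k : R -> R) : measurable_fun setT k -> (forall t, `|k t| <= 1) ->
  intg (fun t => seg01 t * ((1 - t) * k t)).
Proof.
move=> mk k1; apply: (@intg_bounded _ _ _ 1).
  by apply: mfM => //; apply: measurable_funB.
move=> t /andP[t0 t1]; rewrite normrM -[leRHS]mulr1 ler_pM //.
by rewrite ler_norml; lra.
Qed.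

(** The factor $e^{-eu}$ makes the double integral over [u] and [t] converge absolutely, so the
    order of integration can be exchanged. *)
Lemma fej_laplace (e : R) : 0 < e -> RI (fun u => half u * (expR (u * - e) * fej u)) =
  pi^-1 * RI (fun t => seg01 t * ((1 - t) * (e / (e ^+ 2 + t ^+ 2)))).
Proof.
move=> e0; have pn0 : pi != 0 :> R by rewrite gt_eqF // pi_gt0.
have fej1 u : `|fej u| <= 1 :> R.
  have p2 := @pi_ge2' R; rewrite ger0_norm ?fej_ge0 // fejE.
  have h : RI (fun t : R => seg01 t * ((1 - t) * cos (t * u))) <= 1.
    rewrite [leRHS](_ : 1 = RI (fun t : R => seg01 t)); last by rewrite RI_seg // subr0.
    apply: RI_le; [exact: intg_fej|exact: intg_seg|move=> t].
    case: (boolP (0 <= t <= 1)) => [/andP[t0 t1]|_]; last by rewrite mul0r.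
    have : 0 <= (1 - t) * (1 - cos (t * u)) by rewrite mulr_ge0 // subr_ge0 // cos_le1.
    rewrite /= mul1r mulrBr mulr1; lra.
  have p0 : 0 < pi :> R by exact: pi_gt0.
  by rewrite mulrC ler_pdivrMr // mul1r; lra.
have cosM1 u t : `|cos (t * u)| <= 1 :> R by exact: cos_max.
have iu t := @intg_exp_mul e (fun u => cos (u * t)) e0 (measurable_cosM t) (cosM1 t).
have s1 : intg (fun t : R => seg01 t * ((1 - t) * 1)).
  by apply: intg_seg01_1t => // t; rewrite normr1.
have E1 : RI (fun t : R => seg01 t * ((1 - t) * 1)) = 1 / 2.
  have := @fejE R 0; rewrite /fej eqxx invfM => /esym.
  move=> /(congr1 (fun z => pi * z)); rewrite mulrA divff // mul1r mulrA.
  rewrite [pi * 2^-1]mulrC -mulrA divff // mulr1 mul1r => <-.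
  by congr RI; apply: funext => t; rewrite mulr0 cos0.
have mk2 : measurable_fun setT (fun t : R => e / (e ^+ 2 + t ^+ 2)).
  apply: continuous_measurable_fun => t; apply: cvgM; first exact: cvg_cst.
  apply: cvgV; first by rewrite gt_eqF // ltr_pwDl ?exprn_gt0 ?sqr_ge0.
  by apply: cvgD; [exact: cvg_cst|exact: exprn_continuous].
have i3 : intg (fun t : R => seg01 t * ((1 - t) * (e / (e ^+ 2 + t ^+ 2)))).
  apply: (@intg_bounded _ _ _ e^-1).
    by apply: mfM => //; apply: measurable_funB.
  move=> t /andP[t0 t1]; rewrite normrM -[leRHS]mul1r ler_pM //; first by rewrite ler_norml; lra.
  have q0 : 0 < e ^+ 2 + t ^+ 2 by rewrite ltr_pwDl ?exprn_gt0 ?sqr_ge0.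
  rewrite ger0_norm ?divr_ge0 ?(ltW e0) ?(ltW q0) // ler_pdivrMr //.
  rewrite mulrDr expr2 mulrA mulVf ?gt_eqF // mul1r lerDl mulr_ge0 ?sqr_ge0 // invr_ge0 ltW //.
(* [1 + cos] instead of [cos] makes the integrand non-negative, as Tonelli requires; the extra 1
   contributes $1/(2e)$ to both sides and cancels at the end. *)
pose a (z : R * R) : R :=
  half z.1 * expR (z.1 * - e) * (seg01 z.2 * ((1 - z.2) * (1 + cos (z.2 * z.1)))).
have a0 z : 0 <= a z.
  rewrite /a; apply: mulr_ge0; first by rewrite mulr_ge0 ?expR_ge0.
  case: (boolP (0 <= z.2 <= 1)) => [/andP[t0 t1]|_]; last by rewrite mul0r.
  rewrite mul1r mulr_ge0 // ?subr_ge0 //; have := cos_geN1 (z.2 * z.1); lra.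
have ma : measurable_fun setT a.
  apply: measurable_funM.
    apply: measurable_funM.
      by apply: (@measurableT_comp _ _ _ _ _ _ (fun u : R => half u)) => //; exact: mf_half.
    apply: (@measurableT_comp _ _ _ _ _ _ (fun u : R => expR (u * - e))) => //.
    by apply: continuous_measurable_fun; exact: continuous_expM.
  apply: measurable_funM.
    by apply: (@measurableT_comp _ _ _ _ _ _ (fun u : R => seg01 u)) => //; exact: mf_seg.
  apply: measurable_funM.
    by apply: measurable_funB => //; exact: measurable_snd.
  apply: measurable_funD => //.
  apply: (@measurableT_comp _ _ _ _ _ _ (cos : R -> R)).
    by apply: continuous_measurable_fun; exact: continuous_cos.
  by apply: measurable_funM; [exact: measurable_snd|exact: measurable_fst].
have mae : measurable_fun setT (fun z => (a z)%:E) by exact/measurable_EFinP.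
have a0e z : (0 <= (a z)%:E)%E by rewrite lee_fin.
have := @fubini_tonelli _ _ _ _ R mu mu (fun z => (a z)%:E) mae a0e.
have -> : (\int[mu]_x \int[mu]_y (a (x, y))%:E = (RI (fun u => 2^-1 * (half u * expR (u * - e)) +
   pi * (half u * (expR (u * - e) * fej u))))%:E)%E.
  rewrite -RI_EFin; last first.
    apply: intgD; first by apply: intgZ; exact: intg_exp.
    by apply: intgZ; apply: intg_exp_mul => //; exact: fej_measurable.
  apply: eq_integral => u _; rewrite -[RHS]/((_)%:E).
  have i2 := intgD s1 (@intg_fej R u).
  rewrite RI_EFin; last first.
    rewrite /a /=; apply: intgZ; move: i2; congr intg; apply: funext => t; ring.
  congr EFin; rewrite /a /= RIZ; last by move: i2; congr intg; apply: funext => t; ring.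
  rewrite (_ : RI _ = 1 / 2 + pi * fej u); first by ring.
  rewrite fejE mulrA divff // [1 * RI _]mul1r -E1 -RID //; last exact: intg_fej.
  by congr RI; apply: funext => t; ring.
have -> : (\int[mu]_y \int[mu]_x (a (x, y))%:E = (RI (fun t => e^-1 * (seg01 t * ((1 - t) * 1)) +
   seg01 t * ((1 - t) * (e / (e ^+ 2 + t ^+ 2)))))%:E)%E.
  rewrite -RI_EFin; last by apply: intgD => //; apply: intgZ.
  apply: eq_integral => t _; rewrite -[RHS]/((_)%:E).
  have i2 := intgD (intg_exp e0) (iu t).
  have aE x : a (x, t) = seg01 t * (1 - t) *
      (half x * expR (x * - e) + half x * (expR (x * - e) * cos (x * t))).
    by rewrite /a /= [t * x]mulrC; ring.
  rewrite (_ : (\int[mu]_x (a (x, t))%:E)%E = (\int[mu]_x (seg01 t * (1 - t) *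
      (half x * expR (x * - e) + half x * (expR (x * - e) * cos (x * t))))%:E)%E); last first.
    by apply: eq_integral => x _; rewrite aE.
  rewrite RI_EFin; last exact: intgZ.
  by congr EFin; rewrite RIZ // RID ?RI_exp ?RI_exp_cos //; [ring|exact: intg_exp].
move=> H; have {}H := EFin_inj H; move: H.
have iF : intg (fun u => half u * (expR (u * - e) * fej u)).
  by apply: intg_exp_mul => //; exact: fej_measurable.
rewrite (RID (intgZ 2^-1 (intg_exp e0)) (intgZ pi iF)) (RIZ _ (intg_exp e0)) (RIZ _ iF).
rewrite (RID (intgZ e^-1 s1) i3) (RIZ _ s1) E1 RI_exp // => H.
apply: (mulfI pn0); rewrite mulrA divff // mul1r.
by move: H; rewrite mulrC mul1r => /addrI.
Qed.

End FejerMass.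

(** * Fejer and Gaussian integrals *)

Section FejerGauss.
Variable R : realType.
Local Notation mu := (@lebesgue_measure R).
Local Notation seg01 t := ((0 <= t <= 1)%R%:R : R).
Local Notation half u := ((0 <= u)%R%:R : R).

(** As [e] tends to 0, $e/(e^2+t^2)$ concentrates at 0: its integral over $[0,1]$ is
    $\arctan(1/e)\to\pi/2$, while the part of $1-t$ with the factor [t] contributes nothing in the
    limit. *)
Lemma RI_half_fej : RI (fun u : R => half u * fej u) = 1 / 2.
Proof.
pose e (n : nat) : R := n.+1%:R^-1.
have e0 n : 0 < e n by rewrite invr_gt0 ltr0n.
have ee : e n @[n --> \oo] --> 0 by exact: cvg_harmonic.
have pn0 : pi != 0 :> R by rewrite gt_eqF // pi_gt0.
have [|||| _ cv1] := @RI_dct R (fun n u => half u * (expR (u * - e n) * fej u))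
  (fun u => half u * fej u) (@fej R).
- move=> n; apply: mfM; first exact: mf_half; apply: mfM; last exact: fej_measurable.
  by apply: continuous_measurable_fun; exact: continuous_expM.
- move=> n u; case: (boolP (0 <= u)) => u0; last by rewrite mul0r normr0 fej_ge0.
  rewrite /= mul1r normrM (ger0_norm (fej_ge0 u)) ger0_norm ?expR_ge0 // ler_piMl ?fej_ge0 //.
  by rewrite -expR0 ler_expR mulrN oppr_le0 mulr_ge0 // ltW.
- exact: intg_fejT.
- move=> u; apply: cvgM; first exact: cvg_cst.
  rewrite -[X in _ --> X]mul1r; apply: cvgM; last exact: cvg_cst.
  rewrite -expR0; apply: cvg_comp; last exact: continuous_expR.
  rewrite -(mulr0 u) -oppr0; apply: cvgM; first exact: cvg_cst.
  exact: cvgN.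
have q0 n t : 0 < e n ^+ 2 + t ^+ 2 by rewrite ltr_pwDl ?exprn_gt0 ?sqr_ge0.
have cq n : continuous (fun t : R => e n / (e n ^+ 2 + t ^+ 2)).
  move=> t; apply: cvgM; first exact: cvg_cst.
  apply: cvgV; first by rewrite gt_eqF.
  by apply: cvgD; [exact: cvg_cst|exact: exprn_continuous].
have mq n := continuous_measurable_fun (cq n).
have bq n t : 0 <= t -> t * (e n / (e n ^+ 2 + t ^+ 2)) <= 1.
  move=> t0; rewrite mulrA ler_pdivrMr // mul1r.
  have : 0 <= (t - e n) ^+ 2 by rewrite sqr_ge0.
  have : 0 <= t ^+ 2 by rewrite sqr_ge0.
  have : 0 <= e n ^+ 2 by rewrite sqr_ge0.
  rewrite sqrrB; nra.
have [|||| i2 cv2] := @RI_dct R (fun n t => seg01 t * (t * (e n / (e n ^+ 2 + t ^+ 2))))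
  (fun t => 0) (fun t => seg01 t).
- by move=> n; apply: mfM; [exact: mf_seg|apply: mfM => //].
- move=> n t; case: (boolP (0 <= t <= 1)) => [/andP[t0 t1]|_]; last by rewrite mul0r normr0.
  by rewrite /= mul1r ger0_norm ?bq // mulr_ge0 // divr_ge0 ?ltW.
- exact: intg_seg.
- move=> t; rewrite [X in _ --> X](_ : 0 = seg01 t * 0); last by rewrite mulr0.
  apply: cvgM; first exact: cvg_cst.
  have [->|t0] := eqVneq t 0.
    rewrite (_ : (fun n => _) = fun=> 0); first exact: cvg_cst.
    by apply: funext => n; rewrite mul0r.
  rewrite [X in _ --> X](_ : 0 = t * (0 * (0 ^+ 2 + t ^+ 2)^-1)); last by rewrite mul0r mulr0.
  apply: cvgM; first exact: cvg_cst.
  apply: cvgM; first exact: ee.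
  apply: cvgV; first by rewrite expr0n add0r expf_neq0.
  apply: cvgD; last exact: cvg_cst.
  by apply: (cvg_comp _ (fun x : R => x ^+ 2) ee); exact: exprn_continuous.
have E n : RI (fun u => half u * (expR (u * - e n) * fej u)) =
    pi^-1 * (atan n.+1%:R - RI (fun t => seg01 t * (t * (e n / (e n ^+ 2 + t ^+ 2))))).
  rewrite fej_laplace //; congr (_ * _).
  have d (t : R) : is_derive t 1 (fun t => atan (t * (e n)^-1)) (e n / (e n ^+ 2 + t ^+ 2)).
    have := @is_derive1_comp R atan (fun t => t * (e n)^-1) t _ _ _ (is_derive_mulr t (e n)^-1).
    move=> /(_ _ (is_derive1_atan _)) H; apply: is_deriveS H.
    field; rewrite (gt_eqF (e0 n)) gt_eqF //=.
  have E2 := RI_FTC_seg ltr01 (cq n) d.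
  rewrite mul1r mul0r atan0 subr0 /e invrK -/(e n) in E2.
  rewrite -E2 -RIB.
  - by congr RI; apply: funext => t; ring.
  - apply: (@intg_bounded _ _ _ (e n)^-1) => // t _.
    rewrite ger0_norm; last by rewrite divr_ge0 ?ltW.
    rewrite ler_pdivrMr // mulrDr expr2 mulrA mulVf ?gt_eqF // mul1r lerDl.
    by rewrite mulr_ge0 ?sqr_ge0 // invr_ge0 ltW.
  - apply: (@intg_bounded _ _ _ 1); first by apply: mfM.
    by move=> t /andP[t0 t1]; rewrite ger0_norm ?bq // mulr_ge0 // divr_ge0 ?ltW.
have cv3 : RI (fun u => half u * (expR (u * - e n) * fej u)) @[n --> \oo] --> pi^-1 * (pi / 2 - 0).
  rewrite (_ : (fun n => _) = fun n => pi^-1 * (atan n.+1%:R -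
     RI (fun t => seg01 t * (t * (e n / (e n ^+ 2 + t ^+ 2)))))); last exact: funext.
  apply: cvgM; first exact: cvg_cst.
  apply: cvgB; last by move: cv2; rewrite RI0.
  rewrite (cvg_shiftS (fun n => atan n%:R)).
  by apply: (cvg_comp _ _ _ (@cvgy_atan R)); exact: cvgr_idn.
rewrite (cvg_unique _ cv1 cv3) // subr0 mulrA mulVf //.
Qed.

Lemma RI_fej : RI (@fej R) = 1.
Proof.
have E := @ge0_symfun_integralT R (@fej R) (@fej_ge0 R) (@fej_continuous R).
have {}E := E (fun u => esym (fejN u)).
rewrite /RI /Rintegral E.
have -> : (\int[mu]_(x in [set x | (0 <= x)%R]) (fej x)%:E)%E = (1 / 2)%:E.
  rewrite -RI_half_fej -RI_EFin; last first.
    apply: intg_le (@intg_fejT R); first by apply: mfM; [exact: mf_half|exact: fej_measurable].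
    by move=> u; rewrite normrM (ger0_norm (fej_ge0 u)) ger0_norm // ler_piMl ?fej_ge0 // lern1 leq_b1.
  rewrite integral_mkcond; apply: eq_integral => u _; rewrite patchE.
  case: ifPn => [/set_mem /= ->|/negP h]; first by rewrite mul1r.
  by rewrite (_ : 0 <= u = false) ?mul0r //; apply/negP => u0; apply: h; exact: mem_set.
by rewrite -EFinM /= mulrA mulr1 divff.
Qed.

Lemma intg_gauss0 : intg (fun s : R => expR (- s ^+ 2)).
Proof. exact: integrableT_gauss. Qed.

Lemma intg_gauss (c : R) : 0 < c -> intg (fun s => expR (- (c * s ^+ 2))).
Proof.
move=> c0; have s0 : 0 < Num.sqrt c by rewrite sqrtr_gt0.
have := intg_affine 0 s0 intg_gauss0; congr intg; apply: funext => s.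
by rewrite addr0 exprMn sqr_sqrtr // ltW.
Qed.

Lemma intg_half h : intg h -> intg (fun s : R => half s * h s).
Proof.
move=> ih; apply: intg_le (intg_norm ih).
  by apply: mfM; [exact: mf_half|exact: intg_measurable].
by move=> s; rewrite normrM ger0_norm // ler_piMl // lern1 leq_b1.
Qed.

Lemma RI_gauss (c : R) : 0 < c ->
  RI (fun s => half s * expR (- (c * s ^+ 2))) = Num.sqrt (pi / c) / 2.
Proof.
move=> c0; have s0 : 0 < Num.sqrt c by rewrite sqrtr_gt0.
have := RI_affine 0 s0 (intg_half intg_gauss0).
have -> : RI (fun s : R => half s * expR (- s ^+ 2)) = Num.sqrt pi / 2.
  apply: EFin_inj; rewrite -RI_EFin; last exact: (intg_half intg_gauss0).
  rewrite -integral0y_gauss [RHS]integral_mkcond; apply: eq_integral => s _.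
  by rewrite patchE mem_setE in_itv /= andbT; case: ifP; rewrite ?mul1r ?mul0r.
rewrite sqrtrM ?pi_ge0 // sqrtrV ?(ltW c0) // mulrAC => <-.
congr RI; apply: funext => s.
by rewrite addr0 exprMn sqr_sqrtr ?(ltW c0) // pmulr_rge0.
Qed.

Lemma gauss_sqr_le (c s : R) : 0 < c ->
  s ^+ 2 * expR (- (c * s ^+ 2)) <= 2 / c * expR (- (c / 2 * s ^+ 2)).
Proof.
move=> c0; have -> : - (c * s ^+ 2) = - (c / 2 * s ^+ 2) + - (c / 2 * s ^+ 2) by field.
rewrite expRD mulrA ler_wpM2r ?expR_ge0 // expRN ler_pdivrMr ?expR_gt0 //.
rewrite mulrAC ler_pdivlMr //.
have := expR_ge1Dx (c / 2 * s ^+ 2); lra.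
Qed.

Lemma continuous_gauss (c : R) : continuous (fun s : R => expR (- (c * s ^+ 2))).
Proof.
apply: continuous_compR; first exact: continuous_expR.
move=> s; apply: cvgN; apply: cvgM; [exact: cvg_cst|exact: exprn_continuous].
Qed.

Lemma intg_gauss2 (c : R) : 0 < c -> intg (fun s => s ^+ 2 * expR (- (c * s ^+ 2))).
Proof.
move=> c0; have h : 0 < c / 2 by rewrite divr_gt0.
apply: intg_le (intgZ (2 / c) (intg_gauss h)).
  apply: mfM; apply: continuous_measurable_fun; [exact: exprn_continuous|exact: continuous_gauss].
by move=> s; rewrite ger0_norm ?gauss_sqr_le // mulr_ge0 ?sqr_ge0 ?expR_ge0.
Qed.

(** The derivative of $se^{-cs^2}$ integrates to 0 over the half-line, which expresses the second
    moment through [RI_gauss]. *)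
Lemma RI_gauss2 (c : R) : 0 < c ->
  RI (fun s => half s * (s ^+ 2 * expR (- (c * s ^+ 2)))) = Num.sqrt (pi / c) / (4 * c).
Proof.
move=> c0; pose h s := expR (- (c * s ^+ 2)) - 2 * c * (s ^+ 2 * expR (- (c * s ^+ 2))).
pose F s := s * expR (- (c * s ^+ 2)).
have ch : continuous h.
  move=> s; apply: cvgB; first exact: continuous_gauss.
  apply: cvgM; first exact: cvg_cst.
  by apply: cvgM; [exact: exprn_continuous|exact: continuous_gauss].
have d (s : R) : is_derive s 1 F (h s).
  have d1 : is_derive s 1 (fun s : R => - (c * s ^+ 2)) (- (c * (2 * s))).
    by apply: is_derive_eq; rewrite /GRing.scale /=; ring.
  have := @is_derive1_comp R expR (fun s => - (c * s ^+ 2)) s _ _ _ d1.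
  move=> /(_ _ (is_derive_expR _)) d2.
  have d3 : is_derive s 1 (fun s : R => expR (- (c * s ^+ 2)))
    (expR (- (c * s ^+ 2)) * - (c * (2 * s))) := d2.
  by rewrite /F /h; apply: is_derive_eq; rewrite /GRing.scale /=; ring.
have i1 := intg_half (intg_gauss c0); have i2 := intg_half (intg_gauss2 c0).
have E := @RI_FTC_half R h F 0 ch d.
have hE : (fun s => half s * h s) = (fun s => half s * expR (- (c * s ^+ 2)) -
    2 * c * (half s * (s ^+ 2 * expR (- (c * s ^+ 2))))).
  by apply: funext => s; rewrite /h; ring.
move: E; rewrite hE RIB //; last exact: intgZ.
rewrite RIZ // RI_gauss // /F mul0r subr0 => E.
have {}E : Num.sqrt (pi / c) / 2 -
  2 * c * RI (fun s => half s * (s ^+ 2 * expR (- (c * s ^+ 2)))) = 0.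
  apply: E; first by apply: intgB => //; exact: intgZ.
  have c2 : 0 < c / 2 by rewrite divr_gt0.
  apply: (@squeeze_cvgr _ _ _ _ (fun=> 0) (fun n : nat => 2 / c * expR (n%:R * - (c / 2)))).
  - apply: nearW => n; rewrite mulr_ge0 ?expR_ge0 //=.
    case: n => [|n]; first by rewrite mul0r mulr_ge0 ?expR_ge0 // divr_ge0 // ltW.
    have n1 : n.+1%:R <= n.+1%:R ^+ 2 :> R.
      by rewrite expr2 ler_peMl // ler1n.
    apply: (@le_trans _ _ (n.+1%:R ^+ 2 * expR (- (c * n.+1%:R ^+ 2)))).
      by rewrite ler_wpM2r ?expR_ge0.
    apply: le_trans (gauss_sqr_le _ c0) _; rewrite ler_wpM2l ?divr_ge0 ?(ltW c0) //.
    by rewrite ler_expR mulrN lerN2 mulrC ler_wpM2l ?(ltW c2).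
  - exact: cvg_cst.
  - by rewrite -(mulr0 (2 / c)); apply: cvgM; [exact: cvg_cst|exact: cvg_expn].
move/eqP: E; rewrite subr_eq0 => /eqP E.
apply: (mulfI (_ : 2 * c != 0)); first by rewrite mulf_neq0 // gt_eqF.
rewrite -E; field; by rewrite gt_eqF.
Qed.

Lemma fej_tail (M eta : R) : 0 < M -> 0 < eta ->
  exists2 A : nat, (0 < A)%N & RI (fun u : R => (A%:R * M < `|u|)%R%:R * fej u) <= eta.
Proof.
move=> M0 eta0.
have mt n : measurable_fun setT (fun u : R => (n%:R * M < `|u|)%R%:R * fej u).
  apply: mfM; last exact: fej_measurable.
  by apply: mf_lt => //; apply: measurableT_comp.
have [||||_ cv] := @RI_dct R (fun n u => (n%:R * M < `|u|)%R%:R * fej u) (fun=> 0) (@fej R).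
- exact: mt.
- move=> n u; rewrite normrM (ger0_norm (fej_ge0 u)) ger0_norm //.
  by rewrite ler_piMl ?fej_ge0 // lern1 leq_b1.
- exact: intg_fejT.
- move=> u; apply: cvg_near_cst; near=> n; rewrite (_ : _ < _ = false) ?mul0r //.
  apply/negbTE; rewrite -leNgt -ler_pdivrMr //; near: n; exact: nbhs_infty_ger.
move: cv; rewrite RI0 => /cvgrPdist_le/(_ _ eta0)[N _ /(_ N.+1 (leqnSn N))] /=.
rewrite sub0r normrN => H; exists N.+1 => //; exact: le_trans (ler_norm _) H.
Unshelve. all: by end_near. Qed.

End FejerGauss.

(** * Concentration of the free walk *)

Section Concentration.
Variables (R : realType) (X : finType) (P : X -> X -> R) (nu f : X -> R).
Hypothesis hg : good P nu f.
Local Notation seg01 t := ((0 <= t <= 1)%R%:R : R).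
Local Notation half u := ((0 <= u)%R%:R : R).
Local Notation Tn := (Tn P f).
Local Notation Kn := (Kn P f).
Local Notation survn := (survn P f).

Lemma good_stoch : stochastic P. Proof. by case: hg => [[]]. Qed.
Lemma good_inv : invariant_prob P nu. Proof. by case: hg => [[]]. Qed.
Lemma good_H1 : H1 P. Proof. by case: hg. Qed.
Let hP := good_stoch.

Lemma Tn_fej n (a : X -> R) (A v : R) x w :
  Tn n (fun x y => a x * fej (A * (y - v))) x w =
  pi^-1 * RI (fun t => seg01 t * ((1 - t) * Tn n (fun x y => a x * cos (t * (A * (y - v)))) x w)).
Proof.
rewrite /KilledWalk.Tn /Ex.
under eq_bigr do rewrite fejE.
transitivity (pi^-1 * \sum_(s : n.-tuple X) RI (fun t => pathprob P x s * a (last x s) *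
   (seg01 t * ((1 - t) * cos (t * (A * (w + psum f s - v))))))).
  rewrite mulr_sumr; apply: eq_bigr => s _; rewrite RIZ; last exact: intg_fej.
  by ring.
congr (_ * _); rewrite -RI_sum; last by move=> s _; apply: intgZ; exact: intg_fej.
congr RI; apply: funext => t; rewrite !mulr_sumr; apply: eq_bigr => s _; ring.
Qed.

(** The index is shifted so that the scale never vanishes. *)
Definition sq (n : nat) : R := Num.sqrt n.+1%:R.

Lemma sq_gt0 n : 0 < sq n. Proof. by rewrite sqrtr_gt0. Qed.
Lemma sq_sqr n : sq n ^+ 2 = n.+1%:R. Proof. by rewrite sqr_sqrtr. Qed.
Lemma sq_homo m n : (m <= n)%N -> sq m <= sq n.
Proof. by move=> mn; rewrite ler_wsqrtr // ler_nat. Qed.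
Lemma sq_half n : sq n <= 2 * sq n./2.
Proof.
rewrite -(@ler_sqr R) ?nnegrE ?mulr_ge0 ?(ltW (sq_gt0 _)) // exprMn !sq_sqr -natrX -natrM ler_nat.
by have := odd_double_half n; case: (odd n) => /=; lia.
Qed.

(** On $|u|\le1$ the indicator is at most $4\pi$ times the Fejer kernel, whose frequencies lie in
    $[0,1]$; [decay] then leaves a Gaussian integral of order $n^{-1/2}$. *)
Lemma Tn_unit_bound : exists2 C : R, 0 < C & forall n x w v,
  Tn n (fun _ y => (`|y - v| <= 1)%R%:R) x w <= C / sq n.
Proof.
have [[_ hnu] h1 h2 h3 _] := hg.
have [i i0 dec] := decay hP h1 h3 1.
have p0 := @pi_gt0 R; have pn0 : pi != 0 :> R by rewrite gt_eqF.
have iR : 0 < i%:R :> R by rewrite ltr0n.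
(* $e^{1/i}$ pays for [n.+1] in place of [n] in the exponent; the square root comes from the
   Gaussian integral of rate [n.+1 / i]. *)
pose C : R := 4 * (i%:R * expR i%:R^-1 * (Num.sqrt (pi * i%:R) / 2)).
have C0 : 0 < C by rewrite !mulr_gt0 ?expR_gt0 ?invr_gt0 ?sqrtr_gt0 ?mulr_gt0.
exists C => // n x w v.
apply: (@le_trans _ _ (4 * pi * Tn n (fun _ y => 1 * fej (1 * (y - v))) x w)).
  rewrite -TnZ; apply: ler_Tn => // _ y; rewrite !mul1r; case: (lerP `|y - v|) => uv /=; last first.
    by rewrite !mulr_ge0 ?fej_ge0 ?(ltW p0).
  rewrite /fej; case: eqP => [_|/eqP un0].
    rewrite invfM mulrACA divff // mulr1; lra.
  have := cos_le_small uv => /(le_trans (ler_norm _)) hc.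
  have u2 : 0 < (y - v) ^+ 2 by rewrite exprn_even_gt0.
  rewrite mulrA (ler_pdivlMr _ _ (mulr_gt0 p0 u2)) mul1r [4 * pi]mulrC -mulrA.
  by apply: ler_wpM2l; [exact: ltW|lra].
rewrite (Tn_fej n (fun=> 1)) mulrA -[4 * pi * _]mulrA divff // mulr1 /C -mulrA.
rewrite ler_wpM2l //.
pose c : R := n.+1%:R / i%:R.
have c0 : 0 < c by rewrite divr_gt0.
have := RI_gauss c0; have -> : Num.sqrt (pi / c) = Num.sqrt (pi * i%:R) / sq n.
  rewrite /c invfM invrK mulrA mulrAC sqrtrM ?mulr_ge0 ?(ltW p0) ?(ltW iR) //.
  by rewrite sqrtrV.
move=> E.
rewrite [leRHS](_ : _ = i%:R * expR i%:R^-1 * RI (fun s => half s * expR (- (c * s ^+ 2))));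
  last by rewrite E; ring.
rewrite -RIZ; last exact: intg_half (intg_gauss c0).
have mc : measurable_fun setT (fun t : R => Tn n (fun _ y => 1 * cos (t * (1 * (y - v)))) x w).
  rewrite /KilledWalk.Tn /Ex; apply: measurable_sum => s; apply: mfM => //; apply: mfM => //.
  exact: measurable_cosM.
apply: RI_le.
- apply: intg_seg01_1t => // t; apply: Tn_bound => // _ y; rewrite mul1r; exact: cos_max.
- by apply: intgZ; exact: intg_half (intg_gauss c0).
move=> t; case: (boolP (0 <= t <= 1)) => [/andP[t0 t1]|_]; last first.
  by rewrite mul0r !mulr_ge0 ?expR_ge0 ?(ltW iR).
rewrite t0 /= !mul1r.
have wv : wave t (fun (_ : X) (y : R) => 1 * cos (t * (1 * (y - v)))).
  have := @wave_cos R X t (fun=> 1) (- (t * v)).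
  by congr wave; apply: funext => z; apply: funext => y; rewrite !mul1r mulrBr.
have := dec t _ n _ 1 wv; rewrite t0 t1 => /(_ erefl) H.
have {}H : Tn n (fun _ y => 1 * cos (t * (1 * (y - v)))) x w <=
    i%:R * expR (- (t ^+ 2 * n%:R / i%:R)).
  apply: le_trans (ler_norm _) _; rewrite -[leRHS]mulr1; apply: H => z y.
  by rewrite mul1r cos_max.
apply: (@le_trans _ _ ((1 - t) * (i%:R * expR (- (t ^+ 2 * n%:R / i%:R))))).
  by rewrite ler_wpM2l // subr_ge0.
apply: (@le_trans _ _ (i%:R * expR (- (t ^+ 2 * n%:R / i%:R)))).
  by rewrite ler_piMl ?mulr_ge0 ?expR_ge0 // lerBlDr lerDl.
rewrite -[leRHS]mulrA; apply: ler_wpM2l; first exact: ltW.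
rewrite -expRD ler_expR /c.
have t2 : t ^+ 2 <= 1 by rewrite expr_le1.
have : t ^+ 2 / i%:R <= 1 / i%:R by rewrite ler_wpM2r ?invr_ge0.
rewrite -natr1 !mulrDl mulrAC; lra.
Qed.

Lemma Tn_itv_bound : exists2 C : R, 0 < C & forall n x w a b, a <= b ->
  Tn n (fun _ y => (a <= y <= b)%R%:R) x w <= C * (b - a + 1) / sq n.
Proof.
have [C C0 H] := Tn_unit_bound; exists C => // n x w a b ab.
pose N := (Num.truncn (b - a)).+1.
apply: (@le_trans _ _ (\sum_(k < N) Tn n (fun _ y => (`|y - (a + k%:R)| <= 1)%R%:R) x w)).
  rewrite /KilledWalk.Tn -Ex_sum; apply: ler_Ex => // s _.
  move: (w + psum f s) => y; case: (boolP (a <= y <= b)) => [/andP[ay yb]|_]; last first.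
    by rewrite sumr_ge0.
  have ya : 0 <= y - a by rewrite subr_ge0.
  have kN : (Num.truncn (y - a) < N)%N by rewrite ltnS le_truncn // lerD2r.
  rewrite (bigD1 (Ordinal kN)) //= ler_wpDr ?sumr_ge0 //.
  have /andP[k1 k2] := truncn_itv ya.
  rewrite (_ : `|_| <= 1) // opprD addrA ler_norml; move: k2; rewrite -natr1; lra.
apply: (@le_trans _ _ (\sum_(k < N) C / sq n)); first by apply: ler_sum.
rewrite sumr_const card_ord -mulr_natr mulrAC ler_wpM2r ?invr_ge0 ?(ltW (sq_gt0 _)) //.
rewrite ler_wpM2l ?(ltW C0) // /N -natr1 lerD2r.
have ba : 0 <= b - a by rewrite subr_ge0.
by have /andP[] := truncn_itv ba.
Qed.

End Concentration.

(** * Martingale correction and survival bounds *)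

Section Harmonic.
Variables (R : realType) (X : finType) (P : X -> X -> R) (nu f : X -> R).
Hypothesis hg : good P nu f.
Local Notation Tn := (Tn P f).
Local Notation Kn := (Kn P f).
Local Notation survn := (survn P f).
Let hP := good_stoch hg.

(** Killing is kept over the first half of the time, which gives the survival factor, and dropped
    over the second, where concentration applies. *)
Lemma Kn_itv_bound : exists2 C : R, 0 < C & forall n x y a b, 0 < y -> a <= b ->
  Kn n (fun _ u => (a <= u <= b)%R%:R) x y <= survn n./2 x y * (C * (b - a + 1) / sq R n).
Proof.
have [C C0 H] := Tn_itv_bound hg; exists (2 * C); first by rewrite mulr_gt0.
move=> n x y a b y0 ab.
have nE : (n - n./2 + n./2 = n)%N by have := odd_double_half n; lia.
have ba : 0 <= b - a + 1 by rewrite addr_ge0 // subr_ge0.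
rewrite -{1}nE KnD.
apply: (@le_trans _ _ (Kn (n - n./2) (fun _ _ => C * (b - a + 1) / sq R n./2) x y)).
  apply: ler_Kn => // z w w0; apply: le_trans (H _ _ _ _ _ ab).
  by apply: ler_Kn_Tn.
rewrite Kn_cst // mulrC; apply: ler_pM.
- exact: survn_ge0.
- by rewrite divr_ge0 ?(ltW (sq_gt0 _ _)) // mulr_ge0 // ltW.
- by apply: survn_homo => //; have := odd_double_half n; lia.
rewrite ler_pdivrMr ?sq_gt0 // mulrAC ler_pdivlMr ?sq_gt0 //.
rewrite [leRHS](_ : _ = C * (b - a + 1) * (2 * sq R n./2)); last by ring.
by rewrite ler_wpM2l ?sq_half // mulr_ge0 // ltW.
Qed.

Section Potential.
Variable r : X -> R.
Hypothesis hr : forall x, r x = \sum_x' P x x' * (f x' + r x').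
Variable D : R.
Hypothesis fD : forall x, `|f x| + `|r x| <= D.

(** By the Poisson equation $y+S_n+r(X_n)$ is a martingale. *)
Definition hpot (x : X) (y : R) : R := y + r x.

Let rD x : `|r x| <= D.
Proof. by apply: le_trans (fD x); rewrite lerDr. Qed.

Let D0 (x : X) : 0 <= D.
Proof. exact: le_trans (rD x). Qed.

Lemma Tn_hpot x y : Tn 1 hpot x y = hpot x y.
Proof.
rewrite Tn1 /hpot (hr x); under eq_bigr do rewrite -addrA mulrDr.
by rewrite big_split /= -big_distrl /= hP.2 mul1r.
Qed.

(** Contribution of the paths killed at the next step. *)
Definition Lop (G : X -> R -> R) x y := Tn 1 G x y - Kn 1 G x y.

Lemma LopE G x y : Lop G x y = \sum_x' P x x' * ((y + f x' <= 0)%R%:R * G x' (y + f x')).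
Proof.
rewrite /Lop Tn1 Kn1 -sumrB; apply: eq_bigr => z _; rewrite -mulrBr; congr (_ * _).
by case: (lerP (y + f z) 0) => _ /=; rewrite ?mul0r ?mul1r ?subr0 ?subrr.
Qed.

(** A step from a positive height falls at most to [- D], so only the values of [G] on $[-D,0]$
    matter. *)
Lemma Lop_bound G M x y : 0 < y ->
  (forall x' u, - D <= u <= 0 -> `|G x' u| <= M) ->
  `|Lop G x y| <= M * (1 - survn 1 x y).
Proof.
move=> y0 GM; have -> : 1 - survn 1 x y = Lop (fun _ _ => 1) x y.
  by rewrite /Lop Tn_cst.
rewrite !LopE mulr_sumr; apply: le_trans (ler_norm_sum _ _ _) _.
apply: ler_sum => z _; rewrite normrM (ger0_norm (hP.1 _ _)) mulrCA.
rewrite ler_wpM2l ?hP.1 //; case: (lerP (y + f z) 0) => uz /=; last by rewrite !mul0r mulr0 normr0.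
rewrite !mul1r mulr1; apply: GM; rewrite uz andbT.
have := fD z; have := ler_norm (- f z); rewrite normrN; have := normr_ge0 (r z); lra.
Qed.

(** The probability of exit exactly at step [n.+1] is a difference of survival probabilities, so
    these bounds telescope when summed over [n]. *)
Lemma Kn_Lop_bound G M n x y : 0 < y ->
  (forall x' u, - D <= u <= 0 -> `|G x' u| <= M) ->
  `|Kn n (Lop G) x y| <= M * (survn n x y - survn n.+1 x y).
Proof.
move=> y0 GM; apply: le_trans (ler_norm_Kn _ hP _ _ _ _) _.
rewrite mulrBr /KilledWalk.survn KnSr -!KnZ.
have -> : Kn n (fun x y => M * 1) x y - Kn n (fun x y => M * Kn 1 (fun _ _ => 1) x y) x y =
  Kn n (fun x y => M * (1 - survn 1 x y)) x y.
  rewrite -[LHS]addrC -mulN1r -KnDZ; apply: eq_Knw => u v; rewrite /KilledWalk.survn; ring.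
by apply: ler_Kn => // u v v0; apply: Lop_bound.
Qed.

Lemma hpot_bound x u : - D <= u <= 0 -> `|hpot x u| <= 2 * D.
Proof.
move=> /andP[u1 u2]; apply: le_trans (ler_normD _ _) _.
have := rD x; have : `|u| <= D by rewrite ler_norml; have := D0 x; lra.
lra.
Qed.

Lemma Kn_hpotS n x y : Kn n.+1 hpot x y = Kn n hpot x y - Kn n (Lop hpot) x y.
Proof.
rewrite KnSr -mulN1r -[RHS]addrC -KnDZ; apply: eq_Knw => u v.
rewrite /Lop Tn_hpot; ring.
Qed.

(** Each exit changes the killed mean by at most [2 * D] times the survival lost. Subtracting that
    multiple of survival gives a non-decreasing sequence, adding it in [hpot_hi] a non-increasing
    one. *)
Lemma hpot_lo m n x y : 0 < y -> (m <= n)%N ->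
  Kn m hpot x y - 2 * D * survn m x y <= Kn n hpot x y - 2 * D * survn n x y.
Proof.
move=> y0 /subnK <-; elim: (n - m)%N => [//|k IH]; rewrite addSn; apply: le_trans IH _.
have := Kn_Lop_bound (k + m) x y0 hpot_bound; rewrite ler_norml Kn_hpotS => /andP[]; lra.
Qed.

Lemma hpot_hi m n x y : 0 < y -> (m <= n)%N ->
  Kn n hpot x y + 2 * D * survn n x y <= Kn m hpot x y + 2 * D * survn m x y.
Proof.
move=> y0 /subnK <-; elim: (n - m)%N => [//|k IH]; rewrite addSn; apply: le_trans _ IH.
have := Kn_Lop_bound (k + m) x y0 hpot_bound; rewrite ler_norml Kn_hpotS => /andP[]; lra.
Qed.

Lemma Kn_id_le n x y : 0 < y -> Kn n (fun _ u => u) x y <= y + 4 * D.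
Proof.
move=> y0; have := hpot_hi x y0 (leq0n n); rewrite Kn0 /KilledWalk.survn Kn0 -/(KilledWalk.survn P f n x y) => H.
have s0 := survn_ge0 f hP n x y; have s1 := survn_le1 f hP n x y; have d0 := D0 x.
have : Kn n (fun _ u => u) x y <= Kn n hpot x y + D * survn n x y.
  rewrite -Kn_cst // -Kn_add; apply: ler_Kn => // z w _; rewrite /hpot.
  have := rD z; rewrite ler_norml => /andP[]; lra.
have : D * survn n x y <= 2 * D * survn n x y by rewrite ler_wpM2r //; lra.
have := rD x; rewrite ler_norml /hpot in H * => /andP[]; lra.
Qed.

End Potential.

Lemma Kn_id_bound : exists2 E : R, 0 < E & forall n x y, 0 < y ->
  Kn n (fun _ u => u) x y <= E * (1 + y).
Proof.
have [[_ hnu] h1 h2 _ _] := hg.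
have [r [q [hr _]]] := poisson2 hP hnu h1 h2.
have [D D0 HD] := fin_upper (fun x => `|f x| + `|r x|).
have fD x : `|f x| + `|r x| <= D by apply: le_trans (HD x); exact: ler_norm.
exists (1 + 4 * D); first lra.
move=> n x y y0; apply: le_trans (Kn_id_le hr fD n x y0) _; nra.
Qed.

(** Strong induction by halving the time. Survivors above [a] are counted by Markov's inequality and
    [Kn_id_bound]; those below by survival up to [n./2], in a window so low that the induction
    constant shrinks. *)
Lemma survn_bound : exists2 C : R, 0 < C & forall n x y, 0 < y ->
  survn n x y <= C * (1 + y) / sq R n.
Proof.
have [C C0 HC] := Kn_itv_bound; have [E E0 HE] := Kn_id_bound.
(* This [e] makes the window factor at most [1 / 8]; halving the time costs a factor 2, so the
   induction hypothesis returns a quarter of [C']. *)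
pose e := (16 * C)^-1; have e0 : 0 < e by rewrite invr_gt0 mulr_gt0.
pose C' := 16 * C * (1 + 2 * E) + 1.
have CE : 0 <= C * E by rewrite mulr_ge0 ?ltW.
have C'0 : 0 < C' by rewrite /C'; nra.
exists C' => // n; elim/ltn_ind: n => n IH x y y0.
have sn := sq_gt0 R n.
have s1 := survn_le1 f hP n x y.
have [n0|n0] := posnP n.
  apply: le_trans s1 _; rewrite n0 /sq sqrtr1 divr1 /C'; nra.
have [small|big] := lerP (sq R n) (16 * C).
  apply: le_trans s1 _; rewrite ler_pdivlMr // mul1r.
  apply: le_trans small _; rewrite /C'; nra.
pose a := e * sq R n; have a0 : 0 < a by rewrite mulr_gt0.
have H1 : survn n x y <= a^-1 * Kn n (fun _ u => u) x y + Kn n (fun _ u => (0 <= u <= a)%R%:R) x y.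
  rewrite -KnDZ; apply: ler_Kn => // z u u0; rewrite (ltW u0) /=.
  case: (lerP u a) => ua /=; first by rewrite lerDr mulr_ge0 ?invr_ge0 ?ltW.
  by rewrite addr0 mulrC ler_pdivlMr // mul1r ltW.
have H2 := HE n x y y0.
have H3 := HC n x y 0 a y0 (ltW a0).
have H4 : survn n./2 x y <= C' * (1 + y) * 2 / sq R n.
  have := IH n./2 _ x y y0; rewrite ltn_half_double -addnn -addn1 leq_add2l => /(_ n0) H.
  apply: le_trans H _; rewrite ler_pdivrMr ?sq_gt0 // mulrAC ler_pdivlMr // -[leRHS]mulrA.
  apply: ler_wpM2l; last exact: sq_half.
  by rewrite mulr_ge0 ?(ltW C'0) // addr_ge0 // ltW.
have H5 : C * (a - 0 + 1) / sq R n <= 1 / 8.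
  rewrite ler_pdivrMr // /a /e subr0 invfM mulrDr mulr1.
  rewrite (_ : C * (16^-1 * C^-1 * sq R n) = sq R n / 16); first lra.
  by field; rewrite gt_eqF.
apply: le_trans H1 _.
have H6 : a^-1 * Kn n (fun _ u => u) x y <= 16 * C * E * (1 + y) / sq R n.
  apply: le_trans (ler_wpM2l _ H2) _; first by rewrite invr_ge0 ltW.
  by rewrite /a /e le_eqVlt; apply/orP; left; apply/eqP; field; rewrite !gt_eqF.
have H7 : Kn n (fun _ u => (0 <= u <= a)%R%:R) x y <= C' * (1 + y) * 2 / sq R n * (1 / 8).
  apply: le_trans H3 _; apply: ler_pM => //; first exact: survn_ge0.
  by rewrite divr_ge0 ?(ltW sn) // mulr_ge0 ?(ltW C0) // subr0 addr_ge0 ?(ltW a0).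
apply: le_trans (lerD H6 H7) _.
rewrite ler_pdivlMr // mulrDl [in X in X + _]divfK ?gt_eqF //.
rewrite (_ : _ / sq R n * (1 / 8) * sq R n = C' * (1 + y) / 4); last first.
  by field; rewrite gt_eqF.
rewrite /C'; nra.
Qed.

Lemma survn_cvg0 x y : 0 < y -> survn n x y @[n --> \oo] --> (0 : R).
Proof.
move=> y0; have [C C0 H] := survn_bound.
apply: (@squeeze_cvgr _ _ _ _ (fun=> 0) (fun n => C * (1 + y) / sq R n)).
- by apply: nearW => n; rewrite survn_ge0 // H.
- exact: cvg_cst.
rewrite -(mulr0 (C * (1 + y))); apply: cvgM; first exact: cvg_cst.
apply/cvgrPdist_le => e e0; near=> n.
rewrite sub0r normrN ger0_norm ?invr_ge0 ?(ltW (sq_gt0 _ _)) //.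
rewrite invf_ple ?posrE ?sq_gt0 // -(@ler_sqr R) ?nnegrE ?invr_ge0 ?(ltW e0) ?(ltW (sq_gt0 _ _)) //.
rewrite sq_sqr (@le_trans _ _ n%:R) ?ler_nat //; near: n; exact: nbhs_infty_ger.
Unshelve. all: by end_near. Qed.

(** One factor $n^{-1/2}$ comes from survival, the other from concentration. *)
Lemma Kn_bdry_bound : exists2 C : R, 0 < C & forall n x y a b, 0 < y -> a <= b ->
  Kn n (fun _ u => (a <= u <= b)%R%:R) x y <= C * (1 + y) * (b - a + 1) / n.+1%:R.
Proof.
have [C C0 HC] := Kn_itv_bound; have [C1 C10 HC1] := survn_bound.
exists (2 * C * C1); first by rewrite !mulr_gt0.
move=> n x y a b y0 ab; apply: le_trans (HC _ _ _ _ _ y0 ab) _.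
have sn := sq_gt0 R n; have ba : 0 <= b - a + 1 by rewrite addr_ge0 // subr_ge0.
have H4 : survn n./2 x y <= C1 * (1 + y) * 2 / sq R n.
  apply: le_trans (HC1 _ _ _ y0) _.
  rewrite ler_pdivrMr ?sq_gt0 // mulrAC ler_pdivlMr // -[leRHS]mulrA.
  apply: ler_wpM2l; last exact: sq_half.
  by rewrite mulr_ge0 ?(ltW C10) // addr_ge0 // ltW.
apply: (@le_trans _ _ (C1 * (1 + y) * 2 / sq R n * (C * (b - a + 1) / sq R n))).
  by rewrite ler_wpM2r // divr_ge0 ?(ltW sn) // mulr_ge0 // ltW.
rewrite -(sq_sqr R n) le_eqVlt; apply/orP; left; apply/eqP; field; by rewrite gt_eqF.
Qed.

End Harmonic.

(** * Approximate eigenfunctions of the free kernel *)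

Section PerturbedEigenfunction.
Variables (R : realType) (X : finType) (P : X -> X -> R) (nu f r q : X -> R).
Hypothesis hP : stochastic P.
Variable s2 : R.
Hypothesis hr : forall x, r x = \sum_x' P x x' * (f x' + r x').
Hypothesis hq : forall x, q x + s2 / 2 = \sum_x' P x x' * (f x' ^+ 2 / 2 + f x' * r x' + q x').
Variable M : R.
Hypotheses (M1 : 1 <= M) (fM : forall x, `|f x| <= M) (rM : forall x, `|r x| <= M)
  (qM : forall x, `|q x| <= M) (s20 : 0 <= s2) (s2M : s2 <= M).
Local Notation Tn := (Tn P f).
Local Notation Kn := (Kn P f).

(** Imaginary part of $e^{itu}(1+itr-t^2q)$. *)
Definition Gt (t : R) (x : X) (u : R) : R :=
  sin (t * u) * (1 - t ^+ 2 * q x) + t * r x * cos (t * u).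

Definition lam (t : R) : R := expR (- (s2 / 2 * t ^+ 2)).

Lemma normM (a b A B : R) : `|a| <= A -> `|b| <= B -> `|a * b| <= A * B.
Proof. by move=> aA bB; rewrite normrM ler_pM. Qed.

Lemma normD (a b A B : R) : `|a| <= A -> `|b| <= B -> `|a + b| <= A + B.
Proof. by move=> aA bB; apply: le_trans (ler_normD _ _) _; apply: lerD. Qed.

Lemma expRN_le (x : R) : 0 <= x -> expR (- x) <= 1 - x + x ^+ 2.
Proof.
move=> x0; have h := expR_ge1Dx x; rewrite expRN.
have e0 := expR_gt0 x.
have h2 : 0 <= 1 - x + x ^+ 2 by have := sqr_ge0 (x - 1); rewrite sqrrB1; nra.
rewrite -[leLHS]mul1r ler_pdivrMr //.
apply: le_trans (_ : (1 - x + x ^+ 2) * (1 + x) <= _); last by rewrite ler_wpM2l.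
nra.
Qed.

Let M0 : 0 <= M. Proof. exact: le_trans ler01 M1. Qed.

Lemma lam_est t : 0 < t <= 1 -> `|lam t - (1 - s2 / 2 * t ^+ 2)| <= M ^+ 2 * t ^+ 3.
Proof.
move=> /andP[t0 t1]; set x := s2 / 2 * t ^+ 2.
have x0 : 0 <= x by apply: mulr_ge0; [rewrite divr_ge0|rewrite sqr_ge0].
have h1 : 1 - x <= lam t by exact: expR_ge1Dx.
have h2 := expRN_le x0.
rewrite ger0_norm ?subr_ge0 // lerBlDl; apply: le_trans h2 _; rewrite lerD2l.
have xM : x <= M * t ^+ 2.
  apply: ler_wpM2r; first by rewrite sqr_ge0.
  have := s20; have := s2M; lra.
have : x ^+ 2 <= (M * t ^+ 2) ^+ 2 by rewrite ler_sqr ?nnegrE // mulr_ge0 // sqr_ge0.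
move=> /le_trans; apply; rewrite exprMn ler_wpM2l ?sqr_ge0 // -exprM.
by rewrite (exprS t 3) ler_piMl // exprn_ge0 // ltW.
Qed.

(** The coefficients of $\sin(tu)$ and $\cos(tu)$ are compared separately; the two Poisson equations
    cancel every term below order $t^3$. *)
Lemma Gt_eigen t x u : 0 < t <= 1 ->
  `|Tn 1 (Gt t) x u - lam t * Gt t x u| <= 16 * (t ^+ 3 * M ^+ 5).
Proof.
move=> t01; have /andP[t0 t1] := t01; have t0' := ltW t0.
have tn : `|t| <= t by rewrite ger0_norm.
have m1 := M1; have m2 := s2M; have m3 := s20.
set w := t ^+ 3 * M ^+ 5.
have pw k j : (3 <= k)%N -> (j <= 5)%N -> t ^+ k * M ^+ j <= w.
  move=> k3 j5; apply: ler_pM; rewrite ?exprn_ge0 //.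
    by apply: ler_wiXn2l.
  by apply: ler_weXn2l.
have w0 : 0 <= w by rewrite mulr_ge0 ?exprn_ge0.
pose a z := cos (t * f z); pose b z := sin (t * f z).
have tf z : `|t * f z| <= t * M by apply: normM.
have e_a z : `|a z - (1 - (t * f z) ^+ 2 / 2)| <= t ^+ 3 * M ^+ 4.
  apply: le_trans (normr_cos_quad _) _.
  apply: (@le_trans _ _ ((t * M) ^+ 4 / 24)).
    by rewrite ler_wpM2r // lerXn2r ?nnegrE // mulr_ge0.
  rewrite exprMn (exprS t 3).
  have : 0 <= t ^+ 3 * M ^+ 4 by rewrite mulr_ge0 // exprn_ge0.
  rewrite (_ : t * t ^+ 3 * M ^+ 4 / 24 = t / 24 * (t ^+ 3 * M ^+ 4)); last by ring.
  by move=> v0; rewrite ler_piMl //; lra.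
have e_b z : `|b z - t * f z| <= t ^+ 3 * M ^+ 3.
  apply: le_trans (normr_sin_id _) _.
  apply: (@le_trans _ _ ((t * M) ^+ 3 / 6)).
    by rewrite ler_wpM2r // lerXn2r ?nnegrE // mulr_ge0.
  rewrite exprMn; have : 0 <= t ^+ 3 * M ^+ 3 by rewrite mulr_ge0 // exprn_ge0.
  move: (t ^+ 3 * _) => v v0; lra.
have e_q z : `|1 - t ^+ 2 * q z| <= 2 * M.
  have : `|t ^+ 2 * q z| <= 1 * M.
    by apply: normM => //; rewrite ger0_norm ?sqr_ge0 // expr_le1.
  have := ler_normB 1 (t ^+ 2 * q z); rewrite normr1; lra.
(* [eS] concerns the coefficient of $\sin(tu)$ after one step, [eC] below that of $\cos(tu)$. *)
have eS z : `|a z * (1 - t ^+ 2 * q z) - t * r z * b z -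
    (1 - t ^+ 2 * (f z ^+ 2 / 2 + f z * r z + q z))| <= 4 * w.
  rewrite (_ : _ - _ = (a z - (1 - (t * f z) ^+ 2 / 2)) * (1 - t ^+ 2 * q z) +
    (t ^+ 4 * (f z ^+ 2 * q z) / 2 + (- t * r z) * (b z - t * f z))); last by field.
  rewrite (_ : 4 * w = 2 * w + (w + w)); last by ring.
  apply: normD.
    apply: le_trans (normM (e_a z) (e_q z)) _.
    rewrite [leLHS](_ : _ = 2 * (t ^+ 3 * M ^+ 5)) //; ring.
  apply: normD.
    apply: (@le_trans _ _ (t ^+ 4 * (M ^+ 2 * M) * 1)).
      apply: normM; last by rewrite ger0_norm //; lra.
      apply: normM; first by rewrite ger0_norm // exprn_ge0.
      by apply: normM => //; rewrite normrX lerXn2r ?nnegrE.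
    by rewrite mulr1 -exprSr pw.
  apply: le_trans (normM (normM _ (rM z)) (e_b z)) _; [by rewrite normrN; exact: tn|].
  by rewrite [leLHS](_ : _ = t ^+ 4 * M ^+ 4) ?pw //; ring.
have a1 z : `|a z - 1| <= 2 * (t ^+ 2 * M ^+ 4).
  rewrite (_ : a z - 1 = (a z - (1 - (t * f z) ^+ 2 / 2)) + - (t ^+ 2 * (f z ^+ 2 / 2))); last by field.
  rewrite [leRHS](_ : _ = t ^+ 2 * M ^+ 4 + t ^+ 2 * M ^+ 4); last by ring.
  apply: normD.
    apply: le_trans (e_a z) _; rewrite ler_wpM2r ?exprn_ge0 // ler_wiXn2l //.
  rewrite normrN; apply: normM; first by rewrite ger0_norm // sqr_ge0.
  apply: (@le_trans _ _ (M ^+ 2 * 1)).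
    apply: normM; last by rewrite ger0_norm //; lra.
    by rewrite normrX lerXn2r ?nnegrE.
  by rewrite mulr1 ler_weXn2l.
have eC z : `|b z * (1 - t ^+ 2 * q z) + t * r z * a z - t * (f z + r z)| <= 5 * w.
  rewrite (_ : _ - _ = (b z - t * f z) * (1 - t ^+ 2 * q z) +
    (- (t ^+ 3 * (f z * q z)) + t * r z * (a z - 1))); last by ring.
  rewrite (_ : 5 * w = 2 * w + (w + 2 * w)); last by ring.
  apply: normD.
    apply: le_trans (normM (e_b z) (e_q z)) _.
    rewrite [leLHS](_ : _ = 2 * (t ^+ 3 * M ^+ 4)); last by ring.
    by rewrite ler_wpM2l // pw.
  apply: normD.
    rewrite normrN; apply: (@le_trans _ _ (t ^+ 3 * (M * M))).
      by apply: normM; [rewrite ger0_norm // exprn_ge0|apply: normM].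
    by rewrite -expr2 pw.
  apply: le_trans (normM (normM tn (rM z)) (a1 z)) _.
  by rewrite [leLHS](_ : _ = 2 * (t ^+ 3 * M ^+ 5)) //; ring.
have lam1 := lam_est t01.
have e_lam : `|lam t - 1| <= 2 * (t ^+ 2 * M ^+ 2).
  rewrite (_ : lam t - 1 = (lam t - (1 - s2 / 2 * t ^+ 2)) + - (s2 / 2 * t ^+ 2)); last by ring.
  rewrite [leRHS](_ : _ = t ^+ 2 * M ^+ 2 + t ^+ 2 * M ^+ 2); last by ring.
  apply: normD.
    apply: le_trans lam1 _; rewrite mulrC ler_wpM2r ?sqr_ge0 // ler_wiXn2l //.
  rewrite normrN ger0_norm ?mulr_ge0 ?sqr_ge0 // mulrC ler_wpM2l ?sqr_ge0 //.
  have : M <= M ^+ 2 by rewrite expr2 ler_peMl.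
  lra.
pose S := sin (t * u); pose c := cos (t * u).
have S1 : `|S| <= 1 by exact: sin_max.
have c1 : `|c| <= 1 by exact: cos_max.
have E1 : `|Tn 1 (Gt t) x u - (S * (1 - t ^+ 2 * (q x + s2 / 2)) + c * (t * r x))| <= 9 * w.
  have -> : Tn 1 (Gt t) x u - (S * (1 - t ^+ 2 * (q x + s2 / 2)) + c * (t * r x)) =
    \sum_z P x z * (S * (a z * (1 - t ^+ 2 * q z) - t * r z * b z -
       (1 - t ^+ 2 * (f z ^+ 2 / 2 + f z * r z + q z))) +
       c * (b z * (1 - t ^+ 2 * q z) + t * r z * a z - t * (f z + r z))).
    transitivity (Tn 1 (Gt t) x u - (S * (\sum_z P x z - t ^+ 2 *
       (\sum_z P x z * (f z ^+ 2 / 2 + f z * r z + q z))) +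
       c * (t * \sum_z P x z * (f z + r z)))).
      by rewrite hP.2 -hq -hr.
    rewrite Tn1 !mulr_sumr -sumrB mulr_sumr -big_split -sumrB /=; apply: eq_bigr => z _.
    rewrite /Gt (mulrDr t u (f z)) sinD cosD -/S -/c -/(a z) -/(b z); ring.
  apply: le_trans (ler_norm_sum _ _ _) _; rewrite -[leRHS]mul1r -[X in X * (9 * w)](hP.2 x) big_distrl /=.
  apply: ler_sum => z _; rewrite normrM (ger0_norm (hP.1 _ _)) ler_wpM2l ?hP.1 //.
  rewrite (_ : 9 * w = 1 * (4 * w) + 1 * (5 * w)); last by ring.
  by apply: normD; apply: normM.
have E2 : `|lam t * Gt t x u - (S * (1 - t ^+ 2 * (q x + s2 / 2)) + c * (t * r x))| <= 5 * w.
  rewrite (_ : _ - _ = S * ((1 - t ^+ 2 * q x) * (lam t - (1 - s2 / 2 * t ^+ 2)) +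
    t ^+ 4 * (q x * (s2 / 2))) + c * (t * r x * (lam t - 1))); last first.
    by rewrite /Gt -/S -/c; field.
  rewrite (_ : 5 * w = 1 * (2 * w + w) + 1 * (2 * w)); last by ring.
  apply: normD; apply: normM => //.
    apply: normD.
      apply: le_trans (normM (e_q x) lam1) _.
      rewrite [leLHS](_ : _ = 2 * (t ^+ 3 * M ^+ 3)); last by ring.
      by rewrite ler_wpM2l // pw.
    apply: (@le_trans _ _ (t ^+ 4 * (M * M))).
      apply: normM; first by rewrite ger0_norm // exprn_ge0.
      by apply: normM => //; rewrite ger0_norm ?divr_ge0 //; lra.
    by rewrite -expr2 pw.
  apply: le_trans (normM (normM tn (rM x)) e_lam) _.
  rewrite [leLHS](_ : _ = 2 * (t ^+ 3 * M ^+ 3)); last by ring.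
  by rewrite ler_wpM2l // pw.
have := ler_normB (Tn 1 (Gt t) x u - (S * (1 - t ^+ 2 * (q x + s2 / 2)) + c * (t * r x)))
  (lam t * Gt t x u - (S * (1 - t ^+ 2 * (q x + s2 / 2)) + c * (t * r x))).
rewrite opprB addrA subrK; lra.
Qed.

End PerturbedEigenfunction.

Lemma cvg_fsum (R : realType) (I : Type) (s : seq I) (F : I -> nat -> R) (l : I -> R) :
  (forall i, F i n @[n --> \oo] --> l i) ->
  \sum_(i <- s) F i n @[n --> \oo] --> \sum_(i <- s) l i.
Proof.
move=> Fl; elim: s => [|i s IH].
  rewrite big_nil (_ : (fun n => _) = fun=> 0); first exact: cvg_cst.
  by apply: funext => n; rewrite big_nil.
rewrite big_cons (_ : (fun n => _) = fun n => F i n + \sum_(j <- s) F j n).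
  exact: cvgD.
by apply: funext => n; rewrite big_cons.
Qed.

Lemma sum_shift_le (R : realType) (F : nat -> R) I k : (I <= k)%N -> (forall i, 0 <= F i) ->
  \sum_(i < k - I) F (I + i)%N <= \sum_(i < k) F i.
Proof.
move=> /subnKC; move: (k - I)%N => j <- F0.
by rewrite big_split_ord /=; apply: ler_wpDl => //; apply: sumr_ge0.
Qed.

(** * Scaling limit of killed sine waves *)

Section SineTransform.
Variables (R : realType) (X : finType) (P : X -> X -> R) (nu f : X -> R).
Hypothesis hg : good P nu f.
Local Notation Tn := (Tn P f).
Local Notation Kn := (Kn P f).
Local Notation survn := (survn P f).
Local Notation s2 := (sigma2 P nu f).
Let hP := good_stoch hg.

(** Harmonic function of the killed walk, a priori unrelated to survival; [Vfun_eq] identifies it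
    with [V] at positive heights. *)
Definition Vh (x : X) (y : R) : R := limn (fun n => Kn n (fun _ u => u) x y).

Lemma good_data : exists (r q : X -> R) (M : R),
  [/\ forall x, r x = \sum_x' P x x' * (f x' + r x'),
      forall x, q x + s2 / 2 = \sum_x' P x x' * (f x' ^+ 2 / 2 + f x' * r x' + q x'),
      [/\ 1 <= M, 0 <= s2 & s2 <= M] &
      forall x, [/\ `|f x| <= M, `|r x| <= M, `|q x| <= M & `|f x| + `|r x| <= M]].
Proof.
have [[_ hnu] h1 h2 _ s0] := hg.
have [r [q [hr hq]]] := poisson2 hP hnu h1 h2.
have [M M0 HM] := fin_upper (fun x => `|f x| + `|r x| + `|q x|).
exists r, q, (1 + s2 + M); split=> //; first by split; lra.
move=> x; have := HM x; have := normr_ge0 (f x); have := normr_ge0 (r x).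
have := normr_ge0 (q x) => a b c; rewrite ger0_norm ?addr_ge0 // => h.
by split; lra.
Qed.

Lemma Kn_small (G : X -> R -> R) M x y (k : nat -> nat) : 0 < y -> (forall x y, 0 < y -> `|G x y| <= M) ->
  k n @[n --> \oo] --> \oo -> Kn (k n) G x y @[n --> \oo] --> (0 : R).
Proof.
move=> y0 GM koo; have c := cvg_comp _ _ koo (survn_cvg0 hg x y0).
apply: (@squeeze_cvgr _ _ _ _ (fun n => - (M * survn (k n) x y)) (fun n => M * survn (k n) x y)).
- by apply: nearW => n; rewrite -ler_norml; apply: Kn_bound.
- rewrite -oppr0 -(mulr0 M); apply: cvgN; apply: cvgM; [exact: cvg_cst|exact: c].
- rewrite -(mulr0 M); apply: cvgM; [exact: cvg_cst|exact: c].
Qed.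

(** The monotone sequences of [hpot_lo] and [hpot_hi] enclose the limit, which gives the error
    bound; the bounded term [r] disappears together with survival. *)
Lemma Vh_hpot r D x y : (forall x, r x = \sum_x' P x x' * (f x' + r x')) ->
  (forall x, `|f x| + `|r x| <= D) -> 0 < y ->
  [/\ Kn n (hpot r) x y @[n --> \oo] --> Vh x y,
      Kn n (fun _ u => u) x y @[n --> \oo] --> Vh x y &
      forall I, `|Kn I (hpot r) x y - Vh x y| <= 2 * D * survn I x y].
Proof.
move=> hr fD y0.
have D0 : 0 <= D by apply: le_trans (fD x); rewrite addr_ge0.
have c0 := survn_cvg0 hg x y0.
have cD : 2 * D * survn n x y @[n --> \oo] --> (0 : R).
  by rewrite -(mulr0 (2 * D)); apply: cvgM; [exact: cvg_cst|].
pose u n := Kn n (hpot r) x y - 2 * D * survn n x y.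
have cu : cvgn u.
  apply: nondecreasing_is_cvgn.
    by move=> m n mn; apply: (hpot_lo hg hr fD).
  exists (hpot r x y + 2 * D) => _ [n _ <-].
  have := hpot_hi hg hr fD x y0 (leq0n n); rewrite Kn0 /KilledWalk.survn Kn0 mulr1 -/(KilledWalk.survn P f n x y).
  have : 0 <= 2 * D * survn n x y by rewrite !mulr_ge0 // survn_ge0.
  rewrite /u; lra.
have /cvg_ex[l cl] := cu.
have ch : Kn n (hpot r) x y @[n --> \oo] --> l.
  rewrite (_ : (fun n => _) = fun n => u n + 2 * D * survn n x y).
    by rewrite -[l]addr0; apply: cvgD.
  by apply: funext => n; rewrite /u subrK.
have ci : Kn n (fun _ u => u) x y @[n --> \oo] --> l.
  rewrite (_ : (fun n => _) = fun n => Kn n (hpot r) x y - Kn n (fun x _ => r x) x y).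
    rewrite -[l]subr0; apply: cvgB => //.
    apply: (@Kn_small (fun x _ => r x) D _ _ id) => // z w _.
    by apply: le_trans (fD z); rewrite lerDr.
  by apply: funext => n; rewrite -[X in _ - X]mul1r -mulNr -[RHS]addrC -KnDZ;
    apply: eq_Knw => z w; rewrite /hpot; ring.
have -> : Vh x y = l by apply: cvg_lim.
split=> // I; rewrite ler_norml; apply/andP; split.
  have : l <= Kn I (hpot r) x y + 2 * D * survn I x y.
    apply: (@ler_cvg_to nat \oo _ _ (fun n => Kn n (hpot r) x y + 2 * D * survn n x y)
      (fun=> Kn I (hpot r) x y + 2 * D * survn I x y)).
    - by rewrite -[l]addr0; apply: cvgD.
    - exact: cvg_cst.
    - by exists I => // n In; apply: (hpot_hi hg hr fD).
  lra.
have : Kn I (hpot r) x y - 2 * D * survn I x y <= l.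
  apply: (@ler_cvg_to nat \oo _ _ (fun=> Kn I (hpot r) x y - 2 * D * survn I x y)
    (fun n => Kn n (hpot r) x y - 2 * D * survn n x y)).
  - exact: cvg_cst.
  - by rewrite -[l]subr0; apply: cvgB.
  - by exists I => // n In; apply: (hpot_lo hg hr fD).
lra.
Qed.

Lemma Vh_cvg x y : 0 < y -> Kn n (fun _ u => u) x y @[n --> \oo] --> Vh x y.
Proof.
move=> y0; have [r [q [M [hr _ _ b]]]] := good_data.
have fD z : `|f z| + `|r z| <= M by case: (b z).
by case: (Vh_hpot x hr fD y0).
Qed.

Lemma sum_survn_le : exists2 C : R, 0 < C & forall k x y, 0 < y ->
  \sum_(i < k) survn i x y <= C * (1 + y) * Num.sqrt k%:R.
Proof.
have [C C0 HC] := survn_bound hg; exists (2 * C); first by rewrite mulr_gt0.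
move=> k x y y0; elim: k => [|k IH]; first by rewrite big_ord0 sqrtr0 mulr0.
rewrite big_ord_recr /=; apply: le_trans (lerD IH (HC k x y y0)) _.
have s1 := sq_gt0 R k; have ss := sq_sqr R k; rewrite -/(sq R k).
pose s : R := Num.sqrt k%:R; have s0 : 0 <= s by rewrite sqrtr_ge0.
have sk : s ^+ 2 = k%:R by rewrite sqr_sqrtr.
have CY : 0 <= C * (1 + y) by rewrite mulr_ge0 ?(ltW C0) // addr_ge0 // ltW.
rewrite -/s (_ : _ + _ = C * (1 + y) * (2 * s + (sq R k)^-1)); last by ring.
rewrite (_ : 2 * C * (1 + y) * sq R k = C * (1 + y) * (2 * sq R k)); last by ring.
apply: ler_wpM2l => //; rewrite -lerBrDl -mulrBr -[leLHS]mul1r ler_pdivrMr // -mulrA.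
have : sq R k ^+ 2 = s ^+ 2 + 1 by rewrite ss sk natr1.
have : 0 <= (sq R k - s) ^+ 2 by rewrite sqr_ge0.
rewrite sqrrB mulrBl; move: (sq R k) => v; rewrite -!expr2 mulrC; nra.
Qed.

(** The eigenfunction relation is iterated from a fixed time [I] to [k n]. One-step errors of order
    $t^3$ are weighted by survival and sum to order $t^3\sqrt k=o(t)$; exits after [I] cost [t]
    times survival at [I], small relative to [t] once [I] is large. *)
Lemma sine_limit x y (t : nat -> R) (k : nat -> nat) (theta : R) : 0 < y ->
  (forall n, 0 < t n <= 1) -> t n @[n --> \oo] --> (0 : R) -> k n @[n --> \oo] --> \oo ->
  (k n)%:R * t n ^+ 2 @[n --> \oo] --> theta ->
  Kn (k n) (fun _ u => sin (t n * u)) x y / t n @[n --> \oo] -->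
    expR (- (s2 / 2 * theta)) * Vh x y.
Proof.
move=> y0 t01 t0 koo kt.
have [r [q [M [hr hq [M1 s20 s2M] b]]]] := good_data.
have fM z : `|f z| <= M by case: (b z).
have rM z : `|r z| <= M by case: (b z).
have qM z : `|q z| <= M by case: (b z).
have fD z : `|f z| + `|r z| <= M by case: (b z).
have M0 : 0 <= M by lra.
have tp n : 0 < t n by case/andP: (t01 n).
have [_ _ HV] := Vh_hpot x hr fD y0.
have [C C0 HC] := sum_survn_le.
pose G n := Gt r q (t n).
pose L n := lam s2 (t n).
have L01 n : 0 <= L n <= 1.
  rewrite expR_ge0 /L /lam -[leRHS]expR0 ler_expR oppr_le0.
  by apply: mulr_ge0; [rewrite divr_ge0|rewrite sqr_ge0].
(* At an exit the height lies in $[-M,0]$, where the wave is of order [t]. *)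
have Gbd n z u : - M <= u <= 0 -> `|G n z u| <= t n * (3 * M ^+ 2).
  move=> /andP[u1 u2]; have /andP[_ t1] := t01 n; have tn := ltW (tp n).
  have MM : M <= M ^+ 2 by rewrite expr2 ler_peMl.
  rewrite /G /Gt (_ : t n * (3 * M ^+ 2) = t n * M * (2 * M) + t n * M ^+ 2 * 1); last by ring.
  apply: normD.
    apply: normM.
      apply: le_trans (normr_sin_le _) _; apply: normM; first by rewrite ger0_norm.
      by rewrite ler_norml u1 /=; lra.
    have : `|t n ^+ 2 * q z| <= 1 * M.
      by apply: normM => //; rewrite ger0_norm ?sqr_ge0 // expr_le1.
    have := ler_normB 1 (t n ^+ 2 * q z); rewrite normr1; lra.
  apply: normM; last exact: cos_max.
  apply: normM; first by rewrite ger0_norm.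
  exact: le_trans (rM z) MM.
pose err n j : R := 16 * (t n ^+ 3 * M ^+ 5) * j.
have tele n I j : `|Kn (I + j) (G n) x y - L n ^+ j * Kn I (G n) x y| <=
   16 * (t n ^+ 3 * M ^+ 5) * (\sum_(i < j) survn (I + i) x y) +
   t n * (3 * M ^+ 2) * (survn I x y - survn (I + j) x y).
  elim: j => [|j IH]; first by rewrite addn0 mul1r !subrr normr0 big_ord0 !mulr0 addr0.
  rewrite addnS KnSr big_ord_recr /=.
  have -> : Kn (I + j) (Kn 1 (G n)) x y = L n * Kn (I + j) (G n) x y +
     (Kn (I + j) (fun x u => Tn 1 (G n) x u - L n * G n x u) x y - Kn (I + j) (Lop P f (G n)) x y).
    rewrite -[X in _ - X]mul1r -mulNr [in X in _ + X]addrC -KnDZ -KnDZ; apply: eq_Knw => z u.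
    rewrite /Lop; ring.
  have h1 := Kn_Lop_bound hg fD (I + j) x y0 (Gbd n).
  have h2 : `|Kn (I + j) (fun x u => Tn 1 (G n) x u - L n * G n x u) x y| <=
      16 * (t n ^+ 3 * M ^+ 5) * survn (I + j) x y.
    by apply: Kn_bound => // z u _; apply: Gt_eigen.
  rewrite exprS -mulrA (_ : _ - _ = L n * (Kn (I + j) (G n) x y - L n ^+ j * Kn I (G n) x y) +
    (Kn (I + j) (fun x u => Tn 1 (G n) x u - L n * G n x u) x y - Kn (I + j) (Lop P f (G n)) x y));
    last by ring.
  have h3 : `|L n * (Kn (I + j) (G n) x y - L n ^+ j * Kn I (G n) x y)| <= 1 *
     (16 * (t n ^+ 3 * M ^+ 5) * (\sum_(i < j) survn (I + i) x y) +
   t n * (3 * M ^+ 2) * (survn I x y - survn (I + j) x y)).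
    by apply: normM => //; have /andP[? ?] := L01 n; rewrite ger0_norm.
  have h4 := ler_normB (Kn (I + j) (fun x u => Tn 1 (G n) x u - L n * G n x u) x y)
    (Kn (I + j) (Lop P f (G n)) x y).
  apply: le_trans (ler_normD _ _) _; move: h1 h2 h3 h4.
  rewrite mul1r mulrDr !mulrBr; lra.
have ct2 : t n ^+ 2 @[n --> \oo] --> (0 : R).
  rewrite [X in _ --> X](_ : 0 = 0 ^+ 2); last by rewrite expr0n.
  by apply: (cvg_comp _ (fun x : R => x ^+ 2) t0); exact: exprn_continuous.
have cL I : (L n) ^+ (k n - I) @[n --> \oo] --> expR (- (s2 / 2 * theta)).
  rewrite (_ : (fun n => _) = fun n => expR (- (s2 / 2 * ((k n - I)%:R * t n ^+ 2)))); last first.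
    by apply: funext => n; rewrite /L /lam -expRM_natl; congr expR; ring.
  apply: cvg_comp; last exact: continuous_expR.
  apply: cvgN; apply: cvgM; first exact: cvg_cst.
  apply: (@cvg_trans _ ((fun n => (k n)%:R * t n ^+ 2 - I%:R * t n ^+ 2) @ \oo)); last first.
    rewrite -[theta]subr0; apply: cvgB => //.
    rewrite -(mulr0 I%:R); apply: cvgM; first exact: cvg_cst.
    exact: ct2.
  apply: near_eq_cvg; near=> n; rewrite natrB ?mulrBl //.
  near: n; have := koo; move/(_ [set m | (I <= m)%N]); apply; exact: nbhs_infty_ge.
have cG I : Kn I (G n) x y / t n @[n --> \oo] --> Kn I (hpot r) x y.
  rewrite (_ : (fun n => _) = fun n => \sum_(s : I.-tuple X) pathprob P x s * ((surv f y s)%:R *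
     (G n (last x s) (y + psum f s) / t n))); last first.
    apply: funext => n; rewrite /KilledWalk.Kn /Ex big_distrl /=; apply: eq_bigr => s _; ring.
  rewrite /KilledWalk.Kn /Ex; apply: cvg_fsum => s.
  apply: cvgM; first exact: cvg_cst; apply: cvgM; first exact: cvg_cst.
  move: (last x s) (y + _) => z u; rewrite /hpot.
  have st : sin (t n * u) / t n @[n --> \oo] --> u.
    apply/cvgrPdist_le => e e0.
    have : t n ^+ 2 * (`|u| ^+ 3 / 6) @[n --> \oo] --> 0 * (`|u| ^+ 3 / 6).
      apply: cvgM; last exact: cvg_cst.
      exact: ct2.
    rewrite mul0r => /cvgrPdist_le/(_ _ e0); apply: filterS => n.
    rewrite sub0r normrN => /(le_trans (ler_norm _)) H; apply: le_trans _ H.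
    rewrite distrC (_ : _ - _ = (sin (t n * u) - t n * u) / t n); last first.
      by field; rewrite gt_eqF.
    rewrite normrM (ger0_norm (x := (t n)^-1)) ?invr_ge0 ?(ltW (tp n)) //.
    rewrite ler_pdivrMr //; apply: le_trans (normr_sin_id _) _.
    rewrite normrM (ger0_norm (ltW (tp n))) le_eqVlt; apply/orP; left; apply/eqP; ring.
  rewrite (_ : (fun n => _) = fun n => sin (t n * u) / t n * (1 - t n ^+ 2 * q z) +
     r z * cos (t n * u)); last first.
    by apply: funext => n; rewrite /G /Gt; field; rewrite gt_eqF.
  rewrite -[X in X + _]mulr1 -[X in _ + X]mulr1 -[X in _ * X + _](subr0 1) -{1}(mul0r (q z)).
  apply: cvgD.
    apply: cvgM => //; apply: cvgB; first exact: cvg_cst.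
    by apply: cvgM => //; exact: cvg_cst.
  apply: cvgM; first exact: cvg_cst.
  rewrite -cos0 -(mul0r u); apply: (cvg_comp (fun n => t n * u) cos); last exact: continuous_cos.
  by apply: cvgM => //; exact: cvg_cst.
(* Sine and eigenfunction differ by $O(t)$, and survival at time [k n] tends to 0. *)
have csin : (Kn (k n) (G n) x y - Kn (k n) (fun _ u => sin (t n * u)) x y) / t n
    @[n --> \oo] --> (0 : R).
  have cs := cvg_comp _ _ koo (survn_cvg0 hg x y0).
  have bd n : `|(Kn (k n) (G n) x y - Kn (k n) (fun _ u => sin (t n * u)) x y) / t n| <=
     2 * M * survn (k n) x y.
    rewrite normrM (ger0_norm (x := (t n)^-1)) ?invr_ge0 ?(ltW (tp n)) // ler_pdivrMr //.
    rewrite mulrAC (_ : Kn _ _ _ _ - _ = Kn (k n) (fun x u => G n x u - sin (t n * u)) x y); last first.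
      rewrite -[X in _ - X]mul1r -mulNr -[LHS]addrC -KnDZ; apply: eq_Knw => z u; ring.
    apply: Kn_bound => // z u _; have /andP[_ t1] := t01 n; have tn := ltW (tp n).
    rewrite /G /Gt (_ : _ - _ = - (sin (t n * u) * (t n * (t n * q z))) + t n * r z * cos (t n * u));
      last by ring.
    rewrite (_ : 2 * M * t n = 1 * (t n * (1 * M)) + t n * M * 1); last by ring.
    apply: normD; first rewrite normrN.
      apply: normM; first exact: sin_max.
      apply: normM; first by rewrite ger0_norm.
      by apply: normM => //; rewrite ger0_norm.
    by apply: normM; [apply: normM => //; rewrite ger0_norm|exact: cos_max].
  apply: (@squeeze_cvgr _ _ _ _ (fun n => - (2 * M * survn (k n) x y)) (fun n => 2 * M * survn (k n) x y)).
  - by apply: nearW => n; rewrite -ler_norml.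
  - rewrite -oppr0 -(mulr0 (2 * M)); apply: cvgN; apply: cvgM; [exact: cvg_cst|exact: cs].
  - rewrite -(mulr0 (2 * M)); apply: cvgM; [exact: cvg_cst|exact: cs].
pose a n := 16 * M ^+ 5 * (C * (1 + y)) * (t n * Num.sqrt ((k n)%:R * t n ^+ 2)).
have ca : a n @[n --> \oo] --> (0 : R).
  rewrite -(mulr0 (16 * M ^+ 5 * (C * (1 + y)))) -(mul0r (Num.sqrt theta)).
  apply: cvgM; first exact: cvg_cst; apply: cvgM => //.
  by apply: (cvg_comp _ Num.sqrt kt); exact: sqrt_continuous.
apply/cvgrPdist_le => e e0.
pose K := 3 * M ^+ 2 + 2 * M.
have K0 : 0 < K + 1 by rewrite ltr_wpDl // /K addr_ge0 // mulr_ge0 // exprn_ge0.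
(* [I] is fixed before [n]: it bounds the exits after [I] and the distance of [Kn I (hpot r)] from
   its limit. *)
have [I HI] : exists I, (K + 1) * survn I x y <= e / 4.
  have /cvgrPdist_le/(_ (e / 4 / (K + 1)))[] := survn_cvg0 hg x y0; first by rewrite !divr_gt0.
  move=> I _ /(_ I (leqnn I)) /=; rewrite sub0r normrN => /(le_trans (ler_norm _)) H.
  by exists I; rewrite mulrC -ler_pdivlMr.
have c1 : L n ^+ (k n - I) * (Kn I (G n) x y / t n) @[n --> \oo] -->
    expR (- (s2 / 2 * theta)) * Kn I (hpot r) x y by exact: cvgM.
near=> n.
have n1 : `|a n| <= e / 4.
  by near: n; have /cvgrPdist_le/(_ (e / 4)) := ca; rewrite divr_gt0 // => /(_ erefl);
    apply: filterS => n; rewrite sub0r normrN.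
have n2 : `|expR (- (s2 / 2 * theta)) * Kn I (hpot r) x y -
    L n ^+ (k n - I) * (Kn I (G n) x y / t n)| <= e / 4.
  by near: n; have /cvgrPdist_le/(_ (e / 4)) := c1; rewrite divr_gt0 // => /(_ erefl).
have n3 : `|(Kn (k n) (G n) x y - Kn (k n) (fun _ u => sin (t n * u)) x y) / t n| <= e / 4.
  by near: n; have /cvgrPdist_le/(_ (e / 4)) := csin; rewrite divr_gt0 // => /(_ erefl);
    apply: filterS => n; rewrite sub0r normrN.
have In : (I <= k n)%N.
  by near: n; have := koo; move/(_ [set m | (I <= m)%N]); apply; exact: nbhs_infty_ge.
have s0 := survn_ge0 f hP I x y.
have n4 : `|Kn (k n) (G n) x y / t n - L n ^+ (k n - I) * (Kn I (G n) x y / t n)| <=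
    a n + 3 * M ^+ 2 * survn I x y.
  have := tele n I (k n - I)%N; rewrite subnKC // => H.
  rewrite mulrA -mulrBl normrM (ger0_norm (x := (t n)^-1)) ?invr_ge0 ?(ltW (tp n)) // ler_pdivrMr //.
  apply: le_trans H _; rewrite [leRHS]mulrDl; apply: lerD.
    apply: (@le_trans _ _ (16 * (t n ^+ 3 * M ^+ 5) * (C * (1 + y) * Num.sqrt (k n)%:R))).
      apply: ler_wpM2l.
        by apply: mulr_ge0 => //; apply: mulr_ge0; apply: exprn_ge0 => //; exact: ltW.
      apply: le_trans (HC (k n) x y y0).
      by apply: (@sum_shift_le R (fun i => survn i x y)) => // i; exact: survn_ge0.
    rewrite /a sqrtrM // sqrtr_sqr (ger0_norm (ltW (tp n))) le_eqVlt; apply/orP; left.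
    by apply/eqP; ring.
  rewrite mulrC mulrCA mulrA [_ * t n]mulrC -mulrA ler_wpM2l ?(ltW (tp n)) // mulrC.
  apply: ler_wpM2l; first by rewrite mulr_ge0 // exprn_ge0.
  by rewrite gerBl survn_ge0.
have n5 : `|expR (- (s2 / 2 * theta)) * Vh x y - expR (- (s2 / 2 * theta)) * Kn I (hpot r) x y| <=
    1 * (2 * M * survn I x y).
  rewrite -mulrBr; apply: normM; last by rewrite distrC; exact: HV.
  rewrite ger0_norm ?expR_ge0 // -[leRHS]expR0 ler_expR oppr_le0 mulr_ge0 ?divr_ge0 //.
  apply: (@ler_cvg_to nat \oo _ _ (fun=> 0) (fun n => (k n)%:R * t n ^+ 2) 0 theta) => //.
    exact: cvg_cst.
  by apply: nearW => m; apply: mulr_ge0 => //; rewrite sqr_ge0.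
have := HI; rewrite /K mulrDl mul1r mulrDl => HI'.
have := ler_norm (a n) => an.
rewrite ler_norml; move: n2 n3 n4 n5; rewrite !ler_norml mulrBl mul1r => /andP[b1 b2] /andP[b3 b4] /andP[b5 b6] /andP[b7 b8].
by apply/andP; split; lra.
Unshelve. all: by end_near. Qed.

End SineTransform.

(** * Fubini for cosine transforms *)

Section CosineFubini.
Variable R : realType.
Local Notation mu := (@lebesgue_measure R).
Implicit Types a b : R -> R.

Lemma intg_cosM a t : intg a -> intg (fun u => a u * cos (u * t)).
Proof.
move=> ia; apply: intg_le (intg_norm ia).
  by apply: mfM; [exact: intg_measurable|exact: measurable_cosM].
by move=> u; rewrite normrM ler_piMr // cos_max.
Qed.

Lemma RI_swap_cos a b : intg a -> intg b ->
  RI (fun u => a u * RI (fun t => b t * cos (t * u))) =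
  RI (fun t => b t * RI (fun u => a u * cos (u * t))).
Proof.
move=> ia ib; have ma := intg_measurable ia; have mb := intg_measurable ib.
pose F (z : R * R) : R := a z.1 * (b z.2 * cos (z.2 * z.1)).
have mF : measurable_fun setT F.
  apply: measurable_funM; first exact: (measurableT_comp ma).
  apply: measurable_funM; first exact: (measurableT_comp mb).
  apply: (@measurableT_comp _ _ _ _ _ _ (cos : R -> R)).
    by apply: continuous_measurable_fun; exact: continuous_cos.
  by apply: measurable_funM; [exact: measurable_snd|exact: measurable_fst].
have mFe : measurable_fun setT (fun z => (F z)%:E) by exact/measurable_EFinP.
have iF : ((mu \x mu)%E).-integrable setT (fun z => (F z)%:E).
  apply/integrable12ltyP => //.
  apply: (@le_lt_trans _ _ (\int[mu]_x (`|a x| * RI (fun t => `|b t|))%:E)%E); last first.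
    rewrite RI_EFin ?ltry //; have := intgZ (RI (fun t => `|b t|)) (intg_norm ia).
    by congr intg; apply: funext => x; rewrite mulrC.
  apply: ge0_le_integral => //.
  - by move=> x _; apply: integral_ge0.
  - have mabs : measurable_fun setT (fun z => `|(F z)%:E|)%E by exact: measurableT_comp.
    exact: (@measurable_fun_fubini_tonelli_F _ _ _ _ R mu _ mabs (fun z => abse_ge0 _)).
  - by apply/measurable_EFinP; apply: mfM => //; apply: measurableT_comp.
  move=> x _.
  have i1 : intg (fun t => `|a x| * `|b t|) by apply: intgZ; exact: intg_norm.
  rewrite -(RIZ _ (intg_norm ib)) -RI_EFin //.
  apply: ge0_le_integral => //.
  - have m1 : measurable_fun setT (fun t => a x * (b t * cos (t * x))).
      by apply: mfM => //; apply: mfM => //; exact: measurable_cosM.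
    have m2 : measurable_fun setT (fun t => (F (x, t))%:E) by exact/measurable_EFinP.
    exact: measurableT_comp.
  - by apply/measurable_EFinP; exact: intg_measurable i1.
  - by move=> t _; rewrite /F /= lee_fin normrM ler_wpM2l // normrM ler_piMr // cos_max.
have := Fubini iF; rewrite /F /= => E.
have E1 : (\int[mu]_x \int[mu]_y (a x * (b y * cos (y * x)))%:E =
   \int[mu]_x (a x * RI (fun t => b t * cos (t * x)))%:E)%E.
  apply: eq_integral => x _; have i2 := intg_cosM x ib.
  by rewrite RI_EFin; [rewrite RIZ|exact: intgZ].
have E2 : (\int[mu]_y \int[mu]_x (a x * (b y * cos (y * x)))%:E =
   \int[mu]_y (b y * RI (fun u => a u * cos (u * y)))%:E)%E.
  apply: eq_integral => y _; have i2 := intg_cosM y ia.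
  rewrite (_ : (\int[mu]_x _)%E = (\int[mu]_x (b y * (a x * cos (x * y)))%:E)%E); last first.
    by apply: eq_integral => x _; rewrite mulrCA [y * x]mulrC.
  by rewrite RI_EFin; [rewrite RIZ|exact: intgZ].
by rewrite /RI /Rintegral -E1 E E2.
Qed.

End CosineFubini.

(** * Survival asymptotics *)

Section SurvivalAsymptotics.
Variables (R : realType) (X : finType) (P : X -> X -> R) (nu f : X -> R).
Hypothesis hg : good P nu f.
Local Notation Tn := (Tn P f).
Local Notation Kn := (Kn P f).
Local Notation survn := (survn P f).
Local Notation s2 := (sigma2 P nu f).
Local Notation seg01 t := ((0 <= t <= 1)%R%:R : R).
Local Notation half u := ((0 <= u)%R%:R : R).
Let hP := good_stoch hg.

(** Only large [n] matter, so [t n <= 1] may be enforced by a minimum. *)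
Lemma sine_limit' x y (t : nat -> R) (k : nat -> nat) (theta : R) : 0 < y ->
  (forall n, 0 < t n) -> t n @[n --> \oo] --> (0 : R) -> k n @[n --> \oo] --> \oo ->
  (k n)%:R * t n ^+ 2 @[n --> \oo] --> theta ->
  Kn (k n) (fun _ u => sin (t n * u)) x y / t n @[n --> \oo] -->
    expR (- (s2 / 2 * theta)) * Vh P f x y.
Proof.
move=> y0 t0 ct koo kt; pose t' n := Num.min (t n) 1.
have E : \forall n \near \oo, t' n = t n.
  have /cvgrPdist_le/(_ _ ltr01) := ct; apply: filterS => n.
  by rewrite sub0r normrN => /(le_trans (ler_norm _)) h; apply/min_idPl.
apply: (@cvg_trans _ ((fun n => Kn (k n) (fun _ u => sin (t' n * u)) x y / t' n) @ \oo)).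
  by apply: near_eq_cvg; apply: filterS E => n ->.
apply: (sine_limit hg) => //.
- by move=> n; rewrite lt_min t0 ltr01 ge_min lexx orbT.
- apply: cvg_trans ct; apply: near_eq_cvg; apply: filterS E => n ->; by [].
- apply: cvg_trans kt; apply: near_eq_cvg; apply: filterS E => n ->; by [].
Qed.

(** Smooth substitute for the indicator of $(0,\infty)$: it rises from 0 to 1 and is a superposition
    of $\sin(tv)/t$ with $t\in[0,1]$, to which the sine limit applies. *)
Definition Dfej (v : R) : R := 2 * RI (fun u => (0 <= u <= v)%R%:R * fej u).

Lemma intg_segfej a b : intg (fun u : R => (a <= u <= b)%R%:R * fej u).
Proof.
apply: intg_le (@intg_fejT R); first by apply: mfM; [exact: mf_seg|exact: fej_measurable].
by move=> u; rewrite normrM (ger0_norm (fej_ge0 u)) ger0_norm // ler_piMl ?fej_ge0 // lern1 leq_b1.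
Qed.

Lemma Dfej_le1 v : Dfej v <= 1.
Proof.
rewrite /Dfej; have := RI_half_fej R => E.
have : RI (fun u : R => (0 <= u <= v)%R%:R * fej u) <= RI (fun u : R => half u * fej u).
  apply: RI_le; [exact: intg_segfej|exact: intg_half (@intg_fejT R)|move=> u].
  by rewrite ler_wpM2r ?fej_ge0 // ler_nat; case: (0 <= u); case: (u <= v).
rewrite E; lra.
Qed.

Lemma Dfej_ge0 v : 0 <= Dfej v.
Proof. by rewrite mulr_ge0 // RI_ge0 // => u; rewrite mulr_ge0 ?fej_ge0. Qed.

Lemma Dfej_homo v w : v <= w -> Dfej v <= Dfej w.
Proof.
move=> vw; rewrite ler_wpM2l // RI_le //; try exact: intg_segfej.
move=> u; rewrite ler_wpM2r ?fej_ge0 // ler_nat.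
by case: (0 <= u) => //=; case: (lerP u v) => // uv; rewrite (le_trans uv vw).
Qed.

Lemma Dfej_cvg (a eta : R) : 0 < a -> 0 < eta ->
  exists2 A : nat, (0 < A)%N & forall n : nat, (A <= n)%N -> 1 - Dfej (n%:R * a) <= eta.
Proof.
move=> a0 eta0; have [A A0 HA] := @fej_tail R a (eta / 2) a0 (divr_gt0 eta0 (ltr0n _ 2)).
exists A => // n An.
have : 1 - Dfej (A%:R * a) <= eta; last first.
  have := @Dfej_homo (A%:R * a) (n%:R * a); rewrite ler_wpM2r ?(ltW a0) ?ler_nat // => /(_ erefl); lra.
rewrite /Dfej; have := RI_half_fej R => E.
have mt : measurable_fun setT (fun u : R => (A%:R * a < `|u|)%R%:R * fej u).
  apply: mfM; last exact: fej_measurable.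
  by apply: mf_lt => //; apply: measurableT_comp.
have it : intg (fun u : R => (A%:R * a < `|u|)%R%:R * fej u).
  apply: intg_le (@intg_fejT R) => // u.
  by rewrite normrM (ger0_norm (fej_ge0 u)) ger0_norm // ler_piMl ?fej_ge0 // lern1 leq_b1.
have : RI (fun u : R => half u * fej u) <= RI (fun u : R => (0 <= u <= A%:R * a)%R%:R * fej u +
    (A%:R * a < `|u|)%R%:R * fej u).
  apply: RI_le; [exact: intg_half (@intg_fejT R)|apply: intgD => //; exact: intg_segfej|move=> u].
  rewrite -mulrDl ler_wpM2r ?fej_ge0 // -natrD ler_nat.
  case: (lerP 0 u) => u0 //=; rewrite ger0_norm //.
  by case: (lerP u (A%:R * a)).
rewrite RID //; last exact: intg_segfej.
rewrite E; lra.
Qed.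

Definition sinc (t v : R) : R := if t == 0 then v else sin (t * v) / t.

(** The quotient is a limit of continuous functions that vanish at 0; the value at 0 is added
    through an indicator. *)
Lemma measurable_sinc v : measurable_fun setT (sinc ^~ v).
Proof.
pose g (n : nat) (t : R) :=
  sin (t * v) * (t / (t ^+ 2 + n.+1%:R^-1)) + ((t <= 0) && (0 <= t))%:R * v.
have q0 (n : nat) (t : R) : 0 < t ^+ 2 + n.+1%:R^-1 by rewrite ltr_wpDl ?sqr_ge0 // invr_gt0.
apply: (@measurable_fun_cvg _ _ _ setT g).
  move=> n; apply: mfD.
    apply: continuous_measurable_fun => t; apply: cvgM.
      apply: continuous_compR; first exact: continuous_sin.
      by move=> u; apply: cvgM; [exact: cvg_id|exact: cvg_cst].
    apply: cvgM; first exact: cvg_id.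
    apply: cvgV; first by rewrite gt_eqF.
    by apply: cvgD; [exact: exprn_continuous|exact: cvg_cst].
  by apply: mfM => //; apply: mf_bool; apply: mf_andb; apply: measurable_fun_ler.
move=> t _; rewrite /g /sinc -eq_le; case: eqP => [->|/eqP t0].
  rewrite (_ : (fun n => _) = fun=> v); first exact: cvg_cst.
  by apply: funext => n; rewrite mul0r sin0 mul0r add0r mul1r.
rewrite (_ : (fun n => _) = fun n : nat => sin (t * v) * (t / (t ^+ 2 + n.+1%:R^-1))); last first.
  by apply: funext => n; rewrite mul0r addr0.
rewrite (_ : _ / t = sin (t * v) * (t / (t ^+ 2 + 0))); last by field.
apply: cvgM; first exact: cvg_cst; apply: cvgM; first exact: cvg_cst.
apply: cvgV; first by rewrite addr0 expf_neq0.
by apply: cvgD; [exact: cvg_cst|exact: cvg_harmonic].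
Qed.

Lemma sinc_bound t v : `|sinc t v| <= `|v|.
Proof.
rewrite /sinc; case: eqP => // /eqP t0; rewrite normrM normfV ler_pdivrMr ?normr_gt0 //.
by apply: le_trans (normr_sin_le _) _; rewrite normrM mulrC.
Qed.

Lemma intg_sinc v : intg (fun t => seg01 t * ((1 - t) * sinc t v)).
Proof.
apply: (@intg_bounded _ _ _ `|v|).
  by apply: mfM; [apply: measurable_funB|exact: measurable_sinc].
move=> t /andP[t0 t1]; rewrite normrM -[leRHS]mul1r; apply: ler_pM => //.
  by rewrite ler_norml; lra.
exact: sinc_bound.
Qed.

Lemma DfejE v : 0 < v -> Dfej v = 2 / pi * RI (fun t => seg01 t * ((1 - t) * sinc t v)).
Proof.
move=> v0; rewrite /Dfej -mulrA; congr (2 * _).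
transitivity (pi^-1 * RI (fun u : R => (0 <= u <= v)%R%:R *
    RI (fun t => seg01 t * (1 - t) * cos (t * u)))).
  have i1 : intg (fun u : R => (0 <= u <= v)%R%:R * (pi * fej u)).
    by have := intgZ pi (intg_segfej 0 v); congr intg; apply: funext => u; rewrite mulrCA.
  have pn0 : pi != 0 :> R by rewrite gt_eqF // pi_gt0.
  have -> : (fun u : R => (0 <= u <= v)%R%:R * RI (fun t => seg01 t * (1 - t) * cos (t * u))) =
     (fun u => (0 <= u <= v)%R%:R * (pi * fej u)).
    apply: funext => u; congr (_ * _); rewrite fejE mulrA divff // mul1r; congr RI.
    by apply: funext => t; rewrite mulrA.
  rewrite -RIZ //; congr RI; apply: funext => u.
  by rewrite mulrCA [pi^-1 * _]mulrA mulVf // mul1r.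
congr (_ * _); rewrite RI_swap_cos; last 2 first.
- exact: intg_seg.
- have := @intg_fej R 0; congr intg; apply: funext => t; by rewrite mulr0 cos0 mulr1.
congr RI; apply: funext => t; rewrite -mulrA; congr (_ * (_ * _)).
rewrite /sinc; case: eqP => [->|/eqP t0].
  rewrite (_ : (fun u => _) = fun u : R => (0 <= u <= v)%R%:R).
    by rewrite RI_seg ?subr0 // ltW.
  by apply: funext => u; rewrite mulr0 cos0 mulr1.
have d (u : R) : is_derive u 1 (fun u => sin (u * t) / t) (cos (u * t)).
  have d1 := is_derive_sinM u t.
  by apply: is_derive_eq; rewrite /GRing.scale /=; field.
by rewrite (RI_FTC_seg v0 (@continuous_cosM R t) d) mul0r sin0 mul0r subr0 [v * t]mulrC.
Qed.

Lemma sqrtn_cvg : (Num.sqrt n.+1%:R)^-1 @[n --> \oo] --> (0 : R).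
Proof.
rewrite (_ : (fun n => _) = fun n => Num.sqrt (n.+1%:R^-1) : R); last first.
  by apply: funext => n; rewrite sqrtrV.
rewrite -[X in _ --> X]sqrtr0.
apply: (cvg_comp _ Num.sqrt (@cvg_harmonic R)); exact: sqrt_continuous.
Qed.

(** The [t]-integral is moved outside the kernel; [sinc_bound] and [Kn_id_bound] then dominate its
    integrand uniformly in [n]. *)
Lemma Dfej_limit x y (A : R) : 0 < y -> 0 < A ->
  sq R n * Kn n.+1 (fun _ u => Dfej (A * u / sq R n)) x y @[n --> \oo] -->
  2 / pi * A * RI (fun t => seg01 t * ((1 - t) * expR (- (s2 / 2 * (t * A) ^+ 2)))) * Vh P f x y.
Proof.
move=> y0 A0; have [E E0 HE] := Kn_id_bound hg.
pose F n t := A^-1 * (sq R n * Kn n.+1 (fun _ u => sinc t (A * u / sq R n)) x y).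
have FE n : sq R n * Kn n.+1 (fun _ u => Dfej (A * u / sq R n)) x y =
    2 / pi * A * RI (fun t => seg01 t * ((1 - t) * F n t)).
  have sn := sq_gt0 R n.
  rewrite (@eq_Kn _ _ _ _ _ _ (fun _ u => 2 / pi * RI (fun t => seg01 t * ((1 - t) *
     sinc t (A * u / sq R n))))) //; last first.
    by move=> _ u u0; rewrite DfejE // !mulr_gt0 // invr_gt0.
  rewrite KnZ mulrCA -[RHS]mulrA; congr (_ * _).
  transitivity (sq R n * RI (fun t => seg01 t * ((1 - t) * Kn n.+1 (fun _ u => sinc t (A * u / sq R n)) x y))).
    congr (_ * _); rewrite /KilledWalk.Kn /Ex.
    transitivity (\sum_(s : n.+1.-tuple X) RI (fun t => pathprob P x s * (surv f y s)%:R *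
       (seg01 t * ((1 - t) * sinc t (A * (y + psum f s) / sq R n))))).
      by apply: eq_bigr => s _; rewrite RIZ ?mulrA //; exact: intg_sinc.
    rewrite -RI_sum; last by move=> s _; apply: intgZ; exact: intg_sinc.
    congr RI; apply: funext => t; rewrite !mulr_sumr; apply: eq_bigr => s _; ring.
  have i1 : intg (fun t => seg01 t * ((1 - t) * Kn n.+1 (fun _ u => sinc t (A * u / sq R n)) x y)).
    rewrite /KilledWalk.Kn /Ex.
    have := @intg_sum R _ (index_enum _) (fun=> true) (fun (s : n.+1.-tuple X) t =>
       pathprob P x s * (surv f y s)%:R * (seg01 t * ((1 - t) * sinc t (A * (y + psum f s) / sq R n))))
       (fun s _ => intgZ _ (intg_sinc _)).
    congr intg; apply: funext => t; rewrite !mulr_sumr; apply: eq_bigr => s _; ring.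
  rewrite /F -RIZ // -RIZ; last first.
    have := intgZ (A^-1 * sq R n) i1; congr intg; apply: funext => t; ring.
  congr RI; apply: funext => t; field; by rewrite gt_eqF.
rewrite (_ : (fun n => _) = fun n => 2 / pi * A * RI (fun t => seg01 t * ((1 - t) * F n t)));
  last exact: funext.
rewrite -[X in _ --> X]mulrA; apply: cvgM; first exact: cvg_cst.
have mF n : measurable_fun setT (F n).
  apply: mfM; first exact: measurable_cst.
  apply: mfM; first exact: measurable_cst.
  rewrite /KilledWalk.Kn /Ex; apply: measurable_sum => s.
  apply: mfM; first exact: measurable_cst.
  by apply: mfM; [exact: measurable_cst|exact: measurable_sinc].
have bF n t : `|F n t| <= E * (1 + y).
  have sn := sq_gt0 R n; rewrite /F -[_ * Kn _ _ _ _]KnZ -KnZ.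
  apply: le_trans (ler_norm_Kn _ hP _ _ _ _) _; apply: le_trans _ (HE n.+1 x y y0).
  apply: ler_Kn => // _ u u0; rewrite !normrM (ger0_norm (x := A^-1)) ?invr_ge0 ?(ltW A0) //.
  rewrite (ger0_norm (ltW sn)).
  apply: (@le_trans _ _ (A^-1 * (sq R n * (A * u / sq R n)))); last first.
    by rewrite le_eqVlt; apply/orP; left; apply/eqP; field; rewrite !gt_eqF.
  rewrite ler_wpM2l ?invr_ge0 ?(ltW A0) // ler_wpM2l ?(ltW sn) //.
  by apply: le_trans (sinc_bound _ _) _; rewrite ger0_norm // !mulr_ge0 ?invr_ge0 ?ltW.
have [||||i2 cv] := @RI_dct R (fun n t => seg01 t * ((1 - t) * F n t))
  (fun t => seg01 t * ((1 - t) * (expR (- (s2 / 2 * (t * A) ^+ 2)) * Vh P f x y)))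
  (fun t => E * (1 + y) * seg01 t).
- by move=> n; apply: mfM; [exact: mf_seg|apply: mfM => //; apply: measurable_funB].
- move=> n t; case: (boolP (0 <= t <= 1)) => [/andP[t0 t1]|_]; last by rewrite mul0r mulr0 normr0.
  rewrite /= mul1r mulr1 normrM -[leRHS]mul1r; apply: ler_pM => //.
  by rewrite ler_norml; lra.
- by apply: intgZ; exact: intg_seg.
- move=> t; case: (boolP (0 <= t <= 1)) => [/andP[t0 t1]|_]; last first.
    by rewrite mul0r; under eq_fun do rewrite mul0r; exact: cvg_cst.
  suff cF : F n t @[n --> \oo] --> expR (- (s2 / 2 * (t * A) ^+ 2)) * Vh P f x y.
    by apply: cvgM; [exact: cvg_cst|apply: cvgM; [exact: cvg_cst|exact: cF]].
  move: t0; rewrite le_eqVlt => /predU1P[<-|t0].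
    rewrite mul0r expr0n mulr0 oppr0 expR0 mul1r.
    rewrite (_ : (fun n => _) = fun n => Kn n.+1 (fun _ u => u) x y).
      rewrite (cvg_shiftS (fun n => Kn n (fun _ u => u) x y)). exact: (Vh_cvg hg).
    apply: funext => n; rewrite /F -KnZ -KnZ; apply: eq_Knw => z u.
    by rewrite /sinc eqxx; field; rewrite !gt_eqF // sq_gt0.
  rewrite (_ : (fun n => _) = fun n => Kn n.+1 (fun _ u => sin (t * A / sq R n * u)) x y / (t * A / sq R n));
    last first.
    apply: funext => n; have sn := sq_gt0 R n.
    rewrite /F -KnZ -KnZ mulrC -KnZ; apply: eq_Knw => z u.
    rewrite /sinc gt_eqF // (_ : t * (A * u / sq R n) = t * A / sq R n * u); last by ring.
    by field; rewrite !gt_eqF.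
  apply: (@sine_limit' x y (fun n => t * A / sq R n) (fun n => n.+1)) => //.
  + by move=> n; rewrite !mulr_gt0 // invr_gt0 sq_gt0.
  + by rewrite -(mulr0 (t * A)); apply: cvgM; [exact: cvg_cst|exact: sqrtn_cvg].
  + by move=> B [N _ HB]; exists N => // m Nm; apply: HB; exact: leqW.
  + rewrite (_ : (fun n => _) = fun=> (t * A) ^+ 2); first exact: cvg_cst.
    by apply: funext => n; rewrite -sq_sqr; field; rewrite gt_eqF // sq_gt0.
have i3 : intg (fun t => seg01 t * ((1 - t) * expR (- (s2 / 2 * (t * A) ^+ 2)))).
  apply: intg_seg01_1t.
    have := continuous_measurable_fun (@continuous_gauss R (s2 / 2 * A ^+ 2)).
    by congr measurable_fun; apply: funext => t; congr expR; ring.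
  move=> t; rewrite ger0_norm ?expR_ge0 // -[leRHS]expR0 ler_expR oppr_le0.
  have [_ _ _ _ /ltW s0] := hg.
  by apply: mulr_ge0; [rewrite divr_ge0|rewrite sqr_ge0].
move: cv; rewrite (_ : RI (fun t => _ * (_ * (_ * Vh P f x y))) =
  RI (fun t => seg01 t * ((1 - t) * expR (- (s2 / 2 * (t * A) ^+ 2)))) * Vh P f x y) //.
rewrite [RHS]mulrC -RIZ //; congr RI; apply: funext => t; ring.
Qed.

(** In the variable $s=t(n+1)$ the triangle flattens to 1 and half a Gaussian integral is left. *)
Lemma cA_limit : 2 / pi * n.+1%:R * RI (fun t => seg01 t * ((1 - t) *
    expR (- (s2 / 2 * (t * n.+1%:R) ^+ 2)))) @[n --> \oo] -->
  2 / (Num.sqrt (2 * pi) * Num.sqrt s2).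
Proof.
have [_ _ _ _ s0] := hg; have s0' := ltW s0; have p0 := @pi_gt0 R.
pose h n (s : R) := (0 <= s <= n.+1%:R)%R%:R * ((1 - s / n.+1%:R) * expR (- (s2 / 2 * s ^+ 2))).
have c0 : 0 < s2 / 2 by rewrite divr_gt0.
have mg := continuous_measurable_fun (@continuous_gauss R (s2 / 2)).
have mh n : measurable_fun setT (h n).
  apply: mfM; first exact: mf_seg; apply: mfM => //.
  by apply: measurable_funB => //; apply: mfM.
have bh n s : `|h n s| <= expR (- (s2 / 2 * s ^+ 2)).
  rewrite /h; case: (boolP (0 <= s <= _)) => [/andP[u0 u1]|_]; last by rewrite mul0r normr0 expR_ge0.
  rewrite /= mul1r normrM [X in _ * X]ger0_norm ?expR_ge0 // ler_piMl ?expR_ge0 //.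
  have : 0 <= s / n.+1%:R <= 1 by rewrite divr_ge0 // ler_pdivrMr // mul1r u1.
  by move: (s / _) => z /andP[z0 z1]; rewrite ler_norml; lra.
have ih n : intg (h n) by exact: intg_le (intg_gauss c0).
have E n : n.+1%:R * RI (fun t => seg01 t * ((1 - t) *
    expR (- (s2 / 2 * (t * n.+1%:R) ^+ 2)))) = RI (h n).
  have n0 : 0 < n.+1%:R :> R by rewrite ltr0n.
  have := RI_affine 0 n0 (ih n) => /(congr1 (fun z => n.+1%:R * z)).
  rewrite mulrCA mulfV ?gt_eqF // mulr1 => <-; congr (_ * RI _); apply: funext => t.
  rewrite /h addr0 [t * _]mulrC pmulr_rge0 // -ler_pdivlMl // mulVf ?gt_eqF //.
  by rewrite [n.+1%:R * t / _]mulrAC divff ?gt_eqF // mul1r.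
rewrite (_ : (fun n => _) = fun n => 2 / pi * RI (h n)); last first.
  by apply: funext => n; rewrite -mulrA E.
rewrite (_ : _ / (_ * _) = 2 / pi * RI (fun s => half s * expR (- (s2 / 2 * s ^+ 2)))).
  apply: cvgM; first exact: cvg_cst.
  have [|_ cv] := @RI_dct R h (fun s => half s * expR (- (s2 / 2 * s ^+ 2)))
    (fun s => expR (- (s2 / 2 * s ^+ 2))) mh bh (intg_gauss c0); last exact: cv.
  move=> s; rewrite /h; case: (lerP 0 s) => u0 /=; last first.
    by rewrite mul0r; under eq_fun do rewrite mul0r; exact: cvg_cst.
  apply: (@cvg_trans _ ((fun n => 1 * ((1 - s / n.+1%:R) * expR (- (s2 / 2 * s ^+ 2)))) @ \oo)).
    apply: near_eq_cvg; near=> n; rewrite (_ : s <= _) //.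
    rewrite (@le_trans _ _ n%:R) ?ler_nat //; near: n; exact: nbhs_infty_ger.
  apply: cvgM; first exact: cvg_cst.
  rewrite [X in _ --> X](_ : _ = (1 - s * 0) * expR (- (s2 / 2 * s ^+ 2))); last by ring.
  apply: cvgM; last exact: cvg_cst.
  apply: cvgB; first exact: cvg_cst.
  by apply: cvgM; [exact: cvg_cst|exact: cvg_harmonic].
have Es : Num.sqrt (pi / (s2 / 2)) = Num.sqrt (2 * pi) / Num.sqrt s2.
  rewrite (_ : pi / (s2 / 2) = (2 * pi) * s2^-1); last by rewrite invf_div; ring.
  by rewrite sqrtrM ?sqrtrV // mulr_ge0 // ltW.
rewrite RI_gauss // Es; set q := Num.sqrt (2 * pi).
have q0 : 0 < q by rewrite sqrtr_gt0 mulr_gt0.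
have qq : q ^+ 2 = 2 * pi by rewrite sqr_sqrtr // mulr_ge0 // ltW.
have v0 : 0 < Num.sqrt s2 by rewrite sqrtr_gt0.
have -> : pi = q ^+ 2 / 2 :> R by rewrite qq; field.
by move: (Num.sqrt s2) v0 => v v0; field; rewrite !gt_eqF.
Unshelve. all: by end_near. Qed.

(** [Dfej] is near 1 at heights above [a * sq R n], and by [Kn_bdry_bound] the survivors below have
    mass of order $a/\sqrt n$; so replacing 1 by [Dfej] costs little, uniformly in large [n]. *)
Lemma survn_limit_S x y : 0 < y ->
  sq R n * survn n.+1 x y @[n --> \oo] --> 2 / (Num.sqrt (2 * pi) * Num.sqrt s2) * Vh P f x y.
Proof.
move=> y0; have [C C0 HC] := Kn_bdry_bound hg; have [C1 C10 HC1] := survn_bound hg.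
apply/cvgrPdist_le => e e0.
pose a := e / 8 / (2 * C * (1 + y)).
have CY : 0 < 2 * C * (1 + y) by rewrite !mulr_gt0 // addr_gt0.
have a0 : 0 < a by rewrite divr_gt0 // divr_gt0.
have CY1 : 0 < C1 * (1 + y) by rewrite !mulr_gt0 // addr_gt0.
pose eta := e / 4 / (C1 * (1 + y)); have eta0 : 0 < eta by rewrite !divr_gt0.
have [A0 _ HA0] := Dfej_cvg a0 eta0.
have cV : 2 / pi * n.+1%:R * RI (fun t => seg01 t * ((1 - t) *
    expR (- (s2 / 2 * (t * n.+1%:R) ^+ 2)))) * Vh P f x y @[n --> \oo] -->
  2 / (Num.sqrt (2 * pi) * Num.sqrt s2) * Vh P f x y.
  by apply: cvgM; [exact: cA_limit|exact: cvg_cst].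
have e4 : 0 < e / 4 by rewrite divr_gt0.
have /cvgrPdist_le/(_ _ e4)[N1 _ HN1] := cV.
(* One [A] serves two purposes: [Dfej] is near 1 above the window, and the constant is near its
   limit. *)
pose A := (A0 + N1)%N.
have HA := HN1 A (leq_addl _ _); rewrite /= in HA.
have A1 : 0 < A.+1%:R :> R by [].
have /cvgrPdist_le/(_ _ e4) c2 := @Dfej_limit x y _ y0 A1.
near=> n.
have h2 : `|2 / pi * A.+1%:R * RI (fun t => seg01 t * ((1 - t) *
    expR (- (s2 / 2 * (t * A.+1%:R) ^+ 2)))) * Vh P f x y -
    sq R n * Kn n.+1 (fun _ u => Dfej (A.+1%:R * u / sq R n)) x y| <= e / 4 by near: n.
have sn := sq_gt0 R n.
(* Hence $1\le a\sqrt{n+1}$, which absorbs the [+ 1] in [Kn_bdry_bound]. *)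
have na : a^-1 <= sq R n.
  rewrite -(@ler_sqr R) ?nnegrE ?invr_ge0 ?(ltW a0) ?(ltW sn) // sq_sqr.
  rewrite (@le_trans _ _ n%:R) ?ler_nat //; near: n; exact: nbhs_infty_ger.
have h3 : sq R n * Kn n.+1 (fun _ u => 1 - Dfej (A.+1%:R * u / sq R n)) x y <= e / 2.
  have h4 : Kn n.+1 (fun _ u => 1 - Dfej (A.+1%:R * u / sq R n)) x y <=
     Kn n.+1 (fun _ u => (0 <= u <= a * sq R n)%R%:R) x y + eta * survn n.+1 x y.
    rewrite -Kn_cst // -Kn_add; apply: ler_Kn => // _ u u0; rewrite (ltW u0) /=.
    case: (lerP u (a * sq R n)) => ua /=.
      have := Dfej_ge0 (A.+1%:R * u / sq R n); lra.
    rewrite add0r; apply: le_trans (HA0 A.+1 _); last by rewrite leqW // leq_addr.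
    rewrite lerD2l lerN2 Dfej_homo // -mulrA ler_wpM2l // ler_pdivlMr //.
    exact: ltW.
  have as0 : 0 <= a * sq R n by rewrite mulr_ge0 ?ltW.
  have h5 := HC n.+1 x y 0 (a * sq R n) y0 as0.
  have h6 := HC1 n.+1 x y y0.
  apply: (@le_trans _ _ (sq R n * (C * (1 + y) * (a * sq R n - 0 + 1) / n.+2%:R +
      eta * (C1 * (1 + y) / sq R n.+1)))).
    rewrite ler_wpM2l ?(ltW sn) //; apply: le_trans h4 _; apply: lerD => //.
    by rewrite ler_wpM2l // ltW.
  rewrite mulrDr (_ : e / 2 = e / 4 + e / 4); last by field.
  apply: lerD.
    rewrite mulrA ler_pdivrMr ?ltr0n // subr0.
    apply: (@le_trans _ _ (e / 4 * sq R n ^+ 2)); last first.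
      by rewrite ler_wpM2l ?(ltW e4) // sq_sqr ler_nat.
    have as1 : 1 <= a * sq R n by rewrite mulrC -ler_pdivrMr // mul1r.
    apply: (@le_trans _ _ (sq R n * (C * (1 + y) * (2 * (a * sq R n))))).
      rewrite ler_wpM2l ?(ltW sn) // ler_wpM2l //; last lra.
      by rewrite mulr_ge0 ?(ltW C0) // addr_ge0 // ltW.
    rewrite [leLHS](_ : _ = (2 * C * (1 + y) * a) * sq R n ^+ 2); last by ring.
    rewrite ler_wpM2r ?sqr_ge0 // /a mulrC divfK ?gt_eqF //; lra.
  rewrite /eta [leLHS](_ : _ = e / 4 * (sq R n / sq R n.+1)); last first.
    field; rewrite !gt_eqF ?sq_gt0 //=; lra.
  by rewrite ler_piMr ?(ltW e4) // ler_pdivrMr ?sq_gt0 // mul1r sq_homo.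
have h7 : 0 <= sq R n * Kn n.+1 (fun _ u => 1 - Dfej (A.+1%:R * u / sq R n)) x y.
  by rewrite mulr_ge0 ?(ltW sn) // Kn_ge0 // => _ u _; rewrite subr_ge0 Dfej_le1.
have E : survn n.+1 x y = Kn n.+1 (fun _ u => 1 - Dfej (A.+1%:R * u / sq R n)) x y +
   Kn n.+1 (fun _ u => Dfej (A.+1%:R * u / sq R n)) x y.
  by rewrite -Kn_add; apply: eq_Knw => z u; rewrite subrK.
have tri (p q r s : R) : `|p - q| <= e / 4 -> `|q - r| <= e / 4 -> s <= e / 2 -> 0 <= s ->
    `|p - (s + r)| <= e.
  by rewrite !ler_norml => /andP[? ?] /andP[? ?] ? ?; apply/andP; split; lra.
by have := tri _ _ _ _ HA h2 h3 h7; rewrite -mulrDr -E.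
Unshelve. all: by end_near. Qed.

Lemma Vfun_eq x y : 0 < y -> Vfun P f (Num.sqrt s2) x y = Vh P f x y.
Proof.
move=> y0; have [_ _ _ _ s0] := hg; have p0 := @pi_gt0 R.
rewrite /Vfun; set l := limn _.
have -> : l = 2 / (Num.sqrt (2 * pi) * Num.sqrt s2) * Vh P f x y.
  apply: cvg_lim => //; rewrite -cvg_shiftS.
  rewrite (_ : (fun n => _) = fun n => sq R n * survn n.+1 x y); first exact: survn_limit_S.
  apply: funext => n.
  by rewrite /sq /KilledWalk.survn /KilledWalk.Kn; congr (_ * _); apply: eq_Ex => s _; rewrite mulr1.
have q0 : 0 < Num.sqrt (2 * pi) :> R by rewrite sqrtr_gt0 mulr_gt0.
have v0 : 0 < Num.sqrt s2 by rewrite sqrtr_gt0.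
move: (Num.sqrt (2 * pi)) q0 (Num.sqrt s2) v0 => q q0 v v0.
by field; rewrite !gt_eqF.
Qed.

End SurvivalAsymptotics.

(** * Measurability in the starting height *)

Section KilledMeasurable.
Variables (R : realType) (X : finType) (P : X -> X -> R) (f : X -> R).

Lemma mf_surv (s : seq X) : measurable_fun setT (fun y : R => surv f y s).
Proof.
elim: s => [|a s IH]; first exact: measurable_cst.
rewrite (_ : (fun y => _) = fun y => (0 < y + f a) && surv f (y + f a) s).
  apply: mf_andb; first by apply: measurable_fun_ltr => //; apply: measurable_funD.
  by apply: (measurableT_comp IH); apply: measurable_funD.
by apply: funext => y; rewrite surv_cons.
Qed.

Lemma mf_Kn n (G : X -> R -> R) x : (forall z, measurable_fun setT (G z)) ->
  measurable_fun setT (Kn P f n G x).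
Proof.
move=> mG; rewrite /Kn /Ex; apply: measurable_sum => s.
apply: mfM; first exact: measurable_cst.
by apply: mfM; [apply: mf_bool; exact: mf_surv|exact: mf_shift].
Qed.

End KilledMeasurable.

(** * Lebesgue duality under time reversal *)

Section Duality.
Variables (R : realType) (X : finType) (P : X -> X -> R) (nu f : X -> R).
Hypothesis hg : good P nu f.
Let hP := good_stoch hg.
Let hnu := good_inv hg.
Let h1 := good_H1 hg.
Local Notation Kn := (Kn P f).
Local Notation Ps := (Pdual P nu).
Local Notation fs := (fun x => - f x).
Local Notation Kns := (KilledWalk.Kn Ps fs).

Lemma intg_pos_bounded (g : R -> R) B M : measurable_fun setT g -> (forall z, `|g z| <= M) ->
  (forall z, B < z -> g z = 0) -> intg (fun z => (0 < z)%R%:R * g z).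
Proof.
move=> mg gM gB; have M0 : 0 <= M by apply: le_trans (gM 0).
apply: (@intg_le _ _ (fun z => M * (0 <= z <= B)%R%:R)).
- by apply: mfM => //; apply: mf_lt.
- move=> z; case: (ltrP 0 z) => z0 /=; last by rewrite mul0r normr0 mulr_ge0.
  rewrite (ltW z0) /= mul1r; case: (lerP z B) => zB /=; first by rewrite mulr1.
  by rewrite gB // normr0 mulr0.
- by apply: intgZ; exact: intg_seg.
Qed.

(** A class stable under the killed kernel whose members are integrable over $(0,\infty)$. *)
Definition nicefun (psi : X -> R -> R) := exists B M, [/\ forall x, measurable_fun setT (psi x),
  forall x z, `|psi x z| <= M & forall x z, B < z -> psi x z = 0].

Lemma nice_Kn n psi : nicefun psi -> nicefun (Kn n psi).
Proof.
move=> [B [M [m1 b1 s1]]].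
have [F F0 HF] := fin_upper (fun x => `|f x|).
have psum_lo t : - ((size t)%:R * F) <= psum f t.
  elim: t => [|c t IH]; first by rewrite mul0r oppr0 psum_nil.
  rewrite psum_cons /= -natr1 mulrDl mul1r opprD addrC; apply: lerD => //.
  by have : `|f c| <= F by [apply: le_trans (HF c); exact: ler_norm]; rewrite ler_norml => /andP[].
exists (B + n%:R * F), M; split.
- by move=> x; apply: mf_Kn.
- move=> x z; have M0 : 0 <= M by apply: le_trans (b1 x z).
  apply: le_trans (ler_norm_Kn _ hP _ _ _ _) _.
  apply: (@le_trans _ _ (KilledWalk.Kn P f n (fun _ _ => M) x z)); last first.
    by rewrite Kn_cst // ler_piMr // survn_le1.
  apply: ler_Ex => // s _; rewrite ler_wpM2l //.
- move=> x z zB; rewrite /KilledWalk.Kn /Ex big1 // => s _.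
  rewrite s1 ?mulr0 //.
  have := psum_lo s; rewrite size_tuple.
  lra.
Qed.

(** Translating [z] by $f(x')$ turns a forward step into a backward one, and $\nu(x)P(x,x')$ becomes
    $\nu(x')$ times a dual transition. *)
Lemma duality1 (H psi : X -> R -> R) M : nicefun psi -> (forall x, measurable_fun setT (H x)) ->
  (forall x z, `|H x z| <= M) ->
  RI (fun z => \sum_x nu x * ((0 < z)%R%:R * (H x z * Kn 1 psi x z))) =
  RI (fun z => \sum_x nu x * ((0 < z)%R%:R * (psi x z *
     ((0 < z - f x)%R%:R * \sum_x' Ps x x' * H x' (z - f x))))).
Proof.
move=> [B [M1 [m1 b1 s1]]] mH bH.
have ia x x' : intg (fun z => (0 < z)%R%:R * (H x (z - f x') * ((0 < z - f x')%R%:R * psi x' z))).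
  apply: (@intg_pos_bounded _ B (M * (1 * M1))).
  - apply: mfM; first exact: mf_shift.
    by apply: mfM => //; apply: mf_lt => //; apply: measurable_funD.
  - move=> z; apply: normM => //; apply: normM => //; by rewrite ger0_norm // lern1 leq_b1.
  - by move=> z zB; rewrite s1 // !mulr0.
transitivity (\sum_x \sum_x' RI (fun z => nu x * P x x' *
   ((0 < z + f x')%R%:R * (H x z * ((0 < z)%R%:R * psi x' (z + f x')))))).
  have ib x x' : intg (fun z => (0 < z + f x')%R%:R * (H x z * ((0 < z)%R%:R * psi x' (z + f x')))).
    by have := intg_shift (f x') (ia x x'); congr intg; apply: funext => z; rewrite addrK.
  under eq_bigr => x _.
    rewrite -RI_sum; last by move=> x' _; apply: intgZ; exact: ib.
    over.
  rewrite -RI_sum; last by move=> x _; apply: intg_sum => x' _; apply: intgZ; exact: ib.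
  congr RI; apply: funext => z; apply: eq_bigr => x _.
  rewrite Kn1 !mulr_sumr; apply: eq_bigr => x' _; ring.
transitivity (\sum_x \sum_x' RI (fun z => nu x * P x x' *
   ((0 < z)%R%:R * (H x (z - f x') * ((0 < z - f x')%R%:R * psi x' z))))).
  apply: eq_bigr => x _; apply: eq_bigr => x' _.
  rewrite -[RHS](@RI_shift _ (f x')); last by apply: intgZ; exact: ia.
  by congr RI; apply: funext => z; rewrite addrK.
rewrite exchange_big /=.
under eq_bigr => x' _.
  rewrite -RI_sum; last by move=> x _; apply: intgZ; exact: ia.
  over.
rewrite -RI_sum; last by move=> x' _; apply: intg_sum => x _; apply: intgZ; exact: ia.
congr RI; apply: funext => z; apply: eq_bigr => x' _.
rewrite !mulr_sumr; apply: eq_bigr => x _.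
rewrite -(nu_Pdual hP hnu h1 x' x); ring.
Qed.

(** A step adds [f] of the state reached, so the reversed walk first subtracts [f] at its own
    starting state [x]. This step is explicit; the other [k] form the dual killed kernel. *)
Lemma duality k (al : R -> R) (psi : X -> R -> R) M : nicefun psi -> measurable_fun setT al ->
  (forall u, `|al u| <= M) ->
  RI (fun z => \sum_x nu x * ((0 < z)%R%:R * (al z * Kn k.+1 psi x z))) =
  RI (fun z => \sum_x nu x * ((0 < z)%R%:R * (psi x z *
     ((0 < z - f x)%R%:R * Kns k (fun _ u => al u) x (z - f x))))).
Proof.
move=> npsi mal bal; elim: k psi npsi => [|k IH] psi npsi.
  rewrite (@duality1 (fun _ z => al z) psi M) //; congr RI; apply: funext => z.
  apply: eq_bigr => x _; rewrite Kn0 -big_distrl /= (Pdual_stochastic hP hnu h1).2.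
  by rewrite mul1r.
have hPs := Pdual_stochastic hP hnu h1.
transitivity (RI (fun z => \sum_x nu x * ((0 < z)%R%:R * (al z * Kn k.+1 (Kn 1 psi) x z)))).
  by congr RI; apply: funext => z; apply: eq_bigr => x _; rewrite -KnSr.
rewrite IH; last exact: nice_Kn.
have M0 (x : X) : 0 <= M by apply: le_trans (bal 0).
rewrite (_ : (fun z => _) = fun z => \sum_x nu x * ((0 < z)%R%:R *
   (((0 < z - f x)%R%:R * Kns k (fun _ u => al u) x (z - f x)) * Kn 1 psi x z))); last first.
  by apply: funext => z; apply: eq_bigr => x _; ring.
rewrite (@duality1 _ psi M) //; last 2 first.
- move=> x; apply: mfM; first by apply: mf_lt => //; apply: measurable_funD.
  by apply: mf_shift; apply: mf_Kn.
- move=> x z; rewrite -[M]mul1r; apply: normM; first by rewrite ger0_norm // lern1 leq_b1.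
  apply: le_trans (ler_norm_Kn _ hPs _ _ _ _) _.
  apply: (@le_trans _ _ (Kns k (fun _ _ => M) x (z - f x))); last first.
    by rewrite Kn_cst // ler_piMr ?survn_le1 // (M0 x).
  by apply: ler_Ex => // s _; rewrite ler_wpM2l.
congr RI; apply: funext => z; apply: eq_bigr => x _; congr (_ * (_ * (_ * (_ * _)))).
by rewrite KnS.
Qed.

End Duality.

(** * A priori bounds for step functions *)

Module StepBounds.

Section LocalBounds.
Variables (R : realType) (X : finType) (P : X -> X -> R) (nu f : X -> R).
Hypothesis hg : good P nu f.
Let hP := good_stoch hg.
Let hnu := good_inv hg.
Let h1 := good_H1 hg.
Local Notation Tn := (Tn P f).
Local Notation Kn := (Kn P f).
Local Notation survn := (survn P f).

Definition step_at (a : X -> R) (b : R) (x : X) (u : R) : R := a x * (u <= b)%R%:R.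
(** Extended by 0 to $w\le0$, so that the free kernel can act on it. *)
Definition Qf n a b x (w : R) : R := (0 < w)%R%:R * Kn n (step_at a b) x w.
Definition weight (a : X -> R) := forall x, 0 <= a x <= 1.

Lemma step_at_itv a b x u : weight a -> 0 <= step_at a b x u <= 1.
Proof.
move=> /(_ x) /andP[a0 a1]; rewrite mulr_ge0 //= -[leRHS]mulr1.
by apply: ler_pM => //; rewrite lern1 leq_b1.
Qed.

Lemma step_at_ge0 a b x u : weight a -> 0 <= step_at a b x u.
Proof. by move=> ha; case/andP: (step_at_itv b x u ha). Qed.

Lemma nice_step a b : weight a -> nicefun (step_at a b).
Proof.
move=> ha; exists b, 1; split.
- by move=> x; apply: mfM => //; apply: mf_le.
- by move=> x z; have /andP[? ?] := step_at_itv b x z ha; rewrite ger0_norm.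
- by move=> x z bz; rewrite /step_at leNgt bz mulr0.
Qed.

Lemma Kn_step_ge0 n a b x w : weight a -> 0 <= Kn n (step_at a b) x w.
Proof. by move=> ha; apply: Ex_ge0 => // s _; rewrite mulr_ge0 // step_at_ge0. Qed.

Lemma Qf_ge0 n a b x w : weight a -> 0 <= Qf n a b x w.
Proof. by move=> ha; rewrite mulr_ge0 // Kn_step_ge0. Qed.

Lemma Qf_measurable n a b x : measurable_fun setT (Qf n a b x).
Proof.
apply: mfM; first exact: mf_lt.
by apply: mf_Kn => z; apply: mfM => //; apply: mf_le.
Qed.

Lemma Qf_le1 n a b x w : weight a -> Qf n a b x w <= 1.
Proof.
move=> ha; rewrite -[leRHS]mulr1; apply: ler_pM => //; first exact: Kn_step_ge0.
  by rewrite lern1 leq_b1.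
rewrite -[leRHS](Ex_cst hP x n); apply: ler_Ex => // s _.
rewrite -[leRHS]mulr1; apply: ler_pM => //; rewrite ?step_at_ge0 ?lern1 ?leq_b1 //.
by case/andP: (step_at_itv b (last x s) (w + psum f s) ha).
Qed.

Lemma intg_Qf n a b x : weight a -> intg (Qf n a b x).
Proof.
move=> ha; have [B [M [m bd s]]] := nice_Kn hg n (nice_step b ha).
exact: (@intg_pos_bounded _ _ B M (m x) (bd x) (s x)).
Qed.

(** Raising the start by [u] preserves survival and raises the endpoint by [u]. This one-sided
    inequality stands in for continuity in the starting height. *)
Lemma Qf_mono n a b d x w u : weight a -> 0 <= u <= d ->
  Qf n a b x w <= Qf n a (b + d) x (w + u).
Proof.
move=> ha /andP[u0 ud]; rewrite /Qf; case: (ltrP 0 w) => w0; last by rewrite mul0r Qf_ge0.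
have -> : 0 < w + u by apply: ltr_wpDr.
rewrite !mul1r; apply: ler_Ex => // s _; apply: ler_pM; rewrite ?step_at_ge0 //.
  by rewrite ler_nat; case: (boolP (surv f w s)) => // ss; rewrite (surv_homo _ ss) // lerDl.
have /andP[a0 _] := ha (last x s); apply: ler_wpM2l => //; rewrite ler_nat.
case: (lerP (w + psum f s) b) => // hb; rewrite (_ : _ <= _) //; lra.
Qed.

(** Duality with the constant 1 turns the integral into survival of the dual walk from heights at
    most [b + F], integrated over a window of length [b]. *)
Lemma Qf_L1_bound : exists2 C : R, 0 < C & forall k a b x, weight a -> 0 <= b ->
  RI (Qf k.+1 a b x) <= C * (1 + b) ^+ 2 / sq R k.
Proof.
have [C C0 HC] := survn_bound (good_dual hg).
have [F F0 HF] := fin_upper f.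
have [c c0 Hc] := fin_lower (nu_gt0 hP hnu h1).
have [n0 [n1 _]] := hnu.
exists (C * (1 + F) / c); first by rewrite divr_gt0 // mulr_gt0 // addr_gt0.
move=> k a b x ha b0; have sk := sq_gt0 R k.
pose h z := \sum_x nu x * ((0 < z)%R%:R * (1 * Kn k.+1 (step_at a b) x z)).
have le1 : c * RI (Qf k.+1 a b x) <= RI h.
  rewrite /h (_ : (fun z => _) = fun z => \sum_x nu x * Qf k.+1 a b x z); last first.
    by apply: funext => z; apply: eq_bigr => v _; rewrite mul1r.
  rewrite RI_sum; last by move=> v _; apply/intgZ/intg_Qf.
  under eq_bigr do rewrite RIZ ?intg_Qf //.
  have q0 v : 0 <= RI (Qf k.+1 a b v) by apply: RI_ge0 => z; exact: Qf_ge0.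
  rewrite (bigD1 x) //=; apply: ler_wpDr; last by rewrite ler_wpM2r.
  by apply: sumr_ge0 => v _; rewrite mulr_ge0.
pose K := C * (1 + (b + F)) / sq R k.
have K0 : 0 <= K by rewrite !mulr_ge0 ?invr_ge0 ?ltW //; lra.
have le2 : RI h <= K * b.
  rewrite /h (duality hg (M := 1) k (al := fun=> 1) (nice_step b ha)) //; last first.
    by move=> u; rewrite normr1.
  rewrite -[b in leRHS]subr0 -(RI_seg b0) -RIZ; last exact: intg_seg.
  set g := (fun z => \sum_x0 _).
  have K1 v z : 0 <= KilledWalk.Kn (Pdual P nu) (fun x => - f x) k (fun _ _ => 1) v z.
    exact: (survn_ge0 _ (good_stoch (good_dual hg))).
  have g0 z : 0 <= g z.
    apply: sumr_ge0 => v _; apply: mulr_ge0 => //; apply: mulr_ge0 => //.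
    by apply: mulr_ge0; [exact: step_at_ge0|apply: mulr_ge0].
  have gK z : g z <= K * (0 <= z <= b)%R%:R.
    rewrite /g; case: (ltrP 0 z) => z0; last first.
      rewrite big1; first by apply: mulr_ge0 K0 _.
      by move=> v _; rewrite mul0r mulr0.
    rewrite (ltW z0) /=; case: (lerP z b) => zb; last first.
      by rewrite mulr0 big1 // => v _; rewrite /step_at leNgt zb !(mulr0, mul0r).
    rewrite mulr1 -[leRHS]mul1r -[in leRHS]n1 mulr_suml; apply: ler_sum => v _.
    apply: ler_wpM2l => //; rewrite mul1r /step_at zb mulr1 -[leRHS]mul1r.
    have /andP[a0 a1] := ha v.
    case: (ltrP 0 (z - f v)) => zf; last by rewrite mul0r mulr0 mul1r.
    rewrite !mul1r -[leRHS]mul1r; apply: ler_pM => //.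
    apply: le_trans (HC k v _ zf) _; apply: ler_wpM2r; first by rewrite invr_ge0 ltW.
    apply: ler_wpM2l; first exact: ltW.
    rewrite lerD2l; have := HF v; rewrite ler_norml => /andP[]; lra.
  have ig : intg (fun z => K * (0 <= z <= b)%R%:R) by apply/intgZ/intg_seg.
  apply: RI_le => //; apply: (intg_le _ _ ig); last by move=> z; rewrite ger0_norm.
  apply: measurable_sum => v; apply: mfM => //; apply: mfM; first exact: mf_lt.
  apply: mfM; first by apply: mfM => //; apply: mf_le.
  apply: mfM; first by apply: mf_lt => //; apply: measurable_funD.
  by apply: mf_shift; apply: mf_Kn.
rewrite -(ler_pM2l c0); apply: le_trans le1 (le_trans le2 _).
rewrite /K [leRHS](_ : _ = C * ((1 + F) * (1 + b) ^+ 2) / sq R k); last first.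
  by field; rewrite !gt_eqF.
rewrite mulrAC ler_wpM2r ?invr_ge0 ?(ltW sk) // -mulrA ler_wpM2l ?(ltW C0) //.
have := mulr_ge0 (ltW F0) b0; have := sqr_ge0 b; have := mulr_ge0 (ltW F0) (sqr_ge0 b).
rewrite !expr2; nra.
Qed.

(** By monotonicity a value of [Qf] is at most its mean over the next unit interval at level
    [b + 1]. The free walk meets each such interval with probability of order $i^{-1/2}$, and
    [Qf_L1_bound] sums over the intervals. *)
Lemma Tn_Qf_bound : exists2 C : R, 0 < C & forall i k a b x w, weight a -> 0 <= b ->
  Tn i (Qf k.+1 a b) x w <= C * (1 + b) ^+ 2 / (sq R i * sq R k).
Proof.
have [C C0 HC] := Qf_L1_bound; have [D D0 HD] := Tn_itv_bound hg.
exists (2 * D * (#|X|%:R * C * 4) + 1).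
  by rewrite ltr_wpDl // !mulr_ge0 // ?(ltW C0) ?(ltW D0).
move=> i k a b x w ha b0; have si := sq_gt0 R i; have sk := sq_gt0 R k.
pose S v := \sum_z Qf k.+1 a (b + 1) z v.
have iS : intg S by apply: intg_sum => z _; exact: intg_Qf.
have S0 v : 0 <= S v by apply: sumr_ge0 => z _; exact: Qf_ge0.
have QS z v : Qf k.+1 a (b + 1) z v <= S v.
  by rewrite /S (bigD1 z) //= lerDl; apply: sumr_ge0 => z' _; exact: Qf_ge0.
have ib (c : R) : intg (fun v => (c <= v <= c + 1)%R%:R * S v).
  apply: (intg_le _ _ iS); first by apply: mfM; [exact: mf_seg|exact: (intg_measurable iS)].
  by move=> v; rewrite normrM (ger0_norm (S0 v)) ger0_norm // ler_piMl // lern1 leq_b1.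
have QR z c : Qf k.+1 a b z c <= RI (fun v => (c <= v <= c + 1)%R%:R * S v).
  have -> : Qf k.+1 a b z c = RI (fun v => Qf k.+1 a b z c * (c <= v <= c + 1)%R%:R).
    by rewrite RIZ ?RI_seg; [ring|lra|exact: intg_seg].
  apply: RI_le => //; first exact/intgZ/intg_seg.
  move=> v; rewrite mulrC; case: (boolP (c <= v <= c + 1)) => [/andP[cv vc]|_]; last by rewrite !mul0r.
  rewrite !mul1r; apply: le_trans (QS z v).
  have := @Qf_mono k.+1 a b 1 z c (v - c) ha; rewrite [c + _]addrC subrK; apply; lra.
apply: (@le_trans _ _ (Tn i (fun _ c => RI (fun v => (c <= v <= c + 1)%R%:R * S v)) x w)).
  exact: ler_Tn.
have -> : Tn i (fun _ c => RI (fun v => (c <= v <= c + 1)%R%:R * S v)) x w =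
  RI (fun v => S v * Tn i (fun _ c => (v - 1 <= c <= v)%R%:R) x w).
  rewrite {1}/KilledWalk.Tn /Ex.
  under eq_bigr => s _ do rewrite -RIZ //.
  rewrite -RI_sum; last by move=> s _; exact: intgZ.
  congr RI; apply: funext => v; rewrite /KilledWalk.Tn /Ex mulr_sumr; apply: eq_bigr => s _.
  rewrite [RHS]mulrCA; congr (_ * _); rewrite mulrC; congr (_ * _); congr (_%:R).
  by rewrite andbC lerBlDr.
apply: (@le_trans _ _ (RI (fun v => D * 2 / sq R i * S v))).
  have iDS := intgZ (D * 2 / sq R i) iS.
  have le v : S v * Tn i (fun _ c => (v - 1 <= c <= v)%R%:R) x w <= D * 2 / sq R i * S v.
    rewrite mulrC ler_wpM2r //; apply: le_trans (HD i x w (v - 1) v _) _; first by lra.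
    by rewrite ler_wpM2r ?invr_ge0 ?(ltW si) // ler_wpM2l ?(ltW D0) //; lra.
  apply: RI_le => //; apply: (intg_le _ _ iDS); last first.
    by move=> v; rewrite ger0_norm // mulr_ge0 // Tn_ge0.
  apply: mfM; first exact: (intg_measurable iS).
  apply: measurable_sum => s; apply: mfM => //; apply: mf_bool; apply: mf_andb.
    by apply: measurable_fun_ler => //; apply: measurable_funB.
  by apply: measurable_fun_ler.
rewrite RIZ //.
have SL : RI S <= #|X|%:R * (C * (1 + (b + 1)) ^+ 2 / sq R k).
  rewrite /S RI_sum; last by move=> z _; exact: intg_Qf.
  rewrite mulr_natl -sumr_const; apply: ler_sum => z _; apply: HC => //; lra.
apply: le_trans (ler_wpM2l _ SL) _; first by rewrite !mulr_ge0 ?invr_ge0 ?ltW.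
have b4 : (1 + (b + 1)) ^+ 2 <= 4 * (1 + b) ^+ 2 by rewrite !expr2; nra.
apply: (@le_trans _ _ (2 * D * (#|X|%:R * C * 4) * (1 + b) ^+ 2 / (sq R i * sq R k))); last first.
  rewrite ler_wpM2r ?invr_ge0 ?mulr_ge0 ?(ltW si) ?(ltW sk) //.
  by rewrite ler_wpM2r ?sqr_ge0 // lerDl.
rewrite [leLHS](_ : _ = 2 * D * (#|X|%:R * C) / (sq R i * sq R k) * (1 + (b + 1)) ^+ 2); last first.
  by field; rewrite !gt_eqF.
rewrite [leRHS](_ : _ = 2 * D * (#|X|%:R * C) / (sq R i * sq R k) * (4 * (1 + b) ^+ 2)); last first.
  by field; rewrite !gt_eqF.
apply: ler_wpM2l => //; rewrite !mulr_ge0 ?invr_ge0 ?mulr_ge0 // ?(ltW C0) ?(ltW D0) ?(ltW si) ?(ltW sk) //.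
Qed.

Lemma Kn_Qf i n a b x w : 0 < w -> Kn i (Kn n (step_at a b)) x w = Kn i (Qf n a b) x w.
Proof. by move=> w0; apply: eq_Kn => // z v v0; rewrite /Qf v0 mul1r. Qed.

(** Killing is dropped on the first half of the time: two factors $n^{-1/2}$ from [Tn_Qf_bound]. *)
Lemma Qf_sup_bound : exists2 C : R, 0 < C & forall n a b x w, weight a -> 0 <= b ->
  Qf n a b x w <= C * (1 + b) ^+ 2 / n.+1%:R.
Proof.
have [C C0 HC] := Tn_Qf_bound; exists (1 + 8 * C); first by rewrite addr_gt0 // mulr_gt0.
move=> n a b x w ha b0.
have b1 : 1 <= (1 + b) ^+ 2 by rewrite expr2; nra.
case: n => [|n].
  apply: le_trans (Qf_le1 _ _ _ _ ha) _; rewrite divr1 -[leLHS]mulr1; apply: ler_pM => //; lra.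
rewrite /Qf; case: (ltrP 0 w) => w0; last first.
  rewrite mul0r; apply: divr_ge0 => //; apply: mulr_ge0; last exact: sqr_ge0.
  by have := C0; lra.
rewrite mul1r.
(* [Tn_Qf_bound] asks for at least one step in the last part, hence the successor. *)
have nE : n.+1 = (n.+1./2 + (n./2).+1)%N.
  by rewrite -[in LHS](odd_double_half n.+1) /= uphalf_half; case: (odd n) => /=; lia.
rewrite [in leLHS]nE KnD Kn_Qf //.
apply: le_trans (ler_Kn_Tn _ hP _ _ _ _) _; first by move=> z v; exact: Qf_ge0.
apply: le_trans (HC _ _ _ _ _ _ ha b0) _.
set i := n.+1./2; set k := n./2.
have si := sq_gt0 R i; have sk := sq_gt0 R k.
have n8 : n.+2%:R <= 8 * (sq R i * sq R k).
  have e1 : sq R n.+1 <= 2 * sq R i by exact: sq_half.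
  have e2 : sq R n <= 2 * sq R k by exact: sq_half.
  have e3 : n.+2%:R <= 2 * (sq R n.+1 * sq R n).
    rewrite -(sq_sqr R n.+1) expr2 [leRHS]mulrCA.
    apply: ler_wpM2l; first exact: ltW (sq_gt0 R _).
    apply: le_trans (sq_half R n.+1) _; apply: ler_wpM2l => //; apply: sq_homo; lia.
  apply: le_trans e3 _; have := ler_pM (ltW (sq_gt0 R n.+1)) (ltW (sq_gt0 R n)) e1 e2; lra.
rewrite mulrDl mul1r mulrDl.
apply: (@le_trans _ _ (8 * C * (1 + b) ^+ 2 / n.+2%:R)); last first.
  by rewrite lerDr divr_ge0 // sqr_ge0.
rewrite ler_pdivlMr // mulrAC ler_pdivrMr ?mulr_gt0 //.
rewrite [leRHS](_ : _ = C * (1 + b) ^+ 2 * (8 * (sq R i * sq R k))); last by ring.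
by apply: ler_wpM2l => //; apply: mulr_ge0; [exact: ltW|exact: sqr_ge0].
Qed.

(** Survival over the first half supplies the third factor $n^{-1/2}$: the exact order is reached
    before any limit is taken. *)
Lemma Kn_step_bound : exists2 C : R, 0 < C & forall n a b x y, weight a -> 0 <= b -> 0 < y ->
  Kn n (step_at a b) x y <= C * (1 + y) * (1 + b) ^+ 2 / (n.+1%:R * sq R n).
Proof.
have [C C0 HC] := Qf_sup_bound; have [D D0 HD] := survn_bound hg.
exists (4 * C * D); first by rewrite !mulr_gt0.
move=> n a b x y ha b0 y0; have sn := sq_gt0 R n.
pose k := n./2; pose m := uphalf n.
have nE : n = (k + m)%N by rewrite /k /m uphalf_half -[in LHS](odd_double_half n); lia.
rewrite [in leLHS]nE KnD Kn_Qf //.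
set U := C * (1 + b) ^+ 2 / m.+1%:R.
have U0 : 0 <= U by apply: divr_ge0 => //; apply: mulr_ge0; [exact: ltW|exact: sqr_ge0].
apply: (@le_trans _ _ (U * survn k x y)).
  rewrite -Kn_cst; apply: ler_Kn => // z v _; exact: HC.
apply: le_trans (ler_wpM2l U0 (HD k x y y0)) _.
have e1 : sq R n <= 2 * sq R k by exact: sq_half.
have e2 : n.+1%:R <= 2 * m.+1%:R :> R.
  by rewrite -natrM ler_nat; move: nE; rewrite /k /m uphalf_half; lia.
have sk := sq_gt0 R k.
rewrite /U [leLHS](_ : _ = C * D * (1 + y) * (1 + b) ^+ 2 / (m.+1%:R * sq R k)); last first.
  by field; rewrite (gt_eqF sk) /= addrC natr1 pnatr_eq0.
rewrite ler_pdivrMr ?mulr_gt0 // [leRHS]mulrAC ler_pdivlMr ?mulr_gt0 //.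
have e3 : n.+1%:R * sq R n <= 4 * (m.+1%:R * sq R k).
  by apply: le_trans (ler_pM _ (ltW sn) e2 e1) _ => //; lra.
rewrite [leRHS](_ : _ = C * D * (1 + y) * (1 + b) ^+ 2 * (4 * (m.+1%:R * sq R k))); last by ring.
rewrite [leLHS](_ : _ = C * D * (1 + y) * (1 + b) ^+ 2 * (n.+1%:R * sq R n)); last by ring.
apply: ler_wpM2l => //; apply: mulr_ge0; last exact: sqr_ge0.
by apply: mulr_ge0; [apply: mulr_ge0; exact: ltW|lra].
Qed.

End LocalBounds.

End StepBounds.
Import StepBounds.

(** * Exit probability from a quadratic potential *)

Section HittingPotential.
Variables (R : realType) (X : finType) (P : X -> X -> R) (f r : X -> R) (M : R).
Hypothesis hP : stochastic P.
Hypotheses (hr : forall x, r x = \sum_x' P x x' * (f x' + r x')) (M1 : 1 <= M)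
  (fr : forall x, `|f x| + `|r x| <= M).
Local Notation Tn := (Tn P f).
Local Notation survn := (survn P f).

(** Kolmogorov's inequality by a potential: the squared corrected displacement gains at most $4M^2$
    per step on average and is at least $(w-M)^2$ on exit. *)
Lemma hit_potential j x w : 0 < w -> 1 - survn j x w <= 16 * M ^+ 2 * j.+1%:R / w ^+ 2.
Proof.
have M1' := M1; have M0 : 0 < M by apply: lt_le_trans M1.
move=> w0; rewrite ler_pdivlMr ?exprn_gt0 //.
have j1 : 1 <= j.+1%:R :> R by rewrite ler1n.
have s0 := survn_ge0 f hP j x w.
have MM : 0 < M ^+ 2 by rewrite exprn_gt0.
(* For such [w] the claimed bound exceeds 1. *)
case: (lerP w (2 * M)) => wM.
  have e1 : w ^+ 2 <= 4 * M ^+ 2 by rewrite !expr2; nra.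
  have w2 : 0 <= w ^+ 2 by apply: sqr_ge0.
  apply: (@le_trans _ _ (1 * w ^+ 2)); first by rewrite ler_wpM2r //; lra.
  apply: (@le_trans _ _ (16 * M ^+ 2 * 1)); first by lra.
  by rewrite ler_wpM2l // mulr_ge0 // ltW.
pose g z v := ((v - w) + r z) ^+ 2.
have Tg z v : Tn 1 g z v <= g z v + 4 * M ^+ 2.
  rewrite Tn1; set h := v - w + r z.
  have -> : g z v + 4 * M ^+ 2 =
      \sum_x' P z x' * (h ^+ 2 + 4 * M ^+ 2 + 2 * h * ((f x' + r x') - r z)).
    transitivity (\sum_x' ((h ^+ 2 + 4 * M ^+ 2 - 2 * h * r z) * P z x' +
        2 * h * (P z x' * (f x' + r x')))); last by apply: eq_bigr => i _; ring.
    by rewrite big_split /= -!mulr_sumr hP.2 -hr /g -/h; ring.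
  apply: ler_sum => z' _; apply: ler_wpM2l; first exact: hP.1.
  rewrite /g /h; set D := f z' + r z' - r z.
  have -> : v + f z' - w + r z' = h + D by rewrite /h /D; ring.
  have : `|D| <= 2 * M.
    rewrite /D; apply: le_trans (ler_normB _ _) _; apply: le_trans (lerD (ler_normD _ _) (lexx _)) _.
    have := fr z'; have := fr z; have := normr_ge0 (f z); lra.
  rewrite ler_norml => /andP[D1 D2].
  have : D ^+ 2 <= 4 * M ^+ 2 by rewrite !expr2; nra.
  rewrite /h !expr2; lra.
have H i : forall z v, 0 < v -> (1 - survn i z v) * (w - M) ^+ 2 <= g z v + i%:R * (4 * M ^+ 2).
  elim: i => [|i IH] z v v0.
    by rewrite /KilledWalk.survn Kn0 subrr mul0r mul0r addr0 sqr_ge0.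
  apply: (@le_trans _ _ (Tn 1 g z v + i%:R * (4 * M ^+ 2))); last first.
    by have := Tg z v; rewrite -natr1; lra.
  have -> : 1 - survn i.+1 z v = \sum_x' P z x' * (1 - (0 < v + f x')%R%:R * survn i x' (v + f x')).
    under eq_bigr do rewrite mulrBr mulr1.
    by rewrite sumrB hP.2 /KilledWalk.survn KnS.
  rewrite -[i%:R * _]mul1r -[X in X * (i%:R * _)](hP.2 z) Tn1 !mulr_suml -big_split /=.
  apply: ler_sum => z' _; rewrite -mulrA -mulrDr; apply: ler_wpM2l; first exact: hP.1.
  case: (ltrP 0 (v + f z')) => vf; first by rewrite mul1r; apply: IH.
  rewrite mul0r subr0 mul1r -[leLHS]addr0; apply: lerD; last by rewrite mulr_ge0 // mulr_ge0 // ltW.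
  rewrite /g -[leRHS]sqrrN; have := fr z'; have := normr_ge0 (f z'); have := ler_norm (r z') => r1 f0 r2.
  rewrite ler_sqr ?nnegrE //; lra.
have := H j x w w0; rewrite /g subrr add0r => Hj.
have r2 : r x ^+ 2 <= M ^+ 2.
  rewrite -real_normK ?num_real // ler_sqr ?nnegrE // ?(ltW M0) //.
  by have := fr x; have := normr_ge0 (f x); lra.
have s1 : 0 <= 1 - survn j x w by have := survn_le1 f hP j x w; lra.
have w4 : w ^+ 2 <= 4 * (w - M) ^+ 2 by rewrite !expr2; nra.
apply: le_trans (ler_wpM2l s1 w4) _.
rewrite -natr1; have : 0 <= j%:R :> R by []. 
rewrite mulrCA; move: Hj r2; move: (_ * (w - M) ^+ 2) (r x ^+ 2) => S r2; nra.
Qed.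

Lemma Tn_le_hit j x w d : d < w ->
  Tn j (fun _ u => (u <= d)%R%:R) x w <= 1 - survn j x (w - d).
Proof.
move=> dw; rewrite lerBrDr -Ex_add -[leRHS](Ex_cst hP x j); apply: ler_Ex => // s _.
rewrite mulr1; case: (boolP (surv f (w - d) s)) => ss; last by rewrite addr0 lern1 leq_b1.
have := surv_last _ ss; rewrite subr_gt0 => /(_ dw) h.
by case: (lerP (w + psum f s) d) => /= h'; rewrite ?add0r //; lra.
Qed.

End HittingPotential.

(** * Negligible exits in the middle part *)

Section Hitting.
Variables (R : realType) (X : finType) (P : X -> X -> R) (nu f : X -> R).
Hypothesis hg : good P nu f.
Let hP := good_stoch hg.
Local Notation Tn := (Tn P f).
Local Notation Kn := (Kn P f).
Local Notation survn := (survn P f).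

Lemma nat_ge (x : R) : exists2 p : nat, (1 < p)%N & x <= p%:R.
Proof.
exists (Num.bound `|x|).+2 => //; apply: le_trans (ler_norm x) _.
apply: le_trans (ltW (archi_boundP (normr_ge0 x))) _; rewrite ler_nat.
exact: (leqW (leqW (leqnn _))).
Qed.

Lemma sq_large (K : R) : exists N : nat, forall n, (N <= n)%N -> K <= sq R n.
Proof.
have [N _ HN] := nat_ge (K ^+ 2); exists N => n Nn.
apply: le_trans (ler_norm K) _; rewrite -sqrtr_sqr ler_sqrt //.
by apply: le_trans HN _; rewrite ler_nat; lia.
Qed.

(** The chain with $-f$ is included, with corrector $-r$, to control the mirror walk that starts at
    a negative height. *)
Lemma hit_bounds : exists2 C : R, 0 < C & forall j x w, 0 < w ->
  1 - survn j x w <= C * j.+1%:R / w ^+ 2 /\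
  1 - KilledWalk.survn P (fun x => - f x) j x w <= C * j.+1%:R / w ^+ 2.
Proof.
have [r [q [M [hr _ [M1 _ _] b]]]] := good_data hg.
have fr z : `|f z| + `|r z| <= M by case: (b z).
exists (16 * M ^+ 2); first by rewrite mulr_gt0 // exprn_gt0 // (lt_le_trans ltr01).
move=> j x w w0; split; first exact: (hit_potential hP hr M1 fr).
apply: (@hit_potential R X P _ (fun x => - r x)) => // z; last by rewrite !normrN.
by rewrite hr -sumrN; apply: eq_bigr => z' _; ring.
Qed.

(** At times [k] comparable to [n] few survivors lie below height $a\sqrt n$; from above, an exit
    within [j] steps has probability of order $j/(a^2n)$, small when [p] is large. [p] is chosen
    before [d], which only affects how large [n] must be. *)
Lemma Kn_hit_small (C e : R) : 0 < C -> 0 < e -> exists2 p : nat, (1 < p)%N &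
  forall d, 0 <= d -> exists N : nat, forall n, (N <= n)%N -> forall k j x y G, 0 < y ->
  (n.+1 <= 8 * k.+1)%N -> (j.+1 * p <= 2 * n.+1)%N ->
  (forall z u, 0 < u -> G z u <= 1) -> (forall z u, d < u -> G z u <= C * j.+1%:R / (u - d) ^+ 2) ->
  Kn k G x y <= e * (1 + y) / sq R n.
Proof.
move=> C0 e0; have [C1 C10 HC1] := Kn_bdry_bound hg; have [C2 C20 HC2] := survn_bound hg.
pose a := e / (32 * C1); have a0 : 0 < a by rewrite divr_gt0 // mulr_gt0.
have [p p1 Hp] := nat_ge (12 * C * C2 / (a ^+ 2 * e)).
exists p => // d d0.
have [N HN] := sq_large (32 * C1 * (d + 1) / e); exists N => n Nn k j x y G y0 nk jp G1 G2.
have sn := sq_gt0 R n; have sk := sq_gt0 R k; have ss := sq_sqr R n.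
have y1 : 0 < 1 + y by lra.
have a2 : 0 < a ^+ 2 by rewrite exprn_gt0.
pose B := C * j.+1%:R / (a ^+ 2 * n.+1%:R).
have B0 : 0 <= B by apply: divr_ge0; apply: mulr_ge0 => //; exact: ltW.
apply: (@le_trans _ _ (Kn k (fun _ u => (0 <= u <= d + a * sq R n)%R%:R + B) x y)).
  apply: ler_Kn => // z u u0; rewrite (ltW u0) /=; case: (lerP u (d + a * sq R n)) => ud.
    by apply: le_trans (G1 _ _ u0) _; rewrite lerDl.
  rewrite add0r; have asn : 0 < a * sq R n by rewrite mulr_gt0.
  have du : d < u by lra.
  apply: le_trans (G2 _ _ du) _; rewrite /B ler_wpM2l ?mulr_ge0 ?(ltW C0) //.
  have ud' : 0 < u - d by lra.
  rewrite lef_pV2 ?posrE ?(exprn_gt0 _ ud') ?(mulr_gt0 a2) //.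
  rewrite -ss -exprMn ler_sqr ?nnegrE //; lra.
rewrite Kn_add Kn_cst.
have asn : 0 <= a * sq R n by rewrite mulr_ge0 // ltW.
have dsn : 0 <= d + a * sq R n by lra.
have k8 : k.+1%:R^-1 <= 8 / n.+1%:R :> R.
  by rewrite ler_pdivlMr // mulrC ler_pdivrMr // -natrM ler_nat.
have sk3 : (sq R k)^-1 <= 3 / sq R n.
  rewrite ler_pdivlMr // mulrC ler_pdivrMr //.
  have kn : n.+1%:R <= 9 * k.+1%:R :> R.
    by rewrite -(natrM _ 9) ler_nat; move: nk; clear; lia.
  have n3 : 0 <= 3 * sq R k by rewrite mulr_ge0 // ltW.
  rewrite -ler_sqr ?nnegrE ?(ltW sn) // exprMn !sq_sqr; move: kn; lra.
have t1 : Kn k (fun _ u => (0 <= u <= d + a * sq R n)%R%:R) x y <= e / 2 * (1 + y) / sq R n.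
  apply: le_trans (HC1 k x y _ _ y0 dsn) _.
  apply: (@le_trans _ _ (C1 * (1 + y) * (d + a * sq R n - 0 + 1) * (8 / n.+1%:R))).
    by apply: ler_wpM2l => //; rewrite !mulr_ge0 ?(ltW C10) ?(ltW y1) //; lra.
  rewrite ler_pdivlMr // -ss.
  have -> : C1 * (1 + y) * (d + a * sq R n - 0 + 1) * (8 / sq R n ^+ 2) * sq R n =
     (1 + y) * (8 * C1 * (d + 1) / sq R n + 8 * C1 * a) by field; rewrite gt_eqF.
  rewrite mulrC ler_wpM2r ?(ltW y1) //.
  have -> : 8 * C1 * a = e / 4 by rewrite /a; field; rewrite gt_eqF.
  have : 8 * C1 * (d + 1) / sq R n <= e / 4.
    rewrite ler_pdivrMr //; have := HN n Nn; rewrite ler_pdivrMr //; lra.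
  lra.
have t2 : B * survn k x y <= e / 2 * (1 + y) / sq R n.
  apply: le_trans (ler_wpM2l B0 (HC2 k x y y0)) _.
  apply: (@le_trans _ _ (B * (C2 * (1 + y) * (3 / sq R n)))).
    apply: ler_wpM2l => //; apply: ler_wpM2l => //; by rewrite mulr_ge0 // ltW.
  rewrite [leLHS](_ : _ = 3 * B * C2 * ((1 + y) / sq R n)); last by ring.
  rewrite -[leRHS]mulrA ler_wpM2r ?divr_ge0 ?(ltW y1) ?(ltW sn) //.
  have jn : j.+1%:R * p%:R <= 2 * n.+1%:R :> R by rewrite -!natrM ler_nat.
  have p0 : 0 < p%:R :> R by rewrite ltr0n ltnW.
  have : j.+1%:R / n.+1%:R <= 2 / p%:R :> R.
    by rewrite ler_pdivrMr // mulrAC ler_pdivlMr.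
  have -> : 3 * B * C2 = 3 * C * C2 / a ^+ 2 * (j.+1%:R / n.+1%:R).
    by rewrite /B; field; rewrite (gt_eqF a0) /= addrC natr1 pnatr_eq0.
  have q0 : 0 <= 3 * C * C2 / a ^+ 2.
    by apply: divr_ge0; [rewrite !mulr_ge0 // ltW|exact: ltW].
  move=> /(ler_wpM2l q0) h; apply: le_trans h _.
  move: Hp; rewrite ler_pdivrMr ?(mulr_gt0 a2) // => Hp.
  rewrite [leLHS](_ : _ = 6 * C * C2 / (a ^+ 2 * p%:R)); last first.
    by field; rewrite (gt_eqF a0) (gt_eqF p0).
  by rewrite ler_pdivrMr ?(mulr_gt0 a2 p0) //; lra.
apply: le_trans (lerD t1 t2) _; rewrite -!mulrDl.
by rewrite ler_wpM2r ?invr_ge0 ?(ltW sn) // ler_wpM2r ?(ltW y1) //; lra.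
Qed.

End Hitting.

(** * Central limit estimate with the final state *)

Section CentralLimit.
Variables (R : realType) (X : finType) (P : X -> X -> R) (nu f : X -> R).
Hypothesis hg : good P nu f.
Let hP := good_stoch hg.
Let hnu := good_inv hg.
Let h1 := good_H1 hg.
Local Notation Tn := (Tn P f).
Local Notation s2 := (sigma2 P nu f).

Lemma lam_itv t : 0 <= lam s2 t <= 1.
Proof.
have [_ _ _ _ s0] := hg; rewrite expR_ge0 /lam -[leRHS]expR0 ler_expR oppr_le0.
by apply: mulr_ge0; [rewrite divr_ge0 // ltW|rewrite sqr_ge0].
Qed.

Lemma TnB n G H x y : Tn n (fun x y => G x y - H x y) x y = Tn n G x y - Tn n H x y.
Proof. by rewrite -mulN1r -TnZ -Tn_add; apply: eq_Tn => z u; rewrite mulN1r. Qed.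

Lemma Tn_shift n G x u c : Tn n (fun z v => G z (v + c)) x u = Tn n G x (u + c).
Proof. by apply: eq_Ex => s _; rewrite addrAC. Qed.

(** The phase is removed by translating the start by [phi / t]. Without killing no survival factor
    damps the one-step errors, which add up to $mt^3$. *)
Lemma Tn_sin_est : exists2 B : R, 0 < B & forall m t x u phi, 0 < t <= 1 ->
  `|Tn m (fun _ v => sin (t * v + phi)) x u - lam s2 t ^+ m * sin (t * u + phi)| <=
  B * (m%:R * t ^+ 3 + t).
Proof.
have [r [q [M [hr hq [M1 s20 s2M] b]]]] := good_data hg.
have fM z : `|f z| <= M by case: (b z).
have rM z : `|r z| <= M by case: (b z).
have qM z : `|q z| <= M by case: (b z).
have M0 : 0 < M by lra.
have M5 : 0 < M ^+ 5 by rewrite exprn_gt0.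
exists (16 * M ^+ 5 + 4 * M); first by rewrite addr_gt0 // mulr_gt0.
suff H m t x u : 0 < t <= 1 ->
  `|Tn m (fun _ v => sin (t * v)) x u - lam s2 t ^+ m * sin (t * u)| <=
  (16 * M ^+ 5 + 4 * M) * (m%:R * t ^+ 3 + t).
  move=> m t x u phi t01; have t0 : t != 0 by case/andP: t01 => t0 _; rewrite gt_eqF.
  have E v : t * v + phi = t * (v + phi / t) by field.
  rewrite (@eq_Tn _ _ P f m _ (fun _ v => sin (t * (v + phi / t)))); last by move=> z v; rewrite E.
  by rewrite (Tn_shift m (fun _ v => sin (t * v))) E; apply: H.
move=> t01; have /andP[t0 t1] := t01; have /andP[L0 L1] := lam_itv t.
have t3 : 0 < t ^+ 3 by rewrite exprn_gt0.
have TG : `|Tn m (Gt r q t) x u - lam s2 t ^+ m * Gt r q t x u| <= m%:R * (16 * (t ^+ 3 * M ^+ 5)).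
  elim: m => [|m IH]; first by rewrite Tn0 mul1r subrr normr0 mul0r.
  rewrite -addn1 TnD addn1 exprS.
  have -> : Tn m (Tn 1 (Gt r q t)) x u - lam s2 t * lam s2 t ^+ m * Gt r q t x u =
     Tn m (fun z v => Tn 1 (Gt r q t) z v - lam s2 t * Gt r q t z v) x u +
     lam s2 t * (Tn m (Gt r q t) x u - lam s2 t ^+ m * Gt r q t x u).
    by rewrite TnB TnZ; ring.
  rewrite -natr1 mulrDl addrC; apply: normD.
    rewrite -[leRHS]mul1r; apply: normM => //; by rewrite ger0_norm.
  by rewrite mul1r; apply: Tn_bound => // z v; apply: Gt_eigen.
have D z v : `|sin (t * v) - Gt r q t z v| <= 2 * M * t.
  rewrite /Gt (_ : _ - _ = t * (t * (q z * sin (t * v)) - r z * cos (t * v))); last by ring.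
  rewrite mulrC; apply: normM; last by rewrite ger0_norm // ltW.
  rewrite (_ : 2 * M = 1 * (M * 1) + M * 1); last by ring.
  apply: normD; last by rewrite normrN; apply: normM => //; exact: cos_max.
  apply: normM; first by rewrite ger0_norm // ltW.
  by apply: normM => //; exact: sin_max.
have -> : Tn m (fun _ v => sin (t * v)) x u - lam s2 t ^+ m * sin (t * u) =
  Tn m (fun z v => sin (t * v) - Gt r q t z v) x u +
  (Tn m (Gt r q t) x u - lam s2 t ^+ m * Gt r q t x u) -
  lam s2 t ^+ m * (sin (t * u) - Gt r q t x u) by rewrite TnB; ring.
have a1 : `|Tn m (fun z v => sin (t * v) - Gt r q t z v) x u| <= 2 * M * t by apply: Tn_bound.
have a2 : `|lam s2 t ^+ m * (sin (t * u) - Gt r q t x u)| <= 1 * (2 * M * t).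
  by apply: normM => //; rewrite ger0_norm ?exprn_ge0 // exprn_ile1.
apply: le_trans (ler_normB _ _) _; apply: le_trans (lerD (ler_normD _ _) (lexx _)) _.
have m0 : 0 <= m%:R :> R by [].
have p1 : 0 <= M * (m%:R * t ^+ 3) by rewrite !mulr_ge0 // ltW.
have p2 : 0 <= M ^+ 5 * t by rewrite mulr_ge0 // ltW.
move: a1 a2 TG p1 p2; lra.
Qed.

(** The last [l] steps, [l] fixed, make the final state nearly [nu]-distributed whatever came
    before, and alter the phase by $O(t)$ only. *)
Lemma Tn_sin_mix (e : R) : 0 < e -> exists (l : nat) (B : R), 0 < B /\ forall m t x x' phi, 0 < t <= 1 ->
  `|Tn (m + l) (fun z v => (z == x')%:R * sin (t * v + phi)) x 0 - nu x' * lam s2 t ^+ m * sin phi| <=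
  e + B * (m%:R * t ^+ 3 + t).
Proof.
move=> e0; have [B B0 HB] := Tn_sin_est.
have [M M0 HM] := fin_upper f.
have [l Hl] : exists l, forall z x', `|Pk P l (fun w => (w == x')%:R) z - nu x'| <= e.
  have /choice [N HN] : forall x', exists N, forall n x, (N <= n)%N ->
      `|Pk P n (fun w => (w == x')%:R) x - nu x'| <= e.
    move=> x'; have [N HN] := mix hP hnu h1 (fun w => (w == x')%:R) e0.
    exists N => n x Nn; have := HN n x Nn; rewrite (bigD1 x') //= eqxx mulr1 big1 ?addr0 // => i /negPf ->.
    by rewrite mulr0.
  exists (\max_x' N x') => z x'; apply: HN; exact: leq_bigmax.
exists l, (B + l%:R * M); split; first by rewrite ltr_wpDr // mulr_ge0 // ltW.
move=> m t x x' phi t01; have /andP[t0 t1] := t01.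
have inner z u : `|Tn l (fun z v => (z == x')%:R * sin (t * v + phi)) z u - nu x' * sin (t * u + phi)| <=
    e + l%:R * M * t.
  have -> : Tn l (fun z v => (z == x')%:R * sin (t * v + phi)) z u - nu x' * sin (t * u + phi) =
    (Pk P l (fun w => (w == x')%:R) z - nu x') * sin (t * u + phi) +
    Ex P z l (fun s => (last z s == x')%:R * (sin (t * (u + psum f s) + phi) - sin (t * u + phi))).
    rewrite /Pk mulrBl [X in _ = X - _ + _]mulrC -ExZ addrAC -Ex_add; congr (_ - _).
    by apply: eq_Ex => s _; ring.
  apply: normD.
    by rewrite -[e]mulr1; apply: normM => //; exact: sin_max.
  apply: le_trans (ler_norm_Ex hP _ _ _) _; rewrite -[leRHS](Ex_cst hP z l).
  apply: ler_Ex => // s sl; rewrite -[leRHS]mul1r; apply: normM.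
    by rewrite ger0_norm // lern1 leq_b1.
  apply: le_trans (normr_sinB_le _ _) _.
  rewrite (_ : _ - _ = psum f s * t); last by ring.
  apply: normM; last by rewrite ger0_norm // ltW.
  rewrite -sl; elim: (s) => [|c s' IH]; first by rewrite psum_nil normr0 mul0r.
  by rewrite psum_cons /= -natr1 mulrDl mul1r addrC; apply: normD.
rewrite TnD.
have -> : Tn m (Tn l (fun z v => (z == x')%:R * sin (t * v + phi))) x 0 - nu x' * lam s2 t ^+ m * sin phi =
  Tn m (fun z u => Tn l (fun z v => (z == x')%:R * sin (t * v + phi)) z u - nu x' * sin (t * u + phi)) x 0 +
  nu x' * (Tn m (fun _ v => sin (t * v + phi)) x 0 - lam s2 t ^+ m * sin (t * 0 + phi)).
  by rewrite TnB TnZ mulr0 add0r; ring.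
have a1 : `|Tn m (fun z u => Tn l (fun z v => (z == x')%:R * sin (t * v + phi)) z u -
   nu x' * sin (t * u + phi)) x 0| <= e + l%:R * M * t by apply: Tn_bound.
have a2 : `|nu x' * (Tn m (fun _ v => sin (t * v + phi)) x 0 - lam s2 t ^+ m * sin (t * 0 + phi))| <=
   1 * (B * (m%:R * t ^+ 3 + t)).
  apply: normM; last exact: HB.
  by rewrite ger0_norm ?(nu_le1 hnu) //; exact: hnu.1.
apply: le_trans (ler_normD _ _) _.
have p : 0 <= l%:R * M * (m%:R * t ^+ 3) by rewrite !mulr_ge0 ?exprn_ge0 // ltW.
by move: a1 a2 p; lra.
Qed.

Lemma Tn_sin_limit (t : nat -> R) (j : nat -> nat) (theta e : R) :
  (forall n, 0 < t n) -> t n @[n --> \oo] --> (0 : R) -> j n @[n --> \oo] --> \oo ->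
  (j n)%:R * t n ^+ 2 @[n --> \oo] --> theta -> 0 < e ->
  \forall n \near \oo, forall x x' phi,
    `|Tn (j n) (fun z v => (z == x')%:R * sin (t n * v + phi)) x 0 -
      nu x' * expR (- (s2 / 2 * theta)) * sin phi| <= e.
Proof.
move=> t0 ct joo jt e0.
have [|l [B [B0 HB]]] := @Tn_sin_mix (e / 3); first by rewrite divr_gt0.
have n1 : \forall n \near \oo, (l <= j n)%N := joo _ (nbhs_infty_ge l).
have c1 : lam s2 (t n) ^+ (j n - l) @[n --> \oo] --> expR (- (s2 / 2 * theta)).
  have c2 : (j n - l)%:R * t n ^+ 2 @[n --> \oo] --> theta.
    have c3 : (j n)%:R * t n ^+ 2 - l%:R * t n ^+ 2 @[n --> \oo] --> theta - l%:R * 0 ^+ 2.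
      apply: cvgB => //; apply: cvgM; first exact: cvg_cst.
      by rewrite expr2 (_ : (fun n => _) = fun n => t n * t n); [exact: cvgM|apply: funext => n; rewrite expr2].
    rewrite expr2 !mulr0 subr0 in c3; apply: cvg_trans c3; apply: near_eq_cvg.
    apply: filterS n1 => n /= ln.
    by rewrite natrB // mulrBl.
  rewrite (_ : (fun n => _) = fun n => expR (- (s2 / 2 * ((j n - l)%:R * t n ^+ 2)))); last first.
    by apply: funext => n; rewrite /lam -expRM_natl; congr expR; ring.
  apply: (@cvg_comp _ _ _ (fun n => - (s2 / 2 * ((j n - l)%:R * t n ^+ 2))) expR); last first.
    exact: continuous_expR.
  by apply: cvgN; apply: cvgM => //; exact: cvg_cst.
have c4 : B * (((j n)%:R * t n ^+ 2 + 1) * t n) @[n --> \oo] --> (0 : R).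
  rewrite -(mulr0 B); apply: cvgM; first exact: cvg_cst.
  rewrite -(mulr0 (theta + 1)); apply: cvgM => //; apply: cvgD => //; exact: cvg_cst.
have e3 : 0 < e / 3 by rewrite divr_gt0.
have n2 : \forall n \near \oo, t n <= 1.
  move/cvgrPdist_le: ct => /(_ 1 ltr01); apply: filterS => n; rewrite sub0r normrN ger0_norm //.
  exact: ltW.
move/cvgrPdist_le: c1 => /(_ _ e3) n3; move/cvgrPdist_le: c4 => /(_ _ e3) n4.
near=> n; move=> x x' phi.
have tn1 : t n <= 1 by near: n.
have ln : (l <= j n)%N by near: n.
have a1 : `|expR (- (s2 / 2 * theta)) - lam s2 (t n) ^+ (j n - l)| <= e / 3 by near: n.
have a2 : `|0 - B * (((j n)%:R * t n ^+ 2 + 1) * t n)| <= e / 3 by near: n.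
have tn := t0 n.
have := HB (j n - l)%N (t n) x x' phi; rewrite subnK // tn tn1 => /(_ erefl) a3.
have a4 : B * ((j n - l)%:R * t n ^+ 3 + t n) <= e / 3.
  move: a2; rewrite sub0r normrN => /(le_trans (ler_norm _)); apply: le_trans.
  apply: ler_wpM2l; first exact: ltW.
  rewrite (_ : (_ + 1) * _ = (j n)%:R * t n ^+ 3 + t n); last by ring.
  rewrite lerD2r ler_wpM2r ?exprn_ge0 ?(ltW tn) // ler_nat; exact: leq_subr.
rewrite (_ : _ - _ = (Tn (j n) (fun z v => (z == x')%:R * sin (t n * v + phi)) x 0 - nu x' * lam s2 (t n) ^+ (j n - l) * sin phi) - nu x' * (expR (- (s2 / 2 * theta)) - lam s2 (t n) ^+ (j n - l)) * sin phi); last by ring.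
have a5 : `|nu x' * (expR (- (s2 / 2 * theta)) - lam s2 (t n) ^+ (j n - l)) * sin phi| <= 1 * (e / 3) * 1.
  apply: normM; last exact: sin_max.
  by apply: normM => //; rewrite ger0_norm ?(nu_le1 hnu) //; exact: hnu.1.
apply: le_trans (ler_normB _ _) _; move: a3 a4 a5; lra.
Unshelve. all: by end_near. Qed.

End CentralLimit.

(** * Fejer smoothing as an integral over frequencies *)

Section Smoothing.
Variable R : realType.
Local Notation seg01 t := ((0 <= t <= 1)%R%:R : R).
Implicit Types q g : R -> R.

(** The displacement [c] puts most of the kernel on one side of [u]; for monotone [q] smoothing is
    then a one-sided bound up to the kernel's tail. *)
Definition smooth (A c : R) q (u : R) : R := RI (fun v => q v * (A * fej (A * (v - c - u)))).
Definition trs g (c : R) q (tau : R) : R := RI (fun v => q v * g (tau * (v - c))).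

Lemma intgM q g B : intg q -> measurable_fun setT g -> (forall v, `|g v| <= B) ->
  intg (fun v => q v * g v).
Proof.
move=> iq mg gB; apply: (@intg_le _ _ (fun v => B * `|q v|)).
- by apply: mfM => //; exact: intg_measurable.
- by move=> v; rewrite normrM mulrC ler_wpM2r.
- exact/intgZ/intg_norm.
Qed.

Lemma fej_le2 (u : R) : `|fej u| <= 2.
Proof.
rewrite ger0_norm ?fej_ge0 //; apply: le_trans (fej_le u) _.
by rewrite ler_pdivrMr; have := sqr_ge0 u; lra.
Qed.

Lemma measurable_lip g (a b : R) : (forall u v, `|g u - g v| <= `|u - v|) ->
  measurable_fun setT (fun v : R => g (a * (v - b))).
Proof.
move=> lg; apply: (@lipschitz_measurable _ _ `|a|) => u v; apply: le_trans (lg _ _) _.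
by rewrite -normrM (_ : a * (u - b) - a * (v - b) = a * (u - v)) //; ring.
Qed.

Lemma intg_trs g c q tau : intg q -> (forall u v, `|g u - g v| <= `|u - v|) ->
  (forall u, `|g u| <= 1) -> intg (fun v => q v * g (tau * (v - c))).
Proof. by move=> iq lg bg; apply: (intgM (B := 1)) => //; exact: measurable_lip. Qed.

Lemma trs_bound g c q tau : intg q -> (forall u v, `|g u - g v| <= `|u - v|) ->
  (forall u, `|g u| <= 1) -> `|trs g c q tau| <= RI (fun v => `|q v|).
Proof.
move=> iq lg bg; apply: RI_norm; [exact: intg_trs|exact: intg_norm|move=> v].
by rewrite normrM ler_piMr.
Qed.

Lemma trs_measurable g c q : intg q -> intg (fun v => q v * (v - c)) ->
  (forall u v, `|g u - g v| <= `|u - v|) -> (forall u, `|g u| <= 1) ->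
  measurable_fun setT (trs g c q).
Proof.
move=> iq iqv lg bg.
apply: (@lipschitz_measurable _ _ (RI (fun v => `|q v * (v - c)|))) => t t'.
rewrite -RIB; try exact: intg_trs.
rewrite mulrC -RIZ; last exact: intg_norm.
apply: RI_norm; [by apply: intgB; exact: intg_trs|exact/intgZ/intg_norm|move=> v].
rewrite -mulrBr !normrM mulrCA; apply: ler_wpM2l => //.
by apply: le_trans (lg _ _) _; rewrite -mulrBl normrM.
Qed.

Lemma intg_trs_phase (A c u : R) q : intg q -> intg (fun v => q v * (v - c)) ->
  intg (fun t => seg01 t * ((1 - t) *
    (trs cos c q (t * A) * cos (t * A * u) + trs sin c q (t * A) * sin (t * A * u)))).
Proof.
move=> iq iqv; set B := RI (fun v => `|q v|).
have mt g : (forall u v, `|g u - g v| <= `|u - v|) -> (forall u, `|g u| <= 1) ->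
    measurable_fun setT (fun t : R => trs g c q (t * A) * g (t * A * u)).
  move=> lg bg; apply: mfM.
    rewrite (_ : (fun t => _) = fun t => trs g c q (A * t + 0)); last first.
      by apply: funext => t; congr trs; ring.
    by apply: mf_affine; exact: trs_measurable.
  rewrite (_ : (fun t => _) = fun t => g (A * u * (t - 0))); last first.
    by apply: funext => t; congr g; ring.
  exact: measurable_lip.
apply: (@intg_bounded _ _ _ (1 * (B * 1 + B * 1))).
  apply: mfM; first by apply: measurable_funB.
  by apply: mfD; apply: mt; [exact: normr_cosB_le|exact: cos_max|exact: normr_sinB_le|exact: sin_max].
move=> t /andP[t0 t1]; apply: normM; first by rewrite ler_norml; lra.
apply: normD; apply: normM; rewrite ?cos_max ?sin_max //.
  by apply: trs_bound => //; [exact: normr_cosB_le|exact: cos_max].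
by apply: trs_bound => //; [exact: normr_sinB_le|exact: sin_max].
Qed.

(** The kernel is written through its triangle transform; the addition formula separates [u] from
    the integration variable. *)
Lemma smoothE (A c u : R) q : 0 < A -> intg q -> intg (fun v => q v * (v - c)) ->
  smooth A c q u =
  A / pi * RI (fun t => seg01 t * ((1 - t) *
    (trs cos c q (t * A) * cos (t * A * u) + trs sin c q (t * A) * sin (t * A * u)))).
Proof.
move=> A0 iq iqv; have p0 := @pi_gt0 R.
have V0 : 0 < A^-1 by rewrite invr_gt0.
pose a w := q (A^-1 * w + (c + u)).
have ia : intg a by exact: intg_affine.
pose b (t : R) := seg01 t * (1 - t).
have ib : intg b.
  rewrite /b; have := @intg_seg01_1t R (fun=> 1) (measurable_cst _).
  move=> H; rewrite (_ : (fun t => _) = fun t => seg01 t * ((1 - t) * 1)); last first.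
    by apply: funext => t; rewrite mulr1.
  by apply: H => t; rewrite normr1.
have e1 : smooth A c q u = RI (fun w => a w * fej w).
  pose h v := q v * (A * fej (A * (v - c - u))).
  have ih : intg h.
    apply: (intgM (B := A * 2)) => //.
      apply: mfM => //; rewrite (_ : (fun v => _) = fun v => fej (A * v + - (A * (c + u)))); last first.
        by apply: funext => v; congr fej; ring.
      by apply: mf_affine; exact: fej_measurable.
    by move=> v; apply: normM; [rewrite ger0_norm // ltW|exact: fej_le2].
  have := @RI_affine _ A^-1 (c + u) h V0 ih; rewrite invrK => E.
  rewrite /smooth -/h; apply: (mulIf (x := A)); first by rewrite gt_eqF.
  rewrite -E mulrC -RIZ; last by apply: (intgM (B := 2)) => //; [exact: fej_measurable|exact: fej_le2].
  congr RI; apply: funext => w; rewrite /h /a; set z := _ + (c + u).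
  have -> : A * (z - c - u) = w by rewrite /z; field; rewrite gt_eqF.
  ring.
have e2 : RI (fun w => a w * fej w) = pi^-1 * RI (fun t => b t * RI (fun w => a w * cos (w * t))).
  have fb w : RI (fun t => b t * cos (t * w)) = pi * fej w.
    rewrite fejE mulrA mulfV ?gt_eqF // mul1r; congr RI.
    by apply: funext => t; rewrite /b mulrA.
  rewrite -RI_swap_cos // (_ : (fun w => a w * RI _) = fun w => pi * (a w * fej w)); last first.
    by apply: funext => w; rewrite fb mulrCA.
  rewrite RIZ ?mulrA ?mulVf ?gt_eqF ?mul1r //.
  exact: (intgM (B := 2) ia (@fej_measurable R) fej_le2).
rewrite e1 e2 [A / pi]mulrC -mulrA; congr (_ * _).
have i3 (t : R) : intg (fun v => q v * cos (t * A * (v - (c + u)))).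
  exact: (intg_trs _ _ iq (@normr_cosB_le R) (@cos_max R)).
have E3 t : RI (fun w => a w * cos (w * t)) = A *
  (trs cos c q (t * A) * cos (t * A * u) + trs sin c q (t * A) * sin (t * A * u)).
  transitivity (A * RI (fun v => q v * cos (t * A * (v - (c + u))))).
    have := @RI_affine _ A^-1 (c + u) _ V0 (i3 t); rewrite invrK [in RHS]mulrC => <-.
    congr RI; apply: funext => w; rewrite /a; congr (_ * cos _); field; by rewrite gt_eqF.
  congr (_ * _); rewrite [X in _ = X + _]mulrC [X in _ = _ + X]mulrC /trs.
  rewrite -RIZ; last exact: (intg_trs _ _ iq (@normr_cosB_le R) (@cos_max R)).
  rewrite -RIZ; last exact: (intg_trs _ _ iq (@normr_sinB_le R) (@sin_max R)).
  rewrite -RID; first last.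
  - exact: intgZ (intg_trs _ _ iq (@normr_sinB_le R) (@sin_max R)).
  - exact: intgZ (intg_trs _ _ iq (@normr_cosB_le R) (@cos_max R)).
  congr RI; apply: funext => v.
  rewrite (_ : t * A * (v - (c + u)) = t * A * (v - c) - t * A * u); last by ring.
  rewrite cosB; ring.
transitivity (RI (fun t => A * (seg01 t * ((1 - t) *
    (trs cos c q (t * A) * cos (t * A * u) + trs sin c q (t * A) * sin (t * A * u)))))).
  congr RI; apply: funext => t; rewrite E3 /b; ring.
by rewrite RIZ //; exact: intg_trs_phase.
Qed.

End Smoothing.

(** * Reflection and odd waves *)

Section OddTransform.
Variables (R : realType) (X : finType) (P : X -> X -> R) (f : X -> R).
Local Notation Tn := (Tn P f).
Local Notation Kn := (Kn P f).

Lemma Tn_RI j (G : R -> X -> R -> R) x w : (forall z u, intg (fun t => G t z u)) ->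
  intg (fun t => Tn j (G t) x w) /\
  Tn j (fun z u => RI (fun t => G t z u)) x w = RI (fun t => Tn j (G t) x w).
Proof.
move=> iG; split; first by apply: intg_sum => s _; exact: intgZ.
rewrite /KilledWalk.Tn /Ex RI_sum; last by move=> s _; exact: intgZ.
by apply: eq_bigr => s _; rewrite RIZ.
Qed.

Lemma Kn_RI j (G : R -> X -> R -> R) x w : (forall z u, intg (fun t => G t z u)) ->
  intg (fun t => Kn j (G t) x w) /\
  Kn j (fun z u => RI (fun t => G t z u)) x w = RI (fun t => Kn j (G t) x w).
Proof.
move=> iG; split; first by apply: intg_sum => s _; do 2 apply: intgZ.
rewrite /KilledWalk.Kn /Ex RI_sum; last by move=> s _; do 2 apply: intgZ.
by apply: eq_bigr => s _; rewrite RIZ ?RIZ //; exact: intgZ.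
Qed.

(** [k] killed steps followed by [j] steps in which killing is imitated by subtracting the mirror
    start. *)
Definition Lam k j G x y := Kn k (fun x1 w => Tn j G x1 w - Tn j G x1 (- w)) x y.

Lemma Lam_RI k j (G : R -> X -> R -> R) x y : (forall z u, intg (fun t => G t z u)) ->
  intg (fun t => Lam k j (G t) x y) /\
  Lam k j (fun z u => RI (fun t => G t z u)) x y = RI (fun t => Lam k j (G t) x y).
Proof.
move=> iG.
have i1 z u : intg (fun t => Tn j (G t) z u) by case: (Tn_RI j z u iG).
have i2 z u : intg (fun t => Tn j (G t) z u - Tn j (G t) z (- u)) by exact: intgB.
have [i3 e3] := Kn_RI k x y i2; split; first exact: i3.
rewrite /Lam -e3; apply: eq_Knw => z u; rewrite RIB //.
by rewrite (Tn_RI j z u iG).2 (Tn_RI j z (- u) iG).2.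
Qed.

Lemma LamZ k j a G x y : Lam k j (fun z u => a * G z u) x y = a * Lam k j G x y.
Proof. by rewrite /Lam -KnZ; apply: eq_Knw => z u; rewrite !TnZ mulrBr. Qed.

Definition phs j tau phi x' x1 := Tn j (fun z v => (z == x')%:R * sin (tau * v + phi)) x1 0.
Definition kphs k j tau phi x' x y :=
  Kn k (fun x1 w => sin (tau * w) * phs j tau phi x' x1) x y.

(** Reflection cancels what is even in [w]: the only dependence left is $\sin(\tau w)$, times the
    mean sine or cosine of the middle sum. The phase $\pi/2$ yields the cosine. *)
Lemma Lam_phase k j (C S : X -> R) tau x y :
  Lam k j (fun z u => C z * cos (tau * u) + S z * sin (tau * u)) x y =
  2 * \sum_x' (S x' * kphs k j tau (pi / 2) x' x y - C x' * kphs k j tau 0 x' x y).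
Proof.
transitivity (Kn k (fun x1 w => \sum_x' ((2 * S x') * (sin (tau * w) * phs j tau (pi / 2) x' x1) +
    (- (2 * C x')) * (sin (tau * w) * phs j tau 0 x' x1))) x y); last first.
  rewrite Kn_sum mulr_sumr; apply: eq_bigr => x' _; rewrite KnDZ KnZ /kphs; ring.
apply: eq_Knw => x1 w.
transitivity (Ex P x1 j (fun s => 2 * sin (tau * w) *
    (S (last x1 s) * cos (tau * psum f s) - C (last x1 s) * sin (tau * psum f s)))).
  rewrite /KilledWalk.Tn -[X in _ - X]mul1r -mulNr -ExZ -Ex_add; apply: eq_Ex => s _.
  rewrite !mulrDr !sinD !cosD mulrN sinN cosN; ring.
transitivity (Ex P x1 j (fun s => \sum_x' (2 * S x' * sin (tau * w) * ((last x1 s == x')%:R *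
   sin (tau * (0 + psum f s) + pi / 2)) +
   - (2 * C x') * sin (tau * w) * ((last x1 s == x')%:R * sin (tau * (0 + psum f s) + 0))))); last first.
  rewrite Ex_sum; apply: eq_bigr => x' _.
  by rewrite Ex_add !ExZ -!mulrA.
apply: eq_Ex => s _; rewrite (bigD1 (last x1 s)) //= eqxx big1 ?addr0; last first.
  by move=> z /negPf; rewrite eq_sym => ->; rewrite !mul0r !mulr0 addr0.
rewrite !add0r sinDpihalf !mul1r; ring.
Qed.

End OddTransform.

Lemma cvg_bounded_mul0 (R : realType) (u v : nat -> R) B : (forall n, `|u n| <= B) ->
  v n @[n --> \oo] --> (0 : R) -> u n * v n @[n --> \oo] --> (0 : R).
Proof.
move=> uB v0; have B0 : 0 <= B by apply: le_trans (uB 0%N).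
have c : B * `|v n| @[n --> \oo] --> (0 : R).
  by rewrite -(mulr0 B) -(@normr0 _ R); apply: cvgM; [exact: cvg_cst|exact: cvg_norm].
apply: (@squeeze_cvgr _ _ _ _ (fun n => - (B * `|v n|)) (fun n => B * `|v n|)) => //.
  by apply: nearW => n; rewrite -ler_norml normrM ler_wpM2r.
by rewrite -oppr0; apply: cvgN.
Qed.

(** * Limit of the reflected, smoothed kernel *)

Section OddLimit.
Variables (R : realType) (X : finType) (P : X -> X -> R) (nu f : X -> R).
Hypothesis hg : good P nu f.
Let hP := good_stoch hg.
Let hnu := good_inv hg.
Let h1 := good_H1 hg.
Local Notation Tn := (Tn P f).
Local Notation Kn := (Kn P f).
Local Notation s2 := (sigma2 P nu f).
Local Notation Ps := (Pdual P nu).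
Local Notation fs := (fun x => - f x).
Local Notation Kns := (KilledWalk.Kn Ps fs).
Local Notation seg01 t := ((0 <= t <= 1)%R%:R : R).
Local Notation half u := ((0 <= u)%R%:R : R).
Local Notation N n := (sq R n).

Lemma Kn_sinM_bound : exists2 E : R, 0 < E & forall k t d (D : X -> R) x y, 0 < y -> 0 <= t ->
  (forall x1, `|D x1| <= d) -> `|Kn k (fun x1 w => sin (t * w) * D x1) x y| <= t * d * (E * (1 + y)).
Proof.
have [E E0 HE] := Kn_id_bound hg; exists E => // k t d D x y y0 t0 Dd.
have d0 : 0 <= d by apply: le_trans (Dd x).
apply: le_trans (ler_norm_Kn _ hP _ _ _ _) _.
apply: (@le_trans _ _ (Kn k (fun _ w => t * d * w) x y)).
  apply: ler_Kn => // z w w0; rewrite mulrAC; apply: normM => //.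
  by apply: le_trans (normr_sin_le _) _; rewrite ger0_norm // mulr_ge0 // ltW.
by rewrite KnZ ler_wpM2l // ?mulr_ge0 // HE.
Qed.

(** Mass that the limit measure gives to [step_at a b]; the explicit subtraction of [f x] is the
    first reversed step of [duality]. *)
Definition mlim (a : X -> R) (b : R) : R := RI (fun z => \sum_x nu x * ((0 < z)%R%:R *
  (step_at a b x z * ((0 < z - f x)%R%:R * Vh Ps fs x (z - f x))))).

(** Lengths of the first, middle and last parts with their limiting fractions. [jp] and [k8] keep
    the middle and last lengths comparable to [n] for every [n], as domination requires. *)
Variables (k j k' : nat -> nat) (r1 r2 r3 : R) (p : nat).
Hypotheses (koo : k n @[n --> \oo] --> \oo) (joo : j n @[n --> \oo] --> \oo)
  (koo' : k' n @[n --> \oo] --> \oo)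
  (kr : (k n)%:R / n.+1%:R @[n --> \oo] --> r1) (jr : (j n)%:R / n.+1%:R @[n --> \oo] --> r2)
  (kr' : (k' n)%:R / n.+1%:R @[n --> \oo] --> r3) (r123 : r1 + r2 + r3 = 1)
  (jp : forall n, (n.+1 <= p * (j n).+1)%N) (k8 : forall n, (n.+1 <= 8 * (k' n).+1)%N).
Variables (a : X -> R) (b : R).
Hypotheses (ha : weight a) (b0 : 0 <= b).
Variables (A c : R) (x : X) (y : R).
Hypotheses (A0 : 0 < A) (y0 : 0 < y).
Local Notation Q n := (Qf P f (k' n).+1 a b).

Lemma ratio_time (u : nat -> nat) (rho s : R) : (u n)%:R / n.+1%:R @[n --> \oo] --> rho ->
  (u n)%:R * (s / N n) ^+ 2 @[n --> \oo] --> rho * s ^+ 2.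
Proof.
move=> ur; rewrite (_ : (fun n => _) = fun n => (u n)%:R / n.+1%:R * s ^+ 2).
  by apply: cvgM => //; exact: cvg_cst.
by apply: funext => n; rewrite expr_div_n sq_sqr mulrCA mulrC mulrA.
Qed.

Lemma time_cvg0 s : s / N n @[n --> \oo] --> (0 : R).
Proof. by rewrite -(mulr0 s); apply: cvgM; [exact: cvg_cst|exact: sqrtn_cvg]. Qed.

(** The middle factor tends to a constant uniformly in its starting state, so it can be taken out of
    the killed kernel at a cost bounded by [Kn_sinM_bound]. *)
Lemma kphs_limit s x' phi : 0 < s ->
  N n * kphs P f (k n) (j n) (s / N n) phi x' x y @[n --> \oo] -->
  s * (nu x' * sin phi) * (expR (- (s2 / 2 * ((r1 + r2) * s ^+ 2))) * Vh P f x y).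
Proof.
move=> s0; have [E E0 HE] := Kn_sinM_bound.
pose t n := s / N n; have tn n : 0 < t n by rewrite divr_gt0 // sq_gt0.
pose L := nu x' * expR (- (s2 / 2 * (r2 * s ^+ 2))) * sin phi.
have Nt n : N n * t n = s by rewrite /t mulrC divfK // gt_eqF // sq_gt0.
rewrite (_ : (fun n => _) = fun n => N n * Kn (k n) (fun x1 w => sin (t n * w) *
    (phs P f (j n) (t n) phi x' x1 - L)) x y +
    L * (s * (Kn (k n) (fun _ w => sin (t n * w)) x y / t n))); last first.
  apply: funext => n; rewrite -[in RHS](Nt n) -/(t n).
  rewrite (_ : L * _ = N n * (L * Kn (k n) (fun _ w => sin (t n * w)) x y)); last first.
    by field; rewrite gt_eqF.
  rewrite -mulrDr /kphs -[L * _]KnZ -Kn_add; congr (_ * _); apply: eq_Knw => x1 w; ring.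
rewrite (_ : s * _ * _ = 0 + L * (s * (expR (- (s2 / 2 * (r1 * s ^+ 2))) * Vh P f x y))); last first.
  rewrite /L (_ : - (s2 / 2 * ((r1 + r2) * s ^+ 2)) = - (s2 / 2 * (r1 * s ^+ 2)) - s2 / 2 * (r2 * s ^+ 2));
    last by ring.
  by rewrite expRD; ring.
apply: cvgD; last first.
  apply: cvgM; first exact: cvg_cst.
  apply: cvgM; first exact: cvg_cst.
  by apply: (sine_limit' hg) => //; [exact: time_cvg0|exact: ratio_time].
apply/cvgrPdist_le => e e0; have Ey : 0 < s * (E * (1 + y)) by rewrite !mulr_gt0 // addr_gt0.
have e1 : 0 < e / (s * (E * (1 + y))) by rewrite divr_gt0.
have := Tn_sin_limit hg tn (@time_cvg0 s) joo (@ratio_time j r2 s jr) e1.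
apply: filterS => n Hn; rewrite sub0r normrN normrM ger0_norm ?(ltW (sq_gt0 R n)) //.
apply: le_trans (ler_wpM2l (ltW (sq_gt0 R n)) (HE _ _ _ _ _ _ y0 (ltW (tn n)) _)) _.
  by move=> x1; exact: Hn.
rewrite [leLHS](_ : _ = (N n * t n) * (E * (1 + y)) * (e / (s * (E * (1 + y))))); last by ring.
by rewrite Nt mulrC divfK // gt_eqF.
Qed.

Lemma trs_nuE n tau : \sum_x' nu x' * trs sin c (Q n x') tau =
  RI (fun z => \sum_x nu x * ((0 < z)%R%:R * (step_at a b x z *
     ((0 < z - f x)%R%:R * Kns (k' n) (fun _ u => sin (tau * (u - c))) x (z - f x))))).
Proof.
have ms : measurable_fun setT (fun u : R => sin (tau * (u - c))).
  exact: measurable_lip (@normr_sinB_le R).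
have bs (u : R) : `|sin (tau * (u - c))| <= 1 by exact: sin_max.
have i1 z : intg (fun v => Q n z v * sin (tau * (v - c))).
  apply: (intgM (B := 1)) => //; exact: (intg_Qf hg).
rewrite -(duality hg (k' n) (nice_step b ha) ms bs).
under eq_bigr => z _ do rewrite -RIZ //.
rewrite -RI_sum; last by move=> z _; exact: intgZ.
congr RI; apply: funext => v; apply: eq_bigr => z _; rewrite /Qf; ring.
Qed.

(** Domination is by a constant on $[0,b]$, since [step_at] vanishes above [b]. The centre [c] moves
    the phase by [t n * |c|]; after scaling this is a constant times dual survival, hence
    negligible. *)
Lemma trs_nu_limit s : 0 < s ->
  \sum_x' nu x' * (N n * trs sin c (Q n x') (s / N n)) @[n --> \oo] -->
  s * expR (- (s2 / 2 * (r3 * s ^+ 2))) * mlim a b.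
Proof.
move=> s0; have hgs := good_dual hg; have hPs := good_stoch hgs.
have [E E0 HE] := Kn_id_bound hgs; have [F F0 HF] := fin_upper f.
have [n0 [n1 _]] := hnu.
pose t n := s / N n; have tn n : 0 < t n by rewrite divr_gt0 // sq_gt0.
have Nt n : N n * t n = s by rewrite /t mulrC divfK // gt_eqF // sq_gt0.
pose L := s * expR (- (s2 / 2 * (r3 * s ^+ 2))).
have L0 : 0 < L by rewrite mulr_gt0 // expR_gt0.
pose h n z := \sum_x nu x * ((0 < z)%R%:R * (step_at a b x z *
     ((0 < z - f x)%R%:R * (N n * Kns (k' n) (fun _ u => sin (t n * (u - c))) x (z - f x))))).
pose hl z := \sum_x nu x * ((0 < z)%R%:R * (step_at a b x z *
     ((0 < z - f x)%R%:R * (L * Vh Ps fs x (z - f x))))).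
have hE n : \sum_x' nu x' * (N n * trs sin c (Q n x') (s / N n)) = RI (h n).
  have -> : h n = fun z => N n * \sum_x nu x * ((0 < z)%R%:R * (step_at a b x z *
     ((0 < z - f x)%R%:R * Kns (k' n) (fun _ u => sin (t n * (u - c))) x (z - f x)))).
    by apply: funext => z; rewrite mulr_sumr; apply: eq_bigr => v _; ring.
  rewrite RIZ -?trs_nuE; first by rewrite mulr_sumr; apply: eq_bigr => v _; ring.
  apply: intg_sum => z _; apply: intgZ.
  apply: (@intg_pos_bounded _ _ b (1 * (1 * 1))).
  - apply: mfM; first by apply: mfM => //; apply: mf_le.
    apply: mfM; first by apply: mf_lt => //; apply: measurable_funD.
    by apply: mf_shift; apply: mf_Kn => w; exact: measurable_lip (@normr_sinB_le R).
  - move=> v; apply: normM; first by have /andP[? ?] := step_at_itv b z v ha; rewrite ger0_norm.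
    apply: normM; first by rewrite ger0_norm // lern1 leq_b1.
    apply: le_trans (ler_norm_Kn _ hPs _ _ _ _) _; rewrite -[leRHS](Ex_cst hPs z (k' n)).
    apply: ler_Ex => // q _; rewrite -[leRHS]mulr1; apply: ler_pM => //; last exact: sin_max.
    by rewrite lern1 leq_b1.
  - by move=> v bv; rewrite /step_at leNgt bv mulr0 mul0r.
pose K := s * (E * (1 + (b + F)) + `|c|).
have K0 : 0 <= K by rewrite mulr_ge0 ?(ltW s0) // addr_ge0 // mulr_ge0 ?(ltW E0) // !addr_ge0 // ltW.
have bd n z w : 0 < w -> `|N n * Kns (k' n) (fun _ u => sin (t n * (u - c))) z w| <= s * (E * (1 + w) + `|c|).
  move=> w0; rewrite normrM ger0_norm ?(ltW (sq_gt0 R n)) // -(Nt n) -mulrA.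
  apply: ler_wpM2l; first exact: ltW (sq_gt0 R n).
  apply: le_trans (ler_norm_Kn _ hPs _ _ _ _) _.
  apply: (@le_trans _ _ (Kns (k' n) (fun _ u => t n * u + t n * `|c|) z w)).
    apply: ler_Kn => // v u u0; apply: le_trans (normr_sin_le _) _.
    rewrite normrM (ger0_norm (ltW (tn n))) -mulrDr ler_wpM2l ?(ltW (tn n)) //.
    by apply: le_trans (ler_normB _ _) _; rewrite ger0_norm // ltW.
  rewrite Kn_add KnZ Kn_cst mulrDr; apply: lerD.
    by apply: ler_wpM2l; [exact: ltW|exact: HE].
  apply: ler_piMr; last exact: survn_le1.
  by rewrite mulr_ge0 // ltW.
have lim z w : 0 < w -> N n * Kns (k' n) (fun _ u => sin (t n * (u - c))) z w @[n --> \oo] -->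
    L * Vh Ps fs z w.
  move=> w0.
  rewrite (_ : (fun n => _) = fun n => s * (Kns (k' n) (fun _ u => sin (t n * u)) z w / t n) +
    N n * Kns (k' n) (fun _ u => sin (t n * (u - c)) - sin (t n * u)) z w); last first.
    apply: funext => n; rewrite -[in RHS](Nt n).
    rewrite [X in _ = X + _](_ : _ = N n * Kns (k' n) (fun _ u => sin (t n * u)) z w); last first.
      by field; rewrite gt_eqF.
    rewrite -mulrDr -Kn_add; congr (_ * _); apply: eq_Knw => v u; ring.
  rewrite -[L * _]addr0; apply: cvgD.
    rewrite /L -mulrA; apply: cvgM; first exact: cvg_cst.
    rewrite -(sigma2_dual f hP hnu h1); apply: (sine_limit' hgs) => //; first exact: time_cvg0.
    exact: ratio_time.
  have c0 := cvg_comp _ _ koo' (survn_cvg0 hgs z w0).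
  have c1 : s * `|c| * survn Ps fs (k' n) z w @[n --> \oo] --> (0 : R).
    by rewrite -(mulr0 (s * `|c|)); apply: cvgM; [exact: cvg_cst|exact: c0].
  apply: (@squeeze_cvgr _ _ _ _ (fun n => - (s * `|c| * survn Ps fs (k' n) z w)) (fun n => s * `|c| * survn Ps fs (k' n) z w)) => //; last first.
    by rewrite -oppr0; apply: cvgN.
  apply: nearW => n; rewrite -ler_norml normrM ger0_norm ?(ltW (sq_gt0 R n)) //.
  rewrite [leRHS](_ : _ = N n * (t n * `|c| * survn Ps fs (k' n) z w)); last first.
    by rewrite -[in LHS](Nt n); ring.
  apply: ler_wpM2l; first exact: ltW (sq_gt0 R n).
  apply: Kn_bound => // v u _; apply: le_trans (normr_sinB_le _ _) _.
  rewrite (_ : _ - _ = - (t n * c)); last by ring.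
  by rewrite normrN normrM (ger0_norm (ltW (tn n))).
have [||||ihl cl] := @RI_dct R h hl (fun z => K * (0 <= z <= b)%R%:R).
- move=> n; apply: measurable_sum => v; apply: mfM => //; apply: mfM; first exact: mf_lt.
  apply: mfM; first by apply: mfM => //; apply: mf_le.
  apply: mfM; first by apply: mf_lt => //; apply: measurable_funD.
  apply: mfM => //; apply: mf_shift; apply: mf_Kn => w; exact: measurable_lip (@normr_sinB_le R).
- move=> n z; rewrite /h; case: (ltrP 0 z) => z0; last first.
    rewrite big1 ?normr0; first by apply: mulr_ge0 K0 _.
    by move=> v _; rewrite mul0r mulr0.
  rewrite (ltW z0) /=; case: (lerP z b) => zb; last first.
    by rewrite mulr0 big1 ?normr0 // => v _; rewrite /step_at leNgt zb !(mulr0, mul0r).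
  rewrite mulr1 -[leRHS]mul1r -[in leRHS]n1 mulr_suml; apply: le_trans (ler_norm_sum _ _ _) _.
  apply: ler_sum => v _; rewrite normrM (ger0_norm (n0 v)); apply: ler_wpM2l => //.
  rewrite mul1r -[leRHS]mul1r; apply: normM.
    by have /andP[? ?] := step_at_itv b v z ha; rewrite ger0_norm.
  case: (ltrP 0 (z - f v)) => zf; last by rewrite mul0r normr0.
  rewrite mul1r; apply: le_trans (bd _ _ _ zf) _; rewrite /K; apply: ler_wpM2l; first exact: ltW.
  rewrite lerD2r; apply: ler_wpM2l; first exact: ltW.
  rewrite lerD2l; have := HF v; rewrite ler_norml => /andP[]; lra.
- exact/intgZ/intg_seg.
- move=> z; apply: cvg_fsum => v; apply: cvgM; first exact: cvg_cst.
  apply: cvgM; first exact: cvg_cst.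
  apply: cvgM; first exact: cvg_cst.
  case: (ltrP 0 (z - f v)) => zf; first by apply: cvgM; [exact: cvg_cst|exact: lim].
  rewrite mul0r (_ : (fun n => _) = fun=> 0); first exact: cvg_cst.
  by apply: funext => n; rewrite mul0r.
rewrite (_ : (fun n => _) = fun n => RI (h n)); last by apply: funext => n; rewrite hE.
have hlE : hl = fun z => L * \sum_x nu x * ((0 < z)%R%:R *
  (step_at a b x z * ((0 < z - f x)%R%:R * Vh Ps fs x (z - f x)))).
  by apply: funext => z; rewrite mulr_sumr; apply: eq_bigr => v _; ring.
rewrite -/L /mlim -RIZ -?hlE //.
have := intgZ L^-1 ihl; rewrite hlE; congr intg; apply: funext => z.
by rewrite mulrA mulVf ?mul1r // gt_eqF.
Qed.

Lemma sq_le3 (m n : nat) : (n.+1 <= 8 * m.+1)%N -> N n <= 3 * N m.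
Proof.
move=> nm; have kn : n.+1%:R <= 9 * m.+1%:R :> R.
  by rewrite -(natrM _ 9) ler_nat; move: nm; clear; lia.
have n3 : 0 <= 3 * N m by rewrite mulr_ge0 // ltW // sq_gt0.
rewrite -ler_sqr ?nnegrE ?(ltW (sq_gt0 R n)) // exprMn !sq_sqr; move: kn; lra.
Qed.

Lemma trs_bounded : exists2 B : R, 0 < B & forall n g x' tau,
  (forall u v, `|g u - g v| <= `|u - v|) -> (forall u, `|g u| <= 1) ->
  `|N n * trs g c (Q n x') tau| <= B.
Proof.
have [C C0 HC] := Qf_L1_bound hg.
have B0 : 0 < C * (1 + b) ^+ 2 by rewrite mulr_gt0 // exprn_gt0 // ltr_wpDr.
exists (3 * (C * (1 + b) ^+ 2)); first by rewrite mulr_gt0.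
move=> n g x' tau lg bg; have sn := sq_gt0 R n; have sk := sq_gt0 R (k' n).
have i1 := intg_Qf hg (k' n).+1 b x' ha.
rewrite normrM ger0_norm ?(ltW sn) //.
have h : `|trs g c (Q n x') tau| <= C * (1 + b) ^+ 2 / N (k' n).
  apply: le_trans (trs_bound c tau i1 lg bg) (le_trans _ (HC (k' n) a b x' ha b0)).
  by rewrite le_eqVlt; apply/orP; left; apply/eqP; congr RI; apply: funext => v; rewrite ger0_norm // (Qf_ge0 hg).
apply: le_trans (ler_wpM2l (ltW sn) h) _.
rewrite mulrCA mulrC ler_pM2r // ler_pdivrMr //; exact: sq_le3.
Qed.

Lemma intg_Qf_id n x' : intg (fun v => Q n x' v * (v - c)).
Proof.
have [B [M [m1 bd s1]]] := nice_Kn hg (k' n).+1 (nice_step b ha).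
have M0 : 0 <= M by apply: le_trans (bd x' 0).
apply: (@intg_le _ _ (fun v => M * (`|B| + `|c|) * (0 <= v <= B)%R%:R)).
- by apply: mfM; [exact: Qf_measurable|exact: measurable_funB].
- move=> v; rewrite /Qf; case: (ltrP 0 v) => v0; last by rewrite !mul0r normr0 !mulr_ge0 ?addr_ge0.
  rewrite mul1r (ltW v0) /=; case: (lerP v B) => vB /=; last by rewrite s1 // mul0r normr0 mulr0.
  rewrite mulr1; apply: normM => //; apply: le_trans (ler_normB _ _) _.
  by rewrite lerD2r !ger0_norm ?(ltW v0) // (le_trans (ltW v0)).
- exact/intgZ/intg_seg.
Qed.

(** [decay] over the middle part gives $e^{-t^2j/i}$ with $j+1\ge(n+1)/p$, a Gaussian in [s]; the
    prefactor $e^{A^2/i}$ pays for the missing unit. *)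
Lemma kphs_dom : exists K c0 : R, [/\ 0 < K, 0 < c0 & forall n s phi x', 0 <= s <= A * N n ->
  `|N n * kphs P f (k n) (j n) (s / N n) phi x' x y| <= K * (s * expR (- (c0 * s ^+ 2)))].
Proof.
have [_ _ _ h3 _] := hg; have [i i0 Hi] := decay hP h1 h3 A.
have [E E0 HE] := Kn_sinM_bound.
have p0 : (0 < p)%N by have := jp 0; case: (p).
have i0' : 0 < i%:R :> R by rewrite ltr0n.
have p0' : 0 < p%:R :> R by rewrite ltr0n.
have Ey : 0 < E * (1 + y) by rewrite mulr_gt0 // addr_gt0.
exists (i%:R * expR (A ^+ 2 / i%:R) * (E * (1 + y))), (p%:R * i%:R)^-1; split.
- by rewrite (mulr_gt0 _ Ey) // mulr_gt0 ?expR_gt0.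
- by rewrite invr_gt0 mulr_gt0.
move=> n s phi x' /andP[s0 sA]; have sn := sq_gt0 R n.
set t := s / N n; have t0 : 0 <= t by rewrite divr_ge0 // ltW.
have tA : t <= A by rewrite ler_pdivrMr.
have Nt : N n * t = s by rewrite /t mulrC divfK // gt_eqF.
have t01 : 0 <= t <= A by rewrite t0.
set d := i%:R * expR (- (t ^+ 2 * (j n)%:R / i%:R)).
have Hd x1 : `|phs P f (j n) t phi x' x1| <= d.
  rewrite -[d]mulr1; apply: (Hi t t01); first exact: (wave_sin t (fun z => (z == x')%:R) phi).
  move=> z u; rewrite -[leRHS]mulr1; apply: normM; last exact: sin_max.
  by rewrite ger0_norm // lern1 leq_b1.
rewrite normrM ger0_norm ?(ltW sn) //.
apply: le_trans (ler_wpM2l (ltW sn) (HE _ _ _ _ _ _ y0 t0 Hd)) _.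
rewrite [leLHS](_ : _ = d * (E * (1 + y)) * s); last by rewrite -[in RHS]Nt; ring.
rewrite [leRHS](_ : _ = i%:R * (expR (A ^+ 2 / i%:R) * expR (- ((p%:R * i%:R)^-1 * s ^+ 2))) *
   (E * (1 + y)) * s); last by ring.
apply: ler_wpM2r => //; apply: ler_wpM2r; first exact: ltW.
apply: ler_wpM2l; first exact: ltW.
rewrite -expRD ler_expR.
have key : s ^+ 2 <= p%:R * (t ^+ 2 * (j n)%:R + A ^+ 2).
  rewrite -Nt exprMn sq_sqr.
  have t2 : 0 <= t ^+ 2 by exact: sqr_ge0.
  have : n.+1%:R * t ^+ 2 <= (p%:R * (j n).+1%:R) * t ^+ 2.
    by rewrite ler_wpM2r // -natrM ler_nat.
  have : t ^+ 2 <= A ^+ 2 by rewrite ler_sqr ?nnegrE // ltW.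
  rewrite -natr1 => /(ler_wpM2l (ltW p0')); lra.
rewrite -subr_ge0 (_ : _ - _ = (p%:R * (t ^+ 2 * (j n)%:R + A ^+ 2) - s ^+ 2) / (p%:R * i%:R)); last first.
  by field; rewrite (gt_eqF i0') (gt_eqF p0').
by rewrite divr_ge0 ?subr_ge0 // mulr_ge0 // ltW.
Qed.

(** Of the three factors $\sqrt n$ one goes to [trs], one to [kphs] and one to the substitution
    $s=tA\sqrt{n+1}$. *)
Lemma odd_limit :
  N n ^+ 3 * Lam P f (k n) (j n) (fun z u => smooth A c (Q n z) u) x y @[n --> \oo] -->
  2 / (Num.sqrt (2 * pi) * Num.sqrt s2 ^+ 3) * (Vh P f x y * mlim a b).
Proof.
have [_ _ _ _ s20] := hg; have pi0 := @pi_gt0 R.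
have [B B0 HB] := trs_bounded; have [K [c0 [K0 c00 HK]]] := kphs_dom.
pose G n t z u : R := seg01 t * ((1 - t) *
  (trs cos c (Q n z) (t * A) * cos (t * A * u) + trs sin c (Q n z) (t * A) * sin (t * A * u))).
have iG n z u : intg (fun t => G n t z u).
  by apply: intg_trs_phase; [exact: (intg_Qf hg)|exact: intg_Qf_id].
have sE n z u : smooth A c (Q n z) u = A / pi * RI (fun t => G n t z u).
  by rewrite smoothE //; [exact: (intg_Qf hg)|exact: intg_Qf_id].
pose H n t := Lam P f (k n) (j n) (G n t) x y.
have iH n : intg (H n) by case: (Lam_RI P f (k n) (j n) x y (iG n)).
have AN n : 0 < A * N n by rewrite mulr_gt0 // sq_gt0.
pose F n s := N n ^+ 2 / pi * H n ((A * N n)^-1 * s + 0).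
have JE n : N n ^+ 3 * Lam P f (k n) (j n) (fun z u => smooth A c (Q n z) u) x y = RI (F n).
  rewrite /F RIZ; last by apply: intg_affine => //; rewrite invr_gt0.
  rewrite RI_affine ?invr_gt0 // invrK.
  have -> : Lam P f (k n) (j n) (fun z u => smooth A c (Q n z) u) x y = A / pi * RI (H n).
    rewrite -(Lam_RI P f (k n) (j n) x y (iG n)).2 -LamZ; apply: eq_Knw => z u.
    by congr (_ - _); apply: eq_Tn => z' u'; exact: sE.
  move: pi pi0 => q q0; by field; rewrite gt_eqF.
pose S n s x' := N n * trs sin c (Q n x') (s / N n).
pose C n s x' := N n * trs cos c (Q n x') (s / N n).
pose al n s phi x' := N n * kphs P f (k n) (j n) (s / N n) phi x' x y.
have FE n s : F n s = 2 / pi * (seg01 (s / (A * N n)) * ((1 - s / (A * N n)) *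
    \sum_x' (S n s x' * al n s (pi / 2) x' - C n s x' * al n s 0 x'))).
  rewrite /F addr0 [_^-1 * s]mulrC; set t := s / (A * N n).
  have tA : t * A = s / N n.
    rewrite /t; have := sq_gt0 R n => sn; field; by rewrite !gt_eqF.
  have -> : H n t = seg01 t * ((1 - t) * (2 * \sum_x' (trs sin c (Q n x') (t * A) *
      kphs P f (k n) (j n) (t * A) (pi / 2) x' x y - trs cos c (Q n x') (t * A) *
      kphs P f (k n) (j n) (t * A) 0 x' x y))).
    rewrite -Lam_phase -!LamZ /H /Lam; apply: eq_Knw => z u; congr (_ - _); exact: eq_Tn.
  rewrite tA !mulr_sumr; apply: eq_bigr => z _; rewrite /S /C /al; ring.
have cS s x' n : `|S n s x'| <= B.
  by apply: HB; [exact: normr_sinB_le|exact: sin_max].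
have cC s x' n : `|C n s x'| <= B.
  by apply: HB; [exact: normr_cosB_le|exact: cos_max].
pose Fl (s : R) := 2 / pi * (half s * (s ^+ 2 * expR (- (s2 / 2 * s ^+ 2)))) * (Vh P f x y * mlim a b).
pose W := #|X|%:R * (2 * (B * K)).
have W0 : 0 <= W by rewrite !mulr_ge0 // ltW.
(* The natural bound is $s\,e^{-c_0s^2}$; it is relaxed by $s\le1+s^2$ to Gaussian moments already
   known to be integrable. *)
have ig : intg (fun s => 2 / pi * W * (expR (- (c0 * s ^+ 2)) + s ^+ 2 * expR (- (c0 * s ^+ 2)))).
  by apply: intgZ; apply: intgD; [exact: intg_gauss|exact: intg_gauss2].
have [|||iFl cl] := @RI_dct R F Fl _ _ _ ig.
- move=> n; apply: mfM => //; apply: mf_affine; exact: intg_measurable.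
- move=> n s; rewrite FE; have e0 := expR_gt0 (- (c0 * s ^+ 2)).
  have s20' := sqr_ge0 s.
  rewrite -[leRHS]mulrA; apply: normM; first by rewrite ger0_norm // divr_ge0 // ltW.
  case: (boolP (0 <= s / (A * N n) <= 1)) => [/andP[s0 s1]|_]; last first.
    rewrite mul0r normr0; apply: mulr_ge0 => //; apply: addr_ge0; first exact: ltW.
    by apply: mulr_ge0 => //; exact: ltW.
  have s0' : 0 <= s by move: s0; rewrite pmulr_lge0 // invr_gt0.
  have sA : 0 <= s <= A * N n by rewrite s0'; move: s1; rewrite ler_pdivrMr ?mul1r.
  rewrite mul1r -[leRHS]mul1r; apply: normM; first by rewrite ler_norml; lra.
  apply: le_trans (ler_norm_sum _ _ _) _.
  apply: (@le_trans _ _ (\sum_(x' : X) (2 * (B * (K * (s * expR (- (c0 * s ^+ 2)))))))).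
    apply: ler_sum => z _; rewrite mulr_natl mulr2n; apply: normD; rewrite ?normrN; apply: normM => //; exact: HK.
  rewrite [leLHS](_ : _ = W * (s * expR (- (c0 * s ^+ 2)))); last first.
    by rewrite /W -[RHS]mulrA [RHS]mulr_natl -sumr_const; apply: eq_bigr => z _; ring.
  apply: ler_wpM2l => //.
  rewrite -[X in _ <= X + _]mul1r -mulrDl; apply: ler_wpM2r; first exact: ltW.
  have := sqr_ge0 (s - 1); rewrite sqrrB1; lra.
- move=> s; rewrite /Fl; case: (ltgtP s 0) => s0.
  + rewrite mul0r mulr0 mul0r.
    rewrite (_ : F^~ s = fun=> 0); first exact: cvg_cst.
    apply: funext => n; rewrite FE (_ : (0 <= s / (A * N n)) = false) ?mul0r ?mulr0 //.
    by rewrite pmulr_lge0 ?invr_gt0 // leNgt s0.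
  + rewrite mul1r.
    have cs : s / (A * N n) @[n --> \oo] --> (0 : R).
      rewrite (_ : (fun n => _) = fun n => s / A * (N n)^-1); last first.
        by apply: funext => n; rewrite invfM mulrA.
      by rewrite -(mulr0 (s / A)); apply: cvgM; [exact: cvg_cst|exact: sqrtn_cvg].
    pose L := s * (expR (- (s2 / 2 * ((r1 + r2) * s ^+ 2))) * Vh P f x y).
    (* Cosine transforms drop out because [kphs] with phase 0 tends to 0. Of the sine transforms
       only the [nu]-average is left, which is what duality evaluates. *)
    have cmain : \sum_x' (S n s x' * al n s (pi / 2) x' - C n s x' * al n s 0 x') @[n --> \oo] -->
        L * (s * expR (- (s2 / 2 * (r3 * s ^+ 2))) * mlim a b).
      have cz x' : S n s x' * (al n s (pi / 2) x' - nu x' * L) - C n s x' * al n s 0 x' @[n --> \oo] --> (0 : R).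
        rewrite -[X in _ --> X]subr0; apply: cvgB.
          apply: (cvg_bounded_mul0 (cS s x')).
          rewrite (_ : 0 = nu x' * L - nu x' * L :> R); last by rewrite subrr.
          apply: cvgB; last exact: cvg_cst.
          have := @kphs_limit s x' (pi / 2) s0; rewrite sin_pihalf mulr1 => h.
          by rewrite /L mulrCA mulrA.
        apply: (cvg_bounded_mul0 (cC s x')).
        by have := @kphs_limit s x' 0 s0; rewrite sin0 !mulr0 mul0r.
      have cz2 := @cvg_fsum _ _ (index_enum X) _ _ cz; rewrite big1 // in cz2.
      rewrite -[L * _]add0r (_ : (fun n => _) = fun n =>
        \sum_x' (S n s x' * (al n s (pi / 2) x' - nu x' * L) - C n s x' * al n s 0 x') +
        L * \sum_x' nu x' * S n s x'); last first.
        by apply: funext => n; rewrite mulr_sumr -big_split; apply: eq_bigr => z _ /=; ring.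
      apply: cvgD; first exact: cz2.
      apply: cvgM; [exact: cvg_cst|exact: trs_nu_limit].
    have cseg : seg01 (s / (A * N n)) @[n --> \oo] --> (1 : R).
      apply: (@cvg_trans _ ((fun=> 1) @ \oo)); last exact: cvg_cst.
      apply: near_eq_cvg; move/cvgrPdist_le: cs => /(_ 1 ltr01); apply: filterS => n.
      rewrite sub0r normrN => h; have q0 : 0 <= s / (A * N n) by rewrite divr_ge0 ?(ltW s0) // ltW.
      by rewrite q0 /=; move: h; rewrite ger0_norm // => ->.
    rewrite (_ : F^~ s = fun n => 2 / pi * (seg01 (s / (A * N n)) * ((1 - s / (A * N n)) *
      \sum_x' (S n s x' * al n s (pi / 2) x' - C n s x' * al n s 0 x')))); last by apply: funext => n.
    rewrite -mulrA (_ : s ^+ 2 * _ * _ = 1 * ((1 - 0) * (L * (s * expR (- (s2 / 2 * (r3 * s ^+ 2))) * mlim a b)))); last first.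
      rewrite mul1r subr0 mul1r /L (_ : - (s2 / 2 * s ^+ 2) = - (s2 / 2 * ((r1 + r2) * s ^+ 2)) - s2 / 2 * (r3 * s ^+ 2)).
        by rewrite expRD; ring.
      by rewrite -[s ^+ 2 in LHS]mul1r -r123; ring.
    apply: cvgM; first exact: cvg_cst.
    apply: cvgM => //; apply: cvgM => //; apply: cvgB => //; exact: cvg_cst.
  + rewrite s0 expr0n mul0r !mulr0 mul0r (_ : F^~ 0 = fun=> 0); first exact: cvg_cst.
    apply: funext => n; rewrite FE big1 ?mulr0 // => z _.
    have k0 phi : al n 0 phi z = 0.
      rewrite /al /kphs (_ : Kn _ _ _ _ = 0) ?mulr0 // -[RHS](mul0r (Kn (k n) (fun _ _ => 1) x y)) -KnZ.
      by apply: eq_Knw => v w; rewrite !mul0r sin0 mul0r.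
    by rewrite !k0 !mulr0 subr0.
rewrite (_ : (fun n => _) = fun n => RI (F n)); last by apply: funext => n; rewrite JE.
suff -> : 2 / (Num.sqrt (2 * pi) * Num.sqrt s2 ^+ 3) * (Vh P f x y * mlim a b) = RI Fl by [].
have c2 : 0 < s2 / 2 by rewrite divr_gt0.
have i2 : intg (fun s => half s * (s ^+ 2 * expR (- (s2 / 2 * s ^+ 2)))).
  by apply: intg_half; exact: intg_gauss2.
have -> : Fl = fun s => 2 / pi * (Vh P f x y * mlim a b) * (half s * (s ^+ 2 * expR (- (s2 / 2 * s ^+ 2)))).
  by apply: funext => s; rewrite /Fl; ring.
rewrite RIZ // RI_gauss2 //.
rewrite [pi / (s2 / 2)](_ : _ = (2 * pi) / s2); last by field; rewrite gt_eqF.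
rewrite [Num.sqrt (2 * pi / s2)]sqrtrM ?mulr_ge0 ?(ltW pi0) // sqrtrV ?(ltW s20) //.
have hs : s2 = Num.sqrt s2 ^+ 2 by rewrite sqr_sqrtr // ltW.
have hp : pi = Num.sqrt (2 * pi) ^+ 2 / 2 :> R.
  by rewrite sqr_sqrtr ?mulr_ge0 ?(ltW pi0) //; field.
have a1 : 0 < Num.sqrt s2 by rewrite sqrtr_gt0.
have a2 : 0 < Num.sqrt (2 * pi) :> R by rewrite sqrtr_gt0 mulr_gt0.
rewrite [in 4 * _]hs [in 2 / pi]hp.
by field; rewrite !gt_eqF.
Qed.

End OddLimit.

(** * Splitting the time *)

Section TimeSplit.
Variable R : realType.

Lemma cvg_oo_mul (u : nat -> nat) c : (forall n, (n.+1 <= c * (u n).+1)%N) ->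
  u n @[n --> \oo] --> \oo.
Proof.
move=> h; apply/cvgnyPge => B; exists (c * B)%N => // n /= cn.
rewrite leqNgt; apply/negP => uB; have := h n.
by apply/negP; rewrite -ltnNge ltnS; apply: leq_trans cn; rewrite leq_mul2l uB orbT.
Qed.

Lemma ratio_cvg (u : nat -> nat) (rho D : R) : (forall n, `|(u n)%:R - rho * n.+1%:R| <= D) ->
  (u n)%:R / n.+1%:R @[n --> \oo] --> rho.
Proof.
move=> h; have c0 : D * n.+1%:R^-1 @[n --> \oo] --> (0 : R).
  by rewrite -(mulr0 D); apply: cvgM; [exact: cvg_cst|exact: cvg_harmonic].
have c1 : rho - D * n.+1%:R^-1 @[n --> \oo] --> rho.
  by rewrite -[X in _ --> X]subr0; apply: cvgB => //; exact: cvg_cst.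
have c2 : rho + D * n.+1%:R^-1 @[n --> \oo] --> rho.
  by rewrite -[X in _ --> X]addr0; apply: cvgD => //; exact: cvg_cst.
apply: (squeeze_cvgr _ c1 c2); apply: nearW => n.
have := h n; rewrite ler_norml => /andP[h1 h2].
have n0 : 0 < n.+1%:R :> R by [].
have E : rho = rho * n.+1%:R / n.+1%:R by rewrite mulfK // gt_eqF.
rewrite [X in X - _ <= _]E [X in _ <= X + _]E -mulrBl -mulrDl !ler_pM2r ?invr_gt0 //.
by apply/andP; split; lra.
Qed.

Definition mid p n : nat := n %/ p.
Definition fin p n : nat := (n - mid p n)./2.
Definition ini p n : nat := n - mid p n - fin p n.

Variable p : nat.
Hypothesis p1 : (1 < p)%N.

Lemma mid_facts n : [/\ mid p n * p <= n, n < (mid p n).+1 * p & mid p n * 2 <= n]%N.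
Proof.
have a1 := leq_trunc_div n p; have a2 := ltn_ceil n (ltnW p1).
by split=> //; apply: leq_trans a1; rewrite leq_mul2l p1 orbT.
Qed.

(** Since [mid p n] is at most half of [n], the outer parts have about [n / 4] steps or more; 8
    leaves room for rounding. The last part counts one extra step, the explicit one in [duality]. *)
Lemma split_facts n : [/\ n.+1 = ini p n + (mid p n + (fin p n).+1),
  n.+1 <= 8 * (ini p n).+1, n.+1 <= 8 * (fin p n).+1,
  (2 * fin p n <= n - mid p n <= 2 * fin p n + 1) & fin p n <= ini p n <= fin p n + 1]%N.
Proof.
have [_ _] := mid_facts n; rewrite /ini /fin; move: (mid p n) => m m2.
have := odd_double_half (n - m); move: (n - m)./2 (leq_b1 (odd (n - m))) => q; move: (nat_of_bool _) => o; split; lia.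
Qed.

Lemma mid_mul n : (n.+1 <= p * (mid p n).+1)%N.
Proof. by have [_ h _] := mid_facts n; rewrite mulnC. Qed.

Let p0 : 0 < p%:R :> R. Proof. by rewrite ltr0n ltnW. Qed.

Lemma mid_est n : `|(mid p n)%:R - p%:R^-1 * n.+1%:R| <= 1 :> R.
Proof.
have [h1 h2 _] := mid_facts n.
have a1 : (mid p n)%:R * p%:R <= n.+1%:R :> R by rewrite -natrM ler_nat; apply: leqW.
have a2 : n.+1%:R <= ((mid p n)%:R + 1) * p%:R :> R by rewrite natr1 -natrM ler_nat.
rewrite mulrC ler_norml; apply/andP; split.
  by rewrite lerBrDr addrC lerBlDr ler_pdivrMr.
by rewrite lerBlDr addrC -lerBlDr; apply: (@le_trans _ _ (mid p n)%:R); [lra|rewrite ler_pdivlMr].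
Qed.

Lemma fin_est n : `|(fin p n)%:R - (1 - p%:R^-1) / 2 * n.+1%:R| <= 2 :> R.
Proof.
have [_ _ h3] := mid_facts n; have [_ _ _ /andP[b1 b2] _] := split_facts n.
have mn : (mid p n <= n)%N by lia.
have a1 : 2 * (fin p n)%:R <= n%:R - (mid p n)%:R :> R by rewrite -natrB // -(natrM _ 2) ler_nat.
have a2 : n%:R - (mid p n)%:R <= 2 * (fin p n)%:R + 1 :> R.
  by rewrite -natrB // -(natrM _ 2) -(natrD _ _ 1) ler_nat.
have := mid_est n; rewrite -[n.+1%:R]natr1.
rewrite (_ : (1 - p%:R^-1) / 2 * (n%:R + 1) = ((n%:R + 1) - p%:R^-1 * (n%:R + 1)) / 2); last by ring.
rewrite !ler_norml => /andP[c1 c2]; apply/andP; split; lra.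
Qed.

Lemma ini_est n : `|(ini p n)%:R - (1 - p%:R^-1) / 2 * n.+1%:R| <= 3 :> R.
Proof.
have [_ _ _ _ /andP[b1 b2]] := split_facts n.
have a1 : (fin p n)%:R <= (ini p n)%:R :> R by rewrite ler_nat.
have a2 : (ini p n)%:R <= (fin p n)%:R + 1 :> R by rewrite -(natrD _ _ 1) ler_nat.
have := fin_est n; rewrite !ler_norml => /andP[c1 c2]; apply/andP; split; lra.
Qed.

End TimeSplit.

(** * Smoothing as a one-sided bound *)

Section SmoothBounds.
Variable R : realType.
Variables (A D eta : R).
Hypotheses (A0 : 0 < A) (tail : RI (fun w : R => (A * D < `|w|)%R%:R * fej w) <= eta).
Local Notation ker e := (fun v => A * fej (A * (v - e))).

Lemma intg_tail : intg (fun w : R => (A * D < `|w|)%R%:R * fej w).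
Proof.
apply: intg_le (@intg_fejT R).
  apply: mfM; last exact: fej_measurable.
  by apply: mf_lt => //; apply: measurableT_comp => //; exact: measurable_normr.
by move=> w; rewrite normrM (ger0_norm (fej_ge0 w)) ger0_norm // ler_piMl ?fej_ge0 // lern1 leq_b1.
Qed.

Lemma ker_mass (h : R -> R) e : intg h ->
  intg (fun v => A * h (A * (v - e))) /\ RI (fun v => A * h (A * (v - e))) = RI h.
Proof.
move=> ih.
have E : (fun v => h (A * (v - e))) = fun v => h (A * v + - (A * e)).
  by apply: funext => v; congr h; ring.
have i1 : intg (fun v => h (A * (v - e))) by rewrite E; exact: intg_affine.
split; first exact: intgZ.
by rewrite RIZ // E RI_affine // mulrCA mulfV ?mulr1 // gt_eqF.
Qed.

Lemma ker_tail e : intg (fun v => (D < `|v - e|)%R%:R * (ker e v)) /\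
  RI (fun v => (D < `|v - e|)%R%:R * (ker e v)) <= eta.
Proof.
have [i1 e1] := ker_mass e intg_tail.
have E : (fun v => (D < `|v - e|)%R%:R * (ker e v)) =
    fun v => A * ((A * D < `|A * (v - e)|)%R%:R * fej (A * (v - e))).
  by apply: funext => v; rewrite normrM (gtr0_norm A0) ltr_pM2l // mulrCA.
by rewrite E e1.
Qed.

Lemma ker_ge0 e v : 0 <= ker e v.
Proof. by rewrite mulr_ge0 ?fej_ge0 // ltW. Qed.

Lemma intg_smooth (q : R -> R) (U c u : R) : measurable_fun setT q -> (forall v, 0 <= q v <= U) ->
  intg (fun v => q v * (A * fej (A * (v - c - u)))).
Proof.
move=> mq qU; have [i1 _] := ker_mass (c + u) (@intg_fejT R).
rewrite (_ : (fun v => _) = fun v => (ker (c + u) v) * q v); last first.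
  by apply: funext => v; rewrite mulrC opprD addrA.
apply: (intgM (B := U)) => // v; have /andP[q0 q1] := qU v; by rewrite ger0_norm.
Qed.

(** Only the kernel mass within [D] of its centre is used; it is at least $1-\eta$. *)
Lemma smooth_ge (q : R -> R) (U q0 c u : R) : measurable_fun setT q -> (forall v, 0 <= q v <= U) -> 0 <= q0 ->
  (forall v, `|v - (c + u)| <= D -> q0 <= q v) -> q0 * (1 - eta) <= smooth A c q u.
Proof.
move=> mq qU q00 qD; have [i1 e1] := ker_mass (c + u) (@intg_fejT R).
have [i2 e2] := ker_tail (c + u).
apply: (@le_trans _ _ (RI (fun v => q0 * (ker (c + u) v - (D < `|v - (c + u)|)%R%:R * ker (c + u) v)))).
  rewrite RIZ; last exact: intgB.
  by apply: ler_wpM2l => //; rewrite RIB // e1 RI_fej; lra.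
apply: RI_le; [exact/intgZ/intgB|exact: (@intg_smooth q U)|move=> v].
have k0 := ker_ge0 (c + u) v; rewrite /= in k0.
rewrite -[v - c - u]addrA -opprD; case: (ltrP D `|v - (c + u)|) => h.
  by rewrite mul1r subrr mulr0 mulr_ge0 //; case/andP: (qU v).
by rewrite mul0r subr0 ler_wpM2r // qD.
Qed.

(** Beyond [D] the crude bound [U] is paid, on kernel mass at most [eta]. *)
Lemma smooth_le (q : R -> R) (U q0 c u : R) : measurable_fun setT q -> (forall v, 0 <= q v <= U) -> 0 <= q0 ->
  (forall v, `|v - (c + u)| <= D -> q v <= q0) -> smooth A c q u <= q0 + U * eta.
Proof.
move=> mq qU q00 qD; have [i1 e1] := ker_mass (c + u) (@intg_fejT R).
have [i2 e2] := ker_tail (c + u).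
have U0 : 0 <= U by have /andP[a b] := qU 0; exact: le_trans b.
apply: (@le_trans _ _ (RI (fun v => q0 * ker (c + u) v + U * ((D < `|v - (c + u)|)%R%:R * ker (c + u) v)))); last first.
  rewrite RID; [|exact: intgZ|exact: intgZ].
  by rewrite (RIZ q0 i1) (RIZ U i2) e1 RI_fej mulr1 lerD2l ler_wpM2l.
apply: RI_le; [exact: (@intg_smooth q U)|by apply: intgD; exact: intgZ|move=> v].
have k0 := ker_ge0 (c + u) v; rewrite /= in k0.
rewrite -[v - c - u]addrA -opprD; case: (ltrP D `|v - (c + u)|) => h.
  rewrite mul1r -[leLHS]add0r; apply: lerD; first exact: mulr_ge0.
  by rewrite ler_wpM2r //; case/andP: (qU v).
by rewrite mul0r mulr0 addr0 ler_wpM2r // qD.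
Qed.

End SmoothBounds.

(** * Growth and measurability of the harmonic function *)

Section HarmonicFacts.
Variables (R : realType) (X : finType) (P : X -> X -> R) (nu f : X -> R).
Hypothesis hg : good P nu f.

Lemma Vh_bounds : exists2 E : R, 0 < E & forall x y, 0 < y -> 0 <= Vh P f x y <= E * (1 + y).
Proof.
have [E E0 HE] := Kn_id_bound hg; exists E => // x y y0.
have c := Vh_cvg hg (x := x) y0; have cc : cvgn (fun n => Kn P f n (fun _ u => u) x y).
  by apply/cvg_ex; exists (Vh P f x y).
apply/andP; split.
  apply: limr_ge => //; apply: nearW => n; apply: Kn_ge0 => //; [exact: good_stoch hg|by move=> z u /ltW].
by apply: limr_le => //; apply: nearW => n; exact: HE.
Qed.

Lemma measurable_Vh x : measurable_fun setT (fun w : R => (0 < w)%R%:R * Vh P f x w).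
Proof.
apply: (@measurable_fun_cvg _ _ _ setT (fun n (w : R) => (0 < w)%R%:R * Kn P f n (fun _ u => u) x w)).
  by move=> n; apply: mfM; [exact: mf_lt|exact: mf_Kn].
move=> w _; case: (ltrP 0 w) => w0.
  by apply: cvgM; [exact: cvg_cst|exact: (Vh_cvg hg)].
rewrite mul0r (_ : (fun n => _) = fun=> 0); first exact: cvg_cst.
by apply: funext => n; rewrite mul0r.
Qed.

End HarmonicFacts.

(** * Density of the limit measure *)

Section LimitMass.
Variables (R : realType) (X : finType) (P : X -> X -> R) (nu f : X -> R).
Hypothesis hg : good P nu f.
Let hgs := good_dual hg.
Local Notation Ps := (Pdual P nu).
Local Notation fs := (fun x => - f x).

Definition mdens (a : X -> R) (z : R) : R := \sum_x nu x * ((0 < z)%R%:R *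
  (a x * ((0 < z - f x)%R%:R * Vh Ps fs x (z - f x)))).

Lemma mlimE a b : mlim P nu f a b = RI (fun z => (z <= b)%R%:R * mdens a z).
Proof.
congr RI; apply: funext => z; rewrite mulr_sumr; apply: eq_bigr => x _; rewrite /step_at; ring.
Qed.

Lemma mdens_measurable a : measurable_fun setT (mdens a).
Proof.
apply: measurable_sum => x; apply: mfM => //; apply: mfM; first exact: mf_lt.
by apply: mfM => //; apply: mf_shift (measurable_Vh hgs x).
Qed.

Lemma mdens_bound : exists2 C : R, 0 < C & forall a z, weight a ->
  0 <= mdens a z <= C * (1 + `|z|) * (0 < z)%R%:R.
Proof.
have [E E0 HE] := Vh_bounds hgs; have [F F0 HF] := fin_upper f.
have [n0 [n1 _]] := good_inv hg.
exists (E * (1 + F)); first by rewrite mulr_gt0 // addr_gt0.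
move=> a z ha; rewrite /mdens; case: (ltrP 0 z) => z0; last first.
  by rewrite mulr0 big1 ?lexx // => x _; rewrite mul0r mulr0.
have t x : 0 <= a x * ((0 < z - f x)%R%:R * Vh Ps fs x (z - f x)) <= E * (1 + F) * (1 + `|z|).
  have /andP[a0 a1] := ha x.
  have U0 : 0 <= E * (1 + F) * (1 + `|z|) by rewrite !mulr_ge0 ?addr_ge0 // ltW.
  case: (ltrP 0 (z - f x)) => zf; last by rewrite mul0r mulr0 lexx.
  have /andP[v0 v1] := HE x _ zf; rewrite mul1r mulr_ge0 //= -[leRHS]mul1r; apply: ler_pM => //.
  apply: le_trans v1 _; rewrite -mulrA ler_wpM2l ?(ltW E0) // ger0_norm ?(ltW z0) //.
  have := mulr_ge0 (ltW F0) (ltW z0).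
  have := HF x; rewrite ler_norml => /andP[]; lra.
apply/andP; split.
  by apply: sumr_ge0 => x _; rewrite mul1r mulr_ge0 //; case/andP: (t x).
rewrite mulr1 -[leRHS]mul1r -[X in _ <= X * _]n1 mulr_suml; apply: ler_sum => x _.
rewrite mul1r; apply: ler_wpM2l; first exact: n0.
by case/andP: (t x).
Qed.

Lemma intg_mdens a b : weight a -> intg (fun z => (z <= b)%R%:R * mdens a z).
Proof.
move=> ha; have [C C0 HC] := mdens_bound.
apply: (@intg_le _ _ (fun z => C * (1 + `|b|) * (0 <= z <= b)%R%:R)).
- by apply: mfM; [exact: mf_le|exact: mdens_measurable].
- move=> z; have /andP[h0 h1] := HC a z ha; rewrite ger0_norm ?mulr_ge0 //.
  case: (lerP z b) => zb /=; rewrite ?andbF ?mul0r ?mulr0 // mul1r andbT; apply: le_trans h1 _.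
  case: (ltrP 0 z) => z0; last by rewrite mulr0 !mulr_ge0 ?addr_ge0 // ltW.
  rewrite (ltW z0) !mulr1 ler_wpM2l ?(ltW C0) // lerD2l !ger0_norm ?(ltW z0) //.
  by rewrite (le_trans (ltW z0)).
- exact/intgZ/intg_seg.
Qed.

(** Continuity in the level, which lets the shift [d] of the level in the sandwich be made
    harmless. *)
Lemma mlim_lip : exists2 C : R, 0 < C & forall a b b', weight a -> 0 <= b <= b' ->
  mlim P nu f a b <= mlim P nu f a b' <= mlim P nu f a b + C * (1 + b') * (b' - b).
Proof.
have [C C0 HC] := mdens_bound; exists C => // a b b' ha /andP[b0 bb].
rewrite !mlimE; have i1 := intg_mdens b ha; have i2 := intg_mdens b' ha.
apply/andP; split.
  apply: RI_le => // z; have /andP[h0 _] := HC a z ha; rewrite ler_wpM2r // ler_nat.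
  by case: (lerP z b) => // zb; rewrite (le_trans zb bb).
rewrite -lerBlDl -RIB // -RI_seg // -RIZ; last exact: intg_seg.
apply: RI_le; [exact: intgB|exact/intgZ/intg_seg|move=> z].
have /andP[h0 h1] := HC a z ha; rewrite -mulrBl.
have C1 : 0 <= C * (1 + b') by rewrite mulr_ge0 ?(ltW C0) // addr_ge0 // (le_trans b0).
case: (lerP z b) => zb; first by rewrite (le_trans zb bb) subrr mul0r mulr_ge0.
rewrite (ltW zb) /=; case: (lerP z b') => zb' /=; last by rewrite subrr mul0r mulr0.
rewrite subr0 mul1r mulr1; apply: le_trans h1 _.
have z0 : 0 < z by apply: le_lt_trans zb.
by rewrite z0 mulr1 ler_wpM2l ?(ltW C0) // lerD2l ger0_norm // ltW.
Qed.

End LimitMass.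

Lemma mid_mul2 p n : (1 < p)%N -> (p <= n)%N -> ((mid p n).+1 * p <= 2 * n.+1)%N.
Proof. by move=> p1 np; have [h _ _] := mid_facts p1 n; rewrite mulSn; lia. Qed.

(** * Limit for step functions *)

Section StepLimit.
Variables (R : realType) (X : finType) (P : X -> X -> R) (nu f : X -> R).
Hypothesis hg : good P nu f.
Let hP := good_stoch hg.
Local Notation Tn := (Tn P f).
Local Notation Kn := (Kn P f).
Local Notation survn := (survn P f).
Local Notation Qf := (Qf P f).
Local Notation s2 := (sigma2 P nu f).
Local Notation N n := (sq R n).

Lemma Kn_step_split k j m a b x y : 0 < y ->
  Kn (k + (j + m)) (step_at a b) x y = Kn k (Kn j (Qf m a b)) x y.
Proof. by move=> y0; rewrite KnD; apply: eq_Kn => // z w w0; rewrite KnD Kn_Qf. Qed.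

(** With the level raised by [d] and the centre moved by [d / 2], monotonicity bounds [Qf m a b] by
    the smoothed function. Dropping killing in the middle only increases; the mirror term to be
    added back is at most [U] times the chance that the walk from [- w] ends above [- d], up to
    [eta]. *)
Lemma sandwich_up k j m a b d A eta U x y : weight a -> 0 < d -> 0 < A -> 0 <= eta <= 1 ->
  RI (fun w : R => (A * (d / 2) < `|w|)%R%:R * fej w) <= eta ->
  (forall z v, Qf m a (b + d) z v <= U) -> 0 < y ->
  (1 - eta) * Kn (k + (j + m)) (step_at a b) x y <=
  Lam P f k j (fun z u => smooth A (d / 2) (Qf m a (b + d) z) u) x y +
  U * (eta * survn k x y + Kn k (fun x1 w => Tn j (fun _ u => (- d <= u)%R%:R) x1 (- w)) x y).
Proof.
move=> ha d0 A0 /andP[eta0 eta1] tl QU y0.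
pose G z u := smooth A (d / 2) (Qf m a (b + d) z) u.
have Q01 z v : 0 <= Qf m a (b + d) z v <= U by rewrite QU (Qf_ge0 hg).
have U0 : 0 <= U by have /andP[h0 h1] := Q01 x 0; exact: le_trans h1.
have mQ z : measurable_fun setT (Qf m a (b + d) z) by exact: Qf_measurable.
have g1 z u : (1 - eta) * Qf m a b z u <= G z u.
  rewrite mulrC; apply: (smooth_ge A0 tl (mQ z) (Q01 z)); first exact: (Qf_ge0 hg).
  move=> v; rewrite ler_norml => /andP[v1 v2].
  have := @Qf_mono _ _ _ _ _ hg m a b d z u (v - u) ha; rewrite [u + _]addrC subrK; apply.
  by apply/andP; split; lra.
have g2 z u : G z u <= U * ((- d <= u)%R%:R + eta).
  rewrite mulrDr; case: (lerP (- d) u) => du.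
    rewrite mulr1; apply: (smooth_le A0 tl (mQ z) (Q01 z)) => // v _; exact: QU.
  rewrite mulr0; apply: (smooth_le A0 tl (mQ z) (Q01 z)) => // v.
  rewrite ler_norml => /andP[v1 v2]; rewrite /StepBounds.Qf ltNge (_ : v <= 0) ?mul0r //; lra.
rewrite Kn_step_split // -KnZ /Lam -Kn_cst mulrDr.
rewrite -[U * Kn k (fun _ _ => eta) x y]KnZ -[U * Kn k _ x y]KnZ -!Kn_add; apply: ler_Kn => // z w w0.
apply: (@le_trans _ _ (Tn j G z w)).
  apply: (@le_trans _ _ (Tn j (fun z u => (1 - eta) * Qf m a b z u) z w)); last exact: ler_Tn.
  rewrite TnZ ler_wpM2l ?subr_ge0 //; apply: ler_Kn_Tn => // z' u; exact: (Qf_ge0 hg).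
rewrite -[leLHS](subrK (Tn j G z (- w))) lerD2l.
apply: le_trans (ler_Tn (H := fun z u => U * ((- d <= u)%R%:R + eta)) _ _ _ _ _ _) _ => //.
by rewrite TnZ Tn_add Tn_cst // mulrDr addrC.
Qed.

(** Mirror choice: level lowered by [d], centre moved by [- (d / 2)]. The reflected term has a
    favourable sign and is dropped; passing from the free to the killed kernel costs [U] times the
    exit probability. *)
Lemma sandwich_lo k j m a b d A eta U x y : weight a -> 0 < d -> 0 < A -> 0 <= eta ->
  RI (fun w : R => (A * (d / 2) < `|w|)%R%:R * fej w) <= eta ->
  (forall z v, Qf m a b z v <= U) -> 0 < y ->
  Lam P f k j (fun z u => smooth A (- (d / 2)) (Qf m a (b - d) z) u) x y <=
  Kn (k + (j + m)) (step_at a b) x y +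
  U * (eta * survn k x y + Kn k (fun x1 w => 1 - survn j x1 w) x y).
Proof.
move=> ha d0 A0 eta0 tl QU y0.
pose G z u := smooth A (- (d / 2)) (Qf m a (b - d) z) u.
have mono z u v : 0 <= u <= d -> Qf m a (b - d) z v <= Qf m a b z (v + u).
  by move=> ud; have := @Qf_mono _ _ _ _ _ hg m a (b - d) d z v u ha ud; rewrite subrK.
have Q01 z v : 0 <= Qf m a (b - d) z v <= U.
  rewrite (Qf_ge0 hg) //=; apply: le_trans (QU z (v + 0)); apply: mono; by rewrite lexx ltW.
have U0 : 0 <= U by have /andP[h0 h1] := Q01 x 0; exact: le_trans h1.
have mQ z : measurable_fun setT (Qf m a (b - d) z) by exact: Qf_measurable.
have g0 z u : 0 <= G z u.
  apply: RI_ge0 => v; apply: mulr_ge0; first exact: (Qf_ge0 hg).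
  by apply: mulr_ge0; [exact: ltW|exact: fej_ge0].
have g1 z u : G z u <= Qf m a b z u + U * eta.
  apply: (smooth_le A0 tl (mQ z) (Q01 z)); first exact: (Qf_ge0 hg).
  move=> v; rewrite ler_norml => /andP[v1 v2].
  by have := mono z (u - v) v; rewrite [v + _]addrC subrK; apply; apply/andP; split; lra.
rewrite Kn_step_split // /Lam -Kn_cst mulrDr.
rewrite -[U * Kn k (fun _ _ => eta) x y]KnZ -[U * Kn k _ x y]KnZ -!Kn_add; apply: ler_Kn => // z w w0.
apply: (@le_trans _ _ (Tn j G z w)); first by rewrite gerBl Tn_ge0.
apply: (@le_trans _ _ (Tn j (fun z u => Qf m a b z u + U * eta) z w)); first exact: ler_Tn.
rewrite Tn_add Tn_cst //= [leRHS]addrCA [leLHS]addrC lerD2l.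
rewrite -lerBlDl.
have -> : U * (1 - survn j z w) = Ex P z j (fun s => U * (1 - (surv f w s)%:R)).
  rewrite ExZ; congr (_ * _); rewrite -[in LHS](Ex_cst hP z j 1) -mulN1r /KilledWalk.survn /KilledWalk.Kn -ExZ -Ex_add.
  by apply: eq_Ex => s _; ring.
rewrite -mulN1r /KilledWalk.Kn -ExZ -Ex_add; apply: ler_Ex => // s _.
case: (surv f w s); first by rewrite mul1r mulN1r !subrr mulr0.
by rewrite mul0r mulr0 addr0 subr0 mulr1.
Qed.

Lemma small_pos (B e : R) : 0 <= B -> 0 < e -> exists2 t : R, 0 < t <= 1 & B * t <= e.
Proof.
move=> B0 e0; have B1 : 0 < B + 1 by lra.
exists (Num.min 1 (e / (B + 1))); first by rewrite lt_min ltr01 divr_gt0 //= ge_min lexx.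
apply: (@le_trans _ _ (B * (e / (B + 1)))); first by rewrite ler_wpM2l // ge_min lexx orbT.
by rewrite mulrA ler_pdivrMr // mulrC ler_wpM2l ?(ltW e0) //; lra.
Qed.

(** Order of choice: [eta], [e'] and [d] from [e]; [p] from [e']; [A] from [eta] and [d]; [n] last.
    Since [p] and [A] do not occur in the limits of the two bounds, no further passage to the limit
    is needed. *)
Lemma step_limit a b x y : weight a -> 0 < b -> 0 < y ->
  N n ^+ 3 * Kn n.+1 (step_at a b) x y @[n --> \oo] -->
  2 / (Num.sqrt (2 * pi) * Num.sqrt s2 ^+ 3) * (Vh P f x y * mlim P nu f a b).
Proof.
move=> ha b0 y0; set cst := 2 / _; have [_ _ _ _ s20] := hg; have pi0 := @pi_gt0 R.
have cst0 : 0 <= cst by rewrite divr_ge0 // mulr_ge0 ?exprn_ge0 ?sqrtr_ge0.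
have [Cs Cs0 HCs] := Qf_sup_bound hg; have [Cv Cv0 HCv] := survn_bound hg.
have [Ck Ck0 HCk] := Kn_step_bound hg; have [Cm Cm0 HCm] := mlim_lip hg.
have [Ch Ch0 HCh] := hit_bounds hg.
have [E E0 HE] := Vh_bounds hg; have /andP[V0 _] := HE x y y0.
pose kap := cst * Vh P f x y; have kap0 : 0 <= kap by rewrite mulr_ge0.
pose B1 := 8 * (Cs * (2 + b) ^+ 2).
have B10 : 0 < B1 by rewrite !mulr_gt0 ?exprn_gt0 // addr_gt0.
have y1 : 0 < 1 + y by rewrite addr_gt0.
have B1y : 0 <= B1 * (1 + y) := mulr_ge0 (ltW B10) (ltW y1).
pose B2 := Ck * (1 + y) * (1 + b) ^+ 2.
have B20 : 0 <= B2 by apply: mulr_ge0; [rewrite mulr_ge0 // ltW|exact: sqr_ge0].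
apply/cvgrPdist_le => e e0; have e8 : 0 < e / 8 by rewrite divr_gt0.
have [|eta /andP[eta0 eta1] Heta] := @small_pos (B1 * (1 + y) * (3 * Cv) + B2) _ _ e8.
  by apply: addr_ge0 => //; apply: mulr_ge0 => //; rewrite mulr_ge0 // ltW.
have [e' /andP[e'0 _] He'] := @small_pos (B1 * (1 + y)) _ B1y e8.
have [|d0' /andP[d'0 d'1] Hd'] := @small_pos (kap * (Cm * (2 + b))) _ _ e8.
  by rewrite mulr_ge0 // mulr_ge0 ?(ltW Cm0) // addr_ge0 // ltW.
pose d := Num.min d0' b; have d0 : 0 < d by rewrite lt_min d'0.
have dd : d <= d0' by rewrite ge_min lexx.
have d1 : d <= 1 by apply: le_trans dd d'1.
have db : d <= b by rewrite ge_min lexx orbT.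
have Hd : kap * (Cm * (2 + b) * d) <= e / 8.
  rewrite mulrA; apply: le_trans Hd'; apply: ler_wpM2l => //.
  by rewrite mulr_ge0 // mulr_ge0 ?(ltW Cm0) // addr_ge0 // ltW.
have d2 : 0 < d / 2 by rewrite divr_gt0.
have [p p1 Hp] := Kn_hit_small hg Ch0 e'0.
have [A A0' HA] := @fej_tail R (d / 2) eta d2 eta0.
have A0 : 0 < A%:R :> R by rewrite ltr0n.
have [N1 HN1] := Hp d (ltW d0); have [N2 HN2] := Hp 0 (lexx _).
have rs : (1 - p%:R^-1) / 2 + p%:R^-1 + (1 - p%:R^-1) / 2 = 1 :> R.
  by have := splitr (1 - p%:R^-1 : R); lra.
have f1 n : (n.+1 <= 8 * (ini p n).+1)%N by case: (split_facts p1 n).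
have f2 n : (n.+1 <= 8 * (fin p n).+1)%N by case: (split_facts p1 n).
have LIM b' c : 0 <= b' -> N n ^+ 3 * Lam P f (ini p n) (mid p n)
    (fun z u => smooth A%:R c (Qf (fin p n).+1 a b' z) u) x y @[n --> \oo] -->
    cst * (Vh P f x y * mlim P nu f a b').
  move=> b'0; apply: (odd_limit hg (cvg_oo_mul f1) (cvg_oo_mul (mid_mul p1)) (cvg_oo_mul f2)
   (ratio_cvg (ini_est R p1)) (ratio_cvg (mid_est R p1)) (ratio_cvg (fin_est R p1)) rs (mid_mul p1) f2 ha) => //.
have bd0 : 0 <= b + d by rewrite addr_ge0 // ltW.
have bd1 : 0 <= b - d by rewrite subr_ge0.
move: (LIM (b + d) (d / 2) bd0) => /cvgrPdist_le /(_ _ e8) L1.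
move: (LIM (b - d) (- (d / 2)) bd1) => /cvgrPdist_le /(_ _ e8) L2.
case: L1 => M1 _ L1; case: L2 => M2 _ L2.
exists (maxn (maxn M1 M2) (maxn (maxn N1 N2) p)) => // n /=.
rewrite !geq_max => /andP[/andP[nM1 nM2] /andP[/andP[n1 n2] np]].
move: (L1 n nM1) (L2 n nM2) => /= l1 l2.
have jp := mid_mul2 p1 np.
have sn := sq_gt0 R n; have ss := sq_sqr R n.
(* Supremum of the last part at levels up to [b + 1]; together with survival over the first part it
   is of the exact order $n^{-3/2}$, so the small factors decide. *)
pose U := B1 / n.+1%:R.
have QU b' z v : 0 <= b' <= b + 1 -> Qf (fin p n).+1 a b' z v <= U.
  move=> /andP[b'0 b'1]; apply: le_trans (HCs _ _ _ _ _ ha b'0) _.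
  rewrite /U /B1 ler_pdivrMr // mulrAC ler_pdivlMr //.
  have m1 : n.+1%:R <= 8 * (fin p n).+2%:R :> R by rewrite -(natrM _ 8) ler_nat (leq_trans (f2 n)) // leq_mul2l leqW.
  have q1 : Cs * (1 + b') ^+ 2 <= Cs * (2 + b) ^+ 2.
    by rewrite ler_wpM2l ?(ltW Cs0) // ler_sqr ?nnegrE ?addr_ge0 ?(ltW b0) //; lra.
  have q0 : 0 <= Cs * (1 + b') ^+ 2 by apply: mulr_ge0; [exact: ltW|exact: sqr_ge0].
  apply: le_trans (ler_pM q0 _ q1 m1) _ => //.
  by rewrite [leLHS](_ : _ = 8 * (Cs * (2 + b) ^+ 2) * (fin p n).+2%:R) //; ring.
have U0 : 0 <= U by rewrite divr_ge0 // ltW.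
have nE : n.+1 = (ini p n + (mid p n + (fin p n).+1))%N by case: (split_facts p1 n).
have QU1 z v : Qf (fin p n).+1 a (b + d) z v <= U by apply: QU; rewrite bd0 lerD2l.
have QU2 z v : Qf (fin p n).+1 a b z v <= U by apply: QU; rewrite (ltW b0) lerDl ler01.
have eta01 : 0 <= eta <= 1 by rewrite ltW.
have UP := sandwich_up (ini p n) (mid p n) x ha d0 A0 eta01 HA QU1 y0.
have LO := sandwich_lo (ini p n) (mid p n) x ha d0 A0 (ltW eta0) HA QU2 y0.
rewrite -nE in UP LO.
have sk : survn (ini p n) x y <= 3 * Cv * (1 + y) / N n.
  apply: le_trans (HCv _ x y y0) _; rewrite ler_pdivrMr ?sq_gt0 // mulrAC ler_pdivlMr //.
  rewrite [leRHS](_ : _ = Cv * (1 + y) * (3 * N (ini p n))); last by ring.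
  by rewrite ler_wpM2l ?mulr_ge0 ?(ltW Cv0) ?(ltW y1) // sq_le3.
have h1 : Kn (ini p n) (fun x1 w => Tn (mid p n) (fun _ u => (- d <= u)%R%:R) x1 (- w)) x y <=
    e' * (1 + y) / N n.
  apply: (HN1 n n1 _ (mid p n)) => // z u u0.
    rewrite -[leRHS](Ex_cst hP z (mid p n)); apply: ler_Ex => // s _; by rewrite lern1 leq_b1.
  have ud : 0 < u - d by rewrite subr_gt0.
  apply: le_trans (HCh (mid p n) z _ ud).2.
  apply: le_trans (Tn_le_hit _ hP _ _ u0); rewrite le_eqVlt; apply/orP; left; apply/eqP.
  apply: eq_Ex => s _; congr (_%:R); rewrite (_ : psum (fun x => - f x) s = - psum f s).
    by congr nat_of_bool; apply/idP/idP; lra.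
  by rewrite /psum sumrN.
have h2 : Kn (ini p n) (fun x1 w => 1 - survn (mid p n) x1 w) x y <= e' * (1 + y) / N n.
  apply: (HN2 n n2 _ (mid p n)) => // z u u0; first by rewrite gerBl survn_ge0.
  by rewrite subr0; exact: (HCh (mid p n) z _ u0).1.
set KK := Kn n.+1 (step_at a b) x y in UP LO *.
have N3 : 0 < N n ^+ 3 by rewrite exprn_gt0.
have err (q : R) : q <= e' * (1 + y) / N n -> N n ^+ 3 * (U * (eta * survn (ini p n) x y + q)) <= B1 * (1 + y) * (3 * Cv) * eta + B1 * (1 + y) * e'.
  move=> hq.
  apply: (@le_trans _ _ (N n ^+ 3 * (U * (eta * (3 * Cv * (1 + y) / N n) + e' * (1 + y) / N n)))).
    rewrite ler_wpM2l ?(ltW N3) // ler_wpM2l // lerD // ler_wpM2l // ltW //.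
  rewrite /U -ss le_eqVlt; apply/orP; left; apply/eqP.
  by field; rewrite gt_eqF.
have KK0 : 0 <= KK by apply: (Kn_step_ge0 hg).
(* The a priori bound turns the factor $1-\eta$ of the upper sandwich into an additive error. *)
have KB : N n ^+ 3 * KK <= B2.
  apply: le_trans (ler_wpM2l (ltW N3) (HCk n.+1 a b x y ha (ltW b0) y0)) _.
  rewrite -/B2 mulrA ler_pdivrMr ?mulr_gt0 ?sq_gt0 // mulrC ler_wpM2l //.
  rewrite exprSr ss; apply: ler_pM => //; [exact: ltW|by rewrite ler_nat|exact: sq_homo].
have m1 : kap * mlim P nu f a (b + d) <= kap * mlim P nu f a b + e / 8.
  have /andP[_ h] := HCm a b (b + d) ha (introT andP (conj (ltW b0) (ler_wpDr (ltW d0) (lexx b)))).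
  apply: le_trans (ler_wpM2l kap0 h) _; rewrite mulrDr lerD2l; apply: le_trans Hd.
  rewrite ler_wpM2l //; rewrite (_ : b + d - b = d); last by ring.
  by rewrite ler_wpM2r ?(ltW d0) // ler_wpM2l ?(ltW Cm0) //; lra.
have m2 : kap * mlim P nu f a b <= kap * mlim P nu f a (b - d) + e / 8.
  have bdb : 0 <= b - d <= b by rewrite bd1 gerBl ltW.
  have /andP[_ h] := HCm a (b - d) b ha bdb.
  apply: le_trans (ler_wpM2l kap0 h) _; rewrite mulrDr lerD2l; apply: le_trans Hd.
  rewrite ler_wpM2l //; rewrite (_ : b - (b - d) = d); last by ring.
  by rewrite ler_wpM2r ?(ltW d0) // ler_wpM2l ?(ltW Cm0) //; lra.
have kE t : cst * (Vh P f x y * t) = kap * t by rewrite mulrA.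
rewrite !kE in l1 l2 *.
have u1 := ler_wpM2l (ltW N3) UP; have u2 := ler_wpM2l (ltW N3) LO.
rewrite mulrDr in u1; rewrite mulrDr in u2.
have u3 := err _ h1; have u4 := err _ h2.
have u5 : eta * (N n ^+ 3 * KK) <= eta * B2 by rewrite ler_wpM2l // ltW.
move: l1 l2; rewrite !ler_norml => /andP[l11 l12] /andP[l21 l22].
have u6 : N n ^+ 3 * ((1 - eta) * KK) = N n ^+ 3 * KK - eta * (N n ^+ 3 * KK) by ring.
rewrite u6 in u1.
move: u1 u2 u3 u4 u5 l11 l12 l21 l22 m1 m2 Heta He'.
move: (N n ^+ 3 * KK) (N n ^+ 3 * Lam _ _ _ _ _ _ _) (N n ^+ 3 * Lam _ _ _ _ _ _ _) (N n ^+ 3 * (U * _)) (N n ^+ 3 * (U * _)) => w1 w2 w3 w4 w5.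
move=> u1 u2 u3 u4 u5 l11 l12 l21 l22 m1 m2 Heta He'.
have Heta' : 0 <= B1 * (1 + y) * (3 * Cv) * eta.
  by apply: mulr_ge0; [apply: mulr_ge0 => //; rewrite mulr_ge0 // ltW|exact: ltW].
have Heta2 : 0 <= eta * B2 by rewrite mulr_ge0 // ltW.
move: Heta Heta' Heta2; rewrite mulrDl [B2 * eta]mulrC.
move: u1 u2 u3 u4 u5 l11 l12 l21 l22 m1 m2 He'; clear -e0.
move: (eta * w1) (eta * B2) (_ * eta) (_ * e') (kap * _) (kap * _) (kap * _) => *.
by apply/andP; split; lra.
Qed.

End StepLimit.

(** * Uniform continuity and dyadic decay *)

Section RealFacts.
Variable R : realType.

Lemma heine (g : R -> R) (B e : R) : continuous g -> 0 < e ->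
  exists i : nat, forall u v, 0 <= u <= B -> `|u - v| <= i.+1%:R^-1 -> `|g u - g v| <= e.
Proof.
move=> cg e0; pose Pr (i : nat) (u : R) := forall v, `|u - v| <= i.+1%:R^-1 -> `|g u - g v| <= e.
suff : \forall i \near \oo, `[0, B]%classic `<=` Pr i.
  case=> i _ H; exists i => u v uB; apply: (H i) => //=.
have /compact_near_coveringP cov := @segment_compact R 0 B.
apply: cov => u0 _.
have e2 : 0 < e / 2 by rewrite divr_gt0.
have := cg u0 => /cvgrPdist_le /(_ _ e2) /nbhs_ballP [dl /= dl0 H].
have d4 : 0 < dl / 4 by rewrite divr_gt0.
have hi : \forall i \near \oo, i.+1%:R^-1 <= dl / 4.
  move/cvgrPdist_le: (@cvg_harmonic R) => /(_ _ d4); apply: filterS => i.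
  by rewrite sub0r normrN /harmonic /= => h; exact: le_trans (ler_norm _) h.
near=> u i => /= v uv.
have a1 : `|u0 - u| <= dl / 4 by near: u; apply: near_dist_le.
have a2 : i.+1%:R^-1 <= dl / 4 by near: i.
have h1 : `|g u0 - g u| <= e / 2 by apply: H; rewrite /ball /=; lra.
have h2 : `|g u0 - g v| <= e / 2.
  apply: H; rewrite /ball /= (_ : u0 - v = (u0 - u) + (u - v)); last by ring.
  apply: le_lt_trans (ler_normD _ _) (le_lt_trans (lerD a1 (le_trans uv a2)) _); move: dl0; lra.
rewrite (_ : g u - g v = (g u0 - g v) - (g u0 - g u)); last by ring.
by apply: le_trans (ler_normB _ _) _; lra.
Unshelve. all: by end_near. Qed.

Definition dya (i : nat) : R := (2 ^ i)%:R.

Lemma dyaS i : dya i.+1 = 2 * dya i. Proof. by rewrite /dya expnS natrM. Qed.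
Lemma dya_ge1 i : 1 <= dya i. Proof. by rewrite ler1n expn_gt0. Qed.
Lemma dya_gt i : i%:R < dya i. Proof. by rewrite ltr_nat ltn_expl. Qed.
Lemma dya_homo i i' : (i <= i')%N -> dya i <= dya i'.
Proof. by move=> h; rewrite ler_nat leq_exp2l. Qed.

(** Monotone convergence along dyadic truncations. *)
Lemma intg_exhaust (h : R -> R) (C : R) : measurable_fun setT h -> (forall z, 0 <= h z) ->
  (forall i, intg (fun z => (z <= dya i)%R%:R * h z)) ->
  (forall i, RI (fun z => (z <= dya i)%R%:R * h z) <= C) -> intg h.
Proof.
move=> mh h0 ih hC; apply/integrableP; split; first exact/measurable_EFinP.
pose g n z := ((z <= dya n)%R%:R * h z)%:E.
have mono : forall z, setT z -> {homo g^~ z : n m / (n <= m)%N >-> (n <= m)%E}.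
  move=> z _ n m nm; rewrite lee_fin ler_wpM2r // ler_nat.
  by case: (lerP z (dya n)) => // zn; rewrite (le_trans zn (dya_homo nm)).
have mg n : measurable_fun setT (g n).
  by apply/measurable_EFinP; exact: (intg_measurable (ih n)).
have gp n z : setT z -> (0 <= g n z)%E by move=> _; rewrite lee_fin mulr_ge0.
have cv := cvg_monotone_convergence (mu := @lebesgue_measure R) measurableT mg gp mono.
have limE z : limn (g^~ z) = (h z)%:E.
  apply: cvg_lim => //; apply: cvg_near_cst; exists (Num.bound `|z|) => // n /= zn.
  rewrite /g (_ : z <= dya n) ?mul1r //; apply: le_trans (ler_norm z) _.
  apply: le_trans (ltW (archi_boundP (normr_ge0 z))) _; apply: le_trans (ltW (dya_gt n)).
  by rewrite ler_nat.
apply: (@le_lt_trans _ _ C%:E); last by rewrite ltry.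
rewrite (_ : (\int[_]_x _)%E = (\int[lebesgue_measure]_(x in setT) limn (g^~ x))%E); last first.
  by apply: eq_integral => z _; rewrite limE /= ger0_norm.
rewrite -(cvg_lim _ cv) //; apply: lime_le; first by apply/cvg_ex; eexists; exact: cv.
by apply: nearW => n; rewrite RI_EFin // lee_fin.
Qed.

(** The mass up to $2^{i+1}$ grows like $4^i$, and the decay $(r/4)^i$ beats it by a geometric
    factor; this is what the exponent $2+\varepsilon$ is for. *)
Lemma dyadic_sum (r : R) i0 I : 0 < r < 1 ->
  \sum_(i0 <= i < I) (r / 4) ^+ i * (1 + dya i.+1) ^+ 2 <= 16 * r ^+ i0 / (1 - r).
Proof.
move=> /andP[r0 r1]; have q0 : 0 < 1 - r by rewrite subr_gt0.
have t i : (r / 4) ^+ i * (1 + dya i.+1) ^+ 2 <= 16 * r ^+ i.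
  have e1 : dya i ^+ 2 = 4 ^+ i by rewrite /dya -natrX -expnM mulnC expnM natrX.
  rewrite expr_div_n mulrAC ler_pdivrMr ?exprn_gt0 //.
  have := dya_ge1 i; rewrite dyaS => d1.
  have h : (1 + 2 * dya i) ^+ 2 <= 16 * 4 ^+ i by rewrite -e1 !expr2; nra.
  apply: le_trans (ler_wpM2l (exprn_ge0 i (ltW r0)) h) _; lra.
case: (leqP i0 I) => iI; last first.
  by rewrite big_geq ?(ltnW iI) // divr_ge0 ?(ltW q0) // mulr_ge0 // exprn_ge0 // ltW.
apply: (@le_trans _ _ (\sum_(i0 <= i < I) 16 * r ^+ i)); first by apply: ler_sum_nat.
suff -> : \sum_(i0 <= i < I) 16 * r ^+ i = 16 * (r ^+ i0 - r ^+ I) / (1 - r).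
  apply: ler_wpM2r; first by rewrite invr_ge0 ltW.
  by apply: ler_wpM2l => //; rewrite gerBl exprn_ge0 // ltW.
rewrite -(subnK iI); elim: (I - i0)%N => [|k IH]; first by rewrite add0n big_geq // subrr mulr0 mul0r.
rewrite addSn big_nat_recr ?leq_addl //= IH exprS; field; exact: lt0r_neq0.
Qed.

(** Each layer between $2^i$ and $2^{i+1}$ is enlarged to the full step [u <= dya i.+1], the only
    kind of set for which bounds are at hand. *)
Lemma decay_pointwise (gam : R -> R) (C r : R) i0 I u : (i0 <= I)%N -> 0 <= C -> 0 < r ->
  (forall z, 0 <= gam z) -> (forall i z, dya i <= z -> gam z <= C * (r / 4) ^+ i) ->
  (dya i0 < u)%R%:R * gam u <=
  \sum_(i0 <= i < I) (C * (r / 4) ^+ i) * (u <= dya i.+1)%R%:R + (dya I < u)%R%:R * gam u.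
Proof.
move=> i0I C0 r0 g0 gd; have q0 i : 0 <= C * (r / 4) ^+ i.
  by rewrite mulr_ge0 // exprn_ge0 // divr_ge0 // ltW.
rewrite -(subnK i0I); elim: (I - i0)%N => [|k IH].
  by rewrite add0n big_geq // add0r.
rewrite addSn big_nat_recr ?leq_addl //=; apply: le_trans IH _; rewrite -addrA lerD2l.
case: (ltrP (dya (k + i0)) u) => h; last first.
  by rewrite mul0r addr_ge0 // mulr_ge0.
rewrite mul1r; case: (lerP u (dya (k + i0).+1)) => h2; last by rewrite mulr0 add0r mul1r.
by rewrite mulr1 mul0r addr0; apply: gd; exact: ltW.
Qed.

End RealFacts.

(** * From step functions to continuous tests *)

Section TestLimit.
Variables (R : realType) (X : finType) (P : X -> X -> R) (nu f : X -> R).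
Hypothesis hg : good P nu f.
Let hP := good_stoch hg.
Local Notation Kn := (Kn P f).
Local Notation s2 := (sigma2 P nu f).
Local Notation N n := (sq R n).
Variables (a : X -> R) (x : X) (y : R).
Hypotheses (ha : weight a) (y0 : 0 < y).
Local Notation md := (mdens P nu f a).
Let kap := 2 / (Num.sqrt (2 * pi) * Num.sqrt s2 ^+ 3) * Vh P f x y.
(** Linear and monotone in [h], which is all that the approximation uses. *)
Let Ph n (h : R -> R) := N n ^+ 3 * Kn n.+1 (fun z u => a z * h u) x y.

Let kap0 : 0 <= kap.
Proof.
have [E E0 HE] := Vh_bounds hg; have /andP[V0 _] := HE x y y0.
by rewrite mulr_ge0 // divr_ge0 // mulr_ge0 ?exprn_ge0 ?sqrtr_ge0.
Qed.

Let N30 n : 0 <= N n ^+ 3. Proof. by rewrite exprn_ge0 // ltW // sq_gt0. Qed.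

Lemma PhZ n c h : Ph n (fun u => c * h u) = c * Ph n h.
Proof.
rewrite /Ph mulrCA; congr (_ * _); rewrite -KnZ; apply: eq_Knw => z u; ring.
Qed.

Lemma PhD n h h' : Ph n (fun u => h u + h' u) = Ph n h + Ph n h'.
Proof.
rewrite /Ph -mulrDr; congr (_ * _); rewrite -Kn_add; apply: eq_Knw => z u; ring.
Qed.

Lemma Ph_sum n (I : Type) (s : seq I) (h : I -> R -> R) :
  Ph n (fun u => \sum_(i <- s) h i u) = \sum_(i <- s) Ph n (h i).
Proof.
rewrite /Ph -mulr_sumr; congr (_ * _); rewrite -Kn_sum; apply: eq_Knw => z u.
by rewrite mulr_sumr.
Qed.

Lemma Ph_le n h h' : (forall u, 0 < u -> h u <= h' u) -> Ph n h <= Ph n h'.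
Proof.
move=> hh; apply: ler_wpM2l => //; apply: ler_Kn => // z u u0.
by have /andP[a0 _] := ha z; rewrite ler_wpM2l // hh.
Qed.

Lemma Ph_ge0 n h : (forall u, 0 < u -> 0 <= h u) -> 0 <= Ph n h.
Proof.
move=> hh; apply: mulr_ge0 => //; apply: Kn_ge0 => // z u u0.
by have /andP[a0 _] := ha z; rewrite mulr_ge0 // hh.
Qed.

Lemma Ph_step_bound : exists2 C : R, 0 < C & forall n b, 0 <= b ->
  Ph n (fun u => (u <= b)%R%:R) <= C * (1 + b) ^+ 2.
Proof.
have [C C0 HC] := Kn_step_bound hg; exists (C * (1 + y)); first by rewrite mulr_gt0 // addr_gt0.
move=> n b b0; apply: le_trans (ler_wpM2l (N30 n) (HC n.+1 a b x y ha b0 y0)) _.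
have B0 : 0 <= C * (1 + y) * (1 + b) ^+ 2.
  by apply: mulr_ge0; [rewrite mulr_ge0 ?(ltW C0) // addr_ge0 // ltW|exact: sqr_ge0].
rewrite mulrA ler_pdivrMr ?mulr_gt0 ?sq_gt0 // mulrC ler_wpM2l //.
rewrite exprSr sq_sqr; apply: ler_pM => //; [exact: ltW (sq_gt0 R n)|by rewrite ler_nat|exact: sq_homo].
Qed.

Lemma Ph_cst_le n c : 0 <= c -> Ph n (fun=> c) <= c * N n ^+ 3.
Proof.
move=> c0; rewrite mulrC; apply: ler_wpM2l => //.
have h z (u : R) : a z * c <= c by have /andP[_ a1] := ha z; rewrite ler_piMl.
apply: (@le_trans _ _ (Kn n.+1 (fun _ _ => c) x y)).
  by apply: ler_Kn => // z u _; exact: h.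
by rewrite Kn_cst // ler_piMr // survn_le1.
Qed.

Lemma Ph_step b : 0 <= b -> Ph n (fun u => (u <= b)%R%:R) @[n --> \oo] --> kap * mlim P nu f a b.
Proof.
rewrite le_eqVlt => /predU1P[<-|b0]; last first.
  by have := @step_limit _ _ _ _ _ hg a b x y ha b0 y0; rewrite mulrA.
rewrite (_ : (fun n => _) = fun=> 0).
  rewrite mlimE (_ : (fun z => _) = fun=> 0) ?RI0 ?mulr0; first exact: cvg_cst.
  apply: funext => z; case: (lerP z 0) => z0; last by rewrite mul0r.
  rewrite /mdens big1 ?mulr0 // => v _; by rewrite ltNge z0 mul0r mulr0.
apply: funext => n; apply/eqP; rewrite eq_le Ph_ge0 // andbT.
apply: (@le_trans _ _ (Ph n (fun=> 0))); last by have := @Ph_cst_le n 0 (lexx _); rewrite mul0r.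
by apply: Ph_le => u; case: (lerP u 0).
Qed.

Lemma intg_md_itv (s t : R) (g : R -> R) G : measurable_fun setT g -> (forall z, `|g z| <= G) ->
  intg (fun z => (s < z <= t)%R%:R * g z * md z).
Proof.
move=> mg gG; have [C C0 HC] := mdens_bound hg.
apply: (@intg_le _ _ (fun z => G * ((z <= t)%R%:R * md z))).
- apply: mfM; last exact: (mdens_measurable hg).
  apply: mfM => //; apply: mf_bool; apply: mf_andb; first exact: measurable_fun_ltr.
  exact: measurable_fun_ler.
- move=> z; have /andP[m0 _] := HC a z ha; rewrite -mulrA mulrCA normrM; apply: ler_pM => //.
  rewrite normrM (ger0_norm m0) ger0_norm // ler_wpM2r // ler_nat.
  by case: (s < z) => //=; case: (z <= t).
- by apply: intgZ; exact: (intg_mdens hg).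
Qed.

Lemma itv_ind (s t u : R) : s <= t -> (s < u <= t)%R%:R = (u <= t)%R%:R - (u <= s)%R%:R :> R.
Proof.
move=> st; case: (lerP u s) => us /=; first by rewrite (le_trans us st) subrr.
by rewrite subr0.
Qed.

Lemma Ph_itv s t : 0 <= s -> s <= t -> Ph n (fun u => (s < u <= t)%R%:R) @[n --> \oo] -->
  kap * RI (fun z => (s < z <= t)%R%:R * md z).
Proof.
move=> s0 st; have t0 : 0 <= t by exact: le_trans st.
have -> : RI (fun z => (s < z <= t)%R%:R * md z) = mlim P nu f a t - mlim P nu f a s.
  rewrite !mlimE -RIB; try exact: (intg_mdens hg).
  by congr RI; apply: funext => z; rewrite itv_ind // mulrBl.
rewrite mulrBr (_ : (fun n => _) = fun n => Ph n (fun u => (u <= t)%R%:R) - Ph n (fun u => (u <= s)%R%:R)).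
  by apply: cvgB; exact: Ph_step.
apply: funext => n; rewrite -mulN1r -PhZ -PhD; congr (Ph n _).
by apply: funext => u; rewrite itv_ind // mulN1r.
Qed.

Variables (gam : R -> R) (C r c : R).
Hypotheses (cg : continuous gam) (g0 : forall z, 0 <= gam z) (gC : forall z, gam z <= C)
  (r01 : 0 < r < 1) (gd : forall i z, dya R i <= z -> gam z <= C * (r / 4) ^+ i) (c0 : 0 <= c).

Let mgam : measurable_fun setT gam. Proof. exact: continuous_measurable_fun. Qed.
Let C0 : 0 <= C. Proof. exact: le_trans (g0 0) (gC 0). Qed.
Let gCn z : `|gam z| <= C. Proof. by rewrite ger0_norm. Qed.

(** On [q] equal cells [gam] is replaced by its value at the left end, a combination of steps; the
    error is uniform because both sides give bounded mass to $(c,B]$. *)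
Lemma Ph_bounded B : c < B -> Ph n (fun u => (c < u <= B)%R%:R * gam u) @[n --> \oo] -->
  kap * RI (fun z => (c < z <= B)%R%:R * gam z * md z).
Proof.
move=> cB; have B0 : 0 <= B by rewrite (le_trans c0) // ltW.
have [D D0 HD] := Ph_step_bound; have [M M0 HM] := mdens_bound hg.
have ml0 : 0 <= mlim P nu f a B.
  by rewrite mlimE; apply: RI_ge0 => z; have /andP[m0 _] := HM a z ha; rewrite mulr_ge0.
apply/cvgrPdist_le => e e0.
pose T := D * (1 + B) ^+ 2 + kap * mlim P nu f a B.
have T0 : 0 <= T by apply: addr_ge0; apply: mulr_ge0 => //; [exact: ltW|exact: sqr_ge0].
have e2 : 0 < e / 2 by rewrite divr_gt0.
have [e1 /andP[e10 _] He1] := small_pos T0 e2.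
have [i Hi] := heine B cg e10.
have [q q1 Hq] := nat_ge ((B - c) * i.+1%:R).
have q0 : 0 < q%:R :> R by rewrite ltr0n ltnW.
pose t (k : nat) := c + k%:R * ((B - c) / q%:R).
have w0 : 0 <= (B - c) / q%:R by rewrite divr_ge0 ?subr_ge0 ?(ltW q0) // ltW.
have w1 : (B - c) / q%:R <= i.+1%:R^-1 by rewrite ler_pdivrMr // mulrC ler_pdivlMr.
have tS k : t k.+1 = t k + (B - c) / q%:R by rewrite /t -natr1; ring.
have tle k : t k <= t k.+1 by rewrite tS lerDl.
have tc k : c <= t k by rewrite lerDl mulr_ge0.
have t0 : t 0%N = c by rewrite /t mul0r addr0.
have tq : t q = B by rewrite /t mulrC divfK ?gt_eqF // addrC subrK.
have tB k : (k < q)%N -> t k <= B.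
  move=> kq; rewrite -tq /t lerD2l ler_wpM2r // ler_nat ltnW //.
have cells u : (c < u <= B)%R%:R = \sum_(0 <= k < q) (t k < u <= t k.+1)%R%:R :> R.
  rewrite (eq_bigr (fun k => (u <= t k.+1)%R%:R - (u <= t k)%R%:R)); last by move=> k _; rewrite itv_ind.
  by rewrite telescope_sumr // tq t0 itv_ind // ltW.
pose sg u := \sum_(0 <= k < q) gam (t k) * (t k < u <= t k.+1)%R%:R.
have close u : `|(c < u <= B)%R%:R * gam u - sg u| <= e1 * (c < u <= B)%R%:R.
  rewrite cells /sg mulr_suml mulr_sumr -sumrB; apply: le_trans (ler_norm_sum _ _ _) _.
  apply: ler_sum_nat => k /andP[_ kq].
  case: (boolP (t k < u <= t k.+1)) => [/andP[u1 u2]|_]; last by rewrite mul0r !mulr0 subrr normr0.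
  rewrite mul1r !mulr1 distrC; apply: Hi; first by rewrite (le_trans c0 (tc k)) tB.
  by apply: le_trans w1; rewrite distrC ger0_norm ?subr_ge0 ?(ltW u1) // lerBlDl -tS.
have csg : Ph n sg @[n --> \oo] --> kap * RI (fun z => sg z * md z).
  have i1 k : intg (fun z => (t k < z <= t k.+1)%R%:R * md z).
    have := @intg_md_itv (t k) (t k.+1) (fun=> 1) 1 (measurable_cst _).
    rewrite (_ : (fun z => _ * 1 * _) = fun z => (t k < z <= t k.+1)%R%:R * md z); last first.
      by apply: funext => z; rewrite mulr1.
    by apply => z; rewrite normr1.
  rewrite (_ : (fun z => sg z * md z) = fun z => \sum_(0 <= k < q) gam (t k) * ((t k < z <= t k.+1)%R%:R * md z)).
    rewrite RI_sum; last by move=> k _; exact: intgZ.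
    rewrite mulr_sumr (_ : (fun n => _) = fun n =>
      \sum_(0 <= k < q) gam (t k) * Ph n (fun u => (t k < u <= t k.+1)%R%:R)); last first.
      by apply: funext => n; rewrite /sg Ph_sum; apply: eq_bigr => k _; rewrite PhZ.
    apply: cvg_fsum => k; rewrite RIZ // mulrCA; apply: cvgM; first exact: cvg_cst.
    by apply: Ph_itv => //; exact: le_trans (tc k).
  by apply: funext => z; rewrite /sg mulr_suml; apply: eq_bigr => k _; rewrite mulrA.
have isg : intg (fun z => sg z * md z).
  rewrite (_ : (fun z => _) = fun z => \sum_(0 <= k < q) ((t k < z <= t k.+1)%R%:R * gam (t k) * md z)).
    apply: intg_sum => k _; exact: (@intg_md_itv _ _ (fun=> gam (t k)) C).
  by apply: funext => z; rewrite /sg mulr_suml; apply: eq_bigr => k _; rewrite [gam _ * _]mulrC.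
have a1 n : `|Ph n (fun u => (c < u <= B)%R%:R * gam u) - Ph n sg| <= e1 * (D * (1 + B) ^+ 2).
  have hB : Ph n (fun u => e1 * (c < u <= B)%R%:R) <= e1 * (D * (1 + B) ^+ 2).
    rewrite PhZ ler_wpM2l ?(ltW e10) //; apply: le_trans (HD n B B0); apply: Ph_le => u _.
    by rewrite ler_nat; case: (c < u).
  rewrite ler_norml; apply/andP; split.
    rewrite lerBrDr addrC -lerBrDr opprK; apply: le_trans (lerD (lexx _) hB).
    rewrite -PhD; apply: Ph_le => u _; have := close u; rewrite ler_norml => /andP[]; lra.
  rewrite lerBlDr; apply: le_trans (lerD hB (lexx _)); rewrite -PhD; apply: Ph_le => u _.
  by have := close u; rewrite ler_norml => /andP[]; lra.
have a2 : `|kap * RI (fun z => (c < z <= B)%R%:R * gam z * md z) - kap * RI (fun z => sg z * md z)| <=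
    e1 * (kap * mlim P nu f a B).
  rewrite -mulrBr -RIB //; last exact: (intg_md_itv c B mgam gCn).
  rewrite normrM ger0_norm // mulrCA ler_wpM2l // mlimE -RIZ; last exact: (intg_mdens hg).
  apply: RI_norm.
  - by apply: intgB => //; exact: (intg_md_itv c B mgam gCn).
  - by apply: intgZ; exact: (intg_mdens hg).
  move=> z; have /andP[m0 _] := HM a z ha; rewrite -mulrBl normrM (ger0_norm m0) mulrA ler_wpM2r //.
  apply: le_trans (close z) _; rewrite ler_wpM2l ?(ltW e10) // ler_nat; by case: (c < z).
move/cvgrPdist_le: csg => /(_ _ e2); apply: filterS => n h.
move: He1; rewrite /T mulrDl => He1.
rewrite (_ : _ - _ = (kap * RI (fun z => (c < z <= B)%R%:R * gam z * md z) - kap * RI (fun z => sg z * md z)) +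
  (kap * RI (fun z => sg z * md z) - Ph n sg) - (Ph n (fun u => (c < u <= B)%R%:R * gam u) - Ph n sg)); last by ring.
apply: le_trans (ler_normB _ _) _; apply: le_trans (lerD (ler_normD _ _) (lexx _)) _.
by have := a1 n; move: a2 h He1; lra.
Qed.

(** By [mlim_lip] the mass up to $2^i$ is of order $4^i$, so the dyadic sum converges. *)
Lemma md_test_integrable : intg (fun z => (c < z)%R%:R * gam z * md z).
Proof.
have [M M0 HM] := mdens_bound hg; have [L L0 HL] := mlim_lip hg.
have /andP[r0 r1] := r01.
have mh : measurable_fun setT (fun z => (c < z)%R%:R * gam z * md z).
  by apply: mfM; [apply: mfM => //; exact: mf_lt|exact: (mdens_measurable hg)].
have h0 z : 0 <= (c < z)%R%:R * gam z * md z.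
  by have /andP[m0 _] := HM a z ha; rewrite !mulr_ge0.
have ml b : 0 <= b -> mlim P nu f a b <= L * (1 + b) ^+ 2.
  move=> b0; have b1 : (0 : R) <= 0 <= b by rewrite lexx.
  have /andP[_ h] := HL a 0 b ha b1.
  have z0 : mlim P nu f a 0 = 0.
    rewrite mlimE (_ : (fun z => _) = fun=> 0) ?RI0 //; apply: funext => z.
    case: (lerP z 0) => z0; last by rewrite mul0r.
    by rewrite /mdens big1 ?mulr0 // => v _; rewrite ltNge z0 mul0r mulr0.
  apply: le_trans h _; rewrite z0 add0r subr0 expr2 mulrA ler_wpM2l ?mulr_ge0 ?(ltW L0) ?addr_ge0 //.
  by rewrite lerDr.
have iI i : intg (fun z => (z <= dya R i)%R%:R * ((c < z)%R%:R * gam z * md z)).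
  have := intg_md_itv c (dya R i) mgam gCn; congr intg; apply: funext => z.
  by rewrite andbC -mulnb natrM -!mulrA.
pose K := C * (L * (1 + dya R 0) ^+ 2) + C * L * (16 * r ^+ 0 / (1 - r)).
apply: (intg_exhaust (C := K)) => // i.
have im j : intg (fun z => (z <= dya R j)%R%:R * md z) by exact: (intg_mdens hg).
apply: (@le_trans _ _ (RI (fun z => C * ((z <= dya R 0)%R%:R * md z) +
   \sum_(0 <= k < i) (C * (r / 4) ^+ k) * ((z <= dya R k.+1)%R%:R * md z)))).
  apply: RI_le => //; first by apply: intgD; [exact: intgZ|apply: intg_sum => k _; exact: intgZ].
  move=> z; have /andP[m0 _] := HM a z ha.
  have hp := @decay_pointwise R gam C r 0 i z (leq0n i) C0 r0 g0 gd.
  rewrite [leLHS](_ : _ = (z <= dya R i)%R%:R * (c < z)%R%:R * gam z * md z); last by ring.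
  rewrite [leRHS](_ : _ = (C * (z <= dya R 0)%R%:R + \sum_(0 <= k < i) (C * (r / 4) ^+ k) * (z <= dya R k.+1)%R%:R) * md z); last first.
    by rewrite mulrDl mulr_suml; congr (_ + _); [ring|apply: eq_bigr => k _; ring].
  apply: ler_wpM2r => //; case: (lerP z (dya R i)) => zi; last first.
    rewrite !mul0r; apply: addr_ge0; first by rewrite mulr_ge0.
    apply: sumr_ge0 => k _; apply: mulr_ge0 => //; apply: mulr_ge0 => //.
    by apply: exprn_ge0; rewrite divr_ge0 // ltW.
  rewrite mul1r; move: hp; rewrite [dya R i < z]ltNge zi mul0r addr0 => hp.
  have cz : (c < z)%R%:R * gam z <= gam z by rewrite ler_piMl // lern1 leq_b1.
  apply: le_trans cz _; case: (ltrP (dya R 0) z) hp => z1 hp.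
    by rewrite mulr0 add0r -[leLHS]mul1r.
  rewrite mulr1; apply: le_trans (gC z) _; rewrite lerDl sumr_ge0 // => k _.
  by rewrite !mulr_ge0 // exprn_ge0 // divr_ge0 // ltW.
rewrite RID; [|exact: intgZ|by apply: intg_sum => k _; exact: intgZ].
rewrite RI_sum; last by move=> k _; exact: intgZ.
rewrite RIZ // /K; apply: lerD.
  by rewrite ler_wpM2l // -mlimE ml // (le_trans ler01 (dya_ge1 R 0)).
apply: le_trans (ler_wpM2l _ (dyadic_sum 0 i r01)); last by rewrite mulr_ge0 // ltW.
rewrite mulr_sumr; apply: ler_sum_nat => k _; rewrite RIZ // -mlimE.
rewrite [leRHS](_ : _ = C * (r / 4) ^+ k * (L * (1 + dya R k.+1) ^+ 2)); last by ring.
apply: ler_wpM2l; first by rewrite mulr_ge0 // exprn_ge0 // divr_ge0 // ltW.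
by apply: ml; exact: le_trans ler01 (dya_ge1 R _).
Qed.

(** Uniform in [n]: up to level $2^I$ the dyadic sum is bounded by [Ph_step_bound]; beyond it the
    trivial bound [N n ^+ 3] suffices, as [I] may depend on [n]. *)
Lemma Ph_tail : exists2 K : R, 0 <= K & forall n i0,
  Ph n (fun u => (dya R i0 < u)%R%:R * gam u) <= K * r ^+ i0.
Proof.
have [D D0 HD] := Ph_step_bound; have /andP[r0 r1] := r01.
have q1 : 0 < 1 - r by rewrite subr_gt0.
exists (C * D * (16 / (1 - r))); first by rewrite !mulr_ge0 ?invr_ge0 // ltW.
move=> n i0; apply/ler_addgt0Pr => e e0.
have [I [i0I hI]] : exists I, (i0 <= I)%N /\ C * (r / 4) ^+ I * N n ^+ 3 <= e.
  have cz : C * (r / 4) ^+ I * N n ^+ 3 @[I --> \oo] --> (0 : R).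
    rewrite [X in _ --> X](_ : 0 = C * 0 * N n ^+ 3); last by rewrite mulr0 mul0r.
    apply: cvgM; last exact: cvg_cst.
    apply: cvgM; first exact: cvg_cst.
    by apply: cvg_expr; rewrite ger0_norm ?divr_ge0 ?(ltW r0) // ltr_pdivrMr //; lra.
  move/cvgrPdist_le: cz => /(_ _ e0) [I _ HI]; exists (maxn i0 I); split; first exact: leq_maxl.
  have := HI (maxn i0 I) (leq_maxr _ _); rewrite /= sub0r normrN => h; exact: le_trans (ler_norm _) h.
have q0 k : 0 <= C * (r / 4) ^+ k by rewrite mulr_ge0 // exprn_ge0 // divr_ge0 // ltW.
apply: (@le_trans _ _ (Ph n (fun u => \sum_(i0 <= k < I) (C * (r / 4) ^+ k) * (u <= dya R k.+1)%R%:R +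
    C * (r / 4) ^+ I))).
  apply: Ph_le => u u0; apply: le_trans (decay_pointwise u i0I C0 r0 g0 gd) _; rewrite lerD2l.
  case: (ltrP (dya R I) u) => h; last by rewrite mul0r.
  by rewrite mul1r; apply: gd; exact: ltW.
rewrite PhD; apply: lerD; last by apply: le_trans (Ph_cst_le n (q0 I)) hI.
rewrite Ph_sum [leRHS](_ : _ = C * D * (16 * r ^+ i0 / (1 - r))); last by ring.
apply: le_trans (ler_wpM2l _ (dyadic_sum i0 I r01)); last by rewrite mulr_ge0 // ltW.
rewrite mulr_sumr; apply: ler_sum_nat => k _; rewrite PhZ.
rewrite [leRHS](_ : _ = C * (r / 4) ^+ k * (D * (1 + dya R k.+1) ^+ 2)); last by ring.
by apply: ler_wpM2l => //; apply: HD; exact: le_trans ler01 (dya_ge1 R _).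
Qed.

Lemma test_limit : N n ^+ 3 * Kn n.+1 (fun z u => a z * ((c < u)%R%:R * gam u)) x y @[n --> \oo] -->
  kap * RI (fun z => (c < z)%R%:R * gam z * md z).
Proof.
have ih := md_test_integrable; have [K K0 HK] := Ph_tail; have /andP[r0 r1] := r01.
have [M M0 HM] := mdens_bound hg.
have cI : kap * RI (fun z => (c < z <= dya R i)%R%:R * gam z * md z) @[i --> \oo] -->
    kap * RI (fun z => (c < z)%R%:R * gam z * md z).
  apply: cvgM; first exact: cvg_cst.
  have [||||//] := @RI_dct R (fun i z => (c < z <= dya R i)%R%:R * gam z * md z) (fun z => (c < z)%R%:R * gam z * md z) (fun z => (c < z)%R%:R * gam z * md z).
  - by move=> i; exact: intg_measurable (intg_md_itv c (dya R i) mgam gCn).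
  - move=> i z; have /andP[m0 _] := HM a z ha; rewrite ger0_norm ?mulr_ge0 //.
    by rewrite ler_wpM2r // ler_wpM2r // ler_nat; case: (c < z) => //=; case: (z <= _).
  - exact: ih.
  - move=> z; apply: cvg_near_cst; exists (Num.bound `|z|) => // i /= zi.
    rewrite (_ : z <= dya R i) ?andbT //; apply: le_trans (ler_norm z) _.
    apply: le_trans (ltW (archi_boundP (normr_ge0 z))) _; apply: le_trans (ltW (dya_gt R i)).
    by rewrite ler_nat.
apply/cvgrPdist_le => e e0; have e3 : 0 < e / 3 by rewrite divr_gt0.
have cK : K * r ^+ i @[i --> \oo] --> (0 : R).
  rewrite -(mulr0 K); apply: cvgM; first exact: cvg_cst.
  by apply: cvg_expr; rewrite ger0_norm // ltW.
move/cvgrPdist_le: cI => /(_ _ e3) [i1 _ h1]; move/cvgrPdist_le: cK => /(_ _ e3) [i2 _ h2].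
pose i := maxn (maxn i1 i2) (Num.bound `|c|).
have ci : c < dya R i.
  apply: le_lt_trans (ler_norm c) (lt_le_trans (archi_boundP (normr_ge0 c)) _).
  by apply: le_trans (ltW (dya_gt R i)); rewrite ler_nat leq_maxr.
have {}h1 := h1 i (leq_trans (leq_maxl _ _) (leq_maxl _ _)).
have {}h2 := h2 i (leq_trans (leq_maxr _ _) (leq_maxl _ _)).
rewrite /= in h1 h2; rewrite sub0r normrN in h2.
move: (Ph_bounded ci) => /cvgrPdist_le /(_ _ e3); apply: filterS => n h3.
have -> : N n ^+ 3 * Kn n.+1 (fun z u => a z * ((c < u)%R%:R * gam u)) x y =
  Ph n (fun u => (c < u <= dya R i)%R%:R * gam u) + Ph n (fun u => (dya R i < u)%R%:R * gam u).
  rewrite -PhD /Ph; congr (_ * _); apply: eq_Knw => z u; congr (_ * _); rewrite -mulrDl; congr (_ * _).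
  case: (ltrP (dya R i) u) => hu; last by rewrite andbT addr0.
  by rewrite andbF add0r (lt_trans ci hu).
have t0 : 0 <= Ph n (fun u => (dya R i < u)%R%:R * gam u).
  by apply: Ph_ge0 => u _; rewrite mulr_ge0.
have t1 := le_trans (HK n i) (le_trans (ler_norm _) h2).
rewrite opprD addrA; apply: le_trans (ler_normB _ _) _; rewrite (ger0_norm t0).
set A1 := kap * _ in h1 h3 *; set A2 := kap * RI _ in h1 h3.
move: h3; rewrite -/A2 => h3.
rewrite (_ : A1 - _ = (A1 - A2) + (A2 - Ph n (fun u => (c < u <= dya R i)%R%:R * gam u))); last by ring.
have := ler_normD (A1 - A2) (A2 - Ph n (fun u => (c < u <= dya R i)%R%:R * gam u)).
by move: h1 h3 t1; lra.
Qed.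

End TestLimit.

(** * Reversing paths and conditioning on the ends *)

Section Reversal.
Variables (R : realType) (X : finType) (P : X -> X -> R) (nu f : X -> R).
Local Notation Ps := (Pdual P nu).
Local Notation fs := (fun x => - f x).

Lemma big_tuple_rev n (H : seq X -> R) :
  \sum_(t : n.-tuple X) H t = \sum_(t : n.-tuple X) H (rev t).
Proof.
rewrite (reindex_inj (h := fun t : n.-tuple X => [tuple of rev t])) //.
by move=> t t' /(congr1 val) /= /(inv_inj revK) /val_inj.
Qed.

Lemma rev_path xs x' s : stochastic P -> invariant_prob P nu -> H1 P ->
  nu xs * pathprob Ps xs (rcons (rev s) x') = nu x' * pathprob P x' (rcons s xs).
Proof.
move=> hP hnu h1; elim/last_ind: s xs => [|s b IH] xs.
  by rewrite /= !pathprob_cons !pathprob_nil !mulr1 nu_Pdual.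
rewrite rev_rcons /= pathprob_cons mulrA nu_Pdual // [nu b * _]mulrC -mulrA IH.
by rewrite -[in RHS]cats1 pathprob_cat last_rcons pathprob_cons pathprob_nil mulr1; ring.
Qed.

(** In forward time [xs] is the state that follows the path; summing over it removes one transition
    because rows of [P] sum to 1. *)
Lemma rev_path_sum x' s : stochastic P -> invariant_prob P nu -> H1 P ->
  \sum_xs nu xs * pathprob Ps xs (rev (x' :: s)) = nu x' * pathprob P x' s.
Proof.
move=> hP hnu h1; rewrite rev_cons; under eq_bigr do rewrite rev_path //.
rewrite -mulr_sumr; congr (_ * _); rewrite -[RHS]mulr1 -(hP.2 (last x' s)) mulr_sumr.
by apply: eq_bigr => xs _; rewrite -cats1 pathprob_cat pathprob_cons pathprob_nil mulr1.
Qed.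

Lemma psum_opp s : psum fs s = - psum f s.
Proof. by rewrite /psum sumrN. Qed.

(** Both sides say that all heights along the path, its two ends included, are positive. *)
Lemma rev_surv u s : (0 < u) && surv f u s = (0 < u + psum f s) && surv fs (u + psum f s) (rev s).
Proof.
elim: s u => [|b s IH] u; first by rewrite psum_nil addr0.
rewrite surv_cons IH psum_cons rev_cons -cats1 surv_cat surv_cons psum_opp psum_rev addrA.
rewrite (_ : u + f b + psum f s + - psum f s + - f b = u); last by ring.
by rewrite surv_nil andbT [LHS]andbC andbA.
Qed.

Lemma rev_surv_last u x' s : [&& 0 < u, surv f u s & 0 < u - f x'] =
  (0 < u + psum f s) && surv fs (u + psum f s) (rev (x' :: s)).
Proof.
rewrite rev_cons -cats1 surv_cat surv_cons psum_opp psum_rev surv_nil andbT !andbA rev_surv.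
by rewrite addrK.
Qed.

(** Survival of a fixed tail is an open half-line of starting heights, [c] being its deepest fall;
    the tail thus enters a test function through [c < u] alone. *)
Lemma surv_threshold s : exists2 c : R, 0 <= c & forall u, 0 < u -> surv f u s = (c < u).
Proof.
elim: s => [|b s [c c0 Hc]]; first by exists 0.
exists (Num.max 0 (c - f b)) => [|u u0]; first by rewrite le_max lexx.
rewrite surv_cons gt_max u0 /= ltrBlDr.
case: (ltrP 0 (u + f b)) => h /=; first exact: Hc.
by apply/esym/negbTE; rewrite -leNgt (le_trans h).
Qed.

(** Unlike [surv_last] this assumes no sign of [y]: one tested step is enough. It is how every real
    [y] is covered when $l\ge1$. *)
Lemma surv_pos y s : (0 < size s)%N -> surv f y s -> 0 < y + psum f s.
Proof.
case: s => // b s _; rewrite surv_cons psum_cons addrA => /andP[h1 h2].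
exact: surv_last h2.
Qed.

Lemma drop_last_path (x : X) k s : size s = k.+1 -> drop k s = [:: last x s].
Proof.
case/lastP: s => // s b; rewrite size_rcons last_rcons => -[<-].
by rewrite -cats1 drop_size_cat.
Qed.

(** [x'] is $X_{n-m+1}$, the state at the end of the middle block; pinning it by an indicator
    separates the block from the last [m'] steps. *)
Lemma Ex_split x y l k m' (g : seq X -> R -> R) :
  Ex P x (l + (k.+1 + m')) (fun s => (surv f y s)%:R *
     g (take l s ++ drop (l + k) s) (y + psum f s)) =
  \sum_(s1 : l.-tuple X) pathprob P x s1 * (surv f y s1)%:R *
   Kn P f k.+1 (fun z u => \sum_x' \sum_(s3 : m'.-tuple X) pathprob P x' s3 *
     ((z == x')%:R * ((surv f u s3)%:R * g (s1 ++ x' :: s3) (u + psum f s3))))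
     (last x s1) (y + psum f s1).
Proof.
rewrite ExD {1}/Ex; apply: eq_bigr => s1 _; rewrite -mulrA; congr (_ * _).
rewrite ExD /Kn -ExZ; apply: eq_Ex => s2 sz2.
rewrite (bigD1 (last (last x s1) s2)) //= eqxx [X in _ = _ * (_ * (_ + X))]big1 ?addr0; last first.
  move=> z zn; rewrite big1 // => s3 _; rewrite (_ : (_ == z) = false) ?mul0r ?mulr0 //.
  by rewrite eq_sym; exact: negbTE.
rewrite /Ex !mulr_sumr; apply: eq_bigr => s3 _.
rewrite mul1r !surv_cat !psum_cat !addrA take_size_cat ?size_tuple //.
rewrite drop_cat size_tuple ltnNge leq_addr /= addKn drop_cat sz2 ltnSn.
rewrite (@drop_last_path (last x s1)) // -!mulnb !natrM /=; ring.
Qed.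

End Reversal.

(** With $r=2^{-\varepsilon}$ one has $r/4=2^{-(2+\varepsilon)}$, so the weighted bound at
    $1+z\ge2^i$ is exactly dyadic decay. *)
Lemma Cplus_decay (R : realType) (X : finType) k (g : seq X -> R -> R) : Cplus k g ->
  exists C r : R, [/\ 0 < r < 1, forall s z, size s = k -> 0 <= z -> g s z <= C &
    forall s i z, size s = k -> dya R i <= z -> g s z <= C * (r / 4) ^+ i].
Proof.
case=> g0 [_ [eps [e0 [C HC]]]].
have p0 : 0 <= 2 + eps by rewrite addr_ge0 // ltW.
pose w : R := 2 `^ (2 + eps).
have q1 : 1 < 2 `^ eps :> R.
  by rewrite /powR pnatr_eq0 /= expR_gt1 mulr_gt0 // ln_gt0 // ltr1n.
have wE : w = 4 * 2 `^ eps.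
  rewrite /w powRD ?pnatr_eq0 ?implybT // (_ : 2 `^ 2 = 4) //.
  by rewrite powR_mulrn //; ring.
have w0 : 0 < w by rewrite wE mulr_gt0 // (lt_trans ltr01).
exists C, (2 `^ eps)^-1; split.
- by rewrite invr_gt0 invf_lt1 ?q1 ?(lt_trans ltr01 q1).
- move=> s z sk z0; apply: le_trans (HC s sk z z0); rewrite ler_peMr ?g0 //.
  rewrite -[leLHS](_ : 1 `^ (2 + eps) = 1); last by rewrite powR1.
  have z1 : 1 <= 1 + z by rewrite lerDl.
  by apply: ge0_ler_powR => //; rewrite nnegrE ?addr_ge0.
move=> s i z sk iz; have z0 : 0 <= z by apply: le_trans iz; exact: le_trans (dya_ge1 R i).
have -> : (2 `^ eps)^-1 / 4 = w^-1 by rewrite wE invfM mulrC.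
rewrite exprVn ler_pdivlMr ?exprn_gt0 //; apply: le_trans (HC s sk z z0).
rewrite ler_wpM2l ?g0 //.
have -> : w ^+ i = (dya R i) `^ (2 + eps).
  rewrite /dya natrX -(powR_mulrn i (ler0n R 2)) -powRrM mulrC powRrM powR_mulrn //; exact: ltW.
have dy0 : 0 <= dya R i := le_trans ler01 (dya_ge1 R i).
have iz1 : dya R i <= 1 + z by apply: le_trans iz _; rewrite lerDr.
by apply: ge0_ler_powR => //; rewrite nnegrE ?addr_ge0.
Qed.

(** Clamping at 0 extends a function that is controlled only on the closed half-line continuously to
    the whole line. *)
Lemma continuous_max_shift (R : realType) (h : R -> R) (d : R) :
  {within `[0, +oo[, continuous h} -> continuous (fun u => h (Num.max 0 (u + d))).
Proof.
move=> ch u; pose v : R := Num.max 0 (u + d).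
have v0 : 0 <= v by rewrite le_max lexx.
have Av : [set` `[0%R, +oo[%R] v by rewrite /= in_itv /= v0.
apply/cvgrPdist_le => e e0.
have := ch v => /cvgrPdist_le /(_ _ e0); rewrite -[nbhs _]/(nbhs_subspace (v : subspace _)) -nbhs_subspace_in //.
move=> /nbhs_ballP [dl /= dl0 H]; apply/nbhs_ballP; exists dl => //= u'; rewrite /ball /= => uu.
have b0 : 0 <= Num.max 0 (u' + d) by rewrite le_max lexx.
apply: (H (Num.max 0 (u' + d))); last by rewrite /= in_itv /= b0.
rewrite /ball /=; apply: le_lt_trans uu; rewrite /v.
case: (lerP 0 (u + d)) => h1; case: (lerP 0 (u' + d)) => h2.
- by rewrite (_ : u + d - (u' + d) = u - u') //; ring.
- by rewrite subr0 ger0_norm // ler_normr; apply/orP; left; lra.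
- by rewrite sub0r normrN ger0_norm // ler_normr; apply/orP; right; lra.
- by rewrite subrr normr0.
Qed.

Lemma sq_ratio (R : realType) (q : nat) :
  (k + q)%:R `^ (3 / 2) / sq R k ^+ 3 @[k --> \oo] --> (1 : R).
Proof.
have E k : (k + q)%:R `^ (3 / 2) / sq R k ^+ 3 = Num.sqrt ((k + q)%:R / k.+1%:R) ^+ 3 :> R.
  rewrite sqrtrM // sqrtrV // exprMn exprVn -/(sq R k); congr (_ / _).
  by rewrite mulrC powRrM powR12_sqrt // powR_mulrn // sqrtr_ge0.
rewrite (_ : (fun k => _) = fun k => Num.sqrt ((k + q)%:R / k.+1%:R) ^+ 3); last exact: funext.
have c1 : (k + q)%:R / k.+1%:R @[k --> \oo] --> (1 : R).
  apply: (@ratio_cvg R (fun k => (k + q)%N) 1 (q.+1%:R)) => k.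
  rewrite mul1r natrD -natr1 -[q.+1%:R]natr1 ler_norml; have := ler0n R q; lra.
have c2 : Num.sqrt ((k + q)%:R / k.+1%:R) @[k --> \oo] --> (1 : R).
  by rewrite -[X in _ --> X]sqrtr1; apply: (cvg_comp _ Num.sqrt c1); exact: sqrt_continuous.
rewrite -[X in _ --> X](expr1n _ 3).
by apply: (cvg_comp _ (fun z : R => z ^+ 3) c2); exact: exprn_continuous.
Qed.

(** * Assembling the limit *)

Section Assembly.
Variables (R : realType) (X : finType) (P : X -> X -> R) (nu f : X -> R).
Hypothesis hg : good P nu f.
Let hP := good_stoch hg.
Let hnu := good_inv hg.
Let h1 := good_H1 hg.
Variables (x : X) (y : R) (l m' : nat) (g : seq X -> R -> R).
Hypotheses (hl : (0 < l)%N) (hC : Cplus (l + m'.+1) g).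
Local Notation Ps := (Pdual P nu).
Local Notation fs := (fun x => - f x).
Local Notation s2 := (sigma2 P nu f).
Local Notation N n := (sq R n).
Let cst := 2 / (Num.sqrt (2 * pi) * Num.sqrt s2 ^+ 3).
Let delta (x' : X) (z : X) : R := (z == x')%:R.
Variable cc : seq X -> R.
Hypotheses (cc0 : forall s, 0 <= cc s) (ccP : forall s u, 0 < u -> surv f u s = (cc s < u)).
(** The tail is absorbed into the test function: its displacement as the shift by [psum f s3], its
    survival as the factor [cc s3 < z] in [hh]. *)
Let gam s1 x' s3 (u : R) : R := g (s1 ++ x' :: s3) (Num.max 0 (u + psum f s3)).
Let hh s1 x' s3 (z : R) : R := (cc s3 < z)%R%:R * gam s1 x' s3 z * mdens P nu f (delta x') z.
Let W s1 x' s3 : R := pathprob P x s1 * (surv f y s1)%:R * (Vh P f (last x s1) (y + psum f s1) * pathprob P x' s3).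

Let wdelta x' : weight (delta x').
Proof. by move=> z; rewrite /delta ler0n lern1 leq_b1. Qed.

Let size_path (s1 : l.-tuple X) x' (s3 : m'.-tuple X) : size (s1 ++ x' :: s3) = (l + m'.+1)%N.
Proof. by rewrite size_cat /= !size_tuple. Qed.

Lemma hh_facts (s1 : l.-tuple X) x' (s3 : m'.-tuple X) : intg (hh s1 x' s3) /\
  forall x0 y1, 0 < y1 ->
  N k ^+ 3 * Kn P f k.+1 (fun z u => delta x' z * ((cc s3 < u)%R%:R * gam s1 x' s3 u)) x0 y1
  @[k --> \oo] --> cst * Vh P f x0 y1 * RI (hh s1 x' s3).
Proof.
have [C [r [r01 gC gd]]] := Cplus_decay hC; have [g0 [gc _]] := hC.
have sp := size_path s1 x' s3.
have cgam : continuous (gam s1 x' s3) by apply: continuous_max_shift; exact: gc.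
have m0 u : 0 <= Num.max 0 (u + psum f s3) by rewrite le_max lexx.
have gam0 z : 0 <= gam s1 x' s3 z by apply: g0.
have gamC z : gam s1 x' s3 z <= C by apply: gC.
have [F F0 HF] := fin_upper f.
have [i0 hi0] : exists i0, `|psum f s3| <= dya R i0.
  exists (Num.bound `|psum f s3|); apply: ltW; apply: lt_trans (dya_gt R _).
  exact: archi_boundP.
have /andP[r0 r1] := r01; have C0 : 0 <= C by exact: le_trans (gam0 0) (gamC 0).
have q0 : 0 < r / 4 by rewrite divr_gt0.
have q1 : r / 4 <= 1 by lra.
(* The shift by the sum of [s3], at most $2^{i_0}$, costs [i0.+1] dyadic levels, paid by the
   constant. *)
pose C' := C / (r / 4) ^+ i0.+1.
have CC' : C <= C' by rewrite /C' ler_pdivlMr ?exprn_gt0 // ler_piMr // exprn_ile1 // ltW.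
have gamd i z : dya R i <= z -> gam s1 x' s3 z <= C' * (r / 4) ^+ i.
  move=> iz; case: (leqP i i0.+1) => ii.
    apply: le_trans (gamC z) _; rewrite /C' mulrAC ler_pdivlMr ?exprn_gt0 // ler_wpM2l //.
    by apply: ler_wiXn2l => //; exact: ltW.
  have E : (r / 4) ^+ i = (r / 4) ^+ (i - i0.+1) * (r / 4) ^+ i0.+1.
    by rewrite -exprD subnK // ltnW.
  rewrite /C' E [leRHS]mulrA [leRHS]mulrAC divfK; last by rewrite expf_neq0 // gt_eqF.
  apply: gd => //; rewrite le_max; apply/orP; right.
  have e1 : dya R (i - i0.+1) <= dya R i.-1 by apply: dya_homo; lia.
  have e2 : dya R i0 <= dya R i.-1 by apply: dya_homo; lia.
  have e3 : dya R i = 2 * dya R i.-1 by rewrite -dyaS prednK //; lia.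
  have := ler_norm (- psum f s3); rewrite normrN; lra.
have gamC' z : gam s1 x' s3 z <= C' by exact: le_trans CC'.
clear gamC gC gd CC' C0; split.
  change (intg (fun z => (cc s3 < z)%R%:R * gam s1 x' s3 z * mdens P nu f (delta x') z)).
  have HH := @md_test_integrable R X P nu f hg.
  eapply HH; try eassumption; try exact: wdelta; try exact: cc0.
move=> x0 y1 y10.
have HH := @test_limit R X P nu f hg; cbv zeta in HH.
change (N k ^+ 3 * Kn P f k.+1 (fun z u => delta x' z * ((cc s3 < u)%R%:R * gam s1 x' s3 u)) x0 y1
  @[k --> \oo] --> cst * Vh P f x0 y1 *
  RI (fun z => (cc s3 < z)%R%:R * gam s1 x' s3 z * mdens P nu f (delta x') z)).
eapply HH; try eassumption; try exact: wdelta; try exact: cc0.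
Qed.

Lemma real_limit : N k ^+ 3 * Ex P x (l + (k.+1 + m')) (fun s => (surv f y s)%:R *
     g (take l s ++ drop (l + k) s) (y + psum f s)) @[k --> \oo] -->
  cst * \sum_(s1 : l.-tuple X) \sum_x' \sum_(s3 : m'.-tuple X) W s1 x' s3 * RI (hh s1 x' s3).
Proof.
pose T (s1 : l.-tuple X) x' (s3 : m'.-tuple X) k : R := pathprob P x s1 * (surv f y s1)%:R * (pathprob P x' s3 *
  (N k ^+ 3 * Kn P f k.+1 (fun z u => delta x' z * ((cc s3 < u)%R%:R * gam s1 x' s3 u)) (last x s1) (y + psum f s1))).
rewrite (_ : (fun k => _) = fun k => \sum_(s1 : l.-tuple X) \sum_x' \sum_(s3 : m'.-tuple X) T s1 x' s3 k); last first.
  apply: funext => k; rewrite Ex_split mulr_sumr; apply: eq_bigr => s1 _.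
  case: (boolP (surv f y s1)) => ss; last first.
    rewrite mulr0 mul0r mulr0 big1 // => x' _; rewrite big1 // => s3 _.
    by rewrite /T (negbTE ss) mulr0 mul0r.
  have y1 : 0 < y + psum f s1 by apply: surv_pos ss; rewrite size_tuple.
  rewrite Kn_sum !mulr_sumr; apply: eq_bigr => x' _.
  rewrite Kn_sum !mulr_sumr; apply: eq_bigr => s3 _; rewrite KnZ /T ss.
  rewrite (@eq_Kn _ _ _ _ _ _ (fun z u => delta x' z * ((cc s3 < u)%R%:R * gam s1 x' s3 u))) //; first by ring.
  move=> z u u0; rewrite /delta (ccP s3 u0); congr (_ * _).
  case: (boolP (cc s3 < u)) => cu; last by rewrite !mul0r.
  by rewrite /gam max_r // ltW // surv_last // ccP.
rewrite mulr_sumr; apply: cvg_fsum => s1; rewrite mulr_sumr; apply: cvg_fsum => x'.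
rewrite mulr_sumr; apply: cvg_fsum => s3.
case: (boolP (surv f y s1)) => ss; last first.
  rewrite /W (negbTE ss) mulr0 !mul0r mulr0 (_ : T s1 x' s3 = fun=> 0); first exact: cvg_cst.
  by apply: funext => k; rewrite /T (negbTE ss) mulr0 mul0r.
have y1 : 0 < y + psum f s1 by apply: surv_pos ss; rewrite size_tuple.
rewrite (_ : cst * _ = pathprob P x s1 * (surv f y s1)%:R * (pathprob P x' s3 *
  (cst * Vh P f (last x s1) (y + psum f s1) * RI (hh s1 x' s3)))); last by rewrite /W; ring.
apply: cvgM; first exact: cvg_cst.
by apply: cvgM; [exact: cvg_cst|exact: (hh_facts s1 x' s3).2].
Qed.

Let sigma := Num.sqrt s2.
Let V := Vfun P f sigma.
Let Vs := Vfun Ps fs sigma.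

Definition limit_density (z : R) : R := \sum_(xs : X)
  \sum_(s : l.-tuple X) \sum_(t : m'.+1.-tuple X)
  pathprob P x s * pathprob Ps xs t *
  ((surv f y s)%:R * (surv fs z t)%:R *
  (g (s ++ rev t) z * V (last x s) (y + Ssum f l s) *
   Vs (last xs t) (z + Ssum fs m'.+1 t))) * nu xs.

(** Dual paths are the reversed tails [x' :: s3], and the sum over [xs] is [rev_path_sum]. The
    factor [0 < z] appears because dual survival does not test its starting height, whereas that
    height is tested as the end of the forward path. *)
Lemma limit_densityE z : limit_density z * (0 < z)%R%:R =
  \sum_(s1 : l.-tuple X) \sum_x' \sum_(s3 : m'.-tuple X) W s1 x' s3 * hh s1 x' s3 (z + - psum f s3).
Proof.
pose F xs (s1 : l.-tuple X) x' (s3 : m'.-tuple X) : R :=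
  pathprob P x s1 * pathprob Ps xs (rev (x' :: s3)) *
  ((surv f y s1)%:R * (surv fs z (rev (x' :: s3)))%:R *
  (g (s1 ++ x' :: s3) z * V (last x s1) (y + psum f s1) *
   Vs x' (z + psum fs (rev (x' :: s3))))) * nu xs * (0 < z)%R%:R.
transitivity (\sum_xs \sum_(s1 : l.-tuple X) \sum_x' \sum_(s3 : m'.-tuple X) F xs s1 x' s3).
  rewrite /limit_density mulr_suml; apply: eq_bigr => xs _.
  rewrite mulr_suml; apply: eq_bigr => s1 _.
  pose H t := pathprob P x s1 * pathprob Ps xs t *
    ((surv f y s1)%:R * (surv fs z t)%:R *
    (g (s1 ++ rev t) z * V (last x s1) (y + Ssum f l s1) *
     Vs (last xs t) (z + psum fs t))) * nu xs.
  rewrite (eq_bigr (fun t : m'.+1.-tuple X => H t)); last first.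
    by move=> t _; rewrite /H -(Ssum_size fs t) size_tuple.
  rewrite big_tuple_rev (big_tupleS _ (fun s => H (rev s))) mulr_suml; apply: eq_bigr => x' _.
  rewrite mulr_suml; apply: eq_bigr => s3 _.
  have E1 : last xs (rev (x' :: s3)) = x' by rewrite rev_cons last_rcons.
  have E2 : Ssum f l s1 = psum f s1 by rewrite -(Ssum_size f s1) size_tuple.
  by rewrite /H /F revK E1 E2.
rewrite exchange_big /=; apply: eq_bigr => s1 _.
rewrite exchange_big /=; apply: eq_bigr => x' _.
rewrite exchange_big /=; apply: eq_bigr => s3 _.
rewrite /F.
pose K := pathprob P x s1 * ((surv f y s1)%:R * (surv fs z (rev (x' :: s3)))%:R *
  (g (s1 ++ x' :: s3) z * V (last x s1) (y + psum f s1) *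
   Vs x' (z + psum fs (rev (x' :: s3))))) * (0 < z)%R%:R.
transitivity (K * (nu x' * pathprob P x' s3)).
  rewrite -rev_path_sum // mulr_sumr; apply: eq_bigr => xs _; rewrite /K; ring.
rewrite /K /W; case: (boolP (surv f y s1)) => ss; last by rewrite !(mul0r, mulr0).
have y1 : 0 < y + psum f s1 by apply: surv_pos ss; rewrite size_tuple.
have mdE u : mdens P nu f (delta x') u =
    nu x' * ((0 < u)%R%:R * ((0 < u - f x')%R%:R * Vh Ps fs x' (u - f x'))).
  rewrite /mdens (bigD1 x') //= big1 ?addr0; first by rewrite /delta eqxx mul1r.
  by move=> i /negbTE ne; rewrite /delta ne mul0r !mulr0.
(* [V] may be replaced by [Vh] here because survival of [s1] makes the height positive. *)
rewrite /V Vfun_eq // /hh mdE psum_opp psum_rev psum_cons /gam addrNK.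
set u := z + - psum f s3.
have uE : u + psum f s3 = z by rewrite /u addrNK.
have := rev_surv_last f u x' s3; rewrite uE => key.
have -> : z + - (f x' + psum f s3) = u - f x' by rewrite /u; ring.
case: (ltrP 0 z) key => z0 /= key; last first.
  rewrite mulr0 mul0r; case: (ltrP 0 u) key => u0 /=; last by rewrite !(mul0r, mulr0).
  rewrite (ccP s3 u0); case: (cc s3 < u) => /=; last by rewrite !(mul0r, mulr0).
  by move=> ->; rewrite !(mul0r, mulr0).
rewrite -key.
case: (ltrP 0 u) => u0 /=; last by rewrite !(mul0r, mulr0).
rewrite (ccP s3 u0); case: (cc s3 < u) => /=; last by rewrite !(mul0r, mulr0).
case: (ltrP 0 (u - f x')) => uf /=; last by rewrite !(mul0r, mulr0).
rewrite /Vs /sigma -(sigma2_dual f hP hnu h1) (Vfun_eq (good_dual hg)) //.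
by rewrite !(mulr1, mul1r); ring.
Qed.

Lemma limit_integral :
  (\int[lebesgue_measure]_(z in `[0%R, +oo[) (limit_density z)%:E =
   (\sum_(s1 : l.-tuple X) \sum_x' \sum_(s3 : m'.-tuple X) W s1 x' s3 * RI (hh s1 x' s3))%:E)%E.
Proof.
pose G z := \sum_(s1 : l.-tuple X) \sum_x' \sum_(s3 : m'.-tuple X) W s1 x' s3 * hh s1 x' s3 (z + - psum f s3).
have i1 (s1 : l.-tuple X) x' (s3 : m'.-tuple X) : intg (fun z => W s1 x' s3 * hh s1 x' s3 (z + - psum f s3)).
  by apply: intgZ; apply: intg_shift; exact: (hh_facts s1 x' s3).1.
have i2 (s1 : l.-tuple X) x' : intg (fun z => \sum_(s3 : m'.-tuple X) W s1 x' s3 * hh s1 x' s3 (z + - psum f s3)).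
  by apply: intg_sum => s3 _; exact: i1.
have i3 (s1 : l.-tuple X) : intg (fun z => \sum_x' \sum_(s3 : m'.-tuple X) W s1 x' s3 * hh s1 x' s3 (z + - psum f s3)).
  by apply: intg_sum => x' _; exact: i2.
have iG : intg G by apply: intg_sum => s1 _; exact: i3.
have GE z : 0 < z -> limit_density z = G z by move=> z0; rewrite /G -limit_densityE z0 mulr1.
have G0 z : z <= 0 -> G z = 0 by move=> z0; rewrite /G -limit_densityE ltNge z0 mulr0.
(* [limit_density] and [G] are known to agree for $z>0$ only, so the endpoint is removed first. *)
rewrite -integral_itv_obnd_cbnd; last first.
  apply: (eq_measurable_fun (EFin \o G)).
    by move=> z; rewrite inE /= in_itv /= andbT => z0; rewrite GE.
  by apply: measurable_funTS; apply/measurable_EFinP; exact: intg_measurable.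
rewrite integral_mkcond (_ : (\int[_]_x _)%E = (\int[lebesgue_measure]_z (G z)%:E)%E); last first.
  apply: eq_integral => z _; rewrite patchE; case: ifPn.
    by rewrite inE /= in_itv /= andbT => z0; rewrite GE.
  by rewrite notin_setE /= in_itv /= andbT => /negP; rewrite -leNgt => z0; rewrite G0.
rewrite RI_EFin //; congr EFin; rewrite /G RI_sum; last by move=> s1 _; exact: i3.
apply: eq_bigr => s1 _; rewrite RI_sum; last by move=> x' _; exact: i2.
apply: eq_bigr => x' _; rewrite RI_sum; last by move=> s3 _; exact: i1.
apply: eq_bigr => s3 _; have ih := (hh_facts s1 x' s3).1.
by rewrite RIZ ?RI_shift //; exact: intg_shift.
Qed.

End Assembly.

Theorem theorem2p7 (R : realType) (X : finType) (P : X -> X -> R) (nu f : X -> R)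
  (hP : stochastic P) (hnu : invariant_prob P nu)
  (h1 : H1 P) (h2 : H2 nu f) (h3 : H3 P f) (hsig : 0 < sigma2 P nu f)
  (x : X) (y : R) (l m : nat) (hl : (1 <= l)%N) (hm : (1 <= m)%N)
  (g : seq X -> R -> R) (hg : Cplus (l + m) g) :
  let sigma := Num.sqrt (sigma2 P nu f) in
  let Ps := Pdual P nu in
  let V := Vfun P f sigma in
  let Vs := Vfun Ps (fun x => - f x) sigma in
  (fun n : nat =>
     ((n%:R `^ (3 / 2)) *
      Ex P x n (fun s => (surv f y s)%:R *
                         g (take l s ++ drop (n - m) s) (y + Ssum f n s)))%:E)
    @ \oo -->
  ((2 / (Num.sqrt (2 * pi) * sigma ^+ 3))%:E *
   \int[lebesgue_measure]_(z in `[0%R, +oo[)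
     (\sum_(xs : X)
        \sum_(s : l.-tuple X) \sum_(t : m.-tuple X)
          pathprob P x s * pathprob Ps xs t *
          ((surv f y s)%:R * (surv (fun x => - f x) z t)%:R *
           (g (s ++ rev t) z * V (last x s) (y + Ssum f l s) *
            Vs (last xs t) (z + Ssum (fun x => - f x) m t))) * nu xs)%:E)%E.
Proof.
case: m hm hg => // m' _ hg; cbv zeta.
have gd : good P nu f by split.
have /choice [cc Hcc] : forall s : seq X, exists c : R, 0 <= c /\ forall u, 0 < u -> surv f u s = (c < u).
  by move=> s; have [c c0 H] := surv_threshold f s; exists c.
have cc0 s : 0 <= cc s by case: (Hcc s).
have ccP s u : 0 < u -> surv f u s = (cc s < u) by case: (Hcc s) => _; apply.
have RL := @real_limit _ _ _ _ _ gd x y l m' g hl hg cc cc0 ccP.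
have LI := @limit_integral _ _ _ _ _ gd x y l m' g hl hg cc cc0 ccP.
rewrite /limit_density in LI; cbv zeta in RL, LI.
rewrite LI -EFinM.
pose q := (l + m'.+1)%N.
(* [n] is written as [k + q], which leaves a middle block of [k.+1] steps. *)
rewrite -(cvg_shiftn q); apply: cvg_EFin; first exact: nearW.
rewrite -[X in _ --> X]mul1r.
(* The scale $n^{3/2}$ is exchanged for $(k+1)^{3/2}$, the ratio tending to 1. *)
rewrite (_ : _ \o _ = fun k => (k + q)%:R `^ (3 / 2) / sq R k ^+ 3 * (sq R k ^+ 3 *
  Ex P x (l + (k.+1 + m')) (fun s => (surv f y s)%:R * g (take l s ++ drop (l + k) s) (y + psum f s)))).
  by apply: cvgM; [exact: (@sq_ratio R q)|exact: RL].
apply: funext => k /=; rewrite mulrA divfK; last by rewrite expf_neq0 // gt_eqF // sq_gt0.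
have E1 : (k + q)%N = (l + (k.+1 + m'))%N by rewrite /q; lia.
have E2 : (k + q - m'.+1)%N = (l + k)%N by rewrite /q; lia.
rewrite E2 E1; congr (_ * _); apply: eq_Ex => s ss.
by rewrite -(Ssum_size f s) ss.
Qed.
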